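(* Suppose the $K$ observed time series $\mathbf{x}_{t,k}=\boldsymbol{\mu}_k+\boldsymbol{\epsilon}_{t,k}\in\mathbf{R}^d$, $k=1,\dots,K$, $t=1,\dots,T_k$, satisfy Assumptions 1-4 listed in the context. Let $\widehat{S}^*_u$ be the second-order wild bootstrap statistic defined in the context, let $\mathbf{Pr}^*(\cdot)$ denote conditional probability given all the data $\mathbf{x}_{t,k}$, $k=1,\dots,K$, $t=1,\dots,T_k$, and let $\zeta$ be a normal random variable with mean $0$ and variance $$\mathrm{Var}(\zeta)=\sum_{k=2}^K\mathrm{Var}\left(\frac{\sqrt{\mathcal{T}_\circ(B_1-B)}}{V_k\sqrt d}\sum_{B\le|t_1-t_2|\le B_1}^{T_k}\left(\boldsymbol{\epsilon}_{t_1,k}^\top\boldsymbol{\epsilon}_{t_2,k}-\mathbf{E}[\boldsymbol{\epsilon}_{t_1,k}^\top\boldsymbol{\epsilon}_{t_2,k}]\right)\right)+(K-1)^2\,\mathrm{Var}\left(\frac{\sqrt{\mathcal{T}_\circ(B_1-B)}}{V_1\sqrt d}\sum_{B\le|t_1-t_2|\le B_1}^{T_1}\left(\boldsymbol{\epsilon}_{t_1,1}^\top\boldsymbol{\epsilon}_{t_2,1}-\mathbf{E}[\boldsymbol{\epsilon}_{t_1,1}^\top\boldsymbol{\epsilon}_{t_2,1}]\right)\right).$$ Then $$\sup_{x\in\mathbf{R}}\left|\mathbf{Pr}^*\left(\widehat{S}^*_u\le x\right)-\mathbf{Pr}(\zeta\le x)\right|=o_p(1)\quad\text{as }\mathcal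{T}_\circ\to\infty.$$
   Context: Notation. $\|X\|_m=(\mathbf{E}|X|^m)^{1/m}$; $|\cdot|_2$, $|\cdot|_\infty$ are the Euclidean and maximum norms on $\mathbf{R}^d$; $a\vee b=\max(a,b)$. $\mathcal{T}_\circ=\min(T_1,\dots,T_K)$, $\mathcal{T}_\dagger=\max(T_1,\dots,T_K)$. The quantities $K,T_1,\dots,T_K,d,B,B_1,H,\boldsymbol{\mu}_k$ and the laws of the data vary along a sequence with $\mathcal{T}_\circ\to\infty$; $O(\cdot)$ bounds hold with constants not depending on the sample sizes, $a\asymp b$ means $c\,a\le b\le Ca$ with constants $0<c\le C<\infty$, and $o_p(1)$ means converging to $0$ in probability as $\mathcal{T}_\circ\to\infty$. $B<B_1$ are integer bandwidths with $0<B<B_1<\mathcal{T}_\circ$. The symbol $\sum_{B\le|t_1-t_2|\le B_1}^{T_k}$ denotes the sum over all pairs $(t_1,t_2)\in\{1,\dots,T_k\}^2$ with $B\le|t_1-t_2|\le B_1$, and $V_k=\sum_{B\le|t_1-t_2|\le B_1}^{T_k}1=(2T_k-B-B_1)(B_1-B+1)$. Kernel function: a fixed $\mathcal{K}:\mathbf{R}\to[0,\infty)$, symmetric, continuously differentiable, $\mathcal{K}(0)=1$, $\int_{\mathbf{R}}\mathcal{K}(x)\,\mathrm{d}x<\infty$, decreasing on $[0,\infty)$, with Fourier transform $\mathcal{F}\mathcal{K}(x)=\int_{\mathbf{R}}\mathcal{K}(t)\exp(-2\pi\mathrm{i}tx)\,\mathrm{d}t\ge0$ for all $x$ and $\int_{\mathbf{R}}\mathcal{F}\mathcal{K}(x)\,\mathrm{d}x<\infty$.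 Bootstrap statistic. Let $\widehat{\boldsymbol{\mu}}_k=\frac{1}{T_k}\sum_{t=1}^{T_k}\mathbf{x}_{t,k}$, $\widehat{\boldsymbol{\epsilon}}_{t,k}=\mathbf{x}_{t,k}-\widehat{\boldsymbol{\mu}}_k$, and $\widehat{\vartheta}_{t,k}=\sum_{t_2=(t-B_1)\vee1}^{t-B}\widehat{\boldsymbol{\epsilon}}_{t,k}^\top\widehat{\boldsymbol{\epsilon}}_{t_2,k}$ for $t=B+1,\dots,T_k$. Generate, independently of the data, random variables $\varepsilon^*_{t,k}$ such that for each $k$ the vector $(\varepsilon^*_{1,k},\dots,\varepsilon^*_{T_k,k})$ is jointly normal with mean $0$ and $\mathrm{Cov}(\varepsilon^*_{t_1,k},\varepsilon^*_{t_2,k})=\mathcal{K}\left(\frac{t_1-t_2}{H}\right)$, the vectors for different $k$ being independent. Then $$\widehat{S}^*_u=2\sum_{k=2}^K\frac{\sqrt{\mathcal{T}_\circ(B_1-B)}}{V_k\sqrt d}\sum_{t=B+1}^{T_k}\widehat{\vartheta}_{t,k}\varepsilon^*_{t,k}+2(K-1)\frac{\sqrt{\mathcal{T}_\circ(B_1-B)}}{V_1\sqrt d}\sum_{t=B+1}^{T_1}\widehat{\vartheta}_{t,1}\varepsilon^*_{t,1}.$$ $(M,\alpha)$-short-range dependence. Let $\{e_t:t\in\mathbf{Z}\}$ be independent random variables and $\boldsymbol{\epsilon}_t\in\mathbf{R}^d$ have components $\boldsymbol{\epsilon}_t^{(i)}=g_t^{(i)}(\dots,e_{t-1},e_t)$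 with measurable $g_t^{(i)}$, which may vary with $t$ and with the sample size. Let $e_t^\dagger$ be mutually independent, independent of all $e_s$, with $e_t^\dagger$ distributed as $e_t$. For $s\ge0$ let $\boldsymbol{\epsilon}_t(s)$ be $\boldsymbol{\epsilon}_t$ with $e_{t-s}$ replaced by $e_{t-s}^\dagger$, and for $s<0$ let $\boldsymbol{\epsilon}_t(s)=\boldsymbol{\epsilon}_t$. Put $\delta_s=\sup_{t\in\mathbf{Z},|\mathbf{a}|_2=1}\|\mathbf{a}^\top(\boldsymbol{\epsilon}_t-\boldsymbol{\epsilon}_t(s))\|_M$. The process is $(M,\alpha)$-short-range dependent if $\mathbf{E}[\boldsymbol{\epsilon}_t]=0$ for all $t$, $\sup_{t\in\mathbf{Z},|\mathbf{a}|_2=1}\|\mathbf{a}^\top\boldsymbol{\epsilon}_t\|_M=O(1)$, and $\sup_{s=0,1,\dots}(1+s)^\alpha\sum_{j=s}^\infty\delta_j=O(1)$. Assumption 1. $e_{t,k}$, $t\in\mathbf{Z}$, $k=1,\dots,K$, are mutually independent (not necessarily identically distributed) random variables; $\boldsymbol{\epsilon}_{t,k}^{(i)}=g_{t,k}^{(i)}(\dots,e_{t-1,k},e_{t,k})$ for all $t,k$ and $i=1,\dots,d$; and for each $k$, $\boldsymbol{\epsilon}_{t,k}$, $t=1,\dots,T_k$, stem from an $(M,\alpha)$-short-range dependent process (driven by $e_{t,k}$, $t\in\mathbf{Z}$) with $M>8$, $\alpha>14$. Assumption 2. $K=O(1)$, $\mathcal{T}_\circ\asymp\mathcal{T}_\dagger$,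 $d\asymp\mathcal{T}_\circ$, and $\max_{k=1,\dots,K}|\boldsymbol{\mu}_k|_\infty=O(1)$. Assumption 3. $B\asymp\mathcal{T}_\circ^{\kappa_1}$ with $\frac{2}{\alpha}<\kappa_1<\frac16$; $B_1\asymp\mathcal{T}_\circ^{\kappa_2}$ with $\kappa_1\vee\frac{4}{2\alpha-3}<\kappa_2<\frac16$; and $H\asymp\mathcal{T}_\circ^{1/3}\log(\mathcal{T}_\circ)$. Assumption 4. There is a constant $c>0$ such that, for all sufficiently large $\mathcal{T}_\circ$, the quantity displayed as $\mathrm{Var}(\zeta)$ in the claim is greater than $c$. *)

(* Defs.v *)
From HB Require Import structures.
From mathcomp Require Import all_boot all_order all_algebra.
From mathcomp Require Import all_classical all_reals all_analysis.
From mathcomp Require Import measurable_realfun complex.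

Set Implicit Arguments.
Unset Strict Implicit.
Unset Printing Implicit Defensive.

Import Order.TTheory GRing.Theory Num.Theory.
Import numFieldNormedType.Exports.

Local Open Scope classical_set_scope.
Local Open Scope ring_scope.

Section independence.
Context d (Om : measurableType d) (R : realType) (P : probability Om R).

(* the sigma-algebra generated by the real random variables X i, i \in D *)
Definition gen_sigma (I : Type) (D : set I) (X : I -> Om -> R) :
    set_system Om :=
  <<s \bigcup_(i in D) preimage_set_system setT (X i) measurable >>.

(* mutual independence of the set systems F i, i \in D: the product rule over
   every finite subfamily *)
Definition mutually_independent (I : eqType) (D : set I)
    (F : I -> set_system Om) : Prop :=
  forall (s : seq I) (A : I -> set Om), uniq s ->
    (forall i, i \in s -> D i /\ F i (A i)) ->
    P (\big[setI/setT]_(i <- s) A i) = (\prod_(i <- s) P (A i))%E.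

Definition independent_systems (F G : set_system Om) : Prop :=
  forall A B, F A -> G B -> P (A `&` B) = (P A * P B)%E.

(* kappa is a regular conditional distribution of X given the sigma-algebra G:
   kappa w U is a version of the conditional probability of X \in U given G
   for every Borel set U, and kappa w is a probability for every w *)
Definition regular_cond_distribution (G : set_system Om) (X : Om -> R)
    (kappa : Om -> probability (measurableTypeR R) R) : Prop :=
  forall U : set (measurableTypeR R), measurable U ->
    (preimage_set_system setT (fun w => kappa w U) measurable `<=` G) /\
    (forall A, G A -> P (A `&` X @^-1` U) = (\int[P]_(w in A) kappa w U)%E).

End independence.

Section gaussian.
Context (R : realType).

(* The normal law with mean m and standard deviation s. The degenerate case is
   separated because normal_prob m 0 is the uniform law on [0, 1]. *)
Definition gaussian (m s : R) (U : set (measurableTypeR R)) : \bar R :=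
  if s == 0 then dirac m U else normal_prob m s U.

Context d (Om : measurableType d) (P : probability Om R).

Definition normally_distributed (X : Om -> R) : Prop :=
  exists m s : R, 0 <= s /\
    forall U : set (measurableTypeR R), measurable U ->
      P (X @^-1` U) = gaussian m s U.

(* the random vector (X 1, ..., X T) is (possibly degenerate) jointly normal *)
Definition jointly_normal (T : nat) (X : nat -> Om -> R) : Prop :=
  forall a : nat -> R,
    normally_distributed (fun w => \sum_(1 <= t < T.+1) a t * X t w).

End gaussian.

Section asymptotics.
Context (R : realType).

Definition bigO1 (u : nat -> R) : Prop :=
  exists C : R, \forall n \near \oo, `|u n| <= C.

Definition asymp (a b : nat -> R) : Prop :=
  exists c C : R, [/\ 0 < c, c <= C &
    \forall n \near \oo, c * a n <= b n <= C * a n].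

(* convergence to 0 in probability, the n-th variable living on Om n *)
Definition littleop1 (disp : nat -> measure_display)
    (Om : forall n, measurableType (disp n))
    (P : forall n, probability (Om n) R) (Z : forall n, Om n -> \bar R) : Prop :=
  forall eta : R, 0 < eta ->
    (P n [set w | (eta%:E < `|Z n w|)%E]) @[n --> \oo] --> 0%E.

End asymptotics.

Section kernel.
Context (R : realType).

(* \int Ker(t) exp(-2 pi i t x) dt, with real and imaginary parts written out *)
Definition fourier (Ker : R -> R) (x : R) : R[i] :=
  Complex (\int[lebesgue_measure]_t (Ker t * cos (- 2 * pi * t * x)))
          (\int[lebesgue_measure]_t (Ker t * sin (- 2 * pi * t * x))).

(* 0 <= z in R[i] means that z is real and nonnegative *)
Record kernel_function (Ker : R -> R) : Prop := KernelFunction {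
  ker_ge0 : forall x, 0 <= Ker x;
  ker_sym : forall x, Ker (- x) = Ker x;
  ker_derivable : forall x, derivable Ker x 1;
  ker_C1 : continuous (derive1 Ker);
  ker0 : Ker 0 = 1;
  ker_int : (\int[lebesgue_measure]_x (Ker x)%:E < +oo)%E;
  ker_decr : forall x y, 0 <= x -> x <= y -> Ker y <= Ker x;
  ker_fourier_ge0 : forall x, 0 <= fourier Ker x;
  ker_fourier_int :
    (\int[lebesgue_measure]_x (complex.Re (fourier Ker x))%:E < +oo)%E
}.

End kernel.

Section vectors.
Context (R : realType) (d : nat).
Implicit Types u v : 'rV[R]_d.

Definition dotp u v : R := \sum_i u 0 i * v 0 i.
Definition norm2 u : R := Num.sqrt (dotp u u).

End vectors.

Section sequence_space.
Context (R : realType).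

(* the product sigma-algebra of R^nat is generated by the coordinates *)
Definition coordinate_preimages : set_system (nat -> R) :=
  \bigcup_(j in [set: nat])
    preimage_set_system setT (fun u : nat -> R => u j) measurable.

Definition measurable_seqfun (f : (nat -> R) -> R) : Prop :=
  measurable_fun setT (f : g_sigma_algebraType coordinate_preimages -> R).

End sequence_space.

Section dependence.
Context d0 (Om : measurableType d0) (R : realType) (P : probability Om R).
Context (d : nat).
Variables (e : int -> Om -> R) (g : int -> 'I_d -> (nat -> R) -> R).

(* g t i is applied to the past (e_t, e_{t-1}, e_{t-2}, ...) *)
Definition process (t : int) (w : Om) : 'rV[R]_d :=
  \row_i g t i (fun j => e (t - j%:Z) w).

(* epsilon_t(s). On the product space (Om * Om, P \x P), the variables
   e_t(w.1) have the joint law of the e_t, and e_t(w.2) is an independent copy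
   of the whole family, so it serves as e_t^dagger. *)
Definition coupled (s : nat) (t : int) (w : Om * Om) : 'rV[R]_d :=
  \row_i g t i
    (fun j => if j == s then e (t - j%:Z) w.2 else e (t - j%:Z) w.1).

Definition dep_delta (M : R) (s : nat) : \bar R :=
  ereal_sup [set v | exists (t : int) (a : 'rV[R]_d), norm2 a = 1 /\
    v = Lnorm (P \x P)%E M%:E (fun w : Om * Om =>
           (dotp a (process t w.1 - coupled s t w))%:E)].

(* (M, alpha)-short-range dependence, with C the constant of both O(1) bounds;
   it must be chosen uniformly along the sequence of models *)
Record short_range_dependent (M alpha C : R) : Prop := ShortRangeDependent {
  srd_mean : forall t i, ('E_P[fun w => process t w ord0 i] = 0)%E;
  srd_moment :
    (ereal_sup [set v | exists (t : int) (a : 'rV[R]_d), norm2 a = 1%R /\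
       v = Lnorm P M%:E (fun w => (dotp a (process t w))%:E)] <= C%:E)%E;
  srd_decay :
    (ereal_sup (range (fun s : nat =>
       ((1 + s%:R) `^ alpha)%:E * \sum_(s <= j <oo) dep_delta M j))
     <= C%:E)%E
}.

End dependence.

Section pairs.

(* the sum over t1, t2 in {1, ..., T} with B <= |t1 - t2| <= B1 *)
Definition pair_sum (V : nmodType) (T B B1 : nat) (f : nat -> nat -> V) : V :=
  \sum_(1 <= t1 < T.+1)
    \sum_(1 <= t2 < T.+1 | (B <= `|t1%:Z - t2%:Z| <= B1)%N) f t1 t2.

Definition pair_count (T B B1 : nat) : nat := pair_sum T B B1 (fun _ _ => 1%N).

Definition Tmin (K : nat) (T : nat -> nat) : nat :=
  \big[minn/T 1%N]_(1 <= k < K.+1) T k.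
Definition Tmax (K : nat) (T : nat -> nat) : nat :=
  (\max_(1 <= k < K.+1) T k)%N.

End pairs.

Section statistic.
Context (R : realType) (K : nat) (T : nat -> nat) (d B B1 : nat).

Definition scaling (k : nat) : R :=
  Num.sqrt ((Tmin K T)%:R * (B1%:R - B%:R)) /
  ((pair_count (T k) B B1)%:R * Num.sqrt d%:R).

(* x k t is the t-th observation of the k-th series and xi k t the bootstrap
   multiplier, 1 <= k <= K, 1 <= t <= T k *)
Variables (x : nat -> nat -> 'rV[R]_d) (xi : nat -> nat -> R).

Definition mu_hat (k : nat) : 'rV[R]_d :=
  (T k)%:R^-1 *: \sum_(1 <= t < (T k).+1) x k t.
Definition eps_hat (k t : nat) : 'rV[R]_d := x k t - mu_hat k.

Definition theta_hat (k t : nat) : R :=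
  \sum_(maxn (t - B1) 1 <= t2 < (t - B).+1) dotp (eps_hat k t) (eps_hat k t2).

Definition S_hat : R :=
  2 * (\sum_(2 <= k < K.+1)
         scaling k * \sum_(B.+1 <= t < (T k).+1) theta_hat k t * xi k t)
  + 2 * (K%:R - 1) *
      (scaling 1 * \sum_(B.+1 <= t < (T 1).+1) theta_hat 1 t * xi 1%N t).

End statistic.

Section limit_variance.
Context d0 (Om : measurableType d0) (R : realType) (P : probability Om R).
Context (K : nat) (T : nat -> nat) (d B B1 : nat).
Variable eps : nat -> int -> Om -> 'rV[R]_d.

Definition centered_stat (k : nat) (w : Om) : R :=
  scaling R K T d B B1 k *
  pair_sum (T k) B B1 (fun t1 t2 =>
    dotp (eps k t1%:Z w) (eps k t2%:Z w)
    - fine ('E_P[fun w' => dotp (eps k t1%:Z w') (eps k t2%:Z w')])%E).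

Definition var_zeta : \bar R :=
  (\sum_(2 <= k < K.+1) 'V_P[centered_stat k]
   + ((K%:R - 1) ^+ 2)%:E * 'V_P[centered_stat 1])%E.

End limit_variance.

(* The models along the sequence n = 0, 1, ...; the indices are k = 1, ..., K n
   for the series and t = 1, ..., T n k for time. *)
Unset Implicit Arguments.

Section models.
Context (R : realType).
Context (disp : nat -> measure_display).
Context (Om : forall n, measurableType (disp n)).
Context (P : forall n, probability (Om n) R).
Context (K : nat -> nat) (T : nat -> nat -> nat) (d B B1 : nat -> nat).
Context (H : nat -> R).
Context (mu : forall n, nat -> 'rV[R]_(d n)).
Context (e : forall n, nat -> int -> {RV (P n) >-> R}).
Context (g : forall n, nat -> int -> 'I_(d n) -> (nat -> R) -> R).
Context (xi : forall n, nat -> nat -> {RV (P n) >-> R}).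

Definition is_series (n k : nat) : Prop := (1 <= k <= K n)%N.
Definition is_time (n k t : nat) : Prop := (1 <= t <= T n k)%N.

Definition noise (n k : nat) (t : int) (w : Om n) : 'rV[R]_(d n) :=
  process (e n k) (g n k) t w.

Definition observed (n k t : nat) (w : Om n) : 'rV[R]_(d n) :=
  mu n k + noise n k t%:Z w.

Definition data_sigma n : set_system (Om n) :=
  gen_sigma
    [set p : (nat * nat) * 'I_(d n) | is_series n p.1.1 /\
                                      is_time n p.1.1 p.1.2]
    (fun p w => observed n p.1.1 p.1.2 w 0 p.2).

Definition multiplier_sigma (n k : nat) : set_system (Om n) :=
  gen_sigma (is_time n k) (fun t w => xi n k t w).

Definition all_multipliers_sigma n : set_system (Om n) :=
  gen_sigma
    [set p : nat * nat | is_series n p.1 /\ is_time n p.1 p.2]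
    (fun p w => xi n p.1 p.2 w).

Definition bootstrap_stat n (w : Om n) : R :=
  S_hat (K n) (T n) (B n) (B1 n)
    (fun k t => observed n k t w) (fun k t => xi n k t w).

Definition limit_var n : \bar R :=
  var_zeta (P n) (K n) (T n) (B n) (B1 n) (noise n).

Definition Tmin_ n : nat := Tmin (K n) (T n).
Definition Tmax_ n : nat := Tmax (K n) (T n).

Record standing : Prop := Standing {
  standing_K : forall n, (1 <= K n)%N;
  standing_B : forall n, (0 < B n)%N /\ (B n < B1 n)%N /\ (B1 n < Tmin_ n)%N;
  standing_Tmin : Tmin_ n @[n --> \oo] --> \oo
}.

Record multipliers (Ker : R -> R) : Prop := Multipliers {
  mult_indep_data :
    forall n, independent_systems (P n) (data_sigma n) (all_multipliers_sigma n);
  mult_normal : forall n k, is_series n k ->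
    jointly_normal (P n) (T n k) (fun t w => xi n k t w);
  mult_mean : forall n k t, is_series n k -> is_time n k t ->
    ('E_(P n)[xi n k t] = 0)%E;
  mult_cov : forall n k t1 t2,
    is_series n k -> is_time n k t1 -> is_time n k t2 ->
    covariance (P n) (xi n k t1) (xi n k t2)
      = (Ker ((t1%:R - t2%:R) / H n))%:E;
  mult_indep : forall n,
    mutually_independent (P n) (is_series n) (multiplier_sigma n)
}.

Record assumption1 (M alpha : R) : Prop := Assumption1 {
  a1_M : 8 < M;
  a1_alpha : 14 < alpha;
  a1_indep : forall n, mutually_independent (P n)
    [set p : nat * int | is_series n p.1]
    (fun p => preimage_set_system setT (e n p.1 p.2) measurable);
  a1_meas : forall n k t i, is_series n k -> measurable_seqfun (g n k t i);
  a1_srd : exists C : R, \forall n \near \oo, forall k, is_series n k ->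
    short_range_dependent (P n) (fun t => e n k t) (g n k) M alpha C
}.

(* `|mu n k| is the maximum norm of the row vector mu n k *)
Record assumption2 : Prop := Assumption2 {
  a2_K : bigO1 (fun n => (K n)%:R : R);
  a2_T : asymp (fun n => (Tmin_ n)%:R : R) (fun n => (Tmax_ n)%:R);
  a2_d : asymp (fun n => (d n)%:R : R) (fun n => (Tmin_ n)%:R);
  a2_mu : bigO1 (fun n => \big[Num.max/0]_(1 <= k < (K n).+1) `|mu n k|)
}.

Record assumption3 (alpha kappa1 kappa2 : R) : Prop := Assumption3 {
  a3_kappa1 : 2 / alpha < kappa1 < 1 / 6;
  a3_kappa2 : Num.max kappa1 (4 / (2 * alpha - 3)) < kappa2 < 1 / 6;
  a3_B : asymp (fun n => (B n)%:R) (fun n => (Tmin_ n)%:R `^ kappa1);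
  a3_B1 : asymp (fun n => (B1 n)%:R) (fun n => (Tmin_ n)%:R `^ kappa2);
  a3_H : asymp H (fun n => (Tmin_ n)%:R `^ (1 / 3) * ln (Tmin_ n)%:R)
}.

Definition assumption4 : Prop :=
  exists c : R, 0 < c /\ \forall n \near \oo, (c%:E < limit_var n)%E.

(* sup_x |Pr^*(S <= x) - Pr(zeta <= x)| where the conditional law of S is given
   by kappa *)
Definition kolmogorov_dist (kappa : forall n, Om n ->
    probability (measurableTypeR R) R) n (w : Om n) : \bar R :=
  ereal_sup (range (fun x : R =>
    `| kappa n w `]-oo, x]%classic
       - gaussian 0%R (Num.sqrt (fine (limit_var n))) `]-oo, x]%classic |%E)).

End models.

Arguments standing K T B B1 : clear implicits.
Arguments data_sigma {R disp Om P} K T {d} mu e g n.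
Arguments bootstrap_stat {R disp Om P} K T {d} B B1 mu e g xi n w.
Arguments limit_var {R disp Om P} K T {d} B B1 e g n.
Arguments multipliers {R disp Om P} K T {d} H mu e g xi Ker.
Arguments assumption1 {R disp Om P} K {d} e g M alpha.
Arguments assumption2 {R} K T {d} mu.
Arguments assumption3 {R} K T B B1 H alpha kappa1 kappa2.
Arguments assumption4 {R disp Om P} K T {d} B B1 e g.
Arguments kolmogorov_dist {R disp Om P} K T {d} B B1 e g kappa n w.

(* Main.v *)
Require Import Defs.
From HB Require Import structures.
From mathcomp Require Import all_boot all_order all_algebra.
From mathcomp Require Import all_classical all_reals all_analysis.
From mathcomp Require Import measurable_realfun complex.
From mathcomp Require Import zify ring lra.

(** Conditionally on the data, the bootstrap statistic is a linear combination
    of multipliers that are jointly normal for each k and independent across k.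
    Its conditional law is therefore N(0, v), where v is a sum over k of positive
    semidefinite quadratic forms, with matrix Ker((t - s) / H), in the window
    sums theta_t. As N(0, a) and N(0, b) are at total variation distance at most
    |a - b| / b and Var(zeta) is bounded below, it suffices that
    E |v - Var(zeta)| tends to 0.

    Integrating out all but the last B innovations in eps_t gives vectors A_t
    depending on the innovations in ]t - B, t] only. For the array A, theta_t has
    mean zero given the innovations up to t - B, because the window sum pairs A_t
    with A_s for s <= t - B only. Hence theta_t and theta_s are uncorrelated for
    |t - s| >= B, while for |t - s| < B the kernel weight is 1 + O(B / H): the
    quadratic form has mean Var(sum_t theta_t) up to O(B / H), and fourth moments
    bound its variance. Passing from A to eps and centering by the empirical mean
    perturb theta in L^2, and a positive semidefinite form q satisfies
    |q(x + y) - q(x)| <= lam q(x) + (1 + 1 / lam) q(y). *)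

Set Implicit Arguments.
Unset Strict Implicit.
Unset Printing Implicit Defensive.

Import Order.TTheory GRing.Theory Num.Theory.
Import numFieldNormedType.Exports.

Local Open Scope classical_set_scope.
Local Open Scope ring_scope.

(** * Moments *)

(** The hypothesis measures the replacement of one innovation by an independent copy, whereas the
    approximation integrates out infinitely many. On the product of two copies of the space,
    replacements are made one at a time and telescoped; a mixed sequence and its complement always
    form a pair of independent copies, so every increment has the norm of a single replacement.
    Infinitely many replacements are reached by convergence in probability and a Fatou argument, and
    Jensen's inequality over the second copy bounds the integrated version.

    The kernel form is positive semidefinite because it is the variance of a combination of
    multipliers.

    After normalization the form of the approximating array has mean of order at most [B], so [lam]
    must be small against [1 / B], while [1 / lam] multiplies the centering error, of order
    [H * B1 * B ^ 2 / T]. With [lam = T ^ (- kappa2)] the first demand reads [kappa1 < kappa2], and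
    the second holds because both exponents are below [1 / 6]; the bias [B ^ 2 / H] also asks for
    [kappa1 < 1 / 6]. *)

Section moments.
Context d0 (Om : measurableType d0) (R : realType) (P : probability Om R).
Implicit Types (X Y : Om -> R) (k : nat).

(** [fine] sends an infinite integral to 0, so [Ex] is total: positivity holds for every variable,
    while the algebraic rules ask for [Lpow 0]. *)
Definition Ex X : R := fine (\int[P]_w (X w)%:E).

(** Orders are powers of two so that a product of two variables loses exactly one level ([LpowM]).
    Levels 0, 1, 2, 3 stand for moments of order 1, 2, 4, 8; order 8 is what [8 < M] provides. *)
Definition Lpow k X : Prop :=
  measurable_fun setT X /\
  P.-integrable setT (EFin \o (fun w => X w ^+ (2 ^ k))).

Lemma Lpow_meas k X : Lpow k X -> measurable_fun setT X.
Proof. by case. Qed.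

Lemma Lpow0P X : Lpow 0 X <-> P.-integrable setT (EFin \o X).
Proof.
have E : (fun w => X w ^+ (2 ^ 0)) = X by apply/funext => w; rewrite expn0 expr1.
rewrite /Lpow E; split=> [[]//|iX]; split=> //.
by apply/measurable_EFinP; exact: measurable_int iX.
Qed.

Lemma Lpow0_int X : Lpow 0 X -> P.-integrable setT (EFin \o X).
Proof. by move/Lpow0P. Qed.

Lemma Lpow_dom k X Y : measurable_fun setT X -> Lpow 0 Y ->
  (forall w, `|X w| ^+ (2 ^ k) <= Y w) -> Lpow k X.
Proof.
move=> mX /Lpow0P iY XY; split => //.
apply: (le_integrable measurableT _ _ iY).
  by apply/measurable_EFinP; apply: measurable_funX.
move=> w _ /=; rewrite lee_fin normrX.
by rewrite (le_trans (XY w)) ?ler_norm.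
Qed.

Lemma Lpow_pow k X : Lpow k X -> Lpow 0 (fun w => `|X w| ^+ (2 ^ k)).
Proof.
move=> [mX iX]; apply/Lpow0P.
have := integrable_abse iX; apply: eq_integrable => // w _ /=.
by rewrite normrX.
Qed.

Lemma Lpow_eq k X Y : (forall w, X w = Y w) -> Lpow k X -> Lpow k Y.
Proof. by move=> /funext ->. Qed.

Lemma Lpow_cst k (c : R) : Lpow k (fun=> c).
Proof.
split; first exact: measurable_cst.
exact: finite_measure_integrable_cst.
Qed.

Lemma Lpow0Z (c : R) X : Lpow 0 X -> Lpow 0 (fun w => c * X w).
Proof.
by move=> /Lpow0P iX; apply/Lpow0P; apply: (integrableZl measurableT c iX).
Qed.

Lemma Lpow0D X Y : Lpow 0 X -> Lpow 0 Y -> Lpow 0 (fun w => X w + Y w).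
Proof.
move=> /Lpow0P iX /Lpow0P iY; apply/Lpow0P.
by apply: (integrableD measurableT iX iY).
Qed.

Lemma LpowZ k (c : R) X : Lpow k X -> Lpow k (fun w => c * X w).
Proof.
move=> LX; apply: (Lpow_dom _ (Lpow0Z (`|c| ^+ (2 ^ k)) (Lpow_pow LX))).
  by apply: measurable_funM => //; exact: Lpow_meas LX.
by move=> w; rewrite normrM exprMn.
Qed.

(** The sum is at most twice the larger of the two norms; this replaces convexity at the cost of a
    factor 2. *)
Lemma exp_norm_add_le (n : nat) (x y : R) :
  `|x + y| ^+ n <= 2 ^+ n * (`|x| ^+ n + `|y| ^+ n).
Proof.
have [xy|yx] := leP `|x| `|y|.
- have h : `|x + y| ^+ n <= (2 * `|y|) ^+ n.
    by apply: lerXn2r; rewrite ?nnegrE ?mulr_ge0 // (le_trans (ler_normD _ _)) //; lra.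
  rewrite (le_trans h) // exprMn ler_wpM2l ?exprn_ge0 //.
  by rewrite lerDr exprn_ge0.
- have h : `|x + y| ^+ n <= (2 * `|x|) ^+ n.
    by apply: lerXn2r; rewrite ?nnegrE ?mulr_ge0 // (le_trans (ler_normD _ _)) //; lra.
  rewrite (le_trans h) // exprMn ler_wpM2l ?exprn_ge0 //.
  by rewrite lerDl exprn_ge0.
Qed.

Lemma LpowD k X Y : Lpow k X -> Lpow k Y -> Lpow k (fun w => X w + Y w).
Proof.
move=> LX LY.
apply: (Lpow_dom _ (Lpow0Z (2 ^+ (2 ^ k)) (Lpow0D (Lpow_pow LX) (Lpow_pow LY)))).
  by apply: measurable_funD; [exact: Lpow_meas LX|exact: Lpow_meas LY].
by move=> w; exact: exp_norm_add_le.
Qed.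

Lemma LpowN k X : Lpow k X -> Lpow k (fun w => - X w).
Proof. by move=> /(LpowZ (-1)); apply: Lpow_eq => w; rewrite mulN1r. Qed.

Lemma LpowB k X Y : Lpow k X -> Lpow k Y -> Lpow k (fun w => X w - Y w).
Proof. by move=> LX /LpowN; exact: LpowD. Qed.

Lemma Lpow_sum k (I : Type) (r : seq I) (p : pred I) (F : I -> Om -> R) :
  (forall i, p i -> Lpow k (F i)) -> Lpow k (fun w => \sum_(i <- r | p i) F i w).
Proof.
move=> H; elim: r => [|i r IH].
  by apply: Lpow_eq (Lpow_cst k 0) => w; rewrite big_nil.
case pi: (p i); last by apply: Lpow_eq IH => w; rewrite big_cons pi.
by apply: Lpow_eq (LpowD (H _ pi) IH) => w; rewrite big_cons pi.
Qed.

Lemma LpowM k X Y : Lpow k.+1 X -> Lpow k.+1 Y -> Lpow k (fun w => X w * Y w).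
Proof.
move=> LX LY.
apply: (Lpow_dom _ (Lpow0D (Lpow_pow LX) (Lpow_pow LY))).
  by apply: measurable_funM; [exact: Lpow_meas LX|exact: Lpow_meas LY].
move=> w; rewrite expnSr !exprM normrM exprMn.
have /= := sqr_ge0 (`|X w| ^+ (2 ^ k) - `|Y w| ^+ (2 ^ k)).
have : 0 <= `|X w| ^+ (2 ^ k) by rewrite exprn_ge0.
have : 0 <= `|Y w| ^+ (2 ^ k) by rewrite exprn_ge0.
by move: (`|X w| ^+ _) (`|Y w| ^+ _) => x y; nra.
Qed.

Lemma LpowW k X : Lpow k.+1 X -> Lpow k X.
Proof.
move=> LX; apply: Lpow_eq (LpowM LX (Lpow_cst k.+1 1)) => w.
by rewrite mulr1.
Qed.

Lemma Lpow_le j k X : (j <= k)%N -> Lpow k X -> Lpow j X.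
Proof.
move=> /subnK <-; elim: (k - j)%N => [//|i IH].
by rewrite addSn => /LpowW.
Qed.

Lemma Lpow_sqr k X : Lpow k.+1 X -> Lpow k (fun w => X w ^+ 2).
Proof. by move=> L; apply: Lpow_eq (LpowM L L) => w; rewrite expr2. Qed.

Lemma Lpow_norm k X : Lpow k X -> Lpow k (fun w => `|X w|).
Proof.
move=> LX; apply: (Lpow_dom _ (Lpow_pow LX)).
  by apply: measurableT_comp => //; exact: Lpow_meas LX.
by move=> w; rewrite normr_id.
Qed.

Lemma Lpow_bounded k X (c : R) : measurable_fun setT X ->
  (forall w, `|X w| <= c) -> Lpow k X.
Proof.
move=> mX Xc; apply: (Lpow_dom mX (Lpow_cst 0 (c ^+ (2 ^ k)))) => w.
by apply: lerXn2r; rewrite ?nnegrE // (le_trans _ (Xc w)).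
Qed.

Lemma ExE X : Lpow 0 X -> (\int[P]_w (X w)%:E = (Ex X)%:E)%E.
Proof.
by move=> /Lpow0P iX; rewrite /Ex fineK //; exact: (integrable_fin_num measurableT iX).
Qed.

Lemma eq_Ex X Y : (forall w, X w = Y w) -> Ex X = Ex Y.
Proof. by move=> /funext ->. Qed.

Lemma ExD X Y : Lpow 0 X -> Lpow 0 Y -> Ex (fun w => X w + Y w) = Ex X + Ex Y.
Proof.
move=> LX LY; apply: EFin_inj; rewrite -ExE; last exact: LpowD.
rewrite EFinD -!ExE //.
by rewrite -(integralD measurableT (Lpow0_int LX) (Lpow0_int LY)).
Qed.

Lemma ExZ (c : R) X : Lpow 0 X -> Ex (fun w => c * X w) = c * Ex X.
Proof.
move=> LX; apply: EFin_inj; rewrite -ExE; last exact: LpowZ.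
rewrite EFinM -!ExE //.
by rewrite -(integralZl measurableT (Lpow0_int LX)).
Qed.

Lemma Ex_cst (c : R) : Ex (fun=> c) = c.
Proof. by rewrite /Ex integral_cst //= probability_setT mule1. Qed.

Lemma ExN X : Lpow 0 X -> Ex (fun w => - X w) = - Ex X.
Proof.
by move=> LX; rewrite -mulN1r -ExZ //; apply: eq_Ex => w; rewrite mulN1r.
Qed.

Lemma ExB X Y : Lpow 0 X -> Lpow 0 Y -> Ex (fun w => X w - Y w) = Ex X - Ex Y.
Proof. by move=> LX LY; rewrite ExD ?ExN //; exact: LpowN. Qed.

Lemma Ex_sum (I : Type) (r : seq I) (p : pred I) (F : I -> Om -> R) :
  (forall i, p i -> Lpow 0 (F i)) ->
  Ex (fun w => \sum_(i <- r | p i) F i w) = \sum_(i <- r | p i) Ex (F i).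
Proof.
move=> H; elim: r => [|i r IH].
  by under eq_Ex do rewrite big_nil; rewrite Ex_cst big_nil.
case pi: (p i); last first.
  by under eq_Ex do rewrite big_cons pi; rewrite big_cons pi.
under eq_Ex do rewrite big_cons pi.
by rewrite ExD ?IH ?big_cons ?pi //; [exact: H|exact: Lpow_sum].
Qed.

Lemma Ex_ge0 X : (forall w, 0 <= X w) -> 0 <= Ex X.
Proof. by move=> X0; apply: fine_ge0; apply: integral_ge0 => w _; rewrite lee_fin. Qed.

Lemma Ex_le X Y : Lpow 0 X -> Lpow 0 Y -> (forall w, X w <= Y w) -> Ex X <= Ex Y.
Proof.
move=> LX LY XY; rewrite -subr_ge0 -ExB //.
by apply: Ex_ge0 => w; rewrite subr_ge0.
Qed.

Lemma Ex_norm X : Lpow 0 X -> `|Ex X| <= Ex (fun w => `|X w|).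
Proof.
move=> LX; rewrite ler_norml.
have LN := LpowN (Lpow_norm LX).
apply/andP; split.
  rewrite lerNl -ExN //; apply: Ex_le; [exact: LpowN|exact: Lpow_norm|].
  by move=> w; rewrite lerNl lerNnormlW.
by apply: Ex_le => //; [exact: Lpow_norm|move=> w; exact: ler_norm].
Qed.

Lemma Ex_sqr_ge0 X : 0 <= Ex (fun w => X w ^+ 2).
Proof. by apply: Ex_ge0 => w; rewrite sqr_ge0. Qed.

Lemma Ex_CS X Y : Lpow 1 X -> Lpow 1 Y ->
  Ex (fun w => X w * Y w) ^+ 2 <= Ex (fun w => X w ^+ 2) * Ex (fun w => Y w ^+ 2).
Proof.
move=> LX LY.
set a := Ex (fun w => X w ^+ 2); set b := Ex _; set c := Ex (fun w => Y w ^+ 2).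
have key (s t : R) : 0 <= s ^+ 2 * a + 2 * s * t * b + t ^+ 2 * c.
  rewrite /a /b /c -!ExZ; do ?[exact: Lpow_sqr|exact: LpowM].
  rewrite -!ExD; do ?apply: LpowD; do ?apply: LpowZ;
    do ?[exact: Lpow_sqr|exact: LpowM].
  apply: Ex_ge0 => w.
  rewrite [X in 0 <= X](_ : _ = (s * X w + t * Y w) ^+ 2) ?sqr_ge0 //; ring.
have a0 : 0 <= a := Ex_sqr_ge0 _.
have c0 : 0 <= c := Ex_sqr_ge0 _.
have [a00|a1] := eqVneq a 0.
  have [->|b0] := eqVneq b 0; first by rewrite a00 expr0n !mul0r.
  (* With [a = 0] the form is affine in [s], and this [s] gives it the value -1. *)
  have := key (- (c + 1) / (2 * b)) 1; rewrite a00.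
  have -> : 2 * (- (c + 1) / (2 * b)) * 1 * b = - (c + 1) by field.
  lra.
(* At [s = b], [t = - a] the form equals [a * (a * c - b ^+ 2)]. *)
have := key b (- a); have : 0 < a by rewrite lt_neqAle eq_sym a1.
move=> a2 h; rewrite -subr_ge0 -(pmulr_rge0 _ a2).
by rewrite (le_trans h) // le_eqVlt; apply/orP; left; apply/eqP; ring.
Qed.

Lemma Ex_CS_le X Y (a b : R) : Lpow 1 X -> Lpow 1 Y -> 0 <= a -> 0 <= b ->
  Ex (fun w => X w ^+ 2) <= a ^+ 2 -> Ex (fun w => Y w ^+ 2) <= b ^+ 2 ->
  `|Ex (fun w => X w * Y w)| <= a * b.
Proof.
move=> LX LY a0 b0 Xa Yb.
rewrite -(@ler_pXn2r _ 2) ?nnegrE ?mulr_ge0 // real_normK ?num_real //.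
rewrite (le_trans (Ex_CS LX LY)) // exprMn ler_pM ?Ex_sqr_ge0 //.
Qed.

Lemma Ex_sqr_le X : Lpow 1 X -> Ex X ^+ 2 <= Ex (fun w => X w ^+ 2).
Proof.
move=> LX; have := Ex_CS LX (Lpow_cst 1 1).
rewrite [in X in _ <= _ * X](_ : 1 ^+ 2 = 1 :> R) ?expr1n // Ex_cst mulr1.
by under eq_Ex do rewrite mulr1.
Qed.

End moments.

(** * Independence and decoupling *)

Section law.
Context d1 d2 (X : measurableType d1) (Y : measurableType d2) (R : realType).
Variables (P : probability X R) (f : X -> Y) (mf : measurable_fun setT f).

Definition mfun_of : {mfun X >-> Y} :=
  HB.pack f (isMeasurableFun.Build _ _ _ _ _ mf).

Definition law : probability Y R := distribution P mfun_of.

Lemma integral_law (g : Y -> \bar R) : measurable_fun setT g ->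
  (forall y, 0 <= g y)%E -> (\int[law]_y g y = \int[P]_x g (f x))%E.
Proof. by move=> mg g0; rewrite /law ge0_integral_distribution. Qed.

End law.

Lemma bigsetI_seqP (T : Type) (I : eqType) (s : seq I) (B : I -> set T) w :
  (\big[setI/setT]_(i <- s) B i) w <-> forall i, i \in s -> B i w.
Proof.
elim: s => [|j s IH]; first by rewrite big_nil; split.
rewrite big_cons; split=> [[Bj /IH h] i|h].
  by rewrite inE => /predU1P[->//|]; exact: h.
split; first by apply: h; rewrite mem_head.
by apply/IH => i is_; apply: h; rewrite inE is_ orbT.
Qed.

Section independence_sigma.
Context d0 (Om : measurableType d0) (R : realType) (P : probability Om R).
Implicit Types (G C : set_system Om).

Lemma sub_gen_measurable G : G `<=` measurable -> <<s G >> `<=` @measurable _ Om.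
Proof. by move=> GM; apply: smallest_sub => //; exact: sigma_algebra_measurable. Qed.

(** Both sides are finite measures in [A]: the restriction of [P] to [B], and [P] scaled by [P B].
    They agree on a pi-system containing the whole space, hence on everything it generates. *)
Lemma independent_systems_gen_l C (B : set Om) : C `<=` measurable ->
  measurable B -> setI_closed C -> C setT ->
  (forall A, C A -> P (A `&` B) = (P A * P B)%E) ->
  forall A, <<s C >> A -> P (A `&` B) = (P A * P B)%E.
Proof.
move=> CM mB CI CT CB A sA.
have PBnn : 0 <= fine (P B) by exact: fine_ge0.
pose m1 := mrestr P mB; pose m2 := mscale (NngNum PBnn) P.
have E D : m2 D = (P D * P B)%E.
  by rewrite /m2 /mscale /= muleC fineK // fin_num_measure.
rewrite -E; apply: (g_sigma_algebra_measure_unique C CM (fun=> setT) _ _ m1 m2) => //.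
- by apply/seteqP; split => // x _; exists 0%N.
- by move=> D CD; rewrite [RHS]E -CB.
- move=> k; apply: (@le_lt_trans _ _ (P setT)).
    by apply: le_measure; rewrite ?inE //; exact: measurableI.
  by rewrite probability_setT ltry.
Qed.

Lemma independent_systems_gen C1 C2 : C1 `<=` measurable -> C2 `<=` measurable ->
  setI_closed C1 -> setI_closed C2 -> C1 setT -> C2 setT ->
  independent_systems P C1 C2 -> independent_systems P <<s C1 >> <<s C2 >>.
Proof.
move=> m1 m2 I1 I2 T1 T2 C12 A B sA sB.
have mA : measurable A by exact: (sub_gen_measurable m1).
have mB : measurable B by exact: (sub_gen_measurable m2).
apply: (independent_systems_gen_l m1) => // A' CA'.
have mA' : measurable A' by exact: m1.
rewrite setIC muleC; apply: (independent_systems_gen_l m2) => // B' CB'.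
by rewrite setIC muleC; exact: C12.
Qed.

Section families.
Context (I : eqType) (D : set I) (F : I -> set_system Om).
Hypothesis Fm : forall i, D i -> F i `<=` measurable.
Hypothesis FI : forall i, D i -> setI_closed (F i).
Hypothesis FT : forall i, D i -> F i setT.
Hypothesis indF : mutually_independent P D F.

(** The union of the [F i] is not stable under intersection; these finite intersections are, and
    they generate the same sigma-algebra. *)
Definition rectangles (S : set I) : set_system Om :=
  [set A | exists s : seq I, exists B : I -> set Om,
    [/\ uniq s, forall i, i \in s -> S i /\ F i (B i) &
        A = \big[setI/setT]_(i <- s) B i]].

Lemma rectangles_setT S : rectangles S setT.
Proof. by exists [::], (fun=> setT); split => //; rewrite big_nil. Qed.

Lemma rectangles_setI S : S `<=` D -> setI_closed (rectangles S).
Proof.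
move=> SD _ _ [s [A [us sA ->]]] [t [B [ut tB ->]]].
(* An index occurring in both sequences receives the intersection of its two sets; an index
   occurring in one of them meets [setT]. *)
exists (undup (s ++ t)), (fun i => (if i \in s then A i else setT) `&`
   (if i \in t then B i else setT)); split.
- exact: undup_uniq.
- move=> i; rewrite mem_undup mem_cat; case: ifP => [is_|_] /=.
    have [Si FA] := sA _ is_; split=> //.
    apply: FI => //; first exact: SD.
    by case: ifP => [/tB[]//|_]; exact: FT (SD _ Si).
  move=> it; rewrite it; have [Si FB] := tB _ it.
  by split => //; apply: FI => //; [exact: SD|exact: FT (SD _ Si)].
- apply/seteqP; split => w.
    move=> [/bigsetI_seqP h1 /bigsetI_seqP h2]; apply/bigsetI_seqP => i _.
    by split; case: ifP => // ii; [exact: h1|exact: h2].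
  move=> /bigsetI_seqP h; split; apply/bigsetI_seqP => i ii.
    by have /h[] : i \in undup (s ++ t); rewrite ?mem_undup ?mem_cat ii.
  by have /h[] : i \in undup (s ++ t); rewrite ?mem_undup ?mem_cat ii ?orbT.
Qed.

Lemma rectangles_measurable S : S `<=` D -> rectangles S `<=` measurable.
Proof.
move=> SD _ [s [A [us sA ->]]]; rewrite big_seq.
by apply: bigsetI_measurable => i /sA[Si]; apply: Fm; exact: SD.
Qed.

Lemma sub_rectangles S : S `<=` D ->
  <<s \bigcup_(i in S) F i >> `<=` <<s rectangles S >>.
Proof.
move=> SD; apply: smallest_sub; first exact: smallest_sigma_algebra.
move=> A [i Si FA]; apply: sub_sigma_algebra.
exists [:: i], (fun=> A); split => //; last by rewrite big_seq1.
by move=> j; rewrite inE => /eqP ->.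
Qed.

(** Finite sequences from disjoint index sets concatenate without repetition, so the product rule
    for the joined family factors into two rectangles. The passage from rectangles to sigma-algebras
    is the pi-system argument. *)
Lemma mutually_independent_gen (S1 S2 : set I) : S1 `<=` D -> S2 `<=` D ->
  S1 `&` S2 `<=` set0 ->
  independent_systems P <<s \bigcup_(i in S1) F i >> <<s \bigcup_(i in S2) F i >>.
Proof.
move=> S1D S2D S12 A B /(sub_rectangles S1D) sA /(sub_rectangles S2D) sB.
apply: (@independent_systems_gen (rectangles S1) (rectangles S2)) => //;
  do ?[exact: rectangles_measurable|exact: rectangles_setI|exact: rectangles_setT].
move=> _ _ [s [A' [us sA' ->]]] [t [B' [ut tB' ->]]].
pose C i := if i \in s then A' i else B' i.
have nst i : i \in t -> (i \in s) = false.
  by move=> it; apply/negP => is_; apply: (S12 i); split; [case: (sA' _ is_)|case: (tB' _ it)].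
have Cs : {in s, A' =1 C} by move=> i ii; rewrite /C ii.
have Ct : {in t, B' =1 C} by move=> i ii; rewrite /C nst.
have EA : \big[setI/setT]_(i <- s) A' i = \big[setI/setT]_(i <- s) C i.
  exact: eq_big_seq.
have EB : \big[setI/setT]_(i <- t) B' i = \big[setI/setT]_(i <- t) C i.
  exact: eq_big_seq.
rewrite EA EB -big_cat /= !indF ?big_cat //.
- by move=> i it; have [/S2D Di FB] := tB' _ it; rewrite -Ct.
- by move=> i is_; have [/S1D Di FB] := sA' _ is_; rewrite -Cs.
- rewrite cat_uniq us ut andbT /=; apply/hasPn => i it; by rewrite /= nst.
- move=> i; rewrite mem_cat => /orP[is_|it].
    by have [/S1D Di FB] := sA' _ is_; rewrite -Cs.
  by have [/S2D Di FB] := tB' _ it; rewrite -Ct.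
Qed.

End families.

Section decoupling.
Variables (G1 G2 : set_system Om).
Hypotheses (G1m : G1 `<=` measurable) (G2m : G2 `<=` measurable).
Hypothesis ind : independent_systems P <<s G1 >> <<s G2 >>.

Let T1 := g_sigma_algebraType G1.
Let T2 := g_sigma_algebraType G2.

Lemma measurable_sub_id G : G `<=` measurable ->
  measurable_fun setT (id : Om -> g_sigma_algebraType G).
Proof.
by move=> Gm _ A mA; rewrite setTI; exact: (sub_gen_measurable Gm).
Qed.

Lemma measurable_diag : measurable_fun setT ((fun w => (w, w)) : Om -> T1 * T2).
Proof.
by apply: measurable_fun_pair; exact: measurable_sub_id.
Qed.

(* the diagonal w |-> (w, w) pushes P to the product of its restrictions to two
   independent sigma-algebras *)
Lemma decoupling (f : T1 * T2 -> \bar R) : measurable_fun setT f ->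
  (forall z, 0 <= f z)%E ->
  (\int[P]_w f (w, w) = \int[P]_w1 \int[P]_w2 f (w1, w2))%E.
Proof.
move=> mf f0.
pose P1 := law P (measurable_sub_id G1m).
pose P2 := law P (measurable_sub_id G2m).
rewrite -(integral_law P measurable_diag mf f0).
rewrite (eq_measure_integral (P1 \x P2)%E); last first.
  move=> A mA _; apply/esym; apply: (@product_measure_unique _ _ _ _ _ P1 P2
    (law P measurable_diag)) => //.
rewrite fubini_tonelli1 // /fubini_F integral_law.
- apply: eq_integral => w _.
  by rewrite integral_law //; apply: measurableT_comp.
- exact: measurable_fun_fubini_tonelli_F.
- by move=> y; apply: integral_ge0.
Qed.

End decoupling.

(** [G] is only a generating family, so dependence on fewer innovations is compared by plain
    inclusion of generators ([depS]). *)
Definition dep G (X : Om -> R) : Prop :=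
  measurable_fun setT (X : g_sigma_algebraType G -> R).

Lemma depS G G' X : G `<=` G' -> dep G X -> dep G' X.
Proof.
move=> GG' dX _ A mA.
have sub : <<s G >> `<=` <<s G' >>.
  apply: smallest_sub; first exact: smallest_sigma_algebra.
  by move=> B /GG' G'B; exact: sub_sigma_algebra.
exact: sub (dX measurableT A mA).
Qed.

Lemma dep_measurable G X : G `<=` measurable -> dep G X -> measurable_fun setT X.
Proof.
move=> Gm dX _ A mA; apply: (sub_gen_measurable Gm).
exact: (dX measurableT A mA).
Qed.

Lemma depD G X Y : dep G X -> dep G Y -> dep G (fun w => X w + Y w).
Proof. by move=> ? ?; exact: measurable_funD. Qed.

Lemma depM G X Y : dep G X -> dep G Y -> dep G (fun w => X w * Y w).
Proof. by move=> ? ?; exact: measurable_funM. Qed.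

Lemma depB G X Y : dep G X -> dep G Y -> dep G (fun w => X w - Y w).
Proof. by move=> ? ?; exact: measurable_funB. Qed.

Lemma dep_cst G (c : R) : dep G (fun=> c).
Proof. exact: measurable_cst. Qed.

Lemma depZ G (c : R) X : dep G X -> dep G (fun w => c * X w).
Proof. by move=> ?; apply: depM => //; exact: dep_cst. Qed.

Lemma depX G X n : dep G X -> dep G (fun w => X w ^+ n).
Proof. by move=> ?; exact: measurable_funX. Qed.

Lemma dep_norm G X : dep G X -> dep G (fun w => `|X w|).
Proof. by move=> dX; apply: measurableT_comp. Qed.

Lemma dep_sum G (I : eqType) (r : seq I) (p : pred I) (F : I -> Om -> R) :
  (forall i, i \in r -> p i -> dep G (F i)) ->
  dep G (fun w => \sum_(i <- r | p i) F i w).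
Proof.
elim: r => [|i r IH] h.
  rewrite (_ : (fun _ => _) = fun=> 0); first exact: dep_cst.
  by apply/funext => w; rewrite big_nil.
have {}IH : dep G (fun w => \sum_(i <- r | p i) F i w).
  by apply: IH => j jr; apply: h; rewrite inE jr orbT.
case pi: (p i); last first.
  by move: IH; congr (dep G _); apply/funext => w; rewrite big_cons pi.
have -> : (fun w => \sum_(i <- i :: r | p i) F i w) =
    fun w => F i w + \sum_(i <- r | p i) F i w.
  by apply/funext => w; rewrite big_cons pi.
by apply: depD IH; apply: h; rewrite ?mem_head.
Qed.

Section product_rule.
Variables (G1 G2 : set_system Om).
Hypotheses (G1m : G1 `<=` measurable) (G2m : G2 `<=` measurable).
Hypothesis ind : independent_systems P <<s G1 >> <<s G2 >>.
Implicit Types X Y : Om -> R.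

Lemma integral_prod_ge0 X Y : dep G1 X -> dep G2 Y ->
  Lpow P 0 X -> Lpow P 0 Y ->
  (forall w, 0 <= X w) -> (forall w, 0 <= Y w) ->
  (\int[P]_w (X w * Y w)%:E = (Ex P X * Ex P Y)%:E)%E.
Proof.
move=> dX dY LX LY X0 Y0.
rewrite (@decoupling _ _ G1m G2m ind (fun z => (X z.1 * Y z.2)%:E)).
- transitivity (\int[P]_w ((Ex P Y)%:E * (X w)%:E))%E.
    apply: eq_integral => w _ /=.
    under eq_integral do rewrite EFinM.
    rewrite ge0_integralZl //.
    + by rewrite ExE // muleC.
    + by apply/measurable_EFinP; exact: Lpow_meas LY.
    + by move=> x _; rewrite lee_fin.
    + by rewrite lee_fin.
  rewrite ge0_integralZl //.
  + by rewrite ExE // -EFinM mulrC.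
  + by apply/measurable_EFinP; exact: Lpow_meas LX.
  + by move=> x _; rewrite lee_fin.
  + by rewrite lee_fin Ex_ge0.
- apply/measurable_EFinP; apply: measurable_funM.
    exact: (measurableT_comp dX measurable_fst).
  exact: (measurableT_comp dY measurable_snd).
- by move=> z; rewrite lee_fin mulr_ge0.
Qed.

(** Under independence first moments suffice, where [LpowM] asks for second moments. *)
Lemma Lpow0_indepM X Y : dep G1 X -> dep G2 Y -> Lpow P 0 X -> Lpow P 0 Y ->
  Lpow P 0 (fun w => X w * Y w).
Proof.
move=> dX dY LX LY; apply/Lpow0P; apply/integrableP; split.
  by apply/measurable_EFinP; apply: measurable_funM; [exact: Lpow_meas LX|exact: Lpow_meas LY].
under eq_integral do rewrite /= normrM.
rewrite integral_prod_ge0 ?ltry //; do ?exact: dep_norm; exact: Lpow_norm.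
Qed.

Lemma Ex_indepM X Y : dep G1 X -> dep G2 Y -> Lpow P 0 X -> Lpow P 0 Y ->
  Ex P (fun w => X w * Y w) = Ex P X * Ex P Y.
Proof.
move=> dX dY LX LY.
have Epos X' Y' : dep G1 X' -> dep G2 Y' -> Lpow P 0 X' -> Lpow P 0 Y' ->
    (forall w, 0 <= X' w) -> (forall w, 0 <= Y' w) ->
    Ex P (fun w => X' w * Y' w) = Ex P X' * Ex P Y'.
  by move=> *; rewrite {1}/Ex integral_prod_ge0.
(* Twice the positive and negative parts. They are nonnegative, so Tonelli applies to each of the
   four products; the two factors 2 account for [4^-1] below. *)
pose Xp w := `|X w| + X w; pose Xn w := `|X w| - X w.
pose Yp w := `|Y w| + Y w; pose Yn w := `|Y w| - Y w.
have LXa := Lpow_norm LX; have LYa := Lpow_norm LY.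
have [LXp LXn] : Lpow P 0 Xp /\ Lpow P 0 Xn by split; [exact: LpowD|exact: LpowB].
have [LYp LYn] : Lpow P 0 Yp /\ Lpow P 0 Yn by split; [exact: LpowD|exact: LpowB].
have dXa := dep_norm dX; have dYa := dep_norm dY.
have [dXp dXn] : dep G1 Xp /\ dep G1 Xn by split; [exact: depD|exact: depB].
have [dYp dYn] : dep G2 Yp /\ dep G2 Yn by split; [exact: depD|exact: depB].
have nn (x : R) : 0 <= `|x| + x /\ 0 <= `|x| - x.
  by split; rewrite ?subr_ge0 ?ler_norm // -lerBlDr sub0r lerNl lerNnormlW.
have EX : Ex P X = 2^-1 * (Ex P Xp - Ex P Xn).
  rewrite -ExB // -ExZ; last exact: LpowB.
  by apply: eq_Ex => w; rewrite /Xp /Xn; field.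
have EY : Ex P Y = 2^-1 * (Ex P Yp - Ex P Yn).
  rewrite -ExB // -ExZ; last exact: LpowB.
  by apply: eq_Ex => w; rewrite /Yp /Yn; field.
transitivity (Ex P (fun w => 4^-1 * ((Xp w * Yp w - Xp w * Yn w) -
    (Xn w * Yp w - Xn w * Yn w)))).
  by apply: eq_Ex => w; rewrite /Xp /Xn /Yp /Yn; field.
have [L1 L2] : Lpow P 0 (fun w => Xp w * Yp w) /\ Lpow P 0 (fun w => Xp w * Yn w).
  by split; exact: Lpow0_indepM.
have [L3 L4] : Lpow P 0 (fun w => Xn w * Yp w) /\ Lpow P 0 (fun w => Xn w * Yn w).
  by split; exact: Lpow0_indepM.
rewrite ExZ; last by apply: LpowB; exact: LpowB.
rewrite ExB; [|exact: LpowB..].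
rewrite !ExB // !Epos // ?EX ?EY; first (by field);
  by move=> w; case: (nn (X w)); case: (nn (Y w)).
Qed.

End product_rule.

End independence_sigma.

(** * Approximation by finitely many innovations *)

Section sequences.
Context d0 (Om : measurableType d0) (R : realType) (P : probability Om R).
Variable u : nat -> Om -> R.
Hypothesis um : forall j, measurable_fun setT (u j).
Hypothesis ui : mutually_independent P [set: nat]
  (fun j => preimage_set_system setT (u j) measurable).

Notation seqR := (g_sigma_algebraType (@coordinate_preimages R)).

Lemma measurable_seqmap d1 (X : measurableType d1) (h : X -> nat -> R) :
  (forall j, measurable_fun setT (fun x => h x j)) ->
  measurable_fun setT (h : X -> seqR).
Proof.
move=> mh; apply: (@measurability _ _ X seqR setT h (@coordinate_preimages R)) => //.
move=> _ [_ [j _ [V mV <-]] <-]; rewrite !setTI.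
by have := mh j measurableT _ mV; rewrite setTI.
Qed.

Lemma measurable_coord j : measurable_fun setT (fun x : seqR => x j).
Proof.
move=> _ V mV; apply: sub_sigma_algebra; exists j => //.
by exists V.
Qed.

Definition cyln n (B : nat -> set R) : set (nat -> R) :=
  [set x | forall j, (j < n)%N -> B j (x j)].

Definition cylinders : set_system (nat -> R) :=
  [set A | exists n B, (forall j, measurable (B j)) /\ A = cyln n B].

Lemma cyln_widen n m B : (n <= m)%N ->
  cyln n B = cyln m (fun j => if (j < n)%N then B j else setT).
Proof.
move=> nm; apply/seteqP; split => x h j jm.
  by case: ifP => // jn; exact: h.
by have := h j (leq_trans jm nm); rewrite jm.
Qed.

Lemma cylinders_setT : cylinders setT.
Proof.
exists 0%N, (fun=> setT); split => //.
by apply/seteqP; split => x.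
Qed.

Lemma cylinders_setI : setI_closed cylinders.
Proof.
move=> _ _ [n [A [mA ->]]] [m [B [mB ->]]].
exists (maxn n m), (fun j => (if (j < n)%N then A j else setT) `&`
   (if (j < m)%N then B j else setT)); split.
  by move=> j; apply: measurableI; case: ifP.
rewrite (cyln_widen A (leq_maxl n m)) (cyln_widen B (leq_maxr n m)).
apply/seteqP; split => x.
  by move=> [h1 h2] j jn; split; [exact: h1|exact: h2].
by move=> h; split => j jn; have [] := h j jn.
Qed.

Lemma cyln_measurable n B : (forall j, measurable (B j)) ->
  measurable (cyln n B : set seqR).
Proof.
move=> mB.
have -> : cyln n B = \big[setI/setT]_(j <- iota 0 n) [set x | B j (x j)].
  apply/seteqP; split => x.
    by move=> h; apply/bigsetI_seqP => j; rewrite mem_iota => /h.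
  by move=> /bigsetI_seqP h j jn; apply: (h j); rewrite mem_iota.
apply: (@bigsetI_measurable _ seqR) => j _.
by have := @measurable_coord j measurableT _ (mB j); rewrite setTI.
Qed.

Lemma gen_cylinders : @measurable _ seqR = <<s cylinders >>.
Proof.
apply/seteqP; split.
  apply: smallest_sub; first exact: smallest_sigma_algebra.
  move=> _ [j _ [V mV <-]]; apply: sub_sigma_algebra.
  exists j.+1, (fun i => if i == j then V else setT); split.
    by move=> i; case: ifP.
  rewrite setTI; apply/seteqP; split => x.
    by move=> h i _; case: eqP => [->|].
  by move=> /(_ j (ltnSn j)); rewrite eqxx.
apply: smallest_sub; first exact: sigma_algebra_measurable.
by move=> _ [n [B [mB ->]]]; exact: cyln_measurable.
Qed.

Lemma P_cyln n B : (forall j, measurable (B j)) ->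
  P [set w | forall j, (j < n)%N -> B j (u j w)] =
  (\prod_(j <- iota 0 n) P (u j @^-1` B j))%E.
Proof.
move=> mB; rewrite -(ui (iota_uniq 0 n)).
  congr (P _); apply/seteqP; split => w.
    by move=> h; apply/bigsetI_seqP => j; rewrite mem_iota => /h.
  by move=> /bigsetI_seqP h j jn; apply: (h j); rewrite mem_iota.
by move=> j _; split => //; exists (B j); rewrite // setTI.
Qed.

Lemma measurable_u : measurable_fun setT ((fun w j => u j w) : Om -> seqR).
Proof. by apply: measurable_seqmap => j; exact: um. Qed.

(** The coordinates in [J] are taken from the second, independent copy. A singleton [J] gives the
    coupling that measures dependence; [J] equal to a tail gives the one used for integrating out
    the remote past. *)
Definition mix (J : pred nat) (z : Om * Om) : nat -> R :=
  fun j => if J j then u j z.2 else u j z.1.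

Lemma measurable_mix J : measurable_fun setT (mix J : Om * Om -> seqR).
Proof.
apply: measurable_seqmap => j; rewrite /mix; case: (J j).
  exact: (measurableT_comp (um j) measurable_snd).
exact: (measurableT_comp (um j) measurable_fst).
Qed.

Lemma measurable_cyln_u n B : (forall j, measurable (B j)) ->
  measurable [set w | forall j, (j < n)%N -> B j (u j w)].
Proof.
move=> mB.
by have := measurable_u measurableT (cyln_measurable n mB); rewrite setTI.
Qed.

(** On cylinders both sides are finite products, and at each coordinate the choice of the copy only
    exchanges two factors. *)
Lemma mix_cylinders J A B : cylinders A -> cylinders B ->
  (P \x P)%E [set z | A (mix J z) /\ B (mix (predC J) z)] =
  (P [set w | A (fun j => u j w)] * P [set w | B (fun j => u j w)])%E.
Proof.
move=> [n [A' [mA' ->]]] [m [B' [mB' ->]]].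
rewrite (cyln_widen A' (leq_maxl n m)) (cyln_widen B' (leq_maxr n m)).
set N := maxn n m.
pose A0 := fun j => if (j < n)%N then A' j else setT.
pose B0 := fun j => if (j < m)%N then B' j else setT.
rewrite -/A0 -/B0.
have mA0 j : measurable (A0 j) by rewrite /A0; case: ifP.
have mB0 j : measurable (B0 j) by rewrite /B0; case: ifP.
pose A1 j := if J j then B0 j else A0 j.
pose B1 j := if J j then A0 j else B0 j.
have mA1 j : measurable (A1 j) by rewrite /A1; case: ifP.
have mB1 j : measurable (B1 j) by rewrite /B1; case: ifP.
have -> : [set z | cyln N A0 (mix J z) /\ cyln N B0 (mix (predC J) z)] =
   [set w | forall j, (j < N)%N -> A1 j (u j w)] `*`
   [set w | forall j, (j < N)%N -> B1 j (u j w)].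
  apply/seteqP; split => [[w1 w2]|[w1 w2]] [h1 h2].
    by split => j jN /=; move: (h1 j jN) (h2 j jN);
      rewrite /mix /A1 /B1 /=; case: (J j).
  by split => j jN /=; move: (h1 j jN) (h2 j jN);
      rewrite /mix /A1 /B1 /=; case: (J j).
rewrite product_measure1E; [|exact: measurable_cyln_u..].
transitivity ((\prod_(j <- iota 0 N) P (u j @^-1` A1 j)) *
  (\prod_(j <- iota 0 N) P (u j @^-1` B1 j)))%E.
  by congr (_ * _)%E; exact: P_cyln.
rewrite !P_cyln // -!big_split /=; apply: eq_bigr => j _.
by rewrite /A1 /B1; case: (J j) => //; rewrite muleC.
Qed.

Lemma mix_law J (A : set (nat -> R)) : measurable (A : set seqR) ->
  (P \x P)%E [set z | A (mix J z)] = P [set w | A (fun j => u j w)].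
Proof.
move=> mA.
apply: (@measure_unique _ R seqR cylinders (fun=> setT) _ _ _ _
  (law (P \x P)%E (measurable_mix J)) (law P measurable_u) _ _ _ mA).
- exact: gen_cylinders.
- exact: cylinders_setI.
- by move=> _; exact: cylinders_setT.
- by apply/seteqP; split => // x _; exists 0%N.
- move=> B cB.
  change ((P \x P)%E [set z | B (mix J z)] = P [set w | B (fun j => u j w)]).
  have := mix_cylinders J cB cylinders_setT.
  rewrite (_ : [set w | setT (fun j => u j w)] = setT) ?probability_setT ?mule1; last first.
    by apply/seteqP; split.
  by rewrite (_ : [set z | B (mix J z) /\ setT (mix (predC J) z)] = [set z | B (mix J z)]) //;
    apply/seteqP; split => z //= [].
- by move=> k; rewrite /= probability_setT ltry.
Qed.

Lemma mix_pair_law J (A B : set (nat -> R)) :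
  measurable (A : set seqR) -> measurable (B : set seqR) ->
  (P \x P)%E [set z | A (mix J z) /\ B (mix (predC J) z)] =
  (P [set w | A (fun j => u j w)] * P [set w | B (fun j => u j w)])%E.
Proof.
move=> mA mB; rewrite -(mix_law J mA) -(mix_law (predC J) mB).
pose C J := preimage_set_system setT (mix J) cylinders.
have CI J' : setI_closed (C J').
  move=> _ _ [D cD <-] [E cE <-]; rewrite !setTI -preimage_setI.
  by exists (D `&` E); [exact: cylinders_setI|rewrite setTI].
have CT J' : C J' setT by exists setT; [exact: cylinders_setT|rewrite setTI preimage_setT].
have CM J' : C J' `<=` measurable.
  move=> _ [D [n [D' [mD' ->]]] <-].
  exact: (@measurable_mix J' measurableT _ (cyln_measurable n mD')).
have gC J' (D : set (nat -> R)) : measurable (D : set seqR) -> <<s C J' >> (mix J' @^-1` D).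
  move=> mD; rewrite /C g_sigma_preimageE; exists D; last by rewrite setTI.
  by move: mD; rewrite gen_cylinders.
have := @independent_systems_gen _ _ _ (P \x P)%E (C J) (C (predC J)) (CM _) (CM _)
  (CI _) (CI _) (CT _) (CT _) _ _ _ (gC _ _ mA) (gC _ _ mB).
apply => _ _ [D cD <-] [E cE <-]; rewrite !setTI.
have mD : measurable (D : set seqR) by rewrite gen_cylinders; exact: sub_sigma_algebra.
have mE : measurable (E : set seqR) by rewrite gen_cylinders; exact: sub_sigma_algebra.
have := mix_cylinders J cD cE.
by rewrite -(mix_law J mD) -(mix_law (predC J) mE).
Qed.

Lemma measurable_mix_pair J : measurable_fun setT
  ((fun z => (mix J z, mix (predC J) z)) : Om * Om -> seqR * seqR).
Proof. by apply: measurable_fun_pair; exact: measurable_mix. Qed.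

Lemma integral_mix_pair J (f : seqR * seqR -> \bar R) :
  measurable_fun setT f -> (forall x, 0 <= f x)%E ->
  (\int[P \x P]_z f (mix J z, mix (predC J) z) =
   \int[law P measurable_u \x law P measurable_u]_x f x)%E.
Proof.
move=> mf f0; rewrite -(integral_law (P \x P)%E (measurable_mix_pair J) mf f0).
apply: eq_measure_integral => A mA _; apply/esym.
apply: (@product_measure_unique _ _ _ _ _ (law P measurable_u) (law P measurable_u)
  (law (P \x P)%E (measurable_mix_pair J))) => // B C mB mC.
exact: mix_pair_law.
Qed.

(** Whatever [J] is, the mixed sequence and its complement are two independent copies of [u], so no
    function of the pair can detect which coordinates were exchanged. *)
Lemma integral_mix_swap J J' (f : seqR * seqR -> \bar R) :
  measurable_fun setT f -> (forall x, 0 <= f x)%E ->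
  (\int[P \x P]_z f (mix J z, mix (predC J) z) =
   \int[P \x P]_z f (mix J' z, mix (predC J') z))%E.
Proof. by move=> mf f0; rewrite !integral_mix_pair. Qed.

End sequences.

Lemma near_sum_le (R : realType) (a : nat -> nat -> \bar R) :
  (forall i (e : R), 0 < e -> \forall N \near \oo, (a i N <= e%:E)%E) ->
  forall n (e : R), 0 < e -> \forall N \near \oo, (\sum_(i < n) a i N <= e%:E)%E.
Proof.
move=> h; elim=> [|n IH] e e0.
  by near=> N; rewrite big_ord0 lee_fin ltW.
have e2 : 0 < e / 2 by rewrite divr_gt0.
near=> N; rewrite big_ord_recr /= (splitr e) EFinD leeD //.
  by near: N; exact: IH.
by near: N; exact: h.
Unshelve. all: by end_near. Qed.

(** * Replacing finitely many coordinates approximates replacing a whole tail *)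

Section coordinate_replacement.
Context d0 (Om : measurableType d0) (R : realType) (P : probability Om R).
Variable u : nat -> Om -> R.
Hypothesis um : forall j, measurable_fun setT (u j).
Hypothesis ui : mutually_independent P [set: nat]
  (fun j => preimage_set_system setT (u j) measurable).
Variable m : nat.

Notation seqR := (g_sigma_algebraType (@coordinate_preimages R)).
Notation PP := (P \x P)%E.

Definition mid N : pred nat := [pred j | (m <= j < N)%N].
Definition tail : pred nat := [pred j | (m <= j)%N].

Definition mix_diff N (A : set (nat -> R)) : set (Om * Om) :=
  [set z | ~ (A (mix u (mid N) z) <-> A (mix u tail z))].

Lemma measurable_mix_preimage J (A : set (nat -> R)) : measurable (A : set seqR) ->
  measurable [set z | A (mix u J z)].
Proof. by move=> mA; have := measurable_mix um J measurableT mA; rewrite setTI. Qed.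

Lemma mix_diff_measurable N (A : set (nat -> R)) : measurable (A : set seqR) ->
  measurable (mix_diff N A).
Proof.
move=> mA.
have -> : mix_diff N A =
    ([set z | A (mix u (mid N) z)] `\` [set z | A (mix u tail z)]) `|`
    ([set z | A (mix u tail z)] `\` [set z | A (mix u (mid N) z)]).
  apply/seteqP; split => z /=; rewrite /mix_diff /=.
    have [a|a] := pselect (A (mix u (mid N) z));
      have [b|b] := pselect (A (mix u tail z)); tauto.
  tauto.
by apply: measurableU; apply: measurableD; exact: measurable_mix_preimage.
Qed.

(** The sets for which the disagreement vanishes in the limit form a sigma-algebra. It contains the
    preimages under coordinate [j], on which the two mixed sequences agree as soon as [j < N]. *)
Lemma mix_diff_cvg0 (A0 : set (nat -> R)) : measurable (A0 : set seqR) ->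
  forall e : R, 0 < e -> \forall N \near \oo, (PP (mix_diff N A0) <= e%:E)%E.
Proof.
pose H : set_system (nat -> R) := [set A | measurable (A : set seqR) /\
  forall e : R, 0 < e -> \forall N \near \oo, (PP (mix_diff N A) <= e%:E)%E].
suff HS : @measurable _ seqR `<=` H by move=> /HS[].
apply: smallest_sub; last first.
  move=> A CA; split; first exact: sub_sigma_algebra.
  move=> e e0; case: CA => j _ [V mV <-].
  near=> N; rewrite (_ : mix_diff N _ = set0) ?measure0 ?lee_fin ?ltW //.
  apply/seteqP; split => // z; apply; rewrite !setTI /= /mix /mid /tail /=.
  have jN : (j < N)%N by near: N; exact: nbhs_infty_gt.
  by rewrite jN andbT.
split.
- split; first exact: measurable0.
  move=> e e0; near=> N; rewrite (_ : mix_diff N _ = set0) ?measure0 ?lee_fin ?ltW //.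
  by apply/seteqP; split => // z; apply.
- move=> A [mA hA]; rewrite setTD; split; first exact: measurableC.
  move=> e /hA; apply: filterS => N; congr (_ <= _)%E; congr (PP _).
  apply/seteqP; split => z /=; rewrite /mix_diff /=;
    have [a|a] := pselect (A (mix u (mid N) z));
    have [b|b] := pselect (A (mix u tail z)); tauto.
- move=> F hF; have mF n : measurable (F n : set seqR) by case: (hF n).
  have mU : measurable (\bigcup_n F n : set seqR) by exact: bigcup_measurable.
  split => // e e0.
  pose B n : set seqR := \big[setU/set0]_(i < n) F i.
  have mB n : measurable (B n) by apply: bigsetU_measurable.
  (* What the first [n] sets leave out of the union. Both mixed sequences have the law of [u], so
     each visits it with probability at most [e / 4], uniformly in [N]; the first [n] sets use the
     remaining [e / 2]. *)
  pose T n : set seqR := (\bigcup_n F n) `\` B n.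
  have mT n : measurable (T n) by exact: measurableD.
  have T0 : law P (measurable_u um) (T n) @[n --> \oo] --> 0%E.
    have -> : 0%E = law P (measurable_u um) (\bigcap_n T n).
      rewrite (_ : \bigcap_n T n = set0) ?measure0 //.
      apply/seteqP; split => // x hx.
      have [[n _ Fn] _] := hx 0%N I.
      have [_] := hx n.+1 I; apply; rewrite /B -bigcup_mkord.
      by exists n => //=.
    apply: nonincreasing_cvg_mu => //.
    - by rewrite ltey_eq fin_num_measure.
    - exact: bigcapT_measurable.
    - move=> n k nk; apply/subsetPset => x [Ux nB]; split => // Bn; apply: nB.
      by move: Bn; rewrite /B -!bigcup_mkord => -[i /= /leq_trans ik Fi]; exists i => //=; exact: ik.
  have e4 : 0 < e / 4 by rewrite divr_gt0.
  have [n Tn] : exists n, (law P (measurable_u um) (T n) <= (e / 4)%:E)%E.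
    have /fine_cvgP[_ /cvgrPdist_le/(_ _ e4)[n _ hn]] := T0.
    exists n; have := hn n (leqnn n); rewrite /= sub0r normrN => hh.
    rewrite -[leLHS]fineK ?lee_fin ?fin_num_measure //.
    exact: le_trans (ler_norm _) hh.
  have e2 : 0 < e / 2 by rewrite divr_gt0.
  have := @near_sum_le R (fun i N => PP (mix_diff N (F i))) (fun i => (hF i).2) n _ e2.
  apply: filterS => N hN.
  have sub : mix_diff N (\bigcup_n F n) `<=`
     ([set z | T n (mix u (mid N) z)] `|` [set z | T n (mix u tail z)]) `|`
     \big[setU/set0]_(i < n) mix_diff N (F i).
    move=> z hz; apply: contrapT => hn; apply: hz.
    have hi i : (i < n)%N -> F i (mix u (mid N) z) <-> F i (mix u tail z).
      move=> i_n; apply: contrapT => hh; apply: hn; right.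
      by rewrite -(bigcup_mkord n (fun i => mix_diff N (F i))); exists i.
    have nT1 : ~ T n (mix u (mid N) z) by move=> h; apply: hn; left; left.
    have nT2 : ~ T n (mix u tail z) by move=> h; apply: hn; left; right.
    split=> hU; apply: contrapT => nU.
      apply: nT1; split => //; rewrite /B -bigcup_mkord => -[i /= i_n Fi].
      by apply: nU; exists i => //; apply/hi.
    apply: nT2; split => //; rewrite /B -bigcup_mkord => -[i /= i_n Fi].
    by apply: nU; exists i => //; apply/hi.
  have mS : measurable (\big[setU/set0]_(i < n) mix_diff N (F i)).
    by apply: bigsetU_measurable => i _; exact: mix_diff_measurable.
  have mT1 J := measurable_mix_preimage J (mT n).
  apply: (@le_trans _ _ (PP (([set z | T n (mix u (mid N) z)] `|`
      [set z | T n (mix u tail z)]) `|` \big[setU/set0]_(i < n) mix_diff N (F i)))).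
    apply: le_measure; rewrite ?inE //; first exact: mix_diff_measurable.
    by do !apply: measurableU.
  apply: (le_trans (measureU2 _ _ _)) => //; first exact: measurableU.
  have -> : e%:E = ((e / 4 + e / 4)%:E + (e / 2)%:E)%E by rewrite -EFinD; congr EFin; field.
  apply: leeD; last first.
    apply: le_trans hN.
    by apply: (@content_subadditive _ _ _ PP _ (fun i => mix_diff N (F i)) n) => // i _; exact: mix_diff_measurable.
  apply: (le_trans (measureU2 _ _ _)) => //.
  have mixT J : PP [set z | T n (mix u J z)] = law P (measurable_u um) (T n).
    exact: (mix_law um ui J (mT n)).
  by rewrite EFinD; apply: leeD; apply: le_trans Tn; rewrite le_eqVlt;
    apply/orP; left; apply/eqP; exact: mixT.
Unshelve. all: by end_near. Qed.

(** Up to an event of small probability, [f] has modulus below [n * eta]. That range is cut into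
    [2 * n] slabs of width [eta]: two values in one slab differ by at most [eta], and by
    [mix_diff_cvg0] the two sequences eventually fall into the same slabs with high probability. *)
Lemma mix_cvg_probability (f : (nat -> R) -> R) : measurable_seqfun f ->
  forall eta e : R, 0 < eta -> 0 < e -> \forall N \near \oo,
    (PP [set z | (eta < `|f (mix u (mid N) z) - f (mix u tail z)|)%R] <= e%:E)%E.
Proof.
move=> mf eta e eta0 e0.
pose T n : set seqR := [set x | n%:R * eta <= `|f x|].
have mT n : measurable (T n).
  have -> : T n = (fun x => `|f x|) @^-1` `[n%:R * eta, +oo[.
    by apply/seteqP; split => x /=; rewrite in_itv /= andbT.
  rewrite -[X in measurable X]setTI.
  have mN : measurable_fun setT (fun x : seqR => `|f x|) by exact: measurableT_comp.
  by apply: mN => //; exact: measurable_itv.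
have T0 : law P (measurable_u um) (T n) @[n --> \oo] --> 0%E.
  have -> : 0%E = law P (measurable_u um) (\bigcap_n T n).
    rewrite (_ : \bigcap_n T n = set0) ?measure0 //.
    apply/seteqP; split => // x hx.
    have /(_ I) := hx (Num.truncn (`|f x| / eta)).+1.
    rewrite /T /= leNgt => /negP; apply.
    rewrite -ltr_pdivrMr //.
    by have /andP[] := truncn_itv (divr_ge0 (normr_ge0 (f x)) (ltW eta0)).
  apply: nonincreasing_cvg_mu => //.
  - by rewrite ltey_eq fin_num_measure.
  - exact: bigcapT_measurable.
  - move=> n k nk; apply/subsetPset => x; rewrite /T /=; apply: le_trans.
    by apply: ler_wpM2r; rewrite ?ler_nat // ltW.
have e2 : 0 < e / 2 by rewrite divr_gt0.
have [n Tn] : exists n, (law P (measurable_u um) (T n) <= (e / 2)%:E)%E.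
  have /fine_cvgP[_ /cvgrPdist_le/(_ _ e2)[n _ hn]] := T0.
  exists n; have := hn n (leqnn n); rewrite /= sub0r normrN => hh.
  rewrite -[leLHS]fineK ?lee_fin ?fin_num_measure //.
  exact: le_trans (ler_norm _) hh.
pose A (i : nat) : set seqR :=
  f @^-1` `[(i%:R - n%:R) * eta, (i%:R - n%:R + 1) * eta[.
have mA i : measurable (A i).
  by rewrite -[X in measurable X]setTI; apply: mf => //; exact: measurable_itv.
have := @near_sum_le R (fun i N => PP (mix_diff N (A i)))
  (fun i => mix_diff_cvg0 (mA i)) (n + n)%N _ e2.
apply: filterS => N hN.
have mS : measurable (\big[setU/set0]_(i < n + n) mix_diff N (A i)).
  by apply: bigsetU_measurable => i _; exact: mix_diff_measurable.
have mT1 := measurable_mix_preimage tail (mT n).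
have mD J : measurable_fun setT (fun z => f (mix u J z)).
  exact: (measurableT_comp mf (measurable_mix um J)).
apply: (@le_trans _ _ (PP ([set z | T n (mix u tail z)] `|`
      \big[setU/set0]_(i < n + n) mix_diff N (A i)))).
  apply: le_measure; rewrite ?inE //.
  - have -> : [set z | eta < `|f (mix u (mid N) z) - f (mix u tail z)|] =
      (fun z => `|f (mix u (mid N) z) - f (mix u tail z)|) @^-1` `]eta, +oo[.
      by apply/seteqP; split => z /=; rewrite in_itv /= andbT.
    rewrite -[X in measurable X]setTI.
    have mN : measurable_fun setT (fun z => `|f (mix u (mid N) z) - f (mix u tail z)|).
      by apply: measurableT_comp => //; exact: measurable_funB.
    by apply: mN => //; exact: measurable_itv.
  - exact: measurableU.
  - move=> z /= hz; have [|nT] := pselect (T n (mix u tail z)); first by left.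
    right; rewrite -(bigcup_mkord (n + n) (fun i => mix_diff N (A i))).
    move/negP: nT; rewrite -ltNge => fn.
    set y := f (mix u tail z) in hz fn *.
    have yn : 0 <= y / eta + n%:R.
      rewrite -lerBlDr sub0r lerNl -mulNr ler_pdivrMr //.
      by rewrite (le_trans _ (ltW fn)) // -normrN ler_norm.
    have /andP[h1 h2] := truncn_itv yn.
    (* The index of the slab that contains [y]; the shift by [n] makes it a natural number. *)
    exists (Num.truncn (y / eta + n%:R)) => /=.
      rewrite -(ltr_nat R) (le_lt_trans h1) // natrD ltrD2r ltr_pdivrMr //.
      exact: le_lt_trans (ler_norm _) fn.
    set i := Num.truncn _ in h1 h2 *.
    rewrite -lerBlDr in h1 *; rewrite -ltrBrDr in h2 *.
    have Ay : A i (mix u tail z).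
      rewrite /A /= in_itv /= -/y -ler_pdivlMr // lerBlDr; apply/andP; split.
        by move: h1; rewrite lerBlDr.
      rewrite -ltr_pdivrMr //; move: h2; rewrite -natr1; lra.
    move=> [_ /(_ Ay)]; move: Ay; rewrite /A /= !in_itv /= -/y => /andP[a1 a2] /andP[b1 b2].
    move: hz; rewrite ltNge => /negP; apply.
    rewrite ler_norml; apply/andP; split; move: a1 a2 b1 b2; rewrite !mulrDl mul1r; lra.
apply: (le_trans (measureU2 _ _ _)) => //.
have -> : e%:E = ((e / 2)%:E + (e / 2)%:E)%E by rewrite -EFinD; congr EFin; field.
apply: leeD.
  apply: le_trans Tn; rewrite le_eqVlt; apply/orP; left; apply/eqP.
  exact: (mix_law um ui tail (mT n)).
apply: le_trans hN.
by apply: (@content_subadditive _ _ _ PP _ (fun i => mix_diff N (A i)) (n + n)) => // i _; exact: mix_diff_measurable.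
Qed.

End coordinate_replacement.

(** * Moment bounds from norms and through convergence in probability *)

Section moment_transfer.
Context d0 (Om : measurableType d0) (R : realType) (P : probability Om R).
Implicit Types (X Y Z : Om -> R) (k : nat).

(** Jensen's inequality for the exponents [2 ^ k], by iterating the case of the square. *)
Lemma Ex_pow_le k X : Lpow P k X ->
  (Ex P X) ^+ (2 ^ k) <= Ex P (fun w => X w ^+ (2 ^ k)).
Proof.
elim: k X => [|k IH] X LX.
  rewrite expn0 expr1 le_eqVlt; apply/orP; left; apply/eqP.
  by apply: eq_Ex => w; rewrite expr1.
rewrite expnS exprM.
have h := Ex_sqr_le (Lpow_le (ltn0Sn k) LX).
have h2 := IH _ (Lpow_sqr LX).
rewrite [leRHS](_ : _ = Ex P (fun w => (X w ^+ 2) ^+ (2 ^ k))); last first.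
  by apply: eq_Ex => w; rewrite exprM.
apply: le_trans h2; apply: lerXn2r => //; rewrite nnegrE ?sqr_ge0 //.
exact: Ex_sqr_ge0.
Qed.

Lemma Lpow_of_integral k X (b : R) : measurable_fun setT X ->
  (\int[P]_w (X w ^+ (2 ^ k.+1))%:E <= b%:E)%E ->
  Lpow P k.+1 X /\ Ex P (fun w => X w ^+ (2 ^ k.+1)) <= b.
Proof.
move=> mX Xb.
have ev w : 0 <= X w ^+ (2 ^ k.+1) by rewrite expnS exprM exprn_ge0 ?sqr_ge0.
have L : Lpow P k.+1 X.
  split => //; apply/integrableP; split.
    by apply/measurable_EFinP; exact: measurable_funX.
  apply: le_lt_trans (ltry b); apply: le_trans Xb.
  by apply: ge0_le_integral => //;
    do ?[by apply/measurable_EFinP; exact: measurable_funX];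
    do ?[by apply: measurableT_comp => //; apply/measurable_EFinP; exact: measurable_funX];
    move=> w _; rewrite /= ?lee_fin ?ger0_norm.
split => //; rewrite -lee_fin -ExE //.
by case: L => _ iX; apply/Lpow0P.
Qed.

(** When [z] and [z'] are within [eta], the triangle inequality bounds [z]; otherwise the truncation
    level [n] does. *)
Lemma min_pow_le (z z' n eta : R) (p : nat) : 0 <= n -> 0 <= eta ->
  Num.min `|z| n ^+ p <= 2 ^+ p * (`|z'| ^+ p +
     (eta ^+ p + n ^+ p * ((eta < `|z' - z|)%R)%:R)).
Proof.
move=> n0 eta0.
have m0 : 0 <= Num.min `|z| n by rewrite le_min normr_ge0.
have [h|h] := ltP eta `|z' - z|.
  rewrite mulr1 (@le_trans _ _ (n ^+ p)) //.
    by apply: lerXn2r; rewrite ?nnegrE // ge_min lexx orbT.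
  rewrite -[leLHS]mul1r ler_pM ?exprn_ge0 // ?exprn_ege1 //.
    by rewrite ler1n.
  by rewrite addrA lerDr addr_ge0 ?exprn_ge0.
rewrite mulr0 addr0.
have h1 : Num.min `|z| n <= `| `|z'| + eta |.
  rewrite [leRHS]ger0_norm ?addr_ge0 // ge_min; apply/orP; left.
  have -> : z = z' - (z' - z) by rewrite subKr.
  by rewrite (le_trans (ler_normB _ _)) // lerD2l.
have := @exp_norm_add_le R p `|z'| eta; rewrite normr_id (ger0_norm eta0).
by apply: le_trans; apply: lerXn2r.
Qed.

(** No almost surely convergent subsequence is extracted: the bound is proved for the truncation of
    [|Z|] at [n], where the event of a large gap costs at most [n ^ p] times its probability, and
    monotone convergence removes the truncation. The price is the factor [2 ^ p]. *)
Lemma fatou_in_probability k (Z_ : nat -> Om -> R) Z (b : R) :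
  measurable_fun setT Z -> 0 <= b ->
  (\forall N \near \oo, Lpow P k.+1 (Z_ N)) ->
  (\forall N \near \oo, Ex P (fun w => Z_ N w ^+ (2 ^ k.+1)) <= b) ->
  (forall eta e : R, 0 < eta -> 0 < e -> \forall N \near \oo,
     (P [set w | (eta < `|Z_ N w - Z w|)%R] <= e%:E)%E) ->
  Lpow P k.+1 Z /\ Ex P (fun w => Z w ^+ (2 ^ k.+1)) <= 2 ^+ (2 ^ k.+1) * b.
Proof.
move=> mZ b0 LZ Eb cvgZ; apply: Lpow_of_integral => //.
set p := (2 ^ k.+1)%N.
have p0 : (0 < p)%N by rewrite expn_gt0.
pose c n w := Num.min `|Z w| n%:R.
have mc n : measurable_fun setT (c n).
  by apply: measurable_minr => //; exact: measurableT_comp.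
have c0 n w : 0 <= c n w by rewrite le_min normr_ge0 /=.
have Lc n : Lpow P 0 (fun w => c n w ^+ p).
  apply: (@Lpow_bounded _ _ _ _ _ _ (n%:R ^+ p)); first exact: measurable_funX.
  move=> w; rewrite ger0_norm ?exprn_ge0 //.
  by apply: lerXn2r; rewrite ?nnegrE // ge_min lexx orbT.
have key n : Ex P (fun w => c n w ^+ p) <= 2 ^+ p * b.
  apply/ler_addgt0Pr => e e0.
  have e1 : 0 < e / 2 ^+ p by rewrite divr_gt0 ?exprn_gt0.
  pose q : R := e / 2 ^+ p / 2.
  have q0 : 0 < q by rewrite divr_gt0.
  pose eta : R := Num.min 1 q.
  have eta0 : 0 < eta by rewrite lt_min ltr01 q0.
  have etap : eta ^+ p <= q.
    have eta1 : eta <= 1 by rewrite /eta ge_min lexx.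
    apply: (@le_trans _ _ eta); last by rewrite /eta ge_min lexx orbT.
    by rewrite -[leRHS]expr1 ler_wiXn2l // ltW.
  (* Here [n] is fixed before [N], so the probability of a gap can be made small enough for
     [n ^ p * e' <= q]. *)
  pose e' : R := q / (n%:R ^+ p + 1).
  have np1 : 0 < n%:R ^+ p + 1 :> R by rewrite ltr_wpDl ?exprn_ge0.
  have e'0 : 0 < e' by rewrite divr_gt0.
  have [N [LN bN PN]] : exists N, [/\ Lpow P k.+1 (Z_ N),
      Ex P (fun w => Z_ N w ^+ p) <= b &
      (P [set w | (eta < `|Z_ N w - Z w|)%R] <= e'%:E)%E].
    have [N _ h] := filterI LZ (filterI Eb (cvgZ _ _ eta0 e'0)).
    by exists N; have [? []] := h N (leqnn N).
  pose A := [set w | (eta < `|Z_ N w - Z w|)%R].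
  have mA : measurable A.
    have -> : A = (fun w => `|Z_ N w - Z w|) @^-1` `]eta, +oo[.
      by apply/seteqP; split => w /=; rewrite in_itv /= andbT.
    rewrite -[X in measurable X]setTI.
    have mN : measurable_fun setT (fun w => `|Z_ N w - Z w|).
      apply: measurableT_comp => //; apply: measurable_funB => //.
      exact: Lpow_meas LN.
    by apply: mN => //; exact: measurable_itv.
  have LA : Lpow P 0 (\1_A : Om -> R).
    apply: (@Lpow_bounded _ _ _ _ _ _ 1) => //.
    by move=> w; rewrite indicE ger0_norm // lern1 leq_b1.
  have EA : Ex P (\1_A : Om -> R) <= e'.
    by rewrite -lee_fin -ExE // integral_indic // setIT.
  have LZp := Lpow_pow LN.
  have Eabs : Ex P (fun w => `|Z_ N w| ^+ p) = Ex P (fun w => Z_ N w ^+ p).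
    by apply: eq_Ex => w; rewrite /p expnS !exprM real_normK ?num_real.
  apply: (@le_trans _ _ (Ex P (fun w => 2 ^+ p * (`|Z_ N w| ^+ p +
     (eta ^+ p + n%:R ^+ p * \1_A w))))).
    apply: Ex_le => //.
      apply: LpowZ; apply: LpowD => //; apply: LpowD; first exact: Lpow_cst.
      exact: LpowZ.
    move=> w; have := @min_pow_le (Z w) (Z_ N w) n%:R eta p (ler0n _ _) (ltW eta0).
    rewrite indicE; congr (_ <= _ * (_ + (_ + _ * _))); congr (_%:R).
    by congr nat_of_bool; apply/idP/idP; rewrite ?inE.
  rewrite ExZ; last first.
    by apply: LpowD => //; apply: LpowD; [exact: Lpow_cst|exact: LpowZ].
  rewrite ExD //; last by apply: LpowD; [exact: Lpow_cst|exact: LpowZ].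
  rewrite ExD; [|exact: Lpow_cst|exact: LpowZ].
  rewrite Ex_cst ExZ // Eabs.
  have -> : 2 ^+ p * b + e = 2 ^+ p * (b + (q + q)).
    by rewrite /q; field; rewrite expf_neq0.
  rewrite ler_pM2l ?exprn_gt0 // lerD // lerD //.
  rewrite (@le_trans _ _ (n%:R ^+ p * e')) ?ler_wpM2l ?exprn_ge0 //.
  rewrite /e' mulrA ler_pdivrMr // [leLHS]mulrC; apply: ler_wpM2l; first exact: ltW.
  by rewrite lerDl ler01.
have cvgc w : (c n w ^+ p)%:E @[n --> \oo] --> (Z w ^+ p)%:E.
  apply: cvg_EFin; first by near=> n.
  apply: (@cvg_trans _ ((fun=> Z w ^+ p) @ \oo)); last exact: cvg_cst.
  apply: near_eq_cvg; near=> n.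
  rewrite /c /= (_ : Num.min _ _ = `|Z w|).
    by rewrite /p expnS !exprM real_normK ?num_real.
  apply/min_idPl; near: n; exact: nbhs_infty_ger.
have := @cvg_monotone_convergence _ _ _ P setT measurableT
  (fun n w => (c n w ^+ p)%:E).
have limE : (fun w => limn (fun n => (c n w ^+ p)%:E)) = (fun w => (Z w ^+ p)%:E).
  by apply/funext => w; apply/cvg_lim.
rewrite limE => /(_ _ _ _)/cvg_lim <- //; last 3 first.
- by move=> n; apply/measurable_EFinP; exact: measurable_funX.
- by move=> n w _; rewrite lee_fin exprn_ge0.
- move=> w _ i j ij; rewrite lee_fin; apply: lerXn2r; rewrite ?nnegrE //.
  by rewrite le_min !ge_min lexx /= ler_nat ij orbT.
apply: lime_le.
  apply: ereal_nondecreasing_is_cvgn => i j ij; apply: ge0_le_integral => //;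
    do ?[by apply/measurable_EFinP; exact: measurable_funX];
    do ?[by move=> w _; rewrite lee_fin exprn_ge0].
  move=> w _; rewrite lee_fin; apply: lerXn2r; rewrite ?nnegrE //.
  by rewrite le_min !ge_min lexx /= ler_nat ij orbT.
by near=> n; rewrite ExE // lee_fin; exact: key.
Unshelve. all: by end_near. Qed.

(** Pointwise, [|z| ^ p <= D ^ p + D ^ p * (|z| / D) ^ M]: the first term covers [|z| <= D], and the
    second covers [|z| > D] because [p <= M]. Each term integrates to at most [D ^ p]. *)
Lemma Lnorm_le_pow k (M D : R) Z : measurable_fun setT Z ->
  (2 ^ k.+1)%:R <= M -> 0 < D ->
  (Lnorm P M%:E (fun w => (Z w)%:E) <= D%:E)%E ->
  Lpow P k.+1 Z /\ Ex P (fun w => Z w ^+ (2 ^ k.+1)) <= 2 * D ^+ (2 ^ k.+1).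
Proof.
move=> mZ pM D0 ND; set p := (2 ^ k.+1)%N in pM *.
have M0 : 0 < M by apply: lt_le_trans pM; rewrite ltr0n expn_gt0.
have IM : (\int[P]_w (`|Z w| `^ M)%:E <= (D `^ M)%:E)%E.
  have := @poweR_Lnorm _ _ _ P (fun w => (Z w)%:E) M (lt0r_neq0 M0).
  under eq_integral do rewrite abse_EFin poweR_EFin.
  move=> <-; rewrite -poweR_EFin; apply: gt0_ler_poweR => //; rewrite ?ltW //.
    by rewrite in_itv /= leey Lnorm_ge0.
  by rewrite in_itv /= leey lee_fin ltW.
have mM : measurable_fun setT (fun w => `|Z w| `^ M).
  by apply: (measurableT_comp (measurable_powR M)); exact: measurableT_comp.
apply: Lpow_of_integral => //.
have pw w : Z w ^+ p <= D ^+ p + (D ^+ p / D `^ M) * `|Z w| `^ M.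
  have -> : Z w ^+ p = `|Z w| ^+ p by rewrite /p expnS !exprM real_normK ?num_real.
  have [zD|Dz] := leP `|Z w| D.
    rewrite (@le_trans _ _ (D ^+ p)) //.
      by apply: lerXn2r; rewrite ?nnegrE // ltW.
    by rewrite lerDl mulr_ge0 ?divr_ge0 ?exprn_ge0 ?powR_ge0 // ltW.
  rewrite (@le_trans _ _ (D ^+ p / D `^ M * `|Z w| `^ M)) //; last first.
    by rewrite lerDr exprn_ge0 // ltW.
  have z0 : 0 < `|Z w| := lt_trans D0 Dz.
  rewrite mulrAC -mulrA -ler_pdivrMl ?exprn_gt0 // mulrC -exprVn -exprMn.
  have -> : `|Z w| `^ M / D `^ M = (`|Z w| / D) `^ M.
    have DV : D^-1 `^ M = (D `^ M)^-1.
      by rewrite -powR_inv1 ?(ltW D0) // -powRrM mulN1r powRN.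
    by rewrite powRM ?invr_ge0 ?(ltW D0) // DV.
  rewrite -powR_mulrn ?divr_ge0 ?(ltW D0) //.
  by apply: ler_powR => //; rewrite ler_pdivlMr // mul1r ltW.
apply: (@le_trans _ _ (\int[P]_w (D ^+ p + (D ^+ p / D `^ M) * `|Z w| `^ M)%:E)%E).
  apply: ge0_le_integral => //.
  - by move=> w _; rewrite lee_fin /p expnS exprM exprn_ge0 ?sqr_ge0.
  - by apply/measurable_EFinP; exact: measurable_funX.
  - by apply/measurable_EFinP; apply: measurable_funD => //; apply: measurable_funM.
  - by move=> w _; rewrite lee_fin.
under eq_integral do rewrite EFinD EFinM.
rewrite ge0_integralD //; first last.
- apply: emeasurable_funM => //; exact/measurable_EFinP.
- by move=> w _; rewrite -EFinM lee_fin mulr_ge0 ?divr_ge0 ?exprn_ge0 ?powR_ge0 // ltW.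
- by move=> w _; rewrite lee_fin exprn_ge0 // ltW.
rewrite integral_cst //= probability_setT mule1 ge0_integralZl //; first last.
- by rewrite lee_fin divr_ge0 ?exprn_ge0 ?powR_ge0 // ltW.
- exact/measurable_EFinP.
rewrite mulrDl mul1r EFinD leeD2l //.
apply: le_trans (_ : (D ^+ p / D `^ M)%:E * (D `^ M)%:E <= _)%E.
  by apply: lee_wpmul2l => //; rewrite lee_fin divr_ge0 ?exprn_ge0 ?powR_ge0 // ltW.
by rewrite -EFinM lee_fin divfK // gt_eqF // powR_gt0.
Qed.

End moment_transfer.

(** * Averaging a function of the innovations over its remote past *)

Section approximation.
Context d0 (Om : measurableType d0) (R : realType) (P : probability Om R).
Variable u : nat -> Om -> R.
Hypothesis um : forall j, measurable_fun setT (u j).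
Hypothesis ui : mutually_independent P [set: nat]
  (fun j => preimage_set_system setT (u j) measurable).
Variables (m : nat) (M : R).
Hypothesis M8 : 8 < M.

Notation seqR := (g_sigma_algebraType (@coordinate_preimages R)).
Notation PP := (P \x P)%E.

Definition seq_of (w : Om) : nat -> R := fun j => u j w.
Definition upd (s : nat) (z : Om * Om) : nat -> R :=
  fun j => if j == s then u j z.2 else u j z.1.

Lemma measurable_seq_fst : measurable_fun setT ((fun z => seq_of z.1) : Om * Om -> seqR).
Proof.
apply: measurable_seqmap => j.
exact: (measurableT_comp (um j) measurable_fst).
Qed.

Section scalar.
Variable f : (nat -> R) -> R.
Hypothesis mf : measurable_seqfun f.

Definition upd_norm s : \bar R :=
  Lnorm PP M%:E (fun z => (f (seq_of z.1) - f (upd s z))%:E).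

Lemma measurable_f_mix J : measurable_fun setT (fun z => f (mix u J z)).
Proof. exact: (measurableT_comp mf (measurable_mix um J)). Qed.

Lemma measurable_f_fst : measurable_fun setT (fun z : Om * Om => f (seq_of z.1)).
Proof. exact: (measurableT_comp mf measurable_seq_fst). Qed.

(** The two sequences differ only in coordinate [s], which moves from the first copy to the second.
    By [integral_mix_swap] the coordinates already exchanged may be moved back, and a single
    replacement remains. *)
Lemma mix_increment s : (m <= s)%N ->
  Lnorm PP M%:E (fun z => (f (mix u (mid m s) z) - f (mix u (mid m s.+1) z))%:E)
  = upd_norm s.
Proof.
move=> ms.
pose h (x : seqR * seqR) : nat -> R := fun j => if j == s then x.2 j else x.1 j.
have mh : measurable_fun setT (h : seqR * seqR -> seqR).
  apply: measurable_seqmap => j; rewrite /h; case: (j == s).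
    exact: (measurableT_comp (@measurable_coord _ j) measurable_snd).
  exact: (measurableT_comp (@measurable_coord _ j) measurable_fst).
pose Phi (x : seqR * seqR) : \bar R := (`|f x.1 - f (h x)| `^ M)%:E.
have mPhi : measurable_fun setT Phi.
  apply/measurable_EFinP; apply: (measurableT_comp (measurable_powR M)).
  apply: measurableT_comp => //; apply: measurable_funB.
    exact: (measurableT_comp mf measurable_fst).
  exact: (measurableT_comp mf mh).
have Phi0 x : (0 <= Phi x)%E by rewrite lee_fin powR_ge0.
have := integral_mix_swap um ui (mid m s) pred0 mPhi Phi0.
rewrite /upd_norm Lnorm.unlock => E; congr (_ `^ _)%E.
have h1 z : h (mix u (mid m s) z, mix u (predC (mid m s)) z) = mix u (mid m s.+1) z.
  apply/funext => j; rewrite /h /mix /mid /=; have [->|js] := eqVneq j s.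
    by rewrite ms ltnn ltnSn /=.
  by have -> : (j < s.+1)%N = (j < s)%N by rewrite ltnS [LHS]leq_eqVlt (negbTE js).
have h2 z : h (mix u pred0 z, mix u (predC pred0) z) = upd s z.
  by apply/funext => j; rewrite /h /mix /upd /=.
transitivity (\int[PP]_z Phi (mix u (mid m s) z, mix u (predC (mid m s)) z))%E.
  by apply: eq_integral => z _; rewrite /Phi h1 abse_EFin poweR_EFin.
rewrite E; apply: eq_integral => z _.
by rewrite /Phi h2 abse_EFin poweR_EFin.
Qed.

(** Minkowski's inequality over the successive replacements of coordinates [m], ..., [N - 1]; for
    [N <= m] nothing has been replaced. *)
Lemma mix_telescope N :
  (Lnorm PP M%:E (fun z => (f (seq_of z.1) - f (mix u (mid m N) z))%:E)
   <= \sum_(m <= j < N) upd_norm j)%E.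
Proof.
have M1 : 1 <= M by apply: ltW; apply: lt_trans M8; rewrite ltr1n.
have base N' : (N' <= m)%N -> forall z, mix u (mid m N') z = seq_of z.1.
  move=> Nm z; apply/funext => j; rewrite /mix /mid /=.
  by case: ifP => // /andP[mj jN]; move: (leq_trans jN (leq_trans Nm mj)); rewrite ltnn.
elim: N => [|N IH].
  rewrite big_geq // (eq_Lnorm _ _ (g := cst 0)); last first.
    by move=> z; rewrite base // subrr.
  by rewrite Lnorm0 // eqe gt_eqF // (lt_le_trans ltr01).
have [mN|Nm] := leqP m N; last first.
  rewrite big_geq // (eq_Lnorm _ _ (g := cst 0)); last first.
    by move=> z; rewrite base // subrr.
  by rewrite Lnorm0 // eqe gt_eqF // (lt_le_trans ltr01).
rewrite big_nat_recr //=.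
pose a z := f (seq_of z.1) - f (mix u (mid m N) z).
pose b z := f (mix u (mid m N) z) - f (mix u (mid m N.+1) z).
have ma : measurable_fun setT a.
  by apply: measurable_funB; [exact: measurable_f_fst|exact: measurable_f_mix].
have mb : measurable_fun setT b.
  by apply: measurable_funB; exact: measurable_f_mix.
apply: (@le_trans _ _ (Lnorm PP M%:E (EFin \o a) + Lnorm PP M%:E (EFin \o b))%E).
  apply: le_trans (minkowski_EFin PP ma mb M1).
  rewrite le_eqVlt; apply/orP; left; apply/eqP; apply: eq_Lnorm => z.
  by rewrite /= /a /b addrA subrK.
by apply: leeD => //; rewrite -(mix_increment mN).
Qed.

Definition tail_diff (z : Om * Om) : R := f (seq_of z.1) - f (mix u (tail m) z).

(** The bound for finitely many replacements is uniform in their number, so Fatou in probability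
    carries it to the full tail. The constant [2 ^ 9] is the 2 of [Lnorm_le_pow] times the [2 ^ 8]
    of the Fatou step. *)
Lemma tail_diff_bound (D : R) : 0 < D ->
  (forall N, \sum_(m <= j < N) upd_norm j <= D%:E)%E ->
  Lpow PP 3 tail_diff /\
  Ex PP (fun z => tail_diff z ^+ 8) <= 2 ^+ 9 * D ^+ 8.
Proof.
move=> D0 hD.
pose Z_ N z := f (seq_of z.1) - f (mix u (mid m N) z).
have mZ N : measurable_fun setT (Z_ N).
  by apply: measurable_funB; [exact: measurable_f_fst|exact: measurable_f_mix].
have hZ N := Lnorm_le_pow (k := 2) (mZ N) (ltW M8) D0 (le_trans (mix_telescope N) (hD N)).
have := @fatou_in_probability _ _ _ PP 2 Z_ tail_diff (2 * D ^+ 8).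
rewrite mulrA -exprSr; apply.
- by apply: measurable_funB; [exact: measurable_f_fst|exact: measurable_f_mix].
- by rewrite mulr_ge0 // exprn_ge0 // ltW.
- by near=> N; case: (hZ N).
- by near=> N; case: (hZ N).
- move=> eta e eta0 e0.
  have := mix_cvg_probability um ui m mf eta0 e0.
  apply: filterS => N; congr (_ <= _)%E; congr (PP _).
  apply/seteqP; split => z /=; rewrite /Z_ /tail_diff -normrN;
    by congr (_ < `|_|); ring.
Unshelve. all: by end_near. Qed.

End scalar.

Lemma Lpow_fst k (Y : Om -> R) : Lpow P k Y -> Lpow PP k (fun z => Y z.1).
Proof.
move=> [mY /integrableP[mY2 iY]]; split; first exact: (measurableT_comp mY measurable_fst).
apply/integrable12ltyP.
  apply/measurable_EFinP; apply: measurable_funX.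
  exact: (measurableT_comp mY measurable_fst).
apply: le_lt_trans iY; rewrite le_eqVlt; apply/orP; left; apply/eqP.
apply: eq_integral => w _ /=.
by rewrite integral_cst //= probability_setT mule1.
Qed.

Section vector.
Context (d : nat) (g : 'I_d -> (nat -> R) -> R).
Hypothesis mg : forall i, measurable_seqfun (g i).

Definition lin (a : 'rV[R]_d) (x : nat -> R) : R := \sum_i a 0 i * g i x.

Lemma measurable_lin a : measurable_seqfun (lin a).
Proof.
apply: measurable_sum => i; apply: measurable_funM => //.
exact: mg.
Qed.

Variables (C D : R).
Hypotheses (C0 : 0 < C) (D0 : 0 < D).
Hypothesis hC : forall a, norm2 a = 1 ->
  (Lnorm P M%:E (fun w => (lin a (seq_of w))%:E) <= C%:E)%E.
Hypothesis hD : forall a, norm2 a = 1 -> forall N,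
  (\sum_(m <= j < N) upd_norm (lin a) j <= D%:E)%E.

Lemma measurable_seq_of : measurable_fun setT (seq_of : Om -> seqR).
Proof. by apply: measurable_seqmap => j; exact: um. Qed.

Lemma lin_moment a : norm2 a = 1 ->
  Lpow P 3 (fun w => lin a (seq_of w)) /\
  Ex P (fun w => lin a (seq_of w) ^+ 8) <= 2 * C ^+ 8.
Proof.
move=> a1; apply: (Lnorm_le_pow (k := 2) _ (ltW M8) C0 (hC a1)).
exact: (measurableT_comp (measurable_lin a) measurable_seq_of).
Qed.

Definition unitv (i : 'I_d) : 'rV[R]_d := delta_mx 0 i.

Lemma sum_unitv (i : 'I_d) (F : 'I_d -> R) : \sum_j unitv i 0 j * F j = F i.
Proof.
rewrite (bigD1 i) //= big1 ?addr0.
  by rewrite /unitv mxE !eqxx mul1r.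
by move=> j ji; rewrite /unitv mxE (negbTE ji) andbF mul0r.
Qed.

Lemma norm2_unitv i : norm2 (unitv i) = 1.
Proof. by rewrite /norm2 /dotp sum_unitv /unitv mxE !eqxx sqrtr1. Qed.

Lemma lin_unitv i x : lin (unitv i) x = g i x.
Proof. exact: sum_unitv. Qed.

Lemma Lpow_g i : Lpow P 3 (fun w => g i (seq_of w)).
Proof.
have [L _] := lin_moment (norm2_unitv i).
by apply: Lpow_eq L => w; rewrite lin_unitv.
Qed.

Definition Xt i (z : Om * Om) : R := g i (mix u (tail m) z).

Lemma Lpow_Xt i : Lpow PP 3 (Xt i).
Proof.
have [L _] := tail_diff_bound (measurable_lin (unitv i)) D0 (hD (norm2_unitv i)).
apply: Lpow_eq (LpowB (Lpow_fst (Lpow_g i)) L) => z.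
by rewrite /tail_diff !lin_unitv /Xt; ring.
Qed.

(** The conditional expectation of [g i] given the coordinates below [m], as an integral over the
    second copy. Written with two nonnegative integrands, it is measurable on the whole space by
    Tonelli, whether or not every section is integrable. *)
Definition section_mean i (w : Om) : R :=
  2^-1 * (Ex P (fun w2 => `|Xt i (w, w2)| + Xt i (w, w2)) -
          Ex P (fun w2 => `|Xt i (w, w2)| - Xt i (w, w2))).

Definition head_gens : set_system Om :=
  \bigcup_(j in [set j | (j < m)%N]) preimage_set_system setT (u j) measurable.

Lemma head_gens_measurable : head_gens `<=` measurable.
Proof. by move=> _ [j _ [V mV <-]]; exact: um. Qed.

(** [Xt i] reads only head coordinates from its first argument, so it stays measurable when that
    factor carries just the head sigma-algebra; Tonelli then gives measurability for this coarser
    structure. *)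
Lemma dep_section_mean i : dep head_gens (section_mean i).
Proof.
pose T1 := g_sigma_algebraType head_gens.
have mu1 j : (j < m)%N -> measurable_fun setT (u j : T1 -> R).
  by move=> jm _ V mV; apply: sub_sigma_algebra; exists j => //; exists V.
have mX : measurable_fun setT (Xt i : T1 * Om -> R).
  apply: (measurableT_comp (mg i)).
  apply: measurable_seqmap => j; rewrite /mix /tail /=; case: leqP => jm.
    exact: (measurableT_comp (um j) measurable_snd).
  exact: (measurableT_comp (mu1 j jm) measurable_fst).
have aux (s : R) : (s = 1 \/ s = -1) ->
    measurable_fun setT ((fun w => Ex P (fun w2 => `|Xt i (w, w2)| + s * Xt i (w, w2))) : T1 -> R).
  move=> hs.
  pose h (z : T1 * Om) := (`|Xt i z| + s * Xt i z)%:E.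
  have mh : measurable_fun setT h.
    apply/measurable_EFinP; apply: measurable_funD; first exact: measurableT_comp.
    exact: measurable_funM.
  have h0 z : (0 <= h z)%E.
    rewrite lee_fin; case: hs => ->; rewrite ?mul1r ?mulN1r ?subr_ge0 ?ler_norm //.
    by rewrite -lerBlDr sub0r -normrN ler_norm.
  have := @measurable_fun_fubini_tonelli_F _ _ T1 Om R P h mh h0.
  exact: (measurableT_comp (fine_measurable measurableT)).
have m1 := aux 1 (or_introl erefl); have m2 := aux (-1) (or_intror erefl).
have : measurable_fun setT ((fun w => 2^-1 *
   (Ex P (fun w2 => `|Xt i (w, w2)| + 1 * Xt i (w, w2)) -
    Ex P (fun w2 => `|Xt i (w, w2)| + -1 * Xt i (w, w2)))) : T1 -> R).
  by apply: measurable_funM => //; exact: measurable_funB.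
congr (measurable_fun _ _); apply/funext => w; rewrite /section_mean.
by congr (_ * (_ - _)); apply: eq_Ex => w2; rewrite ?mul1r ?mulN1r.
Qed.

Lemma section_meanE i w : Lpow P 0 (fun w2 => Xt i (w, w2)) ->
  section_mean i w = Ex P (fun w2 => Xt i (w, w2)).
Proof.
move=> L; have La := Lpow_norm L.
by rewrite /section_mean ExD // ExB //; field.
Qed.

Lemma ae_sections : {ae P, forall w, forall i, Lpow P 0 (fun w2 => Xt i (w, w2))}.
Proof.
have : {ae P, forall w, forall n : nat, forall i : 'I_d, val i = n ->
    Lpow P 0 (fun w2 => Xt i (w, w2))}.
  apply/ae_foralln => n; have [dn|nd] := leqP d n.
    by apply: aeW => w i E; move: (ltn_ord i); rewrite -E /= in dn *; rewrite ltnNge dn.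
  have /Lpow0_int := Lpow_le (leq0n 3) (Lpow_Xt (Ordinal nd)).
  move=> /ae_integrable1; apply: filterS => w iw i E.
  apply/Lpow0P; rewrite (_ : i = Ordinal nd) //.
  exact: val_inj.
by apply: filterS => w h i; exact: h.
Qed.

(** For almost every [w], the sum is the mean over the second copy of the section of
    [tail_diff (lin a)] at [w]. Jensen bounds its eighth power, and Tonelli integrates the bound. *)
Lemma section_mean_moment a : norm2 a = 1 ->
  Lpow P 3 (fun w => \sum_i a 0 i * (g i (seq_of w) - section_mean i w)) /\
  Ex P (fun w => (\sum_i a 0 i * (g i (seq_of w) - section_mean i w)) ^+ 8)
    <= 2 ^+ 9 * D ^+ 8.
Proof.
move=> a1; have [L B] := tail_diff_bound (measurable_lin a) D0 (hD a1).
have msm i : measurable_fun setT (section_mean i).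
  exact: dep_measurable head_gens_measurable (dep_section_mean i).
have mgi i : measurable_fun setT (fun w => g i (seq_of w)) := Lpow_meas (Lpow_g i).
have mZ : measurable_fun setT (fun w => \sum_i a 0 i * (g i (seq_of w) - section_mean i w)).
  by apply: measurable_sum => i; apply: measurable_funM => //; exact: measurable_funB.
apply: (@Lpow_of_integral _ _ _ _ 2) => //.
have mL : measurable_fun setT (fun z => (tail_diff (lin a) z ^+ 8)%:E).
  by apply/measurable_EFinP; apply: measurable_funX; exact: Lpow_meas L.
have L0 z : (0 <= (tail_diff (lin a) z ^+ 8)%:E)%E.
  by rewrite lee_fin (exprM _ 4 2) sqr_ge0.
apply: (@le_trans _ _ (\int[P]_w1 \int[P]_w2 (tail_diff (lin a) (w1, w2) ^+ 8)%:E)%E); last first.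
  rewrite -(@fubini_tonelli1 _ _ Om Om R P P _ mL L0) ExE ?lee_fin //.
  by apply/Lpow0P; case: L.
apply: ae_ge0_le_integral => //.
- by move=> w _; rewrite lee_fin (exprM _ 4 2) sqr_ge0.
- by apply/measurable_EFinP; exact: measurable_funX.
- by move=> w _; apply: integral_ge0.
- exact: (@measurable_fun_fubini_tonelli_F _ _ Om Om R P _ mL L0).
move: ae_sections; apply: filterS => w hw _.
have mw : measurable_fun setT (fun w2 => tail_diff (lin a) (w, w2)).
  exact: (measurableT_comp (Lpow_meas L) (pair1_measurable w)).
(* If the inner integral is infinite, the inequality at this [w] is trivial; otherwise the section
   has a finite eighth moment. *)
case E : (\int[P]_w2 (tail_diff (lin a) (w, w2) ^+ 8)%:E)%E => [r| |]; last 2 first.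
- by rewrite leey.
- have := integral_ge0 P (D := setT) (fun w2 _ => L0 (w, w2)); rewrite E.
  by rewrite leeNy_eq => /eqP.
have [Lw Bw] : Lpow P 3 (fun w2 => tail_diff (lin a) (w, w2)) /\
    Ex P (fun w2 => tail_diff (lin a) (w, w2) ^+ 8) <= r.
  by apply: (@Lpow_of_integral _ _ _ P 2) => //; rewrite E.
rewrite lee_fin; apply: le_trans Bw; apply: le_trans (Ex_pow_le Lw).
rewrite le_eqVlt; apply/orP; left; apply/eqP; congr (_ ^+ _).
have -> : (fun w2 => tail_diff (lin a) (w, w2)) =
    fun w2 => \sum_i (a 0 i * g i (seq_of w) - a 0 i * Xt i (w, w2)).
  by apply/funext => w2; rewrite sumrB.
rewrite Ex_sum; last first.
  by move=> i _; apply: LpowB; [exact: Lpow_cst|exact: LpowZ].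
apply: eq_bigr => i _.
rewrite ExB; [|exact: Lpow_cst|exact: LpowZ].
by rewrite Ex_cst ExZ // section_meanE // mulrBr.
Qed.

End vector.
End approximation.

(** * From unit vectors to all vectors, and centering *)

Section scaling_moments.
Context d0 (Om : measurableType d0) (R : realType) (P : probability Om R).
Context (d : nat).
Implicit Types (a : 'rV[R]_d) (Y : 'I_d -> Om -> R).

Lemma dotp_ge0 a : 0 <= dotp a a.
Proof. by apply: sumr_ge0 => i _; rewrite -expr2 sqr_ge0. Qed.

(** The square of a fourth moment is at most the eighth moment, and homogeneity of degree 4 passes
    from unit vectors to all [a]. *)
Lemma Ex_pow4_unit Y (b : R) : 0 <= b -> (forall i, Lpow P 3 (Y i)) ->
  (forall a, norm2 a = 1 -> Ex P (fun w => (\sum_i a 0 i * Y i w) ^+ 8) <= b ^+ 2) ->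
  forall a, Ex P (fun w => (\sum_i a 0 i * Y i w) ^+ 4) <= b * dotp a a ^+ 2.
Proof.
move=> b0 LY hb a.
have LS a' : Lpow P 3 (fun w => \sum_i a' 0 i * Y i w).
  by apply: Lpow_sum => i _; exact: LpowZ.
have h4 a' : norm2 a' = 1 -> Ex P (fun w => (\sum_i a' 0 i * Y i w) ^+ 4) <= b.
  move=> a1; rewrite -(@ler_pXn2r _ 2) ?nnegrE //; last first.
    by apply: Ex_ge0 => w; rewrite (exprM _ 2 2) sqr_ge0.
  apply: le_trans (hb a' a1).
  have L4 : Lpow P 1 (fun w => (\sum_i a' 0 i * Y i w) ^+ 4).
    apply: Lpow_eq (Lpow_sqr (Lpow_sqr (LS a'))) => w.
    by rewrite -exprM.
  apply: le_trans (Ex_sqr_le L4) _; rewrite le_eqVlt; apply/orP; left; apply/eqP.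
  by apply: eq_Ex => w; rewrite -exprM.
have [a0|a0] := eqVneq (dotp a a) 0.
  have az i : a 0 i = 0.
    have := a0; rewrite /dotp => /eqP; rewrite psumr_eq0; last first.
      by move=> j _; rewrite -expr2 sqr_ge0.
    by move=> /allP /(_ i (mem_index_enum _)); rewrite mulf_eq0 orbb => /eqP.
  rewrite (@eq_Ex _ _ _ P _ (fun=> 0)) ?Ex_cst ?a0 ?expr0n ?mulr0 //.
  by move=> w; rewrite big1 ?expr0n // => i _; rewrite az mul0r.
have n0 : 0 < norm2 a by rewrite sqrtr_gt0 lt_neqAle eq_sym a0 dotp_ge0.
have n2 : norm2 a ^+ 2 = dotp a a by rewrite sqr_sqrtr // dotp_ge0.
pose a' := (norm2 a)^-1 *: a.
have a'1 : norm2 a' = 1.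
  rewrite /norm2 (_ : dotp a' a' = 1) ?sqrtr1 //.
  rewrite /dotp /a'; under eq_bigr do rewrite !mxE mulrACA.
  by rewrite -mulr_sumr -expr2 exprVn n2 -/(dotp a a) mulVf.
have -> : Ex P (fun w => (\sum_i a 0 i * Y i w) ^+ 4) =
    (norm2 a) ^+ 4 * Ex P (fun w => (\sum_i a' 0 i * Y i w) ^+ 4).
  rewrite -ExZ; last first.
    apply: Lpow_le (leq0n 1) _; apply: Lpow_eq (Lpow_sqr (Lpow_sqr (LS a'))) => w.
    by rewrite -exprM.
  apply: eq_Ex => w; rewrite -exprMn; congr (_ ^+ _).
  rewrite mulr_sumr; apply: eq_bigr => i _.
  by rewrite !mxE mulrA mulrA divff ?mul1r // gt_eqF.
rewrite -n2 -exprM mulrC ler_wpM2r ?exprn_ge0 ?(ltW n0) //.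
exact: h4.
Qed.

(** The variable and its mean contribute equally, the latter by Jensen, after the factor [2 ^ 8] for
    the eighth power of a difference. *)
Lemma Ex_pow8_center Y (c : 'I_d -> R) (b : R) : (forall i, Lpow P 3 (Y i)) ->
  (forall i, c i = Ex P (Y i)) ->
  (forall a, norm2 a = 1 -> Ex P (fun w => (\sum_i a 0 i * Y i w) ^+ 8) <= b) ->
  forall a, norm2 a = 1 ->
    Ex P (fun w => (\sum_i a 0 i * (Y i w - c i)) ^+ 8) <= 2 ^+ 9 * b.
Proof.
move=> LY cE hb a a1.
pose S w := \sum_i a 0 i * Y i w.
have LS : Lpow P 3 S by apply: Lpow_sum => i _; exact: LpowZ.
have LY0 i : Lpow P 0 (Y i) := Lpow_le (leq0n 3) (LY i).
have ES : Ex P S = \sum_i a 0 i * c i.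
  by rewrite Ex_sum => [|i _]; [apply: eq_bigr => i _; rewrite ExZ ?cE //|exact: LpowZ].
have SE w : \sum_i a 0 i * (Y i w - c i) = S w - Ex P S.
  by rewrite ES -sumrB; apply: eq_bigr => i _; rewrite mulrBr.
have L8 : Lpow P 0 (fun w => S w ^+ 8) by apply/Lpow0P; case: LS.
have ev (x : R) : `|x| ^+ 8 = x ^+ 8.
  by rewrite (exprM _ 2 4) real_normK ?num_real // -exprM.
apply: (@le_trans _ _ (Ex P (fun w => 2 ^+ 8 * (S w ^+ 8 + Ex P S ^+ 8)))).
  apply: Ex_le.
  - apply: Lpow_eq (_ : Lpow P 0 (fun w => (S w - Ex P S) ^+ 8)); first by move=> w; rewrite SE.
    have : Lpow P 3 (fun w => S w - Ex P S) by apply: LpowB => //; exact: Lpow_cst.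
    by case => _ iX; apply/Lpow0P.
  - by apply: LpowZ; apply: LpowD => //; exact: Lpow_cst.
  move=> w; rewrite SE -ev -[S w ^+ 8]ev -[Ex P S ^+ 8]ev -[`|Ex P S|]normrN.
  exact: exp_norm_add_le.
rewrite ExZ; last by apply: LpowD => //; exact: Lpow_cst.
rewrite ExD //; last exact: Lpow_cst.
have E9 : 2 ^+ 9 = 2 ^+ 8 * 2 :> R by rewrite exprSr.
rewrite Ex_cst E9 -mulrA ler_wpM2l ?exprn_ge0 // mulr_natl mulr2n lerD //.
  exact: hb.
apply: le_trans (hb a a1); exact: (@Ex_pow_le _ _ _ P 3 S LS).
Qed.

End scaling_moments.

(** * Approximation of a short-range dependent process by finitely many innovations *)

Section short_range.
Context d0 (Om : measurableType d0) (R : realType) (P : probability Om R).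
Context (d : nat) (e : int -> Om -> R) (g : int -> 'I_d -> (nat -> R) -> R).
Variables (M alpha C : R).
Hypothesis em : forall t, measurable_fun setT (e t).
Hypothesis ei : mutually_independent P [set: int]
  (fun t => preimage_set_system setT (e t) measurable).
Hypothesis gm : forall t i, measurable_seqfun (g t i).
Hypotheses (M8 : 8 < M) (C0 : 0 < C).
Hypothesis srd : short_range_dependent P e g M alpha C.

Definition innov (S : set int) : set_system Om :=
  \bigcup_(t in S) preimage_set_system setT (e t) measurable.

Lemma innov_measurable S : innov S `<=` measurable.
Proof. by move=> _ [t _ [V mV <-]]; exact: em. Qed.

Lemma innov_sub S S' : S `<=` S' -> innov S `<=` innov S'.
Proof. by move=> SS' A [t St At]; exists t => //; exact: SS'. Qed.

Lemma innov_indep S S' : S `&` S' `<=` set0 ->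
  independent_systems P <<s innov S >> <<s innov S' >>.
Proof.
apply: (@mutually_independent_gen _ _ _ P int [set: int]
  (fun t => preimage_set_system setT (e t) measurable)) => //.
- by move=> t _ _ [V mV <-]; exact: em.
- move=> t _ _ _ [V mV <-] [W mW <-]; exists (V `&` W); first exact: measurableI.
  by rewrite !setTI preimage_setI.
- by move=> t _; exists setT => //; rewrite setTI preimage_setT.
Qed.

Lemma shifted_indep (t : int) : mutually_independent P [set: nat]
  (fun j => preimage_set_system setT (e (t - j%:Z)) measurable).
Proof.
move=> s A us sA.
pose sh (j : nat) : int := t - j%:Z.
have shI : injective sh by move=> i j /addrI /oppr_inj [].
pose A' (x : int) := A `|t - x|%N.
have AE j : A' (sh j) = A j by rewrite /A' /sh subKr.
have := ei (s := [seq sh j | j <- s]) (A := A').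
rewrite !big_map (map_inj_uniq shI) => /(_ us).
rewrite (eq_bigr A (fun j _ => AE j)).
rewrite (eq_bigr (fun j => P (A j)) (fun j _ => congr1 P (AE j))).
apply => x /mapP[j js ->]; split => //; rewrite AE.
by case: (sA j js).
Qed.

(** The bound that [srd_decay] yields for the sum of all [dep_delta] from [m] on. *)
Definition decay (m : nat) : R := C * (1 + m%:R) `^ (- alpha).

Lemma decay_gt0 m : 0 < decay m.
Proof. by rewrite mulr_gt0 // powR_gt0 // ltr_wpDr. Qed.

Notation eps := (process e g).

Lemma process_lin (t : int) a w :
  dotp a (eps t w) = lin (g t) a (seq_of (fun j => e (t - j%:Z)) w).
Proof. by rewrite /dotp /lin; apply: eq_bigr => i _; rewrite mxE. Qed.

Lemma dep_delta_ge (t : int) a s : norm2 a = 1 ->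
  (upd_norm P (fun j => e (t - j%:Z)) M (lin (g t) a) s <= dep_delta P e g M s)%E.
Proof.
move=> a1; apply: ereal_sup_ubound; exists t, a; split => //.
apply: eq_Lnorm => z; congr (_%:E).
rewrite /dotp /lin -sumrB; apply: eq_bigr => i _.
by rewrite !mxE mulrBr.
Qed.

Lemma sum_upd_norm (t : int) a m : norm2 a = 1 -> forall N,
  (\sum_(m <= j < N) upd_norm P (fun j => e (t - j%:Z)) M (lin (g t) a) j
    <= (decay m)%:E)%E.
Proof.
move=> a1 N.
have dg j : (0 <= dep_delta P e g M j)%E.
  apply: le_trans (dep_delta_ge t j a1); exact: Lnorm_ge0.
apply: (@le_trans _ _ (\sum_(m <= j < N) dep_delta P e g M j)%E).
  by apply: lee_sum => j _; exact: dep_delta_ge.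
apply: (@le_trans _ _ (\sum_(m <= j <oo) dep_delta P e g M j)%E).
  exact: nneseries_lim_ge.
have hm : (((1 + m%:R) `^ alpha)%:E * \sum_(m <= j <oo) dep_delta P e g M j <= C%:E)%E.
  by apply: le_trans (srd_decay srd); apply: ereal_sup_ubound; exists m.
have m1 : 0 < 1 + m%:R :> R by rewrite ltr_wpDr.
by rewrite /decay powRN mulrC EFinM lee_pdivlMl ?powR_gt0.
Qed.

(** The section mean over all but the last [m] innovations, shifted by a constant so that its mean
    is exactly 0. The eighth moment picks up [2 ^ 9] from averaging and [2 ^ 9] from the shift; the
    fourth moment keeps the square root of their product. *)
Lemma approximant (m : nat) (t : int) :
  exists et : Om -> 'rV[R]_d,
  [/\ forall i, dep (innov [set s | t - m%:Z < s <= t]) (fun w => et w 0 i),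
      forall i, Lpow P 3 (fun w => et w 0 i),
      forall i, Ex P (fun w => et w 0 i) = 0 &
      forall a, Ex P (fun w => dotp a (eps t w - et w) ^+ 4)
        <= 2 ^+ 9 * decay m ^+ 4 * dotp a a ^+ 2].
Proof.
pose u j := e (t - j%:Z).
have um j : measurable_fun setT (u j) by exact: em.
have ui := @shifted_indep t.
have hC a : norm2 a = 1 -> (Lnorm P M%:E (fun w => (lin (g t) a (seq_of u w))%:E) <= C%:E)%E.
  move=> a1; apply: le_trans (srd_moment srd); apply: ereal_sup_ubound.
  exists t, a; split => //; apply: eq_Lnorm => w.
  by rewrite process_lin.
have hD a (a1 : norm2 a = 1) := @sum_upd_norm t a m a1.
pose Y i w := g t i (seq_of u w) - section_mean P u m (g t) i w.
have LY i : Lpow P 3 (Y i).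
  have [L _] := section_mean_moment um ui M8 (gm t) C0 (decay_gt0 m) hC hD (norm2_unitv R i).
  by apply: Lpow_eq L => w; rewrite sum_unitv.
have Lg i := Lpow_g um M8 (gm t) C0 hC i.
have Ls i : Lpow P 3 (section_mean P u m (g t) i).
  by apply: Lpow_eq (LpowB (Lg i) (LY i)) => w; rewrite /Y subKr.
have L0 (X : Om -> R) : Lpow P 3 X -> Lpow P 0 X by exact: Lpow_le.
have Eg i : Ex P (fun w => g t i (seq_of u w)) = 0.
  have := srd_mean srd t i; rewrite unlock => E.
  by rewrite /Ex (eq_integral (fun w => (process e g t w 0 i)%:E)) ?E // => w _; rewrite mxE.
have EY i : Ex P (Y i) = - Ex P (section_mean P u m (g t) i).
  by rewrite ExB ?Eg ?sub0r //; exact: L0.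
pose c i := Ex P (Y i).
pose et (w : Om) : 'rV[R]_d := \row_i (section_mean P u m (g t) i w + c i).
have etE i : (fun w => et w 0 i) = fun w => section_mean P u m (g t) i w + c i.
  by apply/funext => w; rewrite mxE.
exists et; split.
- move=> i; rewrite etE.
  apply: depD; last exact: dep_cst.
  have dm : dep (head_gens u m) (section_mean P u m (g t) i) := dep_section_mean P um (gm t) i.
  apply: depS dm.
  move=> A [j jm uj]; exists (t - j%:Z) => //=; move: jm => /=; lia.
- move=> i; rewrite etE.
  by apply: LpowD => //; exact: Lpow_cst.
- move=> i; rewrite etE.
  by rewrite ExD ?Ex_cst ?/c ?EY ?subrr //; [exact: L0|exact: Lpow_cst].
have D8 := decay_gt0 m.
move=> a.
have -> : Ex P (fun w => dotp a (eps t w - et w) ^+ 4)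
   = Ex P (fun w => (\sum_i a 0 i * (Y i w - c i)) ^+ 4).
  apply: eq_Ex => w; congr (_ ^+ _); apply: eq_bigr => i _; rewrite !mxE.
  by congr (_ * _); rewrite /Y /seq_of /u; ring.
apply: Ex_pow4_unit.
- by rewrite mulr_ge0 ?exprn_ge0 // ltW.
- by move=> i; apply: LpowB => //; exact: Lpow_cst.
move=> b b1.
have -> : (2 ^+ 9 * decay m ^+ 4) ^+ 2 = 2 ^+ 9 * (2 ^+ 9 * decay m ^+ 8) by ring.
apply: (@Ex_pow8_center _ _ _ P d Y c _ LY) => // b' b'1.
by have [] := section_mean_moment um ui M8 (gm t) C0 (decay_gt0 m) hC hD b'1.
Qed.

Lemma process_moment (t : int) :
  (forall i, Lpow P 3 (fun w => eps t w 0 i)) /\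
  (forall a, Ex P (fun w => dotp a (eps t w) ^+ 4) <= 2 * C ^+ 4 * dotp a a ^+ 2).
Proof.
pose u j := e (t - j%:Z).
have um j : measurable_fun setT (u j) by exact: em.
have hC a : norm2 a = 1 -> (Lnorm P M%:E (fun w => (lin (g t) a (seq_of u w))%:E) <= C%:E)%E.
  move=> a1; apply: le_trans (srd_moment srd); apply: ereal_sup_ubound.
  exists t, a; split => //; apply: eq_Lnorm => w.
  by rewrite process_lin.
have Lg i : Lpow P 3 (fun w => eps t w 0 i).
  by apply: Lpow_eq (Lpow_g um M8 (gm t) C0 hC i) => w; rewrite mxE.
split => //; apply: Ex_pow4_unit => //; first by rewrite mulr_ge0 ?exprn_ge0 // ltW.
move=> a a1; have [_] := lin_moment um M8 (gm t) C0 hC a1.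
rewrite exprMn -exprM => h; apply: le_trans (_ : 2 * C ^+ 8 <= _); last first.
  by rewrite ler_wpM2r ?exprn_ge0 ?(ltW C0) // expr2; lra.
apply: le_trans h; rewrite le_eqVlt; apply/orP; left; apply/eqP.
by apply: eq_Ex => w; rewrite -process_lin.
Qed.

End short_range.

(** * Window sums of a dependent array *)

Definition near (l t s : nat) : bool := (t < s + l)%N && (s < t + l)%N.

Lemma nearC l t s : near l t s = near l s t.
Proof. by rewrite /near andbC. Qed.

Lemma near_count (R : realType) (l t m n : nat) :
  \sum_(m <= s < n) (near l t s)%:R <= (2 * l)%:R :> R.
Proof.
rewrite -natr_sum ler_nat.
(* The admissible [s] lie in [[t + 1 - l, t + l[]; this count is exact enough to survive the
   induction on the upper end. *)
suff h k : (\sum_(m <= s < k) near l t s <= minn k (t + l) - (t.+1 - l))%N.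
  by have := h n; lia.
elim: k => [|k IH].
  by rewrite big_geq.
have [mk|km] := leqP m k; last by rewrite big_geq.
rewrite big_nat_recr //=; move: IH; set S := (\sum_(_ <= _ < _) _)%N => IH.
by rewrite /near; case: andP => [[h1 h2]|_] /=; lia.
Qed.

Lemma sqr_sum_le (R : realType) (m n : nat) (x : nat -> R) :
  (\sum_(m <= s < n) x s) ^+ 2 <= (n - m)%:R * \sum_(m <= s < n) x s ^+ 2.
Proof.
elim: n => [|n IH]; first by rewrite !big_geq // expr0n mulr0.
have [mn|nm] := leqP m n; last by rewrite !big_geq // expr0n mulr0.
rewrite !big_nat_recr //= subSn // -natr1.
set S := \sum_(_ <= _ < _) _ in IH *; set S2 := \sum_(_ <= _ < _) _ ^+ 2 in IH *.
set k : R := (n - m)%:R in IH *.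
have S20 : 0 <= S2 by apply: sumr_ge0 => i _; rewrite sqr_ge0.
have k0 : 0 <= k by [].
have [k00|k1] := eqVneq k 0.
  have -> : S = 0 by apply/eqP; rewrite -sqrf_eq0 eq_le sqr_ge0 andbT (le_trans IH) // k00 mul0r.
  by rewrite k00 !add0r mul1r lerDr.
have kp : 0 < k by rewrite lt_neqAle eq_sym k1.
have h : 2 * S * x n <= S ^+ 2 / k + k * x n ^+ 2.
  rewrite -subr_ge0.
  have -> : S ^+ 2 / k + k * x n ^+ 2 - 2 * S * x n = (S - k * x n) ^+ 2 / k by field.
  by rewrite divr_ge0 ?sqr_ge0 // ltW.
have h2 : S ^+ 2 / k <= S2 by rewrite ler_pdivrMr // mulrC.
have -> : (S + x n) ^+ 2 = S ^+ 2 + 2 * S * x n + x n ^+ 2 by ring.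
have -> : (k + 1) * (S2 + x n ^+ 2) = k * S2 + (S2 + k * x n ^+ 2) + x n ^+ 2 by ring.
by rewrite lerD2r lerD // (le_trans h) // lerD2r.
Qed.

Lemma sqr_sum_ord_le (R : realType) (d : nat) (x : 'I_d -> R) :
  (\sum_i x i) ^+ 2 <= d%:R * \sum_i x i ^+ 2.
Proof.
pose y k := if insub k is Some i then x i else 0.
have E i : y (val i) = x i by rewrite /y valK.
have := sqr_sum_le 0 d y; rewrite subn0 !big_mkord.
under eq_bigr do rewrite E; under [in X in _ <= _ * X -> _]eq_bigr do rewrite E.
by [].
Qed.

Lemma dotp_sqr_le (R : realType) (d : nat) (u v : 'rV[R]_d) :
  dotp u v ^+ 2 <= dotp u u * dotp v v.
Proof.
have key (s t : R) : 0 <= s ^+ 2 * dotp u u + 2 * s * t * dotp u v + t ^+ 2 * dotp v v.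
  rewrite (_ : _ + _ = \sum_i (s * u 0 i + t * v 0 i) ^+ 2).
    by apply: sumr_ge0 => i _; rewrite sqr_ge0.
  rewrite /dotp !mulr_sumr -!big_split /=; apply: eq_bigr => i _; ring.
have u0 := dotp_ge0 u; have v0 := dotp_ge0 v.
have [a00|a1] := eqVneq (dotp u u) 0.
  have [->|b0] := eqVneq (dotp u v) 0; first by rewrite a00 expr0n !mul0r.
  have := key (- (dotp v v + 1) / (2 * dotp u v)) 1; rewrite a00.
  have -> : 2 * (- (dotp v v + 1) / (2 * dotp u v)) * 1 * dotp u v = - (dotp v v + 1) by field.
  lra.
have := key (dotp u v) (- dotp u u); have : 0 < dotp u u by rewrite lt_neqAle eq_sym a1.
move=> a2 h; rewrite -subr_ge0 -(pmulr_rge0 _ a2).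
by rewrite (le_trans h) // le_eqVlt; apply/orP; left; apply/eqP; ring.
Qed.

Lemma dotpC (R : realType) (d : nat) (u v : 'rV[R]_d) : dotp u v = dotp v u.
Proof. by apply: eq_bigr => i _; rewrite mulrC. Qed.

Lemma dotpDr (R : realType) (d : nat) (u v w : 'rV[R]_d) :
  dotp u (v + w) = dotp u v + dotp u w.
Proof. by rewrite /dotp -big_split; apply: eq_bigr => i _; rewrite mxE mulrDr. Qed.

Lemma dotpDl (R : realType) (d : nat) (u v w : 'rV[R]_d) :
  dotp (v + w) u = dotp v u + dotp w u.
Proof. by rewrite dotpC dotpDr !(dotpC u). Qed.

Lemma dotpNr (R : realType) (d : nat) (u v : 'rV[R]_d) : dotp u (- v) = - dotp u v.
Proof. by rewrite /dotp -sumrN; apply: eq_bigr => i _; rewrite mxE mulrN. Qed.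

Lemma dotpNl (R : realType) (d : nat) (u v : 'rV[R]_d) : dotp (- u) v = - dotp u v.
Proof. by rewrite dotpC dotpNr dotpC. Qed.

Lemma dotpZr (R : realType) (d : nat) (c : R) (u v : 'rV[R]_d) :
  dotp u (c *: v) = c * dotp u v.
Proof. by rewrite /dotp mulr_sumr; apply: eq_bigr => i _; rewrite mxE mulrCA. Qed.

Lemma dotp_sumr (R : realType) (d : nat) (u : 'rV[R]_d) (I : Type) (r : seq I)
  (p : pred I) (F : I -> 'rV[R]_d) :
  dotp u (\sum_(i <- r | p i) F i) = \sum_(i <- r | p i) dotp u (F i).
Proof.
elim: r => [|i r IH]; first by rewrite !big_nil /dotp big1 // => i _; rewrite mxE mulr0.
by rewrite !big_cons; case: (p i); rewrite ?dotpDr IH.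
Qed.

Section orthogonal_sums.
Context d0 (Om : measurableType d0) (R : realType) (P : probability Om R).

Lemma Ex_sqr_sum (I J : Type) (r : seq I) (r' : seq J) (F : I -> Om -> R) (G : J -> Om -> R) :
  (forall i, Lpow P 1 (F i)) -> (forall i, Lpow P 1 (G i)) ->
  Ex P (fun w => (\sum_(i <- r) F i w) * (\sum_(j <- r') G j w)) =
  \sum_(i <- r) \sum_(j <- r') Ex P (fun w => F i w * G j w).
Proof.
move=> LF LG.
transitivity (Ex P (fun w => \sum_(i <- r) \sum_(j <- r') F i w * G j w)).
  by apply: eq_Ex => w; rewrite mulr_suml; apply: eq_bigr => i _; rewrite mulr_sumr.
rewrite Ex_sum => [|i _]; last by apply: Lpow_sum => j _; exact: LpowM.
by apply: eq_bigr => i _; rewrite Ex_sum // => j _; exact: LpowM.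
Qed.

(** Only pairs at distance below [l] contribute. Each is at most [b / 2] times the sum of the two
    squared coefficients, and every index has at most [2 * l] such partners. *)
Lemma orthogonal_sum (F : nat -> Om -> R) (c : nat -> R) (l m n : nat) (b : R) :
  (forall t, Lpow P 1 (F t)) ->
  (forall t, (m <= t < n)%N -> Ex P (fun w => F t w ^+ 2) <= b) ->
  (forall t s, (m <= s)%N -> (t < n)%N -> (s + l <= t)%N -> Ex P (fun w => F t w * F s w) = 0) ->
  Ex P (fun w => (\sum_(m <= t < n) c t * F t w) ^+ 2) <=
    (2 * l)%:R * b * \sum_(m <= t < n) c t ^+ 2.
Proof.
move=> LF Fb F0.
have LcF t : Lpow P 1 (fun w => c t * F t w) by exact: LpowZ.
have [mn|nm] := ltnP m n; last first.
  rewrite [in leRHS]big_geq // mulr0.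
  by rewrite (@eq_Ex _ _ _ P _ (fun=> 0)) ?Ex_cst // => w; rewrite big_geq // expr0n.
have b0 : 0 <= b.
  by apply: le_trans (Fb m _); rewrite ?leqnn ?mn //; exact: Ex_sqr_ge0.
have Eb t s : (m <= t < n)%N -> (m <= s < n)%N ->
    Ex P (fun w => (c t * F t w) * (c s * F s w)) <=
    (near l t s)%:R * (b / 2) * (c t ^+ 2 + c s ^+ 2).
  move=> tmn smn.
  have -> : Ex P (fun w => (c t * F t w) * (c s * F s w)) =
      c t * c s * Ex P (fun w => F t w * F s w).
    by rewrite -ExZ; [apply: eq_Ex => w; ring|exact: LpowM].
  have [ns|] := boolP (near l t s); last first.
    rewrite /near negb_and -!leqNgt => /orP[h|h].
      by rewrite F0 ?mulr0 ?mul0r //; lia.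
    rewrite (_ : Ex P _ = Ex P (fun w => F s w * F t w)); last first.
      by apply: eq_Ex => w; rewrite mulrC.
    by rewrite F0 ?mulr0 ?mul0r //; lia.
  have sb : b = Num.sqrt b ^+ 2 by rewrite sqr_sqrtr.
  have h : `|Ex P (fun w => F t w * F s w)| <= b.
    rewrite [leRHS]sb expr2; apply: Ex_CS_le; rewrite ?sqrtr_ge0 // -sb; exact: Fb.
  rewrite mul1r (le_trans (ler_norm _)) // normrM.
  apply: (@le_trans _ _ (`|c t * c s| * b)); first by rewrite ler_wpM2l.
  rewrite mulrC mulrAC -mulrA ler_wpM2l // normrM.
  rewrite -[c t ^+ 2]real_normK ?num_real // -[c s ^+ 2]real_normK ?num_real //.
  have := sqr_ge0 (`|c t| - `|c s|); nra.
rewrite (_ : Ex P _ = Ex P (fun w => (\sum_(m <= t < n) c t * F t w) *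
   (\sum_(m <= t < n) c t * F t w))); last by apply: eq_Ex => w; rewrite expr2.
rewrite Ex_sqr_sum //.
apply: (@le_trans _ _ (\sum_(m <= t < n) \sum_(m <= s < n)
   (near l t s)%:R * (b / 2) * (c t ^+ 2 + c s ^+ 2))).
  by rewrite !big_nat; apply: ler_sum => t ht; rewrite !big_nat; apply: ler_sum => s hs; exact: Eb.
have half : \sum_(m <= t < n) \sum_(m <= s < n) (near l t s)%:R * (b / 2) * c t ^+ 2
    <= (2 * l)%:R * (b / 2) * \sum_(m <= t < n) c t ^+ 2.
  rewrite mulr_sumr; apply: ler_sum => t _.
  rewrite -mulr_suml -mulr_suml; apply: ler_wpM2r; rewrite ?sqr_ge0 //.
  by apply: ler_wpM2r; rewrite ?divr_ge0 // near_count.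
under eq_bigr do under eq_bigr do rewrite mulrDr.
under eq_bigr do rewrite big_split /=.
rewrite big_split /= [X in _ + X]exchange_big /=.
under [X in _ + X]eq_bigr do under eq_bigr do rewrite nearC.
by have := half; lra.
Qed.

End orthogonal_sums.

Section independent_quadratic.
Context d0 (Om : measurableType d0) (R : realType) (P : probability Om R).
Variables (G1 G2 : set_system Om).
Hypotheses (G1m : G1 `<=` measurable) (G2m : G2 `<=` measurable).
Hypothesis ind : independent_systems P <<s G1 >> <<s G2 >>.

(* conditionally on the V i, the left-hand side is a quadratic form in the U i
   alone *)
Lemma Ex_indep_sqr (I : finType) (U V : I -> Om -> R) (phi : Om -> R) :
  (forall i, dep G1 (U i)) -> (forall i, dep G2 (V i)) ->
  (forall i, Lpow P 1 (U i)) -> (forall i, Lpow P 1 (V i)) -> Lpow P 0 phi ->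
  (forall w, Ex P (fun w' => (\sum_i V i w * U i w') ^+ 2) <= phi w) ->
  Ex P (fun w => (\sum_i U i w * V i w) ^+ 2) <= Ex P phi.
Proof.
move=> dU dV LU LV Lphi h.
pose Ga i j := Ex P (fun w => U i w * U j w).
have LUU i j : Lpow P 0 (fun w => U i w * U j w) by exact: LpowM.
have LVV i j : Lpow P 0 (fun w => V i w * V j w) by exact: LpowM.
have E1 : Ex P (fun w => (\sum_i U i w * V i w) ^+ 2) =
   \sum_i \sum_j Ga i j * Ex P (fun w => V i w * V j w).
  transitivity (Ex P (fun w => \sum_i \sum_j (U i w * U j w) * (V i w * V j w))).
    apply: eq_Ex => w; rewrite expr2 mulr_suml; apply: eq_bigr => i _.
    by rewrite mulr_sumr; apply: eq_bigr => j _; rewrite mulrACA.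
  have L i j : Lpow P 0 (fun w => (U i w * U j w) * (V i w * V j w)).
    by apply: (Lpow0_indepM G1m G2m ind) => //; exact: depM.
  rewrite Ex_sum => [|i _]; last exact: Lpow_sum.
  apply: eq_bigr => i _; rewrite Ex_sum //; apply: eq_bigr => j _.
  by rewrite (Ex_indepM G1m G2m ind) //; exact: depM.
have E2 : \sum_i \sum_j Ga i j * Ex P (fun w => V i w * V j w) =
   Ex P (fun w => \sum_i \sum_j Ga i j * (V i w * V j w)).
  rewrite Ex_sum => [|i _]; last by apply: Lpow_sum => j _; exact: LpowZ.
  apply: eq_bigr => i _; rewrite Ex_sum => [|j _]; last exact: LpowZ.
  by apply: eq_bigr => j _; rewrite ExZ.
rewrite E1 E2; apply: Ex_le => //.
  by apply: Lpow_sum => i _; apply: Lpow_sum => j _; exact: LpowZ.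
move=> w; apply: le_trans (h w); rewrite le_eqVlt; apply/orP; left; apply/eqP.
rewrite (_ : Ex P _ = Ex P (fun w' => \sum_i \sum_j (V i w * V j w) * (U i w' * U j w'))).
  rewrite Ex_sum => [|i _]; last by apply: Lpow_sum => j _; exact: LpowZ.
  apply: eq_bigr => i _; rewrite Ex_sum => [|j _]; last exact: LpowZ.
  by apply: eq_bigr => j _; rewrite ExZ // mulrC.
apply: eq_Ex => w'; rewrite expr2 mulr_suml; apply: eq_bigr => i _.
by rewrite mulr_sumr; apply: eq_bigr => j _; rewrite mulrACA.
Qed.

Context (d : nat).
Variables (U V : Om -> 'rV[R]_d) (c : R).
Hypotheses (dU : forall i, dep G1 (fun w => U w 0 i))
           (dV : forall i, dep G2 (fun w => V w 0 i)).

Lemma Ex_indep_dotp2 :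
  (forall i, Lpow P 1 (fun w => U w 0 i)) -> (forall i, Lpow P 1 (fun w => V w 0 i)) ->
  (forall a, Ex P (fun w => dotp a (U w) ^+ 2) <= c * dotp a a) ->
  Ex P (fun w => dotp (U w) (V w) ^+ 2) <= c * Ex P (fun w => dotp (V w) (V w)).
Proof.
move=> LU LV h.
have LVV : Lpow P 0 (fun w => dotp (V w) (V w)) by apply: Lpow_sum => i _; exact: LpowM.
rewrite -ExZ //.
apply: (@Ex_indep_sqr 'I_d (fun i w => U w 0 i) (fun i w => V w 0 i)) => //.
  exact: LpowZ.
by move=> w; exact: h.
Qed.

(** The squared inner product is a bilinear sum over pairs of coordinates, so its square falls under
    [Ex_indep_sqr] with pairs as indices. *)
Lemma Ex_indep_dotp4 :
  (forall i, Lpow P 2 (fun w => U w 0 i)) -> (forall i, Lpow P 2 (fun w => V w 0 i)) ->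
  (forall a, Ex P (fun w => dotp a (U w) ^+ 4) <= c * dotp a a ^+ 2) ->
  Ex P (fun w => dotp (U w) (V w) ^+ 4) <= c * Ex P (fun w => dotp (V w) (V w) ^+ 2).
Proof.
move=> LU LV h.
have LVV : Lpow P 0 (fun w => dotp (V w) (V w) ^+ 2).
  by apply: Lpow_sqr; apply: Lpow_sum => i _; exact: LpowM.
have sq (x y : 'I_d -> R) : (\sum_i x i * y i) ^+ 2 =
    \sum_(p : 'I_d * 'I_d) (x p.1 * x p.2) * (y p.1 * y p.2).
  by rewrite expr2 big_distrlr /= pair_bigA /=; apply: eq_bigr => p _; rewrite mulrACA.
rewrite -ExZ //.
rewrite (_ : Ex P _ = Ex P (fun w => (\sum_(p : 'I_d * 'I_d)
   (U w 0 p.1 * U w 0 p.2) * (V w 0 p.1 * V w 0 p.2)) ^+ 2)); last first.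
  by apply: eq_Ex => w; rewrite -sq -exprM.
apply: (@Ex_indep_sqr ('I_d * 'I_d)%type (fun p w => U w 0 p.1 * U w 0 p.2)
  (fun p w => V w 0 p.1 * V w 0 p.2)).
- by move=> p; exact: depM.
- by move=> p; exact: depM.
- by move=> p; exact: LpowM.
- by move=> p; exact: LpowM.
- exact: LpowZ.
move=> w; apply: le_trans (h (V w)); rewrite le_eqVlt; apply/orP; left; apply/eqP.
by apply: eq_Ex => w'; rewrite -sq -exprM.
Qed.

End independent_quadratic.

Lemma weighted_sqr_sum_le (R : realType) (I : Type) (r : seq I) (p y : I -> R) :
  (forall i, 0 <= p i) ->
  (\sum_(i <- r) p i * y i) ^+ 2 <= (\sum_(i <- r) p i) * \sum_(i <- r) p i * y i ^+ 2.
Proof.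
move=> p0; rewrite expr2 !big_distrlr /=.
have h : \sum_(i <- r) \sum_(j <- r) p i * y i * (p j * y j) <=
   \sum_(i <- r) \sum_(j <- r) (2^-1 * (p j * (p i * y i ^+ 2)) +
      2^-1 * (p i * (p j * y j ^+ 2))).
  apply: ler_sum => i _; apply: ler_sum => j _.
  have := mulr_ge0 (mulr_ge0 (p0 i) (p0 j)) (sqr_ge0 (y i - y j)).
  rewrite -subr_ge0 => hh; apply: le_trans (_ : p i * p j * (y i - y j) ^+ 2 / 2 <= _).
    by rewrite divr_ge0 //; move: hh; rewrite subr0.
  by rewrite le_eqVlt; apply/orP; left; apply/eqP; field.
apply: le_trans h _.
rewrite (eq_bigr (fun i => \sum_(j <- r) 2^-1 * (p j * (p i * y i ^+ 2)) +
  \sum_(j <- r) 2^-1 * (p i * (p j * y j ^+ 2)))); last first.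
  by move=> i _; rewrite big_split.
rewrite big_split /= [X in X + _]exchange_big /= -big_split /=.
rewrite le_eqVlt; apply/orP; left; apply/eqP; apply: eq_bigr => i _.
by rewrite -big_split /=; apply: eq_bigr => j _; field.
Qed.

(** * Moments and orthogonality for an array with memory shorter than the window gap *)

Section dependent_array.
Context d0 (Om : measurableType d0) (R : realType) (P : probability Om R).
Variable e : int -> Om -> R.
Hypothesis em : forall t, measurable_fun setT (e t).
Hypothesis ei : mutually_independent P [set: int]
  (fun t => preimage_set_system setT (e t) measurable).
Context (d B B1 : nat) (A : nat -> Om -> 'rV[R]_d) (c cw : R).
Hypotheses (B0 : (0 < B)%N) (BB1 : (B < B1)%N).
Hypothesis dA : forall t i,
  dep (innov e [set s | t%:Z - B%:Z < s <= t%:Z]) (fun w => A t w 0 i).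
Hypothesis LA : forall t i, Lpow P 3 (fun w => A t w 0 i).
Hypothesis EA : forall t i, Ex P (fun w => A t w 0 i) = 0.
Hypotheses (c1 : 1 <= c) (cw0 : 0 <= cw).
Hypothesis hA : forall t a, Ex P (fun w => dotp a (A t w) ^+ 4) <= c * dotp a a ^+ 2.
Hypothesis hw : forall i lo hi,
  Ex P (fun w => (\sum_(lo <= s < hi) A s w 0 i) ^+ 2) <= cw * (hi - lo)%:R.

Notation upto x := (innov e [set s | s <= x]).
Notation L := (2 * B1)%N.

Let c0 : 0 <= c. Proof. exact: le_trans ler01 c1. Qed.

Lemma innov_prod (S S' : set int) (X Y : Om -> R) : S `&` S' `<=` set0 ->
  dep (innov e S) X -> dep (innov e S') Y -> Lpow P 0 X -> Lpow P 0 Y ->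
  Ex P (fun w => X w * Y w) = Ex P X * Ex P Y.
Proof.
move=> SS; apply: Ex_indepM; do ?exact: innov_measurable.
exact: innov_indep.
Qed.

Lemma dep_innov (S S' : set int) (X : Om -> R) : S `<=` S' ->
  dep (innov e S) X -> dep (innov e S') X.
Proof. by move=> SS'; apply: depS; exact: innov_sub. Qed.

Lemma dep_upto (S : set int) (x : int) (X : Om -> R) :
  (forall s, S s -> s <= x) -> dep (innov e S) X -> dep (upto x) X.
Proof. by move=> h; apply: depS; apply: innov_sub => s /h. Qed.

Lemma dotp_Lpow k (U V : Om -> 'rV[R]_d) :
  (forall i, Lpow P k.+1 (fun w => U w 0 i)) ->
  (forall i, Lpow P k.+1 (fun w => V w 0 i)) -> Lpow P k (fun w => dotp (U w) (V w)).
Proof. by move=> LU LV; apply: Lpow_sum => i _; exact: LpowM. Qed.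

Lemma A_moment2 t a : Ex P (fun w => dotp a (A t w) ^+ 2) <= c * dotp a a.
Proof.
have L3 : Lpow P 3 (fun w => dotp a (A t w)) by apply: Lpow_sum => i _; exact: LpowZ.
have L1 : Lpow P 1 (fun w => dotp a (A t w) ^+ 2).
  by apply: Lpow_sqr; exact: Lpow_le L3.
rewrite -(@ler_pXn2r _ 2) ?nnegrE ?Ex_sqr_ge0 ?mulr_ge0 ?dotp_ge0 //.
apply: le_trans (Ex_sqr_le L1) _.
rewrite (_ : Ex P _ = Ex P (fun w => dotp a (A t w) ^+ 4)); last first.
  by apply: eq_Ex => w; rewrite -exprM.
apply: le_trans (hA t a) _; rewrite exprMn ler_wpM2r ?sqr_ge0 //.
by rewrite expr2 ler_peMl.
Qed.

Lemma A_coord4 t i : Ex P (fun w => A t w 0 i ^+ 4) <= c.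
Proof.
have := hA t (unitv R i).
rewrite (_ : dotp _ _ = 1); last by rewrite /dotp sum_unitv /unitv mxE !eqxx.
rewrite expr1n mulr1; apply: le_trans; rewrite le_eqVlt; apply/orP; left; apply/eqP.
by apply: eq_Ex => w; rewrite /dotp sum_unitv.
Qed.

Lemma Ex_norm4_le (b : R) (X : Om -> 'rV[R]_d) : (forall i, Lpow P 2 (fun w => X w 0 i)) ->
  (forall i, Ex P (fun w => X w 0 i ^+ 4) <= b) ->
  Ex P (fun w => dotp (X w) (X w) ^+ 2) <= d%:R ^+ 2 * b.
Proof.
move=> LX hX.
have LX4 i : Lpow P 0 (fun w => X w 0 i ^+ 4) by case: (LX i) => _ h; apply/Lpow0P.
have Ls : Lpow P 0 (fun w => \sum_i X w 0 i ^+ 4) by exact: Lpow_sum.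
apply: (@le_trans _ _ (Ex P (fun w => d%:R * \sum_i X w 0 i ^+ 4))).
  apply: Ex_le.
  - by apply: Lpow_sqr; apply: dotp_Lpow.
  - exact: LpowZ.
  move=> w; apply: le_trans (sqr_sum_ord_le _) _.
  by rewrite ler_wpM2l //; apply: ler_sum => i _; rewrite -expr2 -exprM.
rewrite ExZ // Ex_sum // expr2 -mulrA ler_wpM2l //.
apply: (@le_trans _ _ (\sum_(i < d) b)); first by apply: ler_sum.
by rewrite sumr_const card_ord -[leLHS]mulr_natl.
Qed.

Lemma A_norm4 t : Ex P (fun w => dotp (A t w) (A t w) ^+ 2) <= d%:R ^+ 2 * c.
Proof. by apply: Ex_norm4_le => i; [exact: Lpow_le (LA t i)|exact: A_coord4]. Qed.

Definition winsum t (w : Om) : 'rV[R]_d := \sum_(maxn (t - B1) 1 <= s < (t - B).+1) A s w.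
Definition th t (w : Om) : R := dotp (A t w) (winsum t w).

Lemma win_size t : ((t - B).+1 - maxn (t - B1) 1 <= B1)%N.
Proof. by rewrite /maxn; case: ifP; lia. Qed.

Lemma winsumE t w i :
  winsum t w 0 i = \sum_(maxn (t - B1) 1 <= s < (t - B).+1) A s w 0 i.
Proof. by rewrite /winsum summxE. Qed.

Lemma winsum_Lpow t i : Lpow P 3 (fun w => winsum t w 0 i).
Proof.
apply: (@Lpow_eq _ _ _ _ _ (fun w => \sum_(maxn (t - B1) 1 <= s < (t - B).+1) A s w 0 i)).
  by move=> w; rewrite winsumE.
exact: Lpow_sum.
Qed.

Lemma winsum_dep t i : dep (innov e [set s | t%:Z - L%:Z < s <= t%:Z - B%:Z])
  (fun w => winsum t w 0 i).
Proof.
rewrite (_ : (fun w => _) = fun w => \sum_(maxn (t - B1) 1 <= s < (t - B).+1) A s w 0 i); last first.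
  by apply/funext => w; rewrite winsumE.
apply: dep_sum => s; rewrite mem_index_iota geq_max => /andP[/andP[h1 h2] h3] _.
(* Since [s >= t - B1] and [B < B1], the innovations of [A s] come after [t - 2 * B1]. For [t <= B]
   the truncated subtraction gives upper end 1 and the range of [s] is empty. *)
refine (dep_innov _ (@dA s i)) => x /=; lia.
Qed.

(** [hw] is linear in the length of the window, which saves a factor [B1] over Cauchy-Schwarz. *)
Lemma winsum_norm2 t : Ex P (fun w => dotp (winsum t w) (winsum t w)) <= d%:R * (cw * B1%:R).
Proof.
rewrite Ex_sum => [|i _]; last by apply: LpowM; exact: Lpow_le (winsum_Lpow t i).
apply: (@le_trans _ _ (\sum_(i < d) cw * B1%:R)).
  apply: ler_sum => i _.
  rewrite (_ : Ex P _ = Ex P (fun w => (\sum_(maxn (t - B1) 1 <= s < (t - B).+1) A s w 0 i) ^+ 2)).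
    apply: le_trans (@hw i _ _) _.
    by apply: ler_wpM2l => //; rewrite ler_nat; exact: win_size.
  by apply: eq_Ex => w; rewrite !winsumE expr2.
by rewrite sumr_const card_ord -[leLHS]mulr_natl.
Qed.

(** Plain power means, hence [B1 ^ 4]. The crude order is affordable because fourth moments enter
    only the fluctuation of the quadratic form. *)
Lemma winsum_norm4 t : Ex P (fun w => dotp (winsum t w) (winsum t w) ^+ 2) <=
  d%:R ^+ 2 * (B1%:R ^+ 4 * c).
Proof.
apply: Ex_norm4_le => i; first exact: Lpow_le (winsum_Lpow t i).
set lo := maxn (t - B1) 1; set hi := (t - B).+1.
have LA4 s : Lpow P 0 (fun w => A s w 0 i ^+ 4).
  by case: (Lpow_le (leqnSn 2) (LA s i)) => _ h; apply/Lpow0P.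
have nB : (hi - lo)%:R <= B1%:R :> R by rewrite ler_nat win_size.
apply: (@le_trans _ _ (Ex P (fun w => B1%:R ^+ 3 * \sum_(lo <= s < hi) A s w 0 i ^+ 4))).
  apply: Ex_le.
  - by case: (Lpow_le (leqnSn 2) (winsum_Lpow t i)) => _ h; apply/Lpow0P.
  - by apply: LpowZ; exact: Lpow_sum.
  move=> w; rewrite winsumE -/lo -/hi.
  have h1 := sqr_sum_le lo hi (fun s => A s w 0 i).
  have h2 := sqr_sum_le lo hi (fun s => A s w 0 i ^+ 2).
  set S := \sum_(_ <= _ < _) _ in h1 *; set S2 := \sum_(_ <= _ < _) _ ^+ 2 in h1 h2.
  have S4E : \sum_(lo <= s < hi) (A s w 0 i ^+ 2) ^+ 2 = \sum_(lo <= s < hi) A s w 0 i ^+ 4.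
    by apply: eq_bigr => s _; rewrite -exprM.
  rewrite S4E in h2; set S4 := \sum_(_ <= _ < _) _ ^+ 4 in h2 *.
  have S40 : 0 <= S4 by apply: sumr_ge0 => s _; rewrite (exprM _ 2 2) sqr_ge0.
  have S20 : 0 <= S2 by apply: sumr_ge0 => s _; rewrite sqr_ge0.
  have k0 : 0 <= (hi - lo)%:R :> R by [].
  have h3 : S ^+ 2 <= B1%:R * S2 by apply: le_trans h1 _; rewrite ler_wpM2r.
  have h4 : S2 ^+ 2 <= B1%:R * S4 by apply: le_trans h2 _; rewrite ler_wpM2r.
  rewrite (exprM _ 2 2); apply: (@le_trans _ _ ((B1%:R * S2) ^+ 2)).
    by apply: lerXn2r; rewrite ?nnegrE ?sqr_ge0 ?mulr_ge0.
  by rewrite exprMn (exprSr _ 2) -mulrA ler_wpM2l ?exprn_ge0.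
rewrite ExZ ?Ex_sum //; last exact: Lpow_sum.
rewrite (exprSr _ 3) -mulrA ler_wpM2l ?exprn_ge0 //.
apply: (@le_trans _ _ (\sum_(lo <= s < hi) c)); first by apply: ler_sum => s _; exact: A_coord4.
by rewrite sumr_const_nat -[leLHS]mulr_natl ler_wpM2r.
Qed.

Let winA_disjoint t : [set s : int | t%:Z - B%:Z < s <= t%:Z] `&`
   [set s | s <= t%:Z - B%:Z] `<=` set0.
Proof. by move=> s [] /=; lia. Qed.

Lemma winsum_upto t i : dep (upto (t%:Z - B%:Z)) (fun w => winsum t w 0 i).
Proof. by apply: dep_upto (@winsum_dep t i) => s /= /andP[]. Qed.

(** Bounds for the second and fourth moments of [th], linear and quadratic in [d]: conditionally on
    the window sum, [th t] is a linear form in [A t]. *)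
Definition m2 : R := c * (d%:R * (cw * B1%:R)).
Definition m4 : R := c * (d%:R ^+ 2 * (B1%:R ^+ 4 * c)).

Lemma m2_ge0 : 0 <= m2. Proof. by rewrite /m2 !mulr_ge0. Qed.
Lemma m4_ge0 : 0 <= m4. Proof. by rewrite /m4 !mulr_ge0 ?exprn_ge0. Qed.

(** [A t] and its window sum use innovations on either side of [t - B], hence are independent, and
    [A_moment2] holds with the window sum in place of a fixed vector. *)
Lemma th_moment2 t : Ex P (fun w => th t w ^+ 2) <= m2.
Proof.
apply: (@le_trans _ _ (c * Ex P (fun w => dotp (winsum t w) (winsum t w)))); last first.
  by rewrite ler_wpM2l // winsum_norm2.
refine (@Ex_indep_dotp2 _ _ _ P _ _ (@innov_measurable _ _ _ _ em _) (@innov_measurable _ _ _ _ em _)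
  (innov_indep em ei (@winA_disjoint t)) d (A t) (winsum t) c _ _ _ _ _) => //.
- exact: winsum_upto.
- by move=> i; exact: Lpow_le (LA t i).
- by move=> i; exact: Lpow_le (winsum_Lpow t i).
- exact: A_moment2.
Qed.

Lemma th_moment4 t : Ex P (fun w => th t w ^+ 4) <= m4.
Proof.
apply: (@le_trans _ _ (c * Ex P (fun w => dotp (winsum t w) (winsum t w) ^+ 2))); last first.
  by rewrite ler_wpM2l // winsum_norm4.
refine (@Ex_indep_dotp4 _ _ _ P _ _ (@innov_measurable _ _ _ _ em _) (@innov_measurable _ _ _ _ em _)
  (innov_indep em ei (@winA_disjoint t)) d (A t) (winsum t) c _ _ _ _ _) => //.
- exact: winsum_upto.
- by move=> i; exact: Lpow_le (LA t i).
- by move=> i; exact: Lpow_le (winsum_Lpow t i).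
Qed.

Lemma th_Lpow t : Lpow P 2 (th t).
Proof. by apply: dotp_Lpow => // i; exact: winsum_Lpow. Qed.

Lemma th_dep t : dep (innov e [set s | t%:Z - L%:Z < s <= t%:Z]) (th t).
Proof.
apply: dep_sum => i _ _; apply: depM.
  by refine (dep_innov _ (@dA t i)) => s /=; lia.
by refine (dep_innov _ (@winsum_dep t i)) => s /=; lia.
Qed.

Lemma th_upto t (x : int) : t%:Z <= x -> dep (upto x) (th t).
Proof. by move=> tx; apply: dep_upto (@th_dep t) => s /= /andP[_] /le_trans; apply. Qed.

(** Two separate factors are allowed for the sake of integrability: a window sum of order 8, [F2] of
    order 4 and [F1] of order 2 have an integrable product, whereas [F1 * F2] as one factor would be
    controlled at order 1 only. *)
Lemma th_martingale t (F1 F2 : Om -> R) :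
  dep (upto (t%:Z - B%:Z)) F1 -> dep (upto (t%:Z - B%:Z)) F2 ->
  Lpow P 1 F1 -> Lpow P 2 F2 -> Ex P (fun w => th t w * (F1 w * F2 w)) = 0.
Proof.
move=> dF1 dF2 LF1 LF2.
have LW i : Lpow P 0 (fun w => winsum t w 0 i * F2 w * F1 w).
  by apply: LpowM => //; apply: LpowM => //; exact: Lpow_le (winsum_Lpow t i).
have LA0 i : Lpow P 0 (fun w => A t w 0 i) := Lpow_le (leq0n 3) (LA t i).
have dW i : dep (upto (t%:Z - B%:Z)) (fun w => winsum t w 0 i * F2 w * F1 w).
  by apply: depM => //; apply: depM => //; exact: winsum_upto.
transitivity (Ex P (fun w => \sum_i A t w 0 i * (winsum t w 0 i * F2 w * F1 w))).
  apply: eq_Ex => w; rewrite /th /dotp mulr_suml; apply: eq_bigr => i _; ring.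
rewrite Ex_sum => [|i _]; last first.
  exact: (Lpow0_indepM (@innov_measurable _ _ _ _ em _) (@innov_measurable _ _ _ _ em _)
    (innov_indep em ei (@winA_disjoint t)) (@dA t i) (dW i)).
rewrite big1 // => i _.
by rewrite (innov_prod (@winA_disjoint t) (@dA t i) (dW i)) // EA mul0r.
Qed.

Lemma th_orthogonal t s : (s + B <= t)%N -> Ex P (fun w => th t w * th s w) = 0.
Proof.
move=> st; have := @th_martingale t (th s) (fun=> 1).
rewrite (_ : Ex P _ = Ex P (fun w => th t w * th s w)); last first.
  by apply: eq_Ex => w; rewrite mulr1.
apply.
- by apply: th_upto; lia.
- exact: dep_cst.
- exact: LpowW (th_Lpow s).
- exact: Lpow_cst.
Qed.

Lemma th_prod_moment t s : Ex P (fun w => (th t w * th s w) ^+ 2) <= m4.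
Proof.
have L4 r : Lpow P 0 (fun w => th r w ^+ 4).
  by case: (th_Lpow r) => _ h; apply/Lpow0P.
apply: (@le_trans _ _ (Ex P (fun w => 2^-1 * th t w ^+ 4 + 2^-1 * th s w ^+ 4))).
  apply: Ex_le.
  - by apply: Lpow_sqr; apply: LpowM; exact: th_Lpow.
  - by apply: LpowD; apply: LpowZ.
  move=> w; rewrite exprMn !(exprM _ 2 2).
  have := sqr_ge0 (th t w ^+ 2 - th s w ^+ 2); move: (th t w ^+ 2) (th s w ^+ 2) => x y; nra.
rewrite ExD; try exact: LpowZ.
rewrite !ExZ //; have := th_moment4 t; have := th_moment4 s; lra.
Qed.

(** * Mean and variance of the weighted quadratic form in the window sums *)

Section quadratic_form.
Variables (m n : nat) (k : nat -> nat -> R) (kap : R).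
Hypothesis kC : forall t s, k t s = k s t.
Hypothesis k01 : forall t s, 0 <= k t s <= 1.
Hypothesis hkap : forall t, (m <= t < n)%N -> \sum_(m <= s < n) k t s <= kap.

Definition qform (x : nat -> R) : R :=
  \sum_(m <= t < n) \sum_(m <= s < n) k t s * (x t * x s).

(** The cut is at [L = 2 * B1], the length of the stretch of innovations behind [th t]. Beyond it,
    [far t] is independent of [th t] and not merely uncorrelated, so second moments of the product
    factor. *)
Definition far t w : R := \sum_(m <= s < n) ((s + L <= t)%N%:R * k t s) * th s w.
Definition nearpart t w : R :=
  \sum_(m <= s < n) (near L t s)%:R * (k t s * (th t w * th s w)).

Lemma qform_split w :
  qform (th^~ w) = \sum_(m <= t < n) nearpart t w + 2 * \sum_(m <= t < n) th t w * far t w.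
Proof.
have E t s : k t s * (th t w * th s w) = (near L t s)%:R * (k t s * (th t w * th s w)) +
    ((s + L <= t)%N%:R * k t s * (th t w * th s w) +
     (t + L <= s)%N%:R * k s t * (th s w * th t w)).
  rewrite [k s t]kC [th s w * _]mulrC -!mulrA -!mulrDl /near.
  have [h1|h1] := ltnP t (s + L); have [h2|h2] := ltnP s (t + L) => /=;
    rewrite ?(addr0, add0r, mul0r, mul1r) //.
  by move: h1 h2; lia.
have F1 : \sum_(m <= t < n) th t w * far t w = \sum_(m <= t < n) \sum_(m <= s < n)
    (s + L <= t)%N%:R * k t s * (th t w * th s w).
  by apply: eq_bigr => t _; rewrite /far mulr_sumr; apply: eq_bigr => s _; ring.
rewrite /qform; under eq_bigr do under eq_bigr do rewrite E.
under eq_bigr do rewrite big_split /=.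
rewrite big_split /=; congr (_ + _).
under eq_bigr do rewrite big_split /=.
by rewrite big_split /= [X in _ + X]exchange_big /= -F1 mulr_natl mulr2n.
Qed.

Lemma far_Lpow t : Lpow P 2 (far t).
Proof. by apply: Lpow_sum => s _; apply: LpowZ; exact: th_Lpow. Qed.

Lemma far_upto t : dep (upto (t%:Z - L%:Z)) (far t).
Proof.
apply: dep_sum => s _ _; have [h|h] := leqP (s + L) t; last first.
  rewrite (_ : (fun w => _) = fun=> 0); first exact: dep_cst.
  by apply/funext => w; rewrite !mul0r.
by apply: depZ; apply: th_upto; lia.
Qed.

Lemma nearpart_Lpow t : Lpow P 1 (nearpart t).
Proof.
by apply: Lpow_sum => s _; do 2 apply: LpowZ; apply: LpowM; exact: th_Lpow.
Qed.

(** The weights lie between 0 and 1, so their squares still sum to at most [kap]. *)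
Lemma far_moment2 t : (m <= t < n)%N ->
  Ex P (fun w => far t w ^+ 2) <= (2 * B)%:R * m2 * kap.
Proof.
move=> tmn.
have := @orthogonal_sum _ _ _ P th (fun s => (s + L <= t)%N%:R * k t s) B m n m2
  (fun s => LpowW (th_Lpow s)) (fun s _ => th_moment2 s)
  (fun s s' _ _ h => th_orthogonal h).
move=> h; apply: le_trans h _; rewrite ler_wpM2l ?mulr_ge0 ?m2_ge0 //.
apply: le_trans (hkap tmn); apply: ler_sum => s _.
have /andP[k0 k1] := k01 t s.
by case: (s + L <= t)%N; rewrite ?mul1r ?mul0r ?expr0n // expr2 ler_piMl.
Qed.

Lemma thfar_moment2 t : (m <= t < n)%N ->
  Ex P (fun w => (th t w * far t w) ^+ 2) <= m2 * ((2 * B)%:R * m2 * kap).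
Proof.
move=> tmn.
rewrite (_ : Ex P _ = Ex P (fun w => th t w ^+ 2 * far t w ^+ 2)); last first.
  by apply: eq_Ex => w; rewrite exprMn.
rewrite (@innov_prod [set s | t%:Z - L%:Z < s <= t%:Z] [set s | s <= t%:Z - L%:Z]).
- by apply: ler_pM; rewrite ?Ex_sqr_ge0 ?th_moment2 ?far_moment2.
- by move=> s [] /=; lia.
- by apply: depX; exact: th_dep.
- by apply: depX; exact: far_upto.
- by apply: Lpow_sqr; exact: LpowW (th_Lpow t).
- by apply: Lpow_sqr; exact: LpowW (far_Lpow t).
Qed.

Lemma thfar_Lpow t : Lpow P 1 (fun w => th t w * far t w).
Proof. by apply: LpowM; [exact: th_Lpow|exact: far_Lpow]. Qed.

Lemma thfar_mean t : Ex P (fun w => th t w * far t w) = 0.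
Proof.
have := @th_martingale t (fun=> 1) (far t).
rewrite (_ : Ex P _ = Ex P (fun w => th t w * far t w)); last first.
  by apply: eq_Ex => w; rewrite mul1r.
apply; do ?[exact: dep_cst|exact: Lpow_cst|exact: far_Lpow].
by refine (dep_innov _ (@far_upto t)) => s /=; lia.
Qed.

(** Terms at distance [B] are orthogonal: [th t] is centered given the innovations up to [t - B], on
    which [th s * far s] and [far t] depend. *)
Lemma thfar_sum_moment2 :
  Ex P (fun w => (\sum_(m <= t < n) th t w * far t w) ^+ 2) <=
   (2 * B)%:R * (m2 * ((2 * B)%:R * m2 * kap)) * (n - m)%:R.
Proof.
have := @orthogonal_sum _ _ _ P (fun t w => th t w * far t w) (fun=> 1) B m n
  (m2 * ((2 * B)%:R * m2 * kap)) thfar_Lpow thfar_moment2.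
rewrite (_ : \sum_(m <= t < n) 1 ^+ 2 = (n - m)%:R); last first.
  by under eq_bigr do rewrite expr1n; rewrite sumr_const_nat.
under eq_Ex do under eq_bigr do rewrite mul1r.
apply => t s ms tn st.
rewrite (_ : Ex P _ = Ex P (fun w => th t w * ((th s w * far s w) * far t w))); last first.
  by apply: eq_Ex => w; ring.
apply: th_martingale.
- apply: depM; first by apply: th_upto; lia.
  by refine (dep_innov _ (@far_upto s)) => x /=; lia.
- by refine (dep_innov _ (@far_upto t)) => x /=; lia.
- exact: thfar_Lpow.
- exact: far_Lpow.
Qed.

Lemma nearpart_moment2 t : Ex P (fun w => nearpart t w ^+ 2) <= (2 * L)%:R ^+ 2 * m4.
Proof.
have Lp s : Lpow P 0 (fun w => (k t s * (th t w * th s w)) ^+ 2).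
  by apply: Lpow_sqr; apply: LpowZ; apply: LpowM; exact: th_Lpow.
apply: (@le_trans _ _ (Ex P (fun w => (2 * L)%:R *
   \sum_(m <= s < n) (near L t s)%:R * (k t s * (th t w * th s w)) ^+ 2))).
  apply: Ex_le.
  - by apply: Lpow_sqr; exact: nearpart_Lpow.
  - by apply: LpowZ; apply: Lpow_sum => s _; exact: LpowZ.
  move=> w; apply: le_trans (weighted_sqr_sum_le _ _ _) _; first by move=> s.
  rewrite ler_wpM2r ?near_count //.
  by apply: sumr_ge0 => s _; rewrite mulr_ge0 ?sqr_ge0.
rewrite ExZ; last by apply: Lpow_sum => s _; exact: LpowZ.
rewrite expr2 -mulrA ler_wpM2l // Ex_sum => [|s _]; last exact: LpowZ.
apply: (@le_trans _ _ (\sum_(m <= s < n) (near L t s)%:R * m4)); last first.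
  by rewrite -mulr_suml ler_wpM2r ?m4_ge0 ?near_count.
apply: ler_sum => s _; rewrite ExZ // ler_wpM2l //.
apply: le_trans (th_prod_moment t s); apply: Ex_le => //.
  by apply: Lpow_sqr; apply: LpowM; exact: th_Lpow.
move=> w; rewrite exprMn ler_piMl ?sqr_ge0 //.
by have /andP[? ?] := k01 t s; rewrite expr_le1.
Qed.

Lemma nearpart_dep t :
  dep (innov e [set s | t%:Z - (2 * L)%:Z < s <= t%:Z + L%:Z]) (nearpart t).
Proof.
apply: dep_sum => s _ _; rewrite /near; case: andP => [[h1 h2]|_]; last first.
  rewrite (_ : (fun w => _) = fun=> 0); first exact: dep_cst.
  by apply/funext => w; rewrite mul0r.
do 2 apply: depZ; apply: depM.
  by refine (dep_innov _ (@th_dep t)) => x /=; lia.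
by refine (dep_innov _ (@th_dep s)) => x /=; lia.
Qed.

(** [nearpart t] uses innovations in []t - 2 * L, t + L]], so centered terms at distance [3 * L] are
    independent. *)
Lemma nearpart_sum_var :
  Ex P (fun w => (\sum_(m <= t < n) (nearpart t w - Ex P (nearpart t))) ^+ 2) <=
   (2 * (3 * L))%:R * ((2 * L)%:R ^+ 2 * m4) * (n - m)%:R.
Proof.
have LN t : Lpow P 1 (fun w => nearpart t w - Ex P (nearpart t)).
  by apply: LpowB; [exact: nearpart_Lpow|exact: Lpow_cst].
have LN0 t : Lpow P 0 (nearpart t) := LpowW (nearpart_Lpow t).
have EN t : Ex P (fun w => nearpart t w - Ex P (nearpart t)) = 0.
  by rewrite ExB ?Ex_cst ?subrr //; exact: Lpow_cst.
have VN t : Ex P (fun w => (nearpart t w - Ex P (nearpart t)) ^+ 2) <=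
    (2 * L)%:R ^+ 2 * m4.
  apply: le_trans (nearpart_moment2 t).
  have LN2 : Lpow P 0 (fun w => nearpart t w ^+ 2) by apply: Lpow_sqr; exact: nearpart_Lpow.
  rewrite (_ : Ex P _ = Ex P (fun w => nearpart t w ^+ 2 -
     (2 * Ex P (nearpart t) * nearpart t w - Ex P (nearpart t) ^+ 2))); last first.
    by apply: eq_Ex => w; ring.
  rewrite ExB //; last by apply: LpowB; [exact: LpowZ|exact: Lpow_cst].
  rewrite ExB; [|exact: LpowZ|exact: Lpow_cst].
  rewrite ExZ // Ex_cst; have := sqr_ge0 (Ex P (nearpart t)); nra.
have := @orthogonal_sum _ _ _ P (fun t w => nearpart t w - Ex P (nearpart t)) (fun=> 1)
  (3 * L) m n _ LN (fun t _ => VN t).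
rewrite (_ : \sum_(m <= t < n) 1 ^+ 2 = (n - m)%:R); last first.
  by under eq_bigr do rewrite expr1n; rewrite sumr_const_nat.
under eq_Ex do under eq_bigr do rewrite mul1r.
apply => t s ms tn st.
rewrite (@innov_prod [set x | t%:Z - (2 * L)%:Z < x <= t%:Z + L%:Z]
   [set x | s%:Z - (2 * L)%:Z < x <= s%:Z + L%:Z]) ?EN ?mul0r //.
- by move=> x [] /=; lia.
- by apply: depB; [exact: nearpart_dep|exact: dep_cst].
- by apply: depB; [exact: nearpart_dep|exact: dep_cst].
- exact: LpowW.
- exact: LpowW.
Qed.

Lemma qform_Lpow : Lpow P 1 (fun w => qform (th^~ w)).
Proof.
apply: Lpow_sum => t _; apply: Lpow_sum => s _.
by apply: LpowZ; apply: LpowM; exact: th_Lpow.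
Qed.

(** [(N + 2 * F) ^ 2 <= 2 * N ^ 2 + 8 * F ^ 2], with [N] the centered near part and [F] the far
    part. *)
Definition qvar : R :=
  2 * ((2 * (3 * L))%:R * ((2 * L)%:R ^+ 2 * m4) * (n - m)%:R) +
  8 * ((2 * B)%:R * (m2 * ((2 * B)%:R * m2 * kap)) * (n - m)%:R).

Lemma qform_var : Ex P (fun w => (qform (th^~ w) - Ex P (fun w => qform (th^~ w))) ^+ 2)
  <= qvar.
Proof.
pose N w := \sum_(m <= t < n) (nearpart t w - Ex P (nearpart t)).
pose F w := \sum_(m <= t < n) th t w * far t w.
have LNp t : Lpow P 0 (nearpart t) := LpowW (nearpart_Lpow t).
have Lth t : Lpow P 0 (fun w => th t w * far t w) := LpowW (thfar_Lpow t).
have EQ : Ex P (fun w => qform (th^~ w)) = \sum_(m <= t < n) Ex P (nearpart t).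
  rewrite (_ : Ex P _ = Ex P (fun w => \sum_(m <= t < n) nearpart t w + 2 * F w)); last first.
    by apply: eq_Ex => w; exact: qform_split.
  rewrite ExD; [|exact: Lpow_sum|by apply: LpowZ; exact: Lpow_sum].
  rewrite ExZ; last exact: Lpow_sum.
  rewrite !Ex_sum // [X in _ + 2 * X]big1 ?mulr0 ?addr0 // => t _.
  exact: thfar_mean.
have QE w : qform (th^~ w) - Ex P (fun w => qform (th^~ w)) = N w + 2 * F w.
  by rewrite EQ qform_split /N sumrB /F addrAC.
have LN : Lpow P 1 N.
  by apply: Lpow_sum => t _; apply: LpowB; [exact: nearpart_Lpow|exact: Lpow_cst].
have LF : Lpow P 1 F by apply: Lpow_sum => t _; exact: thfar_Lpow.
apply: (@le_trans _ _ (Ex P (fun w => 2 * N w ^+ 2 + 8 * F w ^+ 2))).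
  apply: Ex_le.
  - rewrite (_ : (fun w => _) = fun w => (N w + 2 * F w) ^+ 2).
      by apply: Lpow_sqr; apply: LpowD => //; exact: LpowZ.
    by apply/funext => w; rewrite QE.
  - by apply: LpowD; apply: LpowZ; exact: Lpow_sqr.
  move=> w; rewrite QE; have := sqr_ge0 (N w - 2 * F w); nra.
rewrite ExD; try by apply: LpowZ; exact: Lpow_sqr.
rewrite !ExZ; try exact: Lpow_sqr.
by rewrite /qvar lerD // ler_wpM2l // ?nearpart_sum_var ?thfar_sum_moment2.
Qed.

Lemma th_pair_bound t s : `|Ex P (fun w => th t w * th s w)| <= (near B t s)%:R * m2.
Proof.
have [ns|] := boolP (near B t s); last first.
  rewrite /near negb_and -!leqNgt => /orP[h|h].
    by rewrite th_orthogonal // normr0 mul0r.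
  rewrite (_ : Ex P _ = Ex P (fun w => th s w * th t w)); last first.
    by apply: eq_Ex => w; rewrite mulrC.
  by rewrite th_orthogonal // normr0 mul0r.
have sb : m2 = Num.sqrt m2 ^+ 2 by rewrite sqr_sqrtr // m2_ge0.
rewrite mul1r [leRHS]sb expr2; apply: Ex_CS_le; rewrite ?sqrtr_ge0 // -?sb ?th_moment2 //;
  exact: LpowW (th_Lpow _).
Qed.

Lemma sum_near_bound (a : R) : 0 <= a ->
  \sum_(m <= t < n) \sum_(m <= s < n) (near B t s)%:R * a <= (n - m)%:R * ((2 * B)%:R * a).
Proof.
move=> a0; apply: (@le_trans _ _ (\sum_(m <= t < n) (2 * B)%:R * a)).
  by apply: ler_sum => t _; rewrite -mulr_suml ler_wpM2r ?near_count.
by rewrite sumr_const_nat -[leLHS]mulr_natl.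
Qed.

Lemma qform_mean : Ex P (fun w => qform (th^~ w)) =
  \sum_(m <= t < n) \sum_(m <= s < n) k t s * Ex P (fun w => th t w * th s w).
Proof.
have Ltt t s : Lpow P 0 (fun w => th t w * th s w).
  by apply: LpowW; apply: LpowM; exact: th_Lpow.
rewrite Ex_sum => [|t _]; last by apply: Lpow_sum => s _; exact: LpowZ.
apply: eq_bigr => t _; rewrite Ex_sum => [|s _]; last exact: LpowZ.
by apply: eq_bigr => s _; rewrite ExZ.
Qed.

Lemma qform_mean_le : Ex P (fun w => qform (th^~ w)) <= (n - m)%:R * ((2 * B)%:R * m2).
Proof.
rewrite qform_mean; apply: le_trans (sum_near_bound m2_ge0).
apply: ler_sum => t _; apply: ler_sum => s _.
have /andP[k0 k1] := k01 t s; apply: le_trans (ler_norm _) _.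
rewrite normrM ger0_norm //; apply: le_trans (th_pair_bound t s).
by rewrite ler_piMl.
Qed.

Lemma sum_sqr_mean : Ex P (fun w => (\sum_(m <= t < n) th t w) ^+ 2) =
  \sum_(m <= t < n) \sum_(m <= s < n) Ex P (fun w => th t w * th s w).
Proof.
rewrite -Ex_sqr_sum; try by move=> i; exact: LpowW (th_Lpow i).
by apply: eq_Ex => w; rewrite expr2.
Qed.

Lemma sum_sqr_mean_le :
  Ex P (fun w => (\sum_(m <= t < n) th t w) ^+ 2) <= (n - m)%:R * ((2 * B)%:R * m2).
Proof.
rewrite sum_sqr_mean; apply: le_trans (sum_near_bound m2_ge0).
apply: ler_sum => t _; apply: ler_sum => s _.
exact: le_trans (ler_norm _) (th_pair_bound t s).
Qed.

(** Beyond lag [B] the covariances vanish and the weights are irrelevant; within it they are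
    [del]-close to 1, the weights of the squared sum. *)
Lemma qform_bias (del : R) : (forall t s, near B t s -> 1 - k t s <= del) -> 0 <= del ->
  `|Ex P (fun w => qform (th^~ w)) - Ex P (fun w => (\sum_(m <= t < n) th t w) ^+ 2)|
   <= (n - m)%:R * ((2 * B)%:R * (del * m2)).
Proof.
move=> hdel del0; rewrite qform_mean sum_sqr_mean -sumrB.
apply: le_trans (ler_norm_sum _ _ _) _.
apply: le_trans (sum_near_bound (mulr_ge0 del0 m2_ge0)).
apply: ler_sum => t _; rewrite -sumrB; apply: le_trans (ler_norm_sum _ _ _) _.
apply: ler_sum => s _; have /andP[k0 k1] := k01 t s.
rewrite (_ : _ - _ = (k t s - 1) * Ex P (fun w => th t w * th s w)) ?normrM; last ring.
have := th_pair_bound t s; case: (boolP (near B t s)) => [h|_]; last first.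
  by rewrite !mul0r normr_le0 => /eqP ->; rewrite normr0 mulr0.
rewrite !mul1r => hp; apply: ler_pM => //.
by rewrite distrC ger0_norm ?subr_ge0 // hdel.
Qed.

End quadratic_form.
End dependent_array.

Section vector_moments.
Context d0 (Om : measurableType d0) (R : realType) (P : probability Om R) (d : nat).

Lemma Ex_dotp_CS (U V : Om -> 'rV[R]_d) (a b : R) :
  (forall i, Lpow P 2 (fun w => U w 0 i)) -> (forall i, Lpow P 2 (fun w => V w 0 i)) ->
  0 <= a -> 0 <= b ->
  Ex P (fun w => dotp (U w) (U w) ^+ 2) <= a ^+ 2 ->
  Ex P (fun w => dotp (V w) (V w) ^+ 2) <= b ^+ 2 ->
  Ex P (fun w => dotp (U w) (V w) ^+ 2) <= a * b.
Proof.
move=> LU LV a0 b0 hU hV.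
have L1 (X Y : Om -> 'rV[R]_d) : (forall i, Lpow P 2 (fun w => X w 0 i)) ->
    (forall i, Lpow P 2 (fun w => Y w 0 i)) -> Lpow P 1 (fun w => dotp (X w) (Y w)).
  by move=> LX LY; apply: Lpow_sum => i _; exact: LpowM.
apply: (@le_trans _ _ (Ex P (fun w => dotp (U w) (U w) * dotp (V w) (V w)))).
  apply: Ex_le; [by apply: Lpow_sqr; exact: L1|by apply: LpowM; exact: L1|].
  by move=> w; exact: dotp_sqr_le.
apply: le_trans (ler_norm _) _; apply: Ex_CS_le => //; exact: L1.
Qed.

Lemma mean_pow4 (n : nat) (x : nat -> R) : (0 < n)%N ->
  (n%:R^-1 * \sum_(1 <= s < n.+1) x s) ^+ 4 <= n%:R^-1 * \sum_(1 <= s < n.+1) x s ^+ 4.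
Proof.
move=> n0; have n0' : 0 < n%:R :> R by rewrite ltr0n.
have h1 := sqr_sum_le 1 n.+1 x.
have h2 := sqr_sum_le 1 n.+1 (fun s => x s ^+ 2).
rewrite subn1 /= in h1 h2.
have S4E : \sum_(1 <= s < n.+1) (x s ^+ 2) ^+ 2 = \sum_(1 <= s < n.+1) x s ^+ 4.
  by apply: eq_bigr => s _; rewrite -exprM.
rewrite S4E in h2.
set S := \sum_(_ <= _ < _) _ in h1 *.
set S2 := \sum_(_ <= _ < _) _ ^+ 2 in h1 h2.
set S4 := \sum_(_ <= _ < _) _ ^+ 4 in h2 *.
have S20 : 0 <= S2 by apply: sumr_ge0 => s _; rewrite sqr_ge0.
have h3 : S ^+ 4 <= n%:R ^+ 3 * S4.
  rewrite (exprM _ 2 2); apply: (@le_trans _ _ ((n%:R * S2) ^+ 2)).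
    by apply: lerXn2r; rewrite ?nnegrE ?sqr_ge0 ?mulr_ge0.
  by rewrite exprMn (exprSr _ 2) -mulrA ler_wpM2l ?exprn_ge0.
rewrite exprMn exprVn ler_pdivrMl ?exprn_gt0 //.
apply: le_trans h3 _; rewrite mulrA ler_wpM2r //.
  by apply: sumr_ge0 => s _; rewrite (exprM _ 2 2) sqr_ge0.
by rewrite (exprSr _ 3) mulfK ?gt_eqF.
Qed.

Definition vmean n (X : nat -> Om -> 'rV[R]_d) (w : Om) : 'rV[R]_d :=
  n%:R^-1 *: \sum_(1 <= s < n.+1) X s w.

Lemma vmeanE n X w i : vmean n X w 0 i = n%:R^-1 * \sum_(1 <= s < n.+1) X s w 0 i.
Proof. by rewrite /vmean mxE summxE. Qed.

Lemma vmean_Lpow k n (X : nat -> Om -> 'rV[R]_d) i : (forall s, Lpow P k (fun w => X s w 0 i)) ->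
  Lpow P k (fun w => vmean n X w 0 i).
Proof.
move=> LX; apply: (@Lpow_eq _ _ _ _ _ (fun w => n%:R^-1 * \sum_(1 <= s < n.+1) X s w 0 i)).
  by move=> w; rewrite vmeanE.
by apply: LpowZ; exact: Lpow_sum.
Qed.

Lemma vmean_coord4 n (X : nat -> Om -> 'rV[R]_d) i (b : R) : (0 < n)%N -> (forall s, Lpow P 2 (fun w => X s w 0 i)) ->
  (forall s, Ex P (fun w => X s w 0 i ^+ 4) <= b) ->
  Ex P (fun w => vmean n X w 0 i ^+ 4) <= b.
Proof.
move=> n0 LX hX.
have L4 (Y : Om -> R) : Lpow P 2 Y -> Lpow P 0 (fun w => Y w ^+ 4).
  by move=> [_ h]; apply/Lpow0P.
apply: (@le_trans _ _ (Ex P (fun w => n%:R^-1 * \sum_(1 <= s < n.+1) X s w 0 i ^+ 4))).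
  apply: Ex_le.
  - by apply: L4; exact: vmean_Lpow.
  - by apply: LpowZ; apply: Lpow_sum => s _; exact: L4.
  by move=> w; rewrite vmeanE; exact: mean_pow4.
rewrite ExZ; last by apply: Lpow_sum => s _; exact: L4.
rewrite Ex_sum => [|s _]; last exact: L4.
rewrite ler_pdivrMl ?ltr0n //.
apply: (@le_trans _ _ (\sum_(1 <= s < n.+1) b)); first by apply: ler_sum.
by rewrite sumr_const_nat subn1 /= -[leLHS]mulr_natl.
Qed.

Lemma sub_coord4 (X Y : Om -> R) (a b : R) : Lpow P 2 X -> Lpow P 2 Y ->
  Ex P (fun w => X w ^+ 4) <= a -> Ex P (fun w => Y w ^+ 4) <= b ->
  Ex P (fun w => (X w - Y w) ^+ 4) <= 16 * (a + b).
Proof.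
move=> LX LY hX hY.
have L4 (Z : Om -> R) : Lpow P 2 Z -> Lpow P 0 (fun w => Z w ^+ 4).
  by move=> [_ h]; apply/Lpow0P.
have ev (x : R) : `|x| ^+ 4 = x ^+ 4.
  by rewrite (exprM _ 2 2) real_normK ?num_real // -exprM.
apply: (@le_trans _ _ (Ex P (fun w => 16 * (X w ^+ 4 + Y w ^+ 4)))).
  apply: Ex_le.
  - by apply: L4; exact: LpowB.
  - by apply: LpowZ; apply: LpowD; exact: L4.
  move=> w; have := exp_norm_add_le 4 (X w) (- Y w); rewrite normrN !ev.
  by rewrite (_ : 2 ^+ 4 = 16 :> R) //; ring.
rewrite ExZ; last by apply: LpowD; exact: L4.
by rewrite ExD ?ler_wpM2l ?lerD //; exact: L4.
Qed.

End vector_moments.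

(** * Effect of the approximation error and of centering on the window sums *)

Section perturbation.
Context d0 (Om : measurableType d0) (R : realType) (P : probability Om R).
Variable e : int -> Om -> R.
Hypothesis em : forall t, measurable_fun setT (e t).
Hypothesis ei : mutually_independent P [set: int]
  (fun t => preimage_set_system setT (e t) measurable).
Context (d B B1 n : nat) (A : nat -> Om -> 'rV[R]_d) (c : R).
Hypotheses (B0 : (0 < B)%N) (BB1 : (B < B1)%N) (n0 : (0 < n)%N).
Hypothesis dA : forall t i,
  dep (innov e [set s | t%:Z - B%:Z < s <= t%:Z]) (fun w => A t w 0 i).
Hypothesis LA : forall t i, Lpow P 3 (fun w => A t w 0 i).
Hypothesis EA : forall t i, Ex P (fun w => A t w 0 i) = 0.
Hypothesis c1 : 1 <= c.
Hypothesis hA : forall t a, Ex P (fun w => dotp a (A t w) ^+ 4) <= c * dotp a a ^+ 2.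

Let c0 : 0 <= c. Proof. exact: le_trans ler01 c1. Qed.
Let LA2 t i : Lpow P 2 (fun w => A t w 0 i). Proof. exact: LpowW (LA t i). Qed.

Lemma AA_moment t s : Ex P (fun w => dotp (A t w) (A s w) ^+ 2) <= d%:R ^+ 2 * c.
Proof.
have h r : Ex P (fun w => dotp (A r w) (A r w) ^+ 2) <= Num.sqrt (d%:R ^+ 2 * c) ^+ 2.
  by rewrite sqr_sqrtr ?mulr_ge0 ?exprn_ge0 //; exact: A_norm4.
have := @Ex_dotp_CS _ _ _ P d (A t) (A s) _ _ (LA2 t) (LA2 s)
  (sqrtr_ge0 _) (sqrtr_ge0 _) (h t) (h s).
by rewrite -expr2 sqr_sqrtr // mulr_ge0 ?exprn_ge0.
Qed.

Notation Y := (vmean n A).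

(** The first term comes from the times within [B] of [t], where only Cauchy-Schwarz is available;
    the second from all other times, whose sum is independent of [A t]. The prefactor is that of an
    average and of a squared sum of two terms. *)
Definition vY : R := 2 * n%:R ^- 2 *
  ((2 * B)%:R ^+ 2 * (d%:R ^+ 2 * c) + c * (d%:R * ((2 * B)%:R * c * n%:R))).

Lemma A_coord2 t i : Ex P (fun w => A t w 0 i ^+ 2) <= c.
Proof.
have := @A_moment2 _ _ _ P d A c LA c1 hA t (unitv R i).
rewrite (_ : dotp _ _ = 1); last by rewrite /dotp sum_unitv /unitv mxE !eqxx.
rewrite mulr1; apply: le_trans; rewrite le_eqVlt; apply/orP; left; apply/eqP.
by apply: eq_Ex => w; rewrite /dotp sum_unitv.
Qed.

Lemma AY_moment t : Ex P (fun w => dotp (A t w) (Y w) ^+ 2) <= vY.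
Proof.
pose Z w : 'rV[R]_d := \sum_(1 <= s < n.+1) (~~ near B t s)%:R *: A s w.
pose N w := \sum_(1 <= s < n.+1) (near B t s)%:R * dotp (A t w) (A s w).
have ZE w i : Z w 0 i = \sum_(1 <= s < n.+1) (~~ near B t s)%:R * A s w 0 i.
  by rewrite /Z summxE; apply: eq_bigr => s _; rewrite mxE.
have LZ i : Lpow P 2 (fun w => Z w 0 i).
  apply: (@Lpow_eq _ _ _ _ _ (fun w => \sum_(1 <= s < n.+1) (~~ near B t s)%:R * A s w 0 i)).
    by move=> w; rewrite ZE.
  by apply: Lpow_sum => s _; exact: LpowZ.
have LD s : Lpow P 1 (fun w => dotp (A t w) (A s w)) by apply: dotp_Lpow.
have LN : Lpow P 1 N by apply: Lpow_sum => s _; exact: LpowZ.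
have LAZ : Lpow P 1 (fun w => dotp (A t w) (Z w)) by apply: dotp_Lpow.
have EY w : dotp (A t w) (Y w) = n%:R^-1 * (N w + dotp (A t w) (Z w)).
  rewrite dotpZr !dotp_sumr -big_split /=; congr (_ * _); apply: eq_bigr => s _.
  by rewrite dotpZr; case: near; rewrite /= ?mul1r ?mul0r ?addr0 ?add0r.
have hN : Ex P (fun w => N w ^+ 2) <= (2 * B)%:R ^+ 2 * (d%:R ^+ 2 * c).
  apply: (@le_trans _ _ (Ex P (fun w => (2 * B)%:R *
     \sum_(1 <= s < n.+1) (near B t s)%:R * dotp (A t w) (A s w) ^+ 2))).
    apply: Ex_le; first exact: Lpow_sqr.
      by apply: LpowZ; apply: Lpow_sum => s _; apply: LpowZ; exact: Lpow_sqr.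
    move=> w; apply: le_trans (weighted_sqr_sum_le _ _ _) _; first by [].
    rewrite ler_wpM2r ?near_count //.
    by apply: sumr_ge0 => s _; rewrite mulr_ge0 ?sqr_ge0.
  rewrite ExZ; last by apply: Lpow_sum => s _; apply: LpowZ; exact: Lpow_sqr.
  rewrite Ex_sum => [|s _]; last by apply: LpowZ; exact: Lpow_sqr.
  rewrite expr2 -mulrA ler_wpM2l //.
  apply: (@le_trans _ _ (\sum_(1 <= s < n.+1) (near B t s)%:R * (d%:R ^+ 2 * c))); last first.
    by rewrite -mulr_suml ler_wpM2r ?near_count // mulr_ge0 ?exprn_ge0.
  apply: ler_sum => s _; rewrite ExZ; last exact: Lpow_sqr.
  by rewrite ler_wpM2l // AA_moment.
have hZ : Ex P (fun w => dotp (A t w) (Z w) ^+ 2) <= c * (d%:R * ((2 * B)%:R * c * n%:R)).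
  (* For [s <= t - B] the vector [A s] stops at innovation [t - B]; for [s >= t + B] it starts after
     [t]. Both avoid the stretch of [A t]. *)
  have dj : [set s : int | t%:Z - B%:Z < s <= t%:Z] `&`
     [set s | (s <= t%:Z - B%:Z) || (t%:Z < s)] `<=` set0.
    by move=> s [] /=; lia.
  apply: (@le_trans _ _ (c * Ex P (fun w => dotp (Z w) (Z w)))).
    refine (@Ex_indep_dotp2 _ _ _ P _ _ (@innov_measurable _ _ _ _ em _)
      (@innov_measurable _ _ _ _ em _) (innov_indep em ei dj) d (A t) Z c _ _ _ _ _) => //.
    - move=> i; rewrite (_ : (fun w => Z w 0 i) =
        fun w => \sum_(1 <= s < n.+1) (~~ near B t s)%:R * A s w 0 i); last first.
        by apply/funext => w; rewrite ZE.
      apply: dep_sum => s _ _; rewrite /near negb_and -!leqNgt.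
      have [h|h] /= := boolP ((s + B <= t) || (t + B <= s))%N; last first.
        rewrite (_ : (fun w => _) = fun=> 0); first exact: dep_cst.
        by apply/funext => w; rewrite mul0r.
      apply: depZ; refine (dep_innov _ (@dA s i)) => x /=; lia.
    - by move=> i; exact: LpowW.
    - by move=> i; exact: LpowW.
    - by move=> a; exact: (A_moment2 LA c1 hA).
  rewrite ler_wpM2l // Ex_sum => [|i _]; last by apply: LpowM; exact: LpowW.
  apply: (@le_trans _ _ (\sum_(i < d) (2 * B)%:R * c * n%:R)); last first.
    by rewrite sumr_const card_ord -[leLHS]mulr_natl.
  apply: ler_sum => i _.
  rewrite (_ : Ex P _ = Ex P (fun w => (\sum_(1 <= s < n.+1) (~~ near B t s)%:R * A s w 0 i) ^+ 2)); last first.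
    by apply: eq_Ex => w; rewrite -ZE expr2.
  apply: le_trans (@orthogonal_sum _ _ _ P (fun s w => A s w 0 i) _ B 1 n.+1 c _ _ _) _.
  - by move=> s; exact: LpowW.
  - by move=> s _; exact: A_coord2.
  - move=> s r _ _ rs.
    rewrite (@innov_prod _ _ _ P e em ei [set x | s%:Z - B%:Z < x <= s%:Z]
       [set x | r%:Z - B%:Z < x <= r%:Z]) ?EA ?mul0r //.
    + by move=> x [] /=; lia.
    + exact: Lpow_le (LA s i).
    + exact: Lpow_le (LA r i).
  rewrite ler_wpM2l ?mulr_ge0 //.
  apply: (@le_trans _ _ (\sum_(1 <= s < n.+1) 1)).
    by apply: ler_sum => s _; case: near; rewrite ?expr0n ?expr1n.
  by rewrite sumr_const_nat subn1.
apply: (@le_trans _ _ (Ex P (fun w => 2 * n%:R ^- 2 * (N w ^+ 2 + dotp (A t w) (Z w) ^+ 2)))).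
  apply: Ex_le.
  - apply: Lpow_sqr; apply: dotp_Lpow => // i.
    by apply: vmean_Lpow.
  - by apply: LpowZ; apply: LpowD; exact: Lpow_sqr.
  move=> w; rewrite EY exprMn exprVn (mulrC 2) -mulrA ler_wpM2l ?invr_ge0 ?exprn_ge0 //.
  have := sqr_ge0 (N w - dotp (A t w) (Z w)); nra.
rewrite ExZ; last by apply: LpowD; exact: Lpow_sqr.
rewrite ExD; try exact: Lpow_sqr.
by rewrite /vY ler_wpM2l ?lerD // mulr_ge0 ?invr_ge0 ?exprn_ge0.
Qed.

Let LY i : Lpow P 2 (fun w => Y w 0 i). Proof. exact: vmean_Lpow. Qed.

(** The squared norm of the mean is the average over [s] of its inner products with [A s], each
    bounded by [AY_moment]. *)
Lemma YY_moment : Ex P (fun w => dotp (Y w) (Y w) ^+ 2) <= vY.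
Proof.
have LAY s : Lpow P 0 (fun w => dotp (A s w) (Y w) ^+ 2).
  by apply: Lpow_sqr; apply: dotp_Lpow.
have n0' : 0 < n%:R :> R by rewrite ltr0n.
apply: (@le_trans _ _ (Ex P (fun w => n%:R^-1 * \sum_(1 <= s < n.+1) dotp (A s w) (Y w) ^+ 2))).
  apply: Ex_le.
  - by apply: Lpow_sqr; apply: dotp_Lpow.
  - by apply: LpowZ; exact: Lpow_sum.
  move=> w; rewrite {1}/vmean dotpC dotpZr dotp_sumr exprMn exprVn.
  rewrite ler_pdivrMl ?exprn_gt0 // mulrA (exprSr _ 1) expr1 mulfK ?gt_eqF //.
  have := sqr_sum_le 1 n.+1 (fun s => dotp (Y w) (A s w)); rewrite subn1 /= => h.
  apply: le_trans h _; rewrite ler_wpM2l ?(ltW n0') //.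
  by apply: ler_sum => s _; rewrite dotpC.
rewrite ExZ ?Ex_sum //; last exact: Lpow_sum.
rewrite ler_pdivrMl //.
apply: (@le_trans _ _ (\sum_(1 <= s < n.+1) vY)); first by apply: ler_sum => s _; exact: AY_moment.
by rewrite sumr_const_nat subn1 /= -[leLHS]mulr_natl.
Qed.

Notation th := (th B B1 A).

Definition thp (z : nat -> Om -> 'rV[R]_d) t w : R :=
  \sum_(maxn (t - B1) 1 <= s < (t - B).+1) dotp (A t w + z t w) (A s w + z s w).

Lemma thp_diff (z : nat -> Om -> 'rV[R]_d) (v : R) : 0 <= v ->
  (forall t i, Lpow P 3 (fun w => z t w 0 i)) ->
  (forall t s, Ex P (fun w => dotp (A t w) (z s w) ^+ 2) <= v) ->
  (forall t s, Ex P (fun w => dotp (z t w) (z s w) ^+ 2) <= v) ->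
  forall t, Lpow P 2 (fun w => thp z t w - th t w) /\
    Ex P (fun w => (thp z t w - th t w) ^+ 2) <= B1%:R ^+ 2 * (9 * v).
Proof.
move=> v0 Lz hAz hzz t.
set lo := maxn (t - B1) 1; set hi := (t - B).+1.
pose D s w := dotp (A t w) (z s w) + dotp (z t w) (A s w) + dotp (z t w) (z s w).
have E w : thp z t w - th t w = \sum_(lo <= s < hi) D s w.
  rewrite /thp /th /winsum dotp_sumr -sumrB; apply: eq_bigr => s _.
  by rewrite /D !(dotpDl, dotpDr); ring.
have L1 (U V : Om -> 'rV[R]_d) : (forall i, Lpow P 3 (fun w => U w 0 i)) ->
    (forall i, Lpow P 3 (fun w => V w 0 i)) -> Lpow P 2 (fun w => dotp (U w) (V w)).
  by move=> LU LV; exact: dotp_Lpow.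
have LD s : Lpow P 2 (D s) by do 2 (apply: LpowD; last exact: L1); exact: L1.
have hD s : Ex P (fun w => D s w ^+ 2) <= 9 * v.
  have Ls (X : Om -> R) : Lpow P 2 X -> Lpow P 0 (fun w => X w ^+ 2).
    by move=> LX; apply: Lpow_sqr; exact: LpowW.
  have hzA : Ex P (fun w => dotp (z t w) (A s w) ^+ 2) <= v.
    by apply: le_trans (hAz s t); rewrite le_eqVlt; apply/orP; left; apply/eqP;
       apply: eq_Ex => w; rewrite dotpC.
  (* A square of three terms is at most 3 times the sum of squares, and each term has second moment
     at most [v]: hence [9 * v]. *)
  apply: (@le_trans _ _ (Ex P (fun w => 3 * (dotp (A t w) (z s w) ^+ 2 +
     dotp (z t w) (A s w) ^+ 2 + dotp (z t w) (z s w) ^+ 2)))).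
    apply: Ex_le; first exact: Ls.
      by apply: LpowZ; do 2 (apply: LpowD; last by apply: Ls; exact: L1); apply: Ls; exact: L1.
    move=> w; rewrite /D; set x := dotp _ _; set y := dotp (z t w) (A s w); set u := dotp _ _.
    have := sqr_ge0 (x - y); have := sqr_ge0 (x - u); have := sqr_ge0 (y - u); nra.
  rewrite ExZ; last by do 2 (apply: LpowD; last by apply: Ls; exact: L1); apply: Ls; exact: L1.
  rewrite ExD; [|by apply: LpowD; apply: Ls; exact: L1|by apply: Ls; exact: L1].
  rewrite ExD; [|by apply: Ls; exact: L1..].
  have := hAz t s; have := hzz t s; lra.
split.
  by apply: (@Lpow_eq _ _ _ _ _ (fun w => \sum_(lo <= s < hi) D s w)) => //; exact: Lpow_sum.
have LD2 s : Lpow P 0 (fun w => D s w ^+ 2) by apply: Lpow_sqr; exact: LpowW.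
have nB : (hi - lo)%:R <= B1%:R :> R by rewrite ler_nat /lo /hi /maxn; case: ifP; lia.
apply: (@le_trans _ _ (Ex P (fun w => B1%:R * \sum_(lo <= s < hi) D s w ^+ 2))).
  apply: Ex_le.
  - apply: Lpow_sqr; apply: (@Lpow_eq _ _ _ _ _ (fun w => \sum_(lo <= s < hi) D s w)) => //.
    by apply: LpowW; exact: Lpow_sum.
  - by apply: LpowZ; exact: Lpow_sum.
  move=> w; rewrite E; apply: le_trans (sqr_sum_le _ _ _) _.
  by rewrite ler_wpM2r // sumr_ge0 // => s _; rewrite sqr_ge0.
rewrite ExZ ?Ex_sum //; last exact: Lpow_sum.
rewrite expr2 -mulrA ler_wpM2l //.
apply: (@le_trans _ _ (\sum_(lo <= s < hi) 9 * v)); first by apply: ler_sum => s _; exact: hD.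
by rewrite sumr_const_nat -[leLHS]mulr_natl ler_wpM2r // mulr_ge0.
Qed.

Variables (r : nat -> Om -> 'rV[R]_d) (rho : R).
Hypothesis Lr : forall t i, Lpow P 3 (fun w => r t w 0 i).
Hypotheses (rho0 : 0 <= rho) (rho1 : rho <= 1).
Hypothesis hr : forall t i, Ex P (fun w => r t w 0 i ^+ 4) <= rho ^+ 4.

(** Made for the mixed product of [A] and [r]; because [rho <= 1 <= c] it also covers the product of
    [r] with itself. *)
Definition vr : R := d%:R ^+ 2 * c * rho ^+ 2.

Let vr0 : 0 <= vr. Proof. by rewrite /vr !mulr_ge0 ?exprn_ge0. Qed.
Let Lr2 t i : Lpow P 2 (fun w => r t w 0 i). Proof. exact: LpowW. Qed.

Let A4 t : Ex P (fun w => dotp (A t w) (A t w) ^+ 2) <= (d%:R * c) ^+ 2.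
Proof.
apply: le_trans (@A_norm4 _ _ _ P d A c LA hA t) _.
by rewrite exprMn ler_wpM2l ?exprn_ge0 // expr2 ler_peMl.
Qed.

Let dc0 : 0 <= d%:R * c. Proof. exact: mulr_ge0. Qed.

Lemma r_moments t s : Ex P (fun w => dotp (A t w) (r s w) ^+ 2) <= vr /\
  Ex P (fun w => dotp (r t w) (r s w) ^+ 2) <= vr.
Proof.
have r4 u : Ex P (fun w => dotp (r u w) (r u w) ^+ 2) <= (d%:R * rho ^+ 2) ^+ 2.
  rewrite exprMn -exprM; apply: Ex_norm4_le => //.
have dr0 : 0 <= d%:R * rho ^+ 2 by rewrite mulr_ge0 ?exprn_ge0.
split.
  apply: le_trans (Ex_dotp_CS (LA2 t) (Lr2 s) dc0 dr0 (A4 t) (r4 s)) _.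
  by rewrite /vr le_eqVlt; apply/orP; left; apply/eqP; ring.
apply: le_trans (Ex_dotp_CS (Lr2 t) (Lr2 s) dr0 dr0 (r4 t) (r4 s)) _.
rewrite /vr.
have -> : d%:R * rho ^+ 2 * (d%:R * rho ^+ 2) = d%:R ^+ 2 * rho ^+ 2 * rho ^+ 2 by ring.
have -> : d%:R ^+ 2 * c * rho ^+ 2 = d%:R ^+ 2 * rho ^+ 2 * c by ring.
rewrite ler_wpM2l ?mulr_ge0 ?exprn_ge0 // (le_trans _ c1) // expr_le1 //.
Qed.

Lemma thp_residual t : Lpow P 2 (fun w => thp r t w - th t w) /\
  Ex P (fun w => (thp r t w - th t w) ^+ 2) <= B1%:R ^+ 2 * (9 * vr).
Proof. by apply: thp_diff => // s u; case: (r_moments s u). Qed.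

(* A t + zc t is the array A t + r t centered by its empirical mean *)
Definition zc t w : 'rV[R]_d := (r t w - vmean n r w) - Y w.

(** In [thp_centered] the multiples 36, 6 and 6 of [vr] and one [vY] occur, all times 4; 432 leaves
    slack over [4 * 48]. *)
Definition vc : R := 432 * vr + 4 * vY.

Lemma vY_ge0 : 0 <= vY.
Proof. by apply: le_trans YY_moment; exact: Ex_sqr_ge0. Qed.

Lemma zc_Lpow t i : Lpow P 3 (fun w => zc t w 0 i).
Proof.
apply: (@Lpow_eq _ _ _ _ _ (fun w => (r t w 0 i - vmean n r w 0 i) - Y w 0 i)).
  by move=> w; rewrite !mxE.
by do 2 (apply: LpowB; last exact: vmean_Lpow).
Qed.

Lemma thp_centered t : Lpow P 2 (fun w => thp zc t w - th t w) /\
  Ex P (fun w => (thp zc t w - th t w) ^+ 2) <= B1%:R ^+ 2 * (9 * vc).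
Proof.
have vY0 := vY_ge0.
pose q t w : 'rV[R]_d := r t w - vmean n r w.
have qE t' w i : q t' w 0 i = r t' w 0 i - vmean n r w 0 i by rewrite !mxE.
have Lm i : Lpow P 2 (fun w => vmean n r w 0 i) by exact: vmean_Lpow.
have Lq t' i : Lpow P 2 (fun w => q t' w 0 i).
  apply: (@Lpow_eq _ _ _ _ _ (fun w => r t' w 0 i - vmean n r w 0 i)).
    by move=> w; rewrite qE.
  exact: LpowB.
have dr0 : 0 <= d%:R * (6 * rho ^+ 2) by rewrite !mulr_ge0 ?exprn_ge0.
(* Subtracting the mean costs [16 * (rho ^+ 4 + rho ^+ 4) = 32 * rho ^+ 4], rounded up to the square
   of [6 * rho ^+ 2]. *)
have q4 t' : Ex P (fun w => dotp (q t' w) (q t' w) ^+ 2) <= (d%:R * (6 * rho ^+ 2)) ^+ 2.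
  rewrite exprMn; apply: Ex_norm4_le => // i.
  rewrite (_ : Ex P _ = Ex P (fun w => (r t' w 0 i - vmean n r w 0 i) ^+ 4)); last first.
    by apply: eq_Ex => w; rewrite qE.
  have hm : Ex P (fun w => vmean n r w 0 i ^+ 4) <= rho ^+ 4 by exact: vmean_coord4.
  apply: le_trans (sub_coord4 (Lr2 t' i) (Lm i) (hr t' i) hm) _.
  rewrite exprMn -exprM; have : 0 <= rho ^+ 4 by rewrite exprn_ge0.
  lra.
have Y4 : Ex P (fun w => dotp (Y w) (Y w) ^+ 2) <= (d%:R * c) ^+ 2.
  apply: (@le_trans _ _ (d%:R ^+ 2 * c)).
    apply: Ex_norm4_le => // i; apply: vmean_coord4 => // s.
    exact: (@A_coord4 _ _ _ P d A c hA).
  by rewrite exprMn ler_wpM2l ?exprn_ge0 // expr2 ler_peMl.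
have rr1 : rho ^+ 2 <= 1 by rewrite expr_le1.
have rr0 : 0 <= rho ^+ 2 by rewrite exprn_ge0.
have dd0 : 0 <= d%:R ^+ 2 :> R by rewrite exprn_ge0.
have hAq t' s : Ex P (fun w => dotp (A t' w) (q s w) ^+ 2) <= 6 * vr.
  apply: le_trans (Ex_dotp_CS (LA2 t') (Lq s) dc0 dr0 (A4 t') (q4 s)) _.
  by rewrite /vr le_eqVlt; apply/orP; left; apply/eqP; ring.
have hqY t' : Ex P (fun w => dotp (q t' w) (Y w) ^+ 2) <= 6 * vr.
  apply: le_trans (Ex_dotp_CS (Lq t') LY dr0 dc0 (q4 t') Y4) _.
  by rewrite /vr le_eqVlt; apply/orP; left; apply/eqP; ring.
have hqq t' s : Ex P (fun w => dotp (q t' w) (q s w) ^+ 2) <= 36 * vr.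
  apply: le_trans (Ex_dotp_CS (Lq t') (Lq s) dr0 dr0 (q4 t') (q4 s)) _.
  rewrite /vr.
  have -> : d%:R * (6 * rho ^+ 2) * (d%:R * (6 * rho ^+ 2)) =
    36 * (d%:R ^+ 2 * rho ^+ 2 * rho ^+ 2) by ring.
  rewrite ler_wpM2l //; have -> : d%:R ^+ 2 * c * rho ^+ 2 = d%:R ^+ 2 * rho ^+ 2 * c by ring.
  by rewrite ler_wpM2l ?mulr_ge0 // (le_trans rr1).
have Ls (U V : Om -> 'rV[R]_d) : (forall i, Lpow P 2 (fun w => U w 0 i)) ->
    (forall i, Lpow P 2 (fun w => V w 0 i)) -> Lpow P 0 (fun w => dotp (U w) (V w) ^+ 2).
  by move=> LU LV; apply: Lpow_sqr; exact: dotp_Lpow.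
apply: thp_diff.
- by rewrite /vc; apply: addr_ge0; apply: mulr_ge0; [exact: ler0n|exact: vr0|exact: ler0n|exact: vY_ge0].
- exact: zc_Lpow.
- move=> t' s.
  apply: (@le_trans _ _ (Ex P (fun w => 2 * dotp (A t' w) (q s w) ^+ 2 +
     2 * dotp (A t' w) (Y w) ^+ 2))).
    apply: Ex_le.
    + by apply: Ls => // i; apply: LpowW; exact: zc_Lpow.
    + by apply: LpowD; apply: LpowZ; exact: Ls.
    move=> w; have -> : zc s w = q s w - Y w by [].
    move: (q s w) => q0; rewrite dotpDr dotpNr.
    move: (dotp (A t' w) q0) (dotp (A t' w) (Y w)) => x y.
    by have := sqr_ge0 (x + y); nra.
  rewrite ExD; try by apply: LpowZ; exact: Ls.
  rewrite !ExZ; try exact: Ls.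
  have := hAq t' s; have := AY_moment t'; rewrite /vc; move: vY0 vr0; lra.
- move=> t' s.
  apply: (@le_trans _ _ (Ex P (fun w => 4 * (dotp (q t' w) (q s w) ^+ 2 +
     dotp (q t' w) (Y w) ^+ 2 + dotp (q s w) (Y w) ^+ 2 + dotp (Y w) (Y w) ^+ 2)))).
    apply: Ex_le.
    + by apply: Ls => i; apply: LpowW; exact: zc_Lpow.
    + by apply: LpowZ; do 3 (apply: LpowD; last exact: Ls); exact: Ls.
    move=> w; have -> : zc s w = q s w - Y w by [].
    have -> : zc t' w = q t' w - Y w by [].
    move: (q t' w) (q s w) (Y w) => q1 q2 y0.
    rewrite !(dotpDl, dotpDr, dotpNl, dotpNr) (dotpC y0 q2).
    move: (dotp q1 q2) (dotp q1 y0) (dotp q2 y0) (dotp y0 y0).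
    move=> x y z u; rewrite -subr_ge0.
    (* Lagrange's identity for the four terms [x], [- y], [- z], [u]: four times the sum of squares
       minus the square of the sum is the sum of all squared pairwise differences. *)
    rewrite [X in 0 <= X](_ : _ = (x + z) ^+ 2 + (x + y) ^+ 2 + (x - u) ^+ 2 +
      (z - y) ^+ 2 + (z + u) ^+ 2 + (y + u) ^+ 2); last by ring.
    by rewrite !addr_ge0 ?sqr_ge0.
  rewrite ExZ; last by do 3 (apply: LpowD; last exact: Ls); exact: Ls.
  rewrite ExD; [|by do 2 (apply: LpowD; last exact: Ls); exact: Ls|exact: Ls].
  rewrite ExD; [|by apply: LpowD; exact: Ls|exact: Ls].
  rewrite ExD; [|exact: Ls..].
  have := hqq t' s; have := hqY t'; have := hqY s; have := YY_moment; rewrite /vc; move: vY0 vr0; lra.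
Qed.

End perturbation.

(** * Window sums of a short-range dependent series *)

Lemma inv_sqr_sum_r (R : realType) (t hi : nat) :
  \sum_(t <= s < hi) (1 + (s - t)%:R) ^- 2 <= 2 :> R.
Proof.
(* The remainder [1 / (hi - t)] makes the induction work, through
   [1 / (k + 1) ^ 2 <= 1 / k - 1 / (k + 1)]. *)
suff h : (t < hi)%N ->
    \sum_(t <= s < hi) (1 + (s - t)%:R) ^- 2 <= 2 - (hi - t)%:R^-1 :> R.
  have [th_|ht] := ltnP t hi; last by rewrite big_geq.
  by apply: le_trans (h th_) _; rewrite gerBl invr_ge0.
elim: hi => [//|hi IH]; rewrite ltnS leq_eqVlt => /predU1P[<-|th_].
  by rewrite big_nat1 subnn addr0 expr1n invr1 subSn // subnn invr1; lra.
rewrite big_nat_recr /=; last exact: ltnW.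
have := IH th_; rewrite subSn; last exact: ltnW.
have k0 : 0 < (hi - t)%:R :> R by rewrite ltr0n subn_gt0.
have -> : (hi - t).+1%:R = (hi - t)%:R + 1 :> R by rewrite natr1.
move: ((hi - t)%:R) k0 => k k0 h.
apply: le_trans (_ : 2 - k^-1 + (1 + k) ^- 2 <= _); first by rewrite lerD2r.
have k1 : 0 < k + 1 by rewrite addr_gt0.
rewrite -subr_ge0.
have -> : 2 - (k + 1)^-1 - (2 - k^-1 + (1 + k) ^- 2) = (k * (k + 1) ^+ 2)^-1.
  by rewrite [1 + k]addrC; field; rewrite !gt_eqF.
by rewrite invr_ge0 mulr_ge0 ?exprn_ge0 // ltW.
Qed.

Lemma inv_sqr_sum_l (R : realType) (lo t : nat) :
  \sum_(lo <= s < t) (1 + (t - s)%:R) ^- 2 <= 2 :> R.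
Proof.
rewrite big_nat_rev /=; apply: le_trans (inv_sqr_sum_r R lo t).
rewrite !big_nat; apply: ler_sum => s /andP[s1 s2].
rewrite lef_pV2 ?posrE ?exprn_gt0 ?ltr_wpDr //.
apply: lerXn2r; rewrite ?nnegrE ?addr_ge0 // lerD2l ler_nat; lia.
Qed.

Lemma inv_sqr_sum (R : realType) (lo hi t : nat) :
  \sum_(lo <= s < hi) (1 + (maxn t s - minn t s)%:R) ^- 2 <= 4 :> R.
Proof.
have inv0 (x : nat) : 0 <= (1 + x%:R) ^- 2 :> R by rewrite invr_ge0 exprn_ge0 // addr_ge0.
have [hit|thi] := leqP hi t.
  apply: (@le_trans _ _ 2); last by lra.
  apply: le_trans (inv_sqr_sum_l R lo t).
  have [lh|hl] := leqP lo hi; last by rewrite big_geq ?sumr_ge0 // ltnW.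
  rewrite [leRHS](big_cat_nat lh hit) /= -[leLHS]addr0 lerD ?sumr_ge0 //.
  rewrite !big_nat; apply: ler_sum => s /andP[s1 s2].
  by rewrite (maxn_idPl _) ?(minn_idPr _) //; apply: ltnW; exact: leq_trans hit.
have [tlo|lot] := leqP t lo.
  apply: (@le_trans _ _ 2); last by lra.
  apply: le_trans (inv_sqr_sum_r R t hi).
  have [lh|hl] := leqP lo hi; last by rewrite big_geq ?sumr_ge0 // ltnW.
  rewrite [leRHS](big_cat_nat tlo lh) /= -[leLHS]add0r lerD ?sumr_ge0 //.
  rewrite !big_nat; apply: ler_sum => s /andP[s1 s2].
  by rewrite (maxn_idPr _) ?(minn_idPl _) //; exact: leq_trans s1.
rewrite (big_cat_nat (ltnW lot) (ltnW thi)) /=.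
have -> : 4 = 2 + 2 :> R by ring.
apply: lerD.
  apply: le_trans (inv_sqr_sum_l R lo t).
  rewrite !big_nat; apply: ler_sum => s /andP[s1 s2].
  by rewrite (maxn_idPl _) ?(minn_idPr _) // ltnW.
apply: le_trans (inv_sqr_sum_r R t hi).
rewrite !big_nat; apply: ler_sum => s /andP[s1 s2].
by rewrite (maxn_idPr _) ?(minn_idPl _).
Qed.

Section quadratic_perturbation.
Context (R : realType) (m n : nat) (k : nat -> nat -> R).

Lemma qform_lin (s : R) (x y : nat -> R) :
  qform m n k (fun t => s * x t + y t) = s ^+ 2 * qform m n k x +
    s * (\sum_(m <= t < n) \sum_(m <= r < n) k t r * (x t * y r + y t * x r)) +
    qform m n k y.
Proof.
rewrite /qform !mulr_sumr -!big_split /=; apply: eq_bigr => t _.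
rewrite !mulr_sumr -!big_split /=; apply: eq_bigr => r _; ring.
Qed.

(** Positivity of the form at [lam * x + y] and at [- lam * x + y] bounds the cross term on both
    sides by [lam * q(x) + q(y) / lam]. *)
Lemma qform_perturb (lam : R) (x y : nat -> R) : 0 < lam ->
  (forall z : nat -> R, 0 <= qform m n k z) ->
  `|qform m n k (fun t => x t + y t) - qform m n k x| <=
    lam * qform m n k x + (1 + lam^-1) * qform m n k y.
Proof.
move=> lam0 psd.
have e1 : qform m n k (fun t => x t + y t) = qform m n k (fun t => 1 * x t + y t).
  by congr (qform _ _ _ _); apply/funext => t; rewrite mul1r.
rewrite e1 qform_lin.
have := psd (fun t => lam * x t + y t); have := psd (fun t => (- lam) * x t + y t).
rewrite !qform_lin; set c := \sum_(_ <= _ < _) _.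
have := psd x; have := psd y; move: (qform m n k x) (qform m n k y) => a b b0 a0 h1 h2.
rewrite mulrDl mul1r.
have lb : lam * (lam^-1 * b) = b by rewrite mulrA divff ?mul1r // gt_eqF.
have lb0 : 0 <= lam^-1 * b by rewrite mulr_ge0 // invr_ge0 ltW.
have c1 : c <= lam * a + lam^-1 * b.
  rewrite -(ler_pM2l lam0) mulrDr lb; nra.
have c2 : - c <= lam * a + lam^-1 * b.
  rewrite -(ler_pM2l lam0) mulrDr lb; nra.
have la0 : 0 <= lam * a by rewrite mulr_ge0 // ltW.
rewrite ler_norml; apply/andP; split; lra.
Qed.

(** Schur's test: each product is at most half the sum of the two squares, and the row sums are at
    most [kap]. *)
Lemma qform_le (kap : R) (x : nat -> R) : (forall t s, k t s = k s t) ->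
  (forall t s, 0 <= k t s) ->
  (forall t, (m <= t < n)%N -> \sum_(m <= s < n) k t s <= kap) ->
  qform m n k x <= kap * \sum_(m <= t < n) x t ^+ 2.
Proof.
move=> kC k0 hk.
apply: (@le_trans _ _ (\sum_(m <= t < n) \sum_(m <= s < n)
  (k t s * (x t ^+ 2 / 2) + k s t * (x s ^+ 2 / 2)))).
  apply: ler_sum => t _; apply: ler_sum => s _.
  rewrite [k s t]kC -mulrDr ler_wpM2l //.
  have := sqr_ge0 (x t - x s); lra.
rewrite (eq_bigr (fun t => \sum_(m <= s < n) k t s * (x t ^+ 2 / 2) +
   \sum_(m <= s < n) k s t * (x s ^+ 2 / 2))); last by move=> t _; rewrite big_split.
rewrite big_split /= [X in _ + X]exchange_big /= -big_split /= mulr_sumr.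
rewrite !big_nat; apply: ler_sum => t tmn.
rewrite -mulr_suml; have := hk t tmn; have := sqr_ge0 (x t).
move: (\sum_(_ <= _ < _) _) (x t ^+ 2) => S y y0 hS; nra.
Qed.

End quadratic_perturbation.

Section series.
Context d0 (Om : measurableType d0) (R : realType) (P : probability Om R).
Context (d : nat) (e : int -> Om -> R) (g : int -> 'I_d -> (nat -> R) -> R).
Variables (M alpha C : R).
Hypothesis em : forall t, measurable_fun setT (e t).
Hypothesis ei : mutually_independent P [set: int]
  (fun t => preimage_set_system setT (e t) measurable).
Hypothesis gm : forall t i, measurable_seqfun (g t i).
Hypotheses (M8 : 8 < M) (C1 : 1 <= C) (alpha2 : 2 <= alpha).
Hypothesis srd : short_range_dependent P e g M alpha C.

Let C0 : 0 < C. Proof. exact: lt_le_trans C1. Qed.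
Notation eps := (process e g).
Notation dec := (decay alpha C).

(** All depths are chosen at once: depth [B] defines the array, and depth [h] serves to bound its
    covariances at lag [h]. *)
Lemma approximants : exists et : nat -> int -> Om -> 'rV[R]_d, forall m t,
  [/\ forall i, dep (innov e [set s | t - m%:Z < s <= t]) (fun w => et m t w 0 i),
      forall i, Lpow P 3 (fun w => et m t w 0 i),
      forall i, Ex P (fun w => et m t w 0 i) = 0 &
      forall a, Ex P (fun w => dotp a (eps t w - et m t w) ^+ 4)
        <= 2 ^+ 9 * dec m ^+ 4 * dotp a a ^+ 2].
Proof.
have h (p : nat * int) := approximant em ei gm M8 C0 srd p.1 p.2.
have [et het] := choice h.
by exists (fun m t => et (m, t)) => m t; exact: (het (m, t)).
Qed.

Lemma decay_anti (m n : nat) : (m <= n)%N -> dec n <= dec m.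
Proof.
move=> mn; rewrite /decay ler_pM2l // !powRN lef_pV2 ?posrE ?powR_gt0 ?ltr_wpDr //.
apply: ge0_ler_powR; rewrite ?nnegrE ?addr_ge0 //; first exact: le_trans alpha2.
by rewrite lerD2l ler_nat.
Qed.

Lemma decay_sqr (h : nat) : dec h <= C * (1 + h%:R) ^- 2.
Proof.
rewrite /decay ler_pM2l // powRN lef_pV2 ?posrE ?exprn_gt0 ?powR_gt0 ?ltr_wpDr //.
rewrite -powR_mulrn ?addr_ge0 //; apply: ler_powR => //.
by rewrite lerDl.
Qed.

Variables (et : nat -> int -> Om -> 'rV[R]_d) (B : nat).
Hypothesis het : forall m t,
  [/\ forall i, dep (innov e [set s | t - m%:Z < s <= t]) (fun w => et m t w 0 i),
      forall i, Lpow P 3 (fun w => et m t w 0 i),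
      forall i, Ex P (fun w => et m t w 0 i) = 0 &
      forall a, Ex P (fun w => dotp a (eps t w - et m t w) ^+ 4)
        <= 2 ^+ 9 * dec m ^+ 4 * dotp a a ^+ 2].

Definition appr (t : nat) (w : Om) : 'rV[R]_d := et B t%:Z w.
Definition resid (t : nat) (w : Om) : 'rV[R]_d := eps t%:Z w - appr t w.

Lemma eps_coord_Lpow (t : int) i : Lpow P 3 (fun w => eps t w 0 i).
Proof. by have [h _] := process_moment em gm M8 C0 srd t; exact: h. Qed.

Lemma et_Lpow m t i : Lpow P 3 (fun w => et m t w 0 i).
Proof. by case: (het m t). Qed.

Lemma diff_coord4 m (t : int) i :
  Ex P (fun w => (eps t w 0 i - et m t w 0 i) ^+ 4) <= 2 ^+ 9 * dec m ^+ 4.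
Proof.
have [_ _ _ h] := het m t; have := h (unitv R i).
rewrite (_ : dotp _ _ = 1); last by rewrite /dotp sum_unitv /unitv mxE !eqxx.
rewrite expr1n mulr1; apply: le_trans; rewrite le_eqVlt; apply/orP; left; apply/eqP.
by apply: eq_Ex => w; rewrite /dotp sum_unitv !mxE.
Qed.

Lemma diff_coord2 m (t : int) i :
  Ex P (fun w => (eps t w 0 i - et m t w 0 i) ^+ 2) <= 2 ^+ 5 * dec m ^+ 2.
Proof.
have L2 : Lpow P 2 (fun w => eps t w 0 i - et m t w 0 i).
  by apply: LpowB; apply: LpowW; [exact: eps_coord_Lpow|exact: et_Lpow].
rewrite -(@ler_pXn2r _ 2) ?nnegrE ?Ex_sqr_ge0 ?mulr_ge0 ?exprn_ge0 ?powR_ge0 ?(ltW C0) ?(ltW (decay_gt0 _ C0 _)) //.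
apply: le_trans (Ex_sqr_le (Lpow_sqr L2)) _.
apply: le_trans (_ : 2 ^+ 9 * dec m ^+ 4 <= _); last first.
  have -> : (2 ^+ 5 * dec m ^+ 2) ^+ 2 = 2 ^+ 10 * dec m ^+ 4 by ring.
  rewrite ler_wpM2r ?exprn_ge0 ?powR_ge0 ?(ltW C0) ?(ltW (decay_gt0 _ C0 _)) //.
  by rewrite ler_weXn2l // ler1n.
apply: le_trans (diff_coord4 m t i); rewrite le_eqVlt; apply/orP; left; apply/eqP.
by apply: eq_Ex => w; rewrite -exprM.
Qed.

Lemma dec0 : dec 0 = C.
Proof. by rewrite /decay addr0 powR1 mulr1. Qed.

(** [16 * (2 + 2 ^ 9) <= 2 ^ 14]: the fourth moment of a difference, with the constants of
    [process_moment] and [approximant] and with [decay B <= decay 0 = C]. *)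
Definition cA : R := 2 ^+ 14 * C ^+ 4.

Lemma cA1 : 1 <= cA.
Proof.
rewrite /cA -[leLHS]mulr1 ler_pM // ?exprn_ege1 // ler1n //.
Qed.

Lemma appr_moment4 t a : Ex P (fun w => dotp a (appr t w) ^+ 4) <= cA * dotp a a ^+ 2.
Proof.
have [_ h1] := process_moment em gm M8 C0 srd t%:Z.
have [_ _ _ h2] := het B t%:Z.
have La (X : Om -> 'rV[R]_d) : (forall i, Lpow P 3 (fun w => X w 0 i)) ->
    Lpow P 2 (fun w => dotp a (X w)).
  by move=> LX; apply: Lpow_sum => i _; apply: LpowZ; exact: LpowW.
have L1 := La _ (eps_coord_Lpow t%:Z).
have L2 : Lpow P 2 (fun w => dotp a (eps t%:Z w - et B t%:Z w)).
  apply: La => i; apply: (@Lpow_eq _ _ _ _ _ (fun w => eps t%:Z w 0 i - et B t%:Z w 0 i)).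
    by move=> w; rewrite !mxE.
  by apply: LpowB; [exact: eps_coord_Lpow|exact: et_Lpow].
rewrite (_ : Ex P _ = Ex P (fun w => (dotp a (eps t%:Z w) - dotp a (eps t%:Z w - et B t%:Z w)) ^+ 4)); last first.
  by apply: eq_Ex => w; rewrite /appr dotpDr dotpNr opprD opprK addrA subrr add0r.
apply: le_trans (sub_coord4 L1 L2 (h1 a) (h2 a)) _.
rewrite -mulrDl mulrA ler_wpM2r ?sqr_ge0 // /cA.
have dB : dec B ^+ 4 <= C ^+ 4.
  apply: lerXn2r; rewrite ?nnegrE ?(ltW C0) ?powR_ge0 ?(ltW C0) ?(ltW (decay_gt0 _ C0 _)) //.
  by rewrite -[leRHS]dec0 decay_anti.
have C40 : 0 <= C ^+ 4 by rewrite exprn_ge0 // ltW.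
have : 2 ^+ 9 * dec B ^+ 4 <= 2 ^+ 9 * C ^+ 4 by rewrite ler_wpM2l.
have -> : 2 ^+ 14 = 2 ^+ 9 * 32 :> R by rewrite -(natrX _ 2 9) -(natrX _ 2 14) -natrM.
have : 2 <= 2 ^+ 9 :> R by rewrite -[leLHS]expr1 ler_weXn2l // ler1n.
move: (2 ^+ 9) (C ^+ 4) (dec B ^+ 4) C40 => u v x v0 u1 h.
have : 0 <= (u - 2) * v by rewrite mulr_ge0 // subr_ge0.
nra.
Qed.

Lemma appr_Lpow t i : Lpow P 3 (fun w => appr t w 0 i).
Proof. exact: et_Lpow. Qed.

Lemma appr_mean t i : Ex P (fun w => appr t w 0 i) = 0.
Proof. by case: (het B t%:Z). Qed.

Lemma appr_dep t i :
  dep (innov e [set s | t%:Z - B%:Z < s <= t%:Z]) (fun w => appr t w 0 i).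
Proof. by case: (het B t%:Z). Qed.

(** From lag [B] on the factors are independent. At a smaller lag [h], the depth-[h] approximant at
    time [t] is independent of [appr s] and centered, so subtracting it changes nothing and leaves a
    factor of size [decay h]. *)
Lemma appr_cov_le t s i : (s <= t)%N ->
  `|Ex P (fun w => appr t w 0 i * appr s w 0 i)| <= 12 * cA * C * (1 + (t - s)%:R) ^- 2.
Proof.
move=> st; set h := (t - s)%N.
have cA0 : 0 <= cA := le_trans ler01 cA1.
have inv0 : 0 <= (1 + h%:R) ^- 2 :> R by rewrite invr_ge0 exprn_ge0 // addr_ge0.
have L0 u : Lpow P 0 (fun w => appr u w 0 i) := Lpow_le (leq0n 3) (appr_Lpow u i).
have L1 u : Lpow P 1 (fun w => appr u w 0 i) := Lpow_le (isT : (1 <= 3)%N) (appr_Lpow u i).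
have [Bh|hB] := leqP B h.
  rewrite (@innov_prod _ _ _ P e em ei [set x | t%:Z - B%:Z < x <= t%:Z]
     [set x | s%:Z - B%:Z < x <= s%:Z]) ?appr_mean ?mul0r ?normr0 //.
  + by rewrite !mulr_ge0 // ltW.
  + by move=> x [] /=; rewrite /h in Bh; lia.
  + exact: appr_dep.
  + exact: appr_dep.
have Lh : Lpow P 1 (fun w => et h t%:Z w 0 i) := Lpow_le (isT : (1 <= 3)%N) (et_Lpow h t%:Z i).
have Le : Lpow P 1 (fun w => eps t%:Z w 0 i) := Lpow_le (isT : (1 <= 3)%N) (eps_coord_Lpow t%:Z i).
have E0 : Ex P (fun w => et h t%:Z w 0 i * appr s w 0 i) = 0.
  have [dh _ mh _] := het h t%:Z.
  rewrite (@innov_prod _ _ _ P e em ei [set x | t%:Z - h%:Z < x <= t%:Z]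
     [set x | s%:Z - B%:Z < x <= s%:Z]) ?mh ?mul0r //.
  + by move=> x [] /=; rewrite /h; lia.
  + exact: appr_dep.
  + exact: LpowW.
have -> : Ex P (fun w => appr t w 0 i * appr s w 0 i) =
    Ex P (fun w => (appr t w 0 i - et h t%:Z w 0 i) * appr s w 0 i).
  rewrite -[LHS]subr0 -E0 -ExB; [|exact: LpowM..].
  by apply: eq_Ex => w; rewrite mulrBl.
have d0' m : 0 <= dec m by apply: ltW; exact: decay_gt0.
(* Both approximants are compared with [eps]: [2 * 32 + 2 * 32 = 128], rounded up to [12 ^ 2]. *)
have hb : Ex P (fun w => (appr t w 0 i - et h t%:Z w 0 i) ^+ 2) <= (12 * dec h) ^+ 2.
  have LB : Lpow P 1 (fun w => eps t%:Z w 0 i - appr t w 0 i) by exact: LpowB.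
  have LH : Lpow P 1 (fun w => eps t%:Z w 0 i - et h t%:Z w 0 i) by exact: LpowB.
  apply: (@le_trans _ _ (Ex P (fun w => 2 * (eps t%:Z w 0 i - appr t w 0 i) ^+ 2 +
     2 * (eps t%:Z w 0 i - et h t%:Z w 0 i) ^+ 2))).
    apply: Ex_le; first by apply: Lpow_sqr; exact: LpowB.
      by apply: LpowD; apply: LpowZ; exact: Lpow_sqr.
    move=> w; move: (eps t%:Z w 0 i) (appr t w 0 i) (et h t%:Z w 0 i) => x y z.
    by have := sqr_ge0 ((x - y) + (x - z)); nra.
  rewrite ExD; try by apply: LpowZ; exact: Lpow_sqr.
  rewrite !ExZ; try exact: Lpow_sqr.
  have h1 := diff_coord2 B t%:Z i; have h2 := diff_coord2 h t%:Z i.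
  have hd : dec B ^+ 2 <= dec h ^+ 2.
    by apply: lerXn2r; rewrite ?nnegrE // decay_anti // ltnW.
  have -> : (12 * dec h) ^+ 2 = 144 * dec h ^+ 2 by ring.
  have d2 : 0 <= dec h ^+ 2 by rewrite exprn_ge0.
  have e5 : 2 ^+ 5 = 32 :> R by ring.
  rewrite e5 in h1 h2; rewrite -/(appr _ _) in h1; rewrite /appr in h1 *; lra.
have ha : Ex P (fun w => appr s w 0 i ^+ 2) <= cA ^+ 2.
  apply: le_trans (@A_coord2 _ _ _ P d appr cA (fun t i => @appr_Lpow t i) cA1 appr_moment4 s i) _.
  by rewrite expr2 ler_peMl // cA1.
apply: le_trans (Ex_CS_le _ _ _ cA0 hb ha) _.
- exact: LpowB.
- exact: L1.
- by rewrite mulr_ge0.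
have -> : 12 * dec h * cA = 12 * cA * dec h by ring.
by rewrite -[leRHS]mulrA; apply: ler_wpM2l; [exact: mulr_ge0|exact: decay_sqr].
Qed.

(** [12 * cA * C] per covariance, times 4 for the sum of inverse squares. Summable covariances keep
    this constant free of [B], which the memory length alone would not. *)
Definition cW : R := 48 * cA * C.

Lemma appr_sum_moment2 i lo hi :
  Ex P (fun w => (\sum_(lo <= s < hi) appr s w 0 i) ^+ 2) <= cW * (hi - lo)%:R.
Proof.
have cA0 : 0 <= cA := le_trans ler01 cA1.
have L1 u : Lpow P 1 (fun w => appr u w 0 i) := Lpow_le (isT : (1 <= 3)%N) (appr_Lpow u i).
rewrite (_ : Ex P _ = Ex P (fun w => (\sum_(lo <= s < hi) appr s w 0 i) *
   (\sum_(lo <= s < hi) appr s w 0 i))); last by apply: eq_Ex => w; rewrite expr2.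
rewrite Ex_sqr_sum //.
apply: (@le_trans _ _ (\sum_(lo <= t < hi) 12 * cA * C *
   \sum_(lo <= s < hi) (1 + (maxn t s - minn t s)%:R) ^- 2)).
  apply: ler_sum => t _; rewrite mulr_sumr; apply: ler_sum => s _.
  apply: le_trans (ler_norm _) _; have [ts|st] := leqP t s.
    rewrite (_ : Ex P _ = Ex P (fun w => appr s w 0 i * appr t w 0 i)); last first.
      by apply: eq_Ex => w; rewrite mulrC.
    exact: appr_cov_le.
  by apply: appr_cov_le; exact: ltnW.
apply: (@le_trans _ _ (\sum_(lo <= t < hi) cW)); last first.
  by rewrite sumr_const_nat -[leLHS]mulr_natr.
apply: ler_sum => t _; rewrite /cW.
have -> : 48 * cA * C = 12 * cA * C * 4 by ring.
by apply: ler_wpM2l; [rewrite !mulr_ge0 // ltW|exact: inv_sqr_sum].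
Qed.

End series.

(** * Distance between the conditional variance and the variance of the noise for one series *)

Section series_bound.
Context d0 (Om : measurableType d0) (R : realType) (P : probability Om R).
Context (d : nat) (e : int -> Om -> R) (g : int -> 'I_d -> (nat -> R) -> R).
Variables (M alpha C : R).
Hypothesis em : forall t, measurable_fun setT (e t).
Hypothesis ei : mutually_independent P [set: int]
  (fun t => preimage_set_system setT (e t) measurable).
Hypothesis gm : forall t i, measurable_seqfun (g t i).
Hypotheses (M8 : 8 < M) (C1 : 1 <= C) (alpha2 : 2 <= alpha).
Hypothesis srd : short_range_dependent P e g M alpha C.
Variables (B B1 n : nat) (k : nat -> nat -> R) (kap lam del : R).
Hypotheses (B0 : (0 < B)%N) (BB1 : (B < B1)%N) (n0 : (0 < n)%N).
Hypothesis kC : forall t s, k t s = k s t.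
Hypothesis k01 : forall t s, 0 <= k t s <= 1.
Hypothesis hkap : forall t, (B.+1 <= t < n.+1)%N -> \sum_(B.+1 <= s < n.+1) k t s <= kap.
Hypothesis psd : forall x : nat -> R, 0 <= qform B.+1 n.+1 k x.
Hypothesis hdel : forall t s, near B t s -> 1 - k t s <= del.
Hypotheses (lam0 : 0 < lam) (del0 : 0 <= del).

Notation eps := (process e g).

Definition centered_eps (t : nat) (w : Om) : 'rV[R]_d :=
  eps t%:Z w - vmean n (fun s => eps s%:Z) w.
Definition theta_obs (t : nat) (w : Om) : R :=
  \sum_(maxn (t - B1) 1 <= s < (t - B).+1) dotp (centered_eps t w) (centered_eps s w).
Definition theta_eps (t : nat) (w : Om) : R :=
  \sum_(maxn (t - B1) 1 <= s < (t - B).+1) dotp (eps t%:Z w) (eps s%:Z w).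
Definition noise_sum (w : Om) : R := \sum_(B.+1 <= t < n.+1) theta_eps t w.

Notation N' := (n.+1 - B.+1)%:R.
Notation cA := (cA C).
Notation cW := (cW C).
(** The factor 5 is chosen because [5 ^ 4 = 625] exceeds the [2 ^ 9 = 512] in [diff_coord4]. *)
Definition rho : R := 5 * decay alpha C B.
Hypothesis rho1 : rho <= 1.

(** In order: the fluctuation of the form of the array, the bias of its weights, and two
    perturbations, one of the form by centering and residual, one of the variance of the noise sum
    by the residual. Both perturbations cost [lam] times a mean of the same size, hence the factor
    2. *)
Definition series_err : R :=
  Num.sqrt (qvar d B B1 cA cW B.+1 n.+1 kap) +
  N' * ((2 * B)%:R * (del * m2 d B1 cA cW)) +
  2 * (lam * (N' * ((2 * B)%:R * m2 d B1 cA cW))) +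
  (1 + lam^-1) * (kap * (N' * (B1%:R ^+ 2 * (9 * vc d B n cA rho))) +
                  N' * (N' * (B1%:R ^+ 2 * (9 * vr d cA rho)))).

Lemma series_bound :
  Lpow P 0 (fun w => qform B.+1 n.+1 k (theta_obs^~ w)) /\ Lpow P 1 noise_sum /\
  Ex P (fun w => `|qform B.+1 n.+1 k (theta_obs^~ w) -
     (Ex P (fun w => noise_sum w ^+ 2) - Ex P noise_sum ^+ 2)|) <= series_err.
Proof.
have [et het] := approximants em ei gm M8 C1 srd.
have C0 : 0 < C := lt_le_trans ltr01 C1.
pose A := appr et B; pose r := resid e g et B.
have dA t i : dep (innov e [set s | t%:Z - B%:Z < s <= t%:Z]) (fun w => A t w 0 i).
  by case: (het B t%:Z) => + _ _ _; apply.
have LA t i : Lpow P 3 (fun w => A t w 0 i) by case: (het B t%:Z) => _ + _ _; apply.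
have EA t i : Ex P (fun w => A t w 0 i) = 0 by case: (het B t%:Z) => _ _ + _; apply.
have hA := appr_moment4 em gm M8 C1 alpha2 srd B het : forall t a,
  Ex P (fun w => dotp a (A t w) ^+ 4) <= cA * dotp a a ^+ 2.
have c1 : 1 <= cA by exact: cA1.
have cA0 : 0 <= cA := le_trans ler01 c1.
have cw0 : 0 <= 48 * cA * C by rewrite mulr_ge0 ?(ltW C0) // mulr_ge0.
rewrite -[48 * _ * _]/cW in cw0.
have hw i lo hi : Ex P (fun w => (\sum_(lo <= s < hi) A s w 0 i) ^+ 2) <= cW * (hi - lo)%:R.
  exact: (appr_sum_moment2 em ei gm M8 C1 alpha2 srd B het).
have Le := eps_coord_Lpow em gm M8 C1 srd.
have rE t w i : r t w 0 i = eps t%:Z w 0 i - A t w 0 i by rewrite !mxE.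
have Lr t i : Lpow P 3 (fun w => r t w 0 i).
  apply: (@Lpow_eq _ _ _ _ _ (fun w => eps t%:Z w 0 i - A t w 0 i)).
    by move=> w; rewrite rE.
  exact: LpowB.
have decB0 : 0 <= decay alpha C B := ltW (decay_gt0 alpha C0 B).
have rho0 : 0 <= rho by rewrite mulr_ge0.
have hr t i : Ex P (fun w => r t w 0 i ^+ 4) <= rho ^+ 4.
  rewrite (_ : Ex P _ = Ex P (fun w => (eps t%:Z w 0 i - et B t%:Z w 0 i) ^+ 4)); last first.
    by apply: eq_Ex => w; rewrite rE.
  apply: le_trans (diff_coord4 het B t%:Z i) _.
  rewrite /rho; have : 0 <= decay alpha C B ^+ 4 by rewrite exprn_ge0.
  have -> : (5 * decay alpha C B) ^+ 4 = 625 * decay alpha C B ^+ 4 by ring.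
  have -> : 2 ^+ 9 = 512 :> R by ring.
  lra.
have epsE t w : eps t%:Z w = A t w + r t w by rewrite /r /resid addrCA subrr addr0.
have meanE w : vmean n (fun s => eps s%:Z) w = vmean n A w + vmean n r w.
  rewrite /vmean -scalerDr -big_split /=; congr (_ *: _).
  by apply: eq_bigr => s _; rewrite epsE.
have cenE t w : centered_eps t w = A t w + zc n A r t w.
  rewrite /centered_eps /zc meanE epsE; move: (A t w) (r t w) (vmean n A w) (vmean n r w).
  by move=> a b a' b'; apply/rowP => i; rewrite !mxE; ring.
pose T1 := thp B B1 A (zc n A r); pose T2 := thp B B1 A r; pose T0 := th B B1 A.
have obsE t w : theta_obs t w = T1 t w.
  by apply: eq_bigr => s _; rewrite !cenE.
have noiseE t w : theta_eps t w = T2 t w.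
  by apply: eq_bigr => s _; rewrite !epsE.
have LT0 t : Lpow P 2 (T0 t) := th_Lpow B B1 LA t.
have hz1 t := thp_centered em ei B0 BB1 n0 dA LA EA c1 hA Lr rho0 rho1 hr t.
have hz2 t := thp_residual B0 BB1 n0 LA c1 hA Lr rho0 rho1 hr t.
set m := B.+1; set N := n.+1.
pose Q w := qform m N k (T0^~ w).
pose Del t w := T1 t w - T0 t w.
have LDel t : Lpow P 2 (Del t) by case: (hz1 t).
pose S0 w := \sum_(m <= t < N) T0 t w.
pose D w := \sum_(m <= t < N) (T2 t w - T0 t w).
have LD2 t : Lpow P 2 (fun w => T2 t w - T0 t w) by case: (hz2 t).
have LS0 : Lpow P 1 S0 by apply: Lpow_sum => t _; exact: LpowW.
have LD : Lpow P 1 D by apply: Lpow_sum => t _; exact: LpowW.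
have LQ : Lpow P 1 Q := @qform_Lpow _ _ _ _ _ _ _ _ LA m N k.
have GE w : noise_sum w = S0 w + D w.
  rewrite /noise_sum /S0 /D -big_split /=; apply: eq_bigr => t _.
  by rewrite noiseE addrC subrK.
have LG : Lpow P 1 noise_sum by apply: (@Lpow_eq _ _ _ _ _ (fun w => S0 w + D w)) => //; exact: LpowD.
pose q1 w := qform m N k (Del^~ w).
have Lq1 : Lpow P 0 q1.
  by apply: Lpow_sum => t _; apply: Lpow_sum => s _; apply: LpowZ; apply: LpowW; exact: LpowM.
have obsQ w : qform m N k (theta_obs^~ w) = qform m N k (fun t => T0 t w + Del t w).
  by congr (qform _ _ _ _); apply/funext => t; rewrite obsE /Del addrC subrK.
have LT1 t : Lpow P 2 (T1 t).
  by apply: (@Lpow_eq _ _ _ _ _ (fun w => T0 t w + Del t w)); [move=> w; rewrite /Del addrC subrK|exact: LpowD].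
have LQh : Lpow P 0 (fun w => qform m N k (theta_obs^~ w)).
  apply: (@Lpow_eq _ _ _ _ _ (fun w => qform m N k (T1^~ w))).
    by move=> w; congr (qform _ _ _ _); apply/funext => t; rewrite obsE.
  by apply: Lpow_sum => t _; apply: Lpow_sum => s _; apply: LpowZ; apply: LpowW; exact: LpowM.
split => //; split => //.
have LQ0 : Lpow P 0 Q := LpowW LQ.
set m2' := m2 d B1 cA cW.
have m20 : 0 <= m2' by exact: m2_ge0.
set q0 := N' * ((2 * B)%:R * m2').
have EQ : Ex P Q <= q0.
  exact: (qform_mean_le em ei B0 BB1 dA LA EA c1 cw0 hA hw m N k01).
have ES : Ex P (fun w => S0 w ^+ 2) <= q0.
  exact: (sum_sqr_mean_le em ei B0 BB1 dA LA EA c1 cw0 hA hw m N).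
have bias := qform_bias em ei B0 BB1 dA LA EA c1 cw0 hA hw m N k01 hdel del0.
have var := qform_var em ei B0 BB1 dA LA EA c1 cw0 hA hw kC k01 hkap.
rewrite -/Q in var.
have Eq1 : Ex P q1 <= kap * (N' * (B1%:R ^+ 2 * (9 * vc d B n cA rho))).
  have LD22 t : Lpow P 0 (fun w => Del t w ^+ 2) by apply: Lpow_sqr; exact: LpowW.
  apply: (@le_trans _ _ (Ex P (fun w => kap * \sum_(m <= t < N) Del t w ^+ 2))).
    apply: Ex_le => //; first by apply: LpowZ; exact: Lpow_sum.
    by move=> w; apply: qform_le => // t s; case/andP: (k01 t s).
  have [mN|Nm] := ltnP m N; last first.
    by rewrite (@eq_Ex _ _ _ P _ (fun=> 0)) ?Ex_cst ?(eqP Nm) ?mul0r ?mulr0 // => w; rewrite big_geq ?mulr0.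
  have kap0 : 0 <= kap.
    by apply: le_trans (hkap (t := m) _); rewrite ?leqnn ?mN // sumr_ge0 // => s _; case/andP: (k01 m s).
  rewrite ExZ ?Ex_sum //; last exact: Lpow_sum.
  rewrite ler_wpM2l //; apply: (@le_trans _ _ (\sum_(m <= t < N) B1%:R ^+ 2 * (9 * vc d B n cA rho))).
    by apply: ler_sum => t _; case: (hz1 t).
  by rewrite sumr_const_nat -[leLHS]mulr_natl.
have ED : Ex P (fun w => D w ^+ 2) <= N' * (N' * (B1%:R ^+ 2 * (9 * vr d cA rho))).
  have LD22 t : Lpow P 0 (fun w => (T2 t w - T0 t w) ^+ 2) by apply: Lpow_sqr; exact: LpowW.
  apply: (@le_trans _ _ (Ex P (fun w => N' * \sum_(m <= t < N) (T2 t w - T0 t w) ^+ 2))).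
    apply: Ex_le; [exact: Lpow_sqr|by apply: LpowZ; exact: Lpow_sum|].
    by move=> w; exact: sqr_sum_le.
  rewrite ExZ ?Ex_sum //; last exact: Lpow_sum.
  rewrite ler_wpM2l //; apply: (@le_trans _ _ (\sum_(m <= t < N) B1%:R ^+ 2 * (9 * vr d cA rho))).
    by apply: ler_sum => t _; case: (hz2 t).
  by rewrite sumr_const_nat -[leLHS]mulr_natl.
have lam1 : 0 <= lam^-1 by rewrite invr_ge0 ltW.
have p1 : Ex P (fun w => `|qform m N k (theta_obs^~ w) - Q w|) <=
    lam * q0 + (1 + lam^-1) * (kap * (N' * (B1%:R ^+ 2 * (9 * vc d B n cA rho)))).
  apply: (@le_trans _ _ (Ex P (fun w => lam * Q w + (1 + lam^-1) * q1 w))).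
    apply: Ex_le; [by apply: Lpow_norm; exact: LpowB|by apply: LpowD; exact: LpowZ|].
    by move=> w; rewrite obsQ; exact: qform_perturb.
  rewrite ExD; try exact: LpowZ.
  by rewrite !ExZ // lerD // ler_wpM2l ?addr_ge0 // ltW.
have p2 : Ex P (fun w => `|Q w - Ex P Q|) <= Num.sqrt (qvar d B B1 cA cW m N kap).
  have LQc : Lpow P 1 (fun w => Q w - Ex P Q) by apply: LpowB => //; exact: Lpow_cst.
  have Eabs0 : 0 <= Ex P (fun w => `|Q w - Ex P Q|) by exact: Ex_ge0.
  rewrite -[leLHS]ger0_norm // -sqrtr_sqr ler_wsqrtr //.
  apply: le_trans (Ex_sqr_le (Lpow_norm LQc)) _.
  rewrite (_ : Ex P _ = Ex P (fun w => (Q w - Ex P Q) ^+ 2)) //.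
  by apply: eq_Ex => w; rewrite real_normK ?num_real.
set VG := Ex P (fun w => noise_sum w ^+ 2) - Ex P noise_sum ^+ 2.
(* The trade-off of [qform_perturb] again, now for the variance of [S0 + D]; as [S0] is centered,
   the mean of the noise sum is that of [D]. *)
have p4 : `|Ex P (fun w => S0 w ^+ 2) - VG| <=
    lam * q0 + (1 + lam^-1) * (N' * (N' * (B1%:R ^+ 2 * (9 * vr d cA rho)))).
  have ES0 : Ex P S0 = 0.
    have LT00 t : Lpow P 0 (T0 t) := Lpow_le (leq0n 2) (LT0 t).
    rewrite Ex_sum // big1 // => t _.
    have d1 : dep (innov e [set s | s <= t%:Z - B%:Z]) (fun _ : Om => 1 : R) by move=> ? ?; apply: measurable_cst.
    have := @th_martingale _ _ _ _ _ em ei _ _ _ _ _ _ B0 BB1 dA LA EA c1 cw0 t _ _ d1 d1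
      (Lpow_cst _ _ _) (Lpow_cst _ _ _).
    by move=> <-; apply: eq_Ex => w; rewrite !mulr1.
  have LSD : Lpow P 0 (fun w => S0 w * D w) by exact: LpowM.
  have LS2 := Lpow_sqr LS0; have LDD := Lpow_sqr LD.
  have EG : Ex P noise_sum = Ex P D.
    rewrite (eq_Ex _ GE) ExD ?ES0 ?add0r //; exact: LpowW.
  have EG2 : Ex P (fun w => noise_sum w ^+ 2) = Ex P (fun w => S0 w ^+ 2) +
      (2 * Ex P (fun w => S0 w * D w) + Ex P (fun w => D w ^+ 2)).
    rewrite -ExZ // -ExD //; last exact: LpowZ.
    rewrite -ExD //; last by apply: LpowD => //; exact: LpowZ.
    by apply: eq_Ex => w; rewrite GE; ring.
  have cross : `|2 * Ex P (fun w => S0 w * D w)| <=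
      lam * Ex P (fun w => S0 w ^+ 2) + lam^-1 * Ex P (fun w => D w ^+ 2).
    rewrite -ExZ // -[X in X + _]ExZ // -[X in _ + X]ExZ // -ExD; try exact: LpowZ.
    apply: le_trans (Ex_norm _) _; first exact: LpowZ.
    apply: Ex_le; [by apply: Lpow_norm; exact: LpowZ|by apply: LpowD; exact: LpowZ|].
    move=> w; have li : lam * lam^-1 = 1 by rewrite divff // gt_eqF.
    have h1 := mulr_ge0 lam1 (sqr_ge0 (lam * S0 w - D w)).
    have h2 := mulr_ge0 lam1 (sqr_ge0 (lam * S0 w + D w)).
    have e1 : lam^-1 * (lam * S0 w - D w) ^+ 2 = lam * S0 w ^+ 2 - 2 * (S0 w * D w) + lam^-1 * D w ^+ 2.
      by field; rewrite gt_eqF.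
    have e2 : lam^-1 * (lam * S0 w + D w) ^+ 2 = lam * S0 w ^+ 2 + 2 * (S0 w * D w) + lam^-1 * D w ^+ 2.
      by field; rewrite gt_eqF.
    rewrite e1 in h1; rewrite e2 in h2.
    by rewrite ler_norml; apply/andP; split; lra.
  have jens : Ex P D ^+ 2 <= Ex P (fun w => D w ^+ 2) by exact: Ex_sqr_le.
  have dd := sqr_ge0 (Ex P D).
  have s1 : lam * Ex P (fun w => S0 w ^+ 2) <= lam * q0 by rewrite ler_wpM2l // ltW.
  have s2 := ler_wpM2l lam1 ED.
  rewrite mulrDl mul1r /VG EG2 EG.
  move: cross; rewrite ler_norml => /andP[x1 x2].
  rewrite ler_norml; apply/andP; split; lra.
have LQQ : Lpow P 0 (fun w => `|qform m N k (theta_obs^~ w) - Q w|) by apply: Lpow_norm; exact: LpowB.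
have LQE : Lpow P 0 (fun w => `|Q w - Ex P Q|) by apply: Lpow_norm; apply: LpowB => //; exact: Lpow_cst.
pose c3 := `|Ex P Q - Ex P (fun w => S0 w ^+ 2)| + `|Ex P (fun w => S0 w ^+ 2) - VG|.
apply: (@le_trans _ _ (Ex P (fun w => `|qform m N k (theta_obs^~ w) - Q w| +
   (`|Q w - Ex P Q| + c3)))).
  apply: Ex_le.
  - by apply: Lpow_norm; apply: LpowB => //; exact: Lpow_cst.
  - by apply: LpowD => //; apply: LpowD => //; exact: Lpow_cst.
  move=> w; rewrite /c3.
  have -> : qform m N k (theta_obs^~ w) - VG = (qform m N k (theta_obs^~ w) - Q w) +
    ((Q w - Ex P Q) + ((Ex P Q - Ex P (fun w => S0 w ^+ 2)) + (Ex P (fun w => S0 w ^+ 2) - VG))).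
    by ring.
  by do 3 (apply: le_trans (ler_normD _ _) _; apply: lerD => //).
rewrite ExD //; last by apply: LpowD => //; exact: Lpow_cst.
rewrite ExD //; last exact: Lpow_cst.
rewrite Ex_cst /series_err /c3 -/m -/N -/m2' -/q0.
move: bias p1 p2 p4; rewrite -/Q -/S0 -/m2'.
set a1 := Ex P (fun w => `|_ - Q w|); set a2 := Ex P _.
set a3 := `|Ex P Q - _|; set a4 := `|_ - VG|.
rewrite -/a3; move=> b1 b2 b3 b4; rewrite mulrDr; lra.
Qed.

End series_bound.

(** * Normal laws *)

Section normal_integrals.
Context (R : realType).
Notation mu := (@lebesgue_measure R).
Implicit Types (f : R -> \bar R) (U : set (measurableTypeR R)).

Lemma integral_normal_prob (m s : R) f : measurable_fun setT f -> (forall x, 0 <= f x)%E ->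
  (\int[normal_prob m s]_x f x = \int[mu]_x (f x * (normal_pdf m s x)%:E))%E.
Proof.
move=> mf f0; have dom := @normal_prob_dominates R m s.
rewrite -(Radon_Nikodym_SigmaFinite.change_of_variables dom f0 measurableT mf).
apply: ae_eq_integral => //.
- apply: emeasurable_funM => //.
  exact: measurable_int (Radon_Nikodym_SigmaFinite.f_integrable dom).
- by apply: emeasurable_funM => //; apply/measurable_EFinP; exact: measurable_normal_pdf.
apply: ae_eqe_mul2l; apply: integral_ae_eq => //.
- exact: Radon_Nikodym_SigmaFinite.f_integrable.
- by apply/measurable_EFinP; exact: measurable_normal_pdf.
- by move=> A _ mA; rewrite -Radon_Nikodym_SigmaFinite.f_integral.
Qed.

Lemma integral_translation f (a : R) : measurable_fun setT f -> (forall x, 0 <= f x)%E ->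
  (\int[mu]_x f (x + a)%R = \int[mu]_x f x)%E.
Proof.
move=> mf f0.
have ma : measurable_fun setT (fun x : R => x + a : measurableTypeR R) by exact: measurable_funD.
have -> : (\int[mu]_x f x = \int[pushforward mu (fun x : R => x + a : measurableTypeR R)%R]_x f x)%E.
  apply: eq_measure_integral => A mA _; apply: lebesgue_measure_unique => //= _ [[b c]] _ <-.
  rewrite /pushforward (_ : _ @^-1` _ = `]b - a, c - a]%classic); last first.
    by apply/seteqP; split=> x /=; rewrite !in_itv /= ltrBlDr lerBrDr.
  rewrite !lebesgue_measure_itv /= !lte_fin ltrD2r; case: ifP => // _.
  by rewrite -EFinB -EFinD; congr EFin; ring.
rewrite ge0_integral_pushforward //.
Qed.

Lemma normal_pdf_form (m s x : R) : s != 0 ->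
  normal_pdf m s x = normal_peak s * expR (- (x - m) ^+ 2 / (s ^+ 2 *+ 2)).
Proof. by move=> s0; rewrite normal_pdfE. Qed.

Lemma normal_peakE (s : R) : 0 < s -> normal_peak s = s^-1 * (Num.sqrt (pi *+ 2))^-1.
Proof.
move=> t0; rewrite /normal_peak -!mulrnAr sqrtrM ?sqr_ge0 // sqrtr_sqr gtr0_norm //.
by rewrite invfM.
Qed.

Lemma gaussian_mgf (m s h : R) : 0 <= s -> s != 0 ->
  (\int[normal_prob m s]_x (expR (h * x))%:E = (expR (h * m + h ^+ 2 * s ^+ 2 / 2))%:E)%E.
Proof.
move=> s0 sn0; rewrite integral_normal_prob //; last first.
  by apply/measurable_EFinP; apply: measurableT_comp => //; exact: measurable_funM.
transitivity (\int[mu]_x ((expR (h * m + h ^+ 2 * s ^+ 2 / 2))%:E * (normal_pdf (m + h * s ^+ 2) s x)%:E))%E.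
  apply: eq_integral => x _; rewrite -!EFinM !normal_pdf_form //; congr EFin.
  rewrite mulrCA [RHS]mulrCA -!expRD; congr (_ * expR _).
  by field.
rewrite ge0_integralZl //; last 2 first.
- by apply/measurable_EFinP; exact: measurable_normal_pdf.
- by move=> x _; rewrite lee_fin normal_pdf_ge0.
by rewrite integral_normal_pdf mule1.
Qed.

(** The exponential turns the density into a multiple of the centered normal density with variance
    [s ^ 2 / (1 - 2 * h * s ^ 2)]; the multiple is the ratio of the peaks. *)
Lemma gaussian_sqr_mgf (s h : R) : 0 < s -> 2 * h * s ^+ 2 < 1 ->
  (\int[normal_prob 0 s]_x (expR (h * x ^+ 2))%:E = ((Num.sqrt (1 - 2 * h * s ^+ 2))^-1)%:E)%E.
Proof.
move=> s0 hs; rewrite integral_normal_prob //; last first.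
  by apply/measurable_EFinP; apply: measurableT_comp => //; exact: measurable_funM.
have q0 : 0 < 1 - 2 * h * s ^+ 2 by rewrite subr_gt0.
set q := Num.sqrt (1 - 2 * h * s ^+ 2).
have q1 : 0 < q by rewrite sqrtr_gt0.
have qq : q ^+ 2 = 1 - 2 * h * s ^+ 2 by rewrite sqr_sqrtr // ltW.
have sq0 : s / q != 0 by rewrite gt_eqF // divr_gt0.
transitivity (\int[mu]_x ((q^-1)%:E * (normal_pdf 0 (s / q) x)%:E))%E.
  apply: eq_integral => x _; rewrite -!EFinM !normal_pdf_form ?gt_eqF ?divr_gt0 //; congr EFin.
  rewrite mulrCA -expRD [RHS]mulrA.
  have -> : h * x ^+ 2 + - (x - 0) ^+ 2 / (s ^+ 2 *+ 2) = - (x - 0) ^+ 2 / ((s / q) ^+ 2 *+ 2).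
    rewrite subr0 expr_div_n qq; field.
    by rewrite !gt_eqF.
  congr (_ * _).
  rewrite (normal_peakE s0) (normal_peakE (divr_gt0 s0 q1)).
  by move: (Num.sqrt (pi *+ 2))^-1 => p; field; rewrite !gt_eqF.
rewrite ge0_integralZl //; last 3 first.
- by apply/measurable_EFinP; exact: measurable_normal_pdf.
- by move=> x _; rewrite lee_fin normal_pdf_ge0.
- by rewrite lee_fin invr_ge0 ltW.
by rewrite integral_normal_pdf mule1.
Qed.

(** Completing the square in [y]: the joint density of the two summands is the density of their sum
    [x] times the conditional density of the second summand given the sum. *)
Lemma normal_pdf_product (s1 s2 x y : R) : 0 < s1 -> 0 < s2 ->
  normal_pdf 0 s1 (x - y) * normal_pdf 0 s2 y =
  normal_pdf 0 (Num.sqrt (s1 ^+ 2 + s2 ^+ 2)) x *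
  normal_pdf (s2 ^+ 2 * x / (s1 ^+ 2 + s2 ^+ 2)) (s1 * s2 / Num.sqrt (s1 ^+ 2 + s2 ^+ 2)) y.
Proof.
move=> s10 s20; set S := Num.sqrt _.
have S20 : 0 < s1 ^+ 2 + s2 ^+ 2 by rewrite addr_gt0 // exprn_gt0.
have S0 : 0 < S by rewrite sqrtr_gt0.
have SS : S ^+ 2 = s1 ^+ 2 + s2 ^+ 2 by rewrite sqr_sqrtr // ltW.
have t0 : 0 < s1 * s2 / S by rewrite divr_gt0 // mulr_gt0.
rewrite !normal_pdf_form ?gt_eqF // mulrACA [RHS]mulrACA -!expRD; congr (_ * expR _).
  rewrite !normal_peakE //; move: (Num.sqrt (pi *+ 2))^-1 => p; field.
  by rewrite !gt_eqF.
rewrite expr_div_n exprMn SS; field.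
by rewrite !gt_eqF.
Qed.

Lemma normal_convolution (s1 s2 : R) U : 0 < s1 -> 0 < s2 -> measurable U ->
  (\int[normal_prob 0 s2]_y normal_prob 0 s1 ((fun x : R => x + y)%R @^-1` U) =
   normal_prob 0 (Num.sqrt (s1 ^+ 2 + s2 ^+ 2)) U)%E.
Proof.
move=> s10 s20 mU; set S := Num.sqrt _.
have t0 : 0 < s1 * s2 / S by rewrite divr_gt0 ?mulr_gt0 // sqrtr_gt0 addr_gt0 // exprn_gt0.
pose f (z : R * R) := ((\1_U z.1)%:E * (normal_pdf 0 s1 (z.1 - z.2))%:E)%E.
have mf : measurable_fun setT (f : measurableTypeR R * measurableTypeR R -> \bar R).
  apply: emeasurable_funM; apply/measurable_EFinP; apply: measurableT_comp => //.
    exact: measurable_normal_pdf.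
  exact: measurable_funB.
have f0 z : (0 <= f z)%E by rewrite mule_ge0 // lee_fin ?normal_pdf_ge0 // indicE.
have mfy y : measurable_fun setT (fun x => f (x, y)).
  have mp : measurable_fun setT ((fun x => (x, y)) : measurableTypeR R -> measurableTypeR R * measurableTypeR R).
    by apply: measurable_fun_pair; [exact: measurable_id|exact: measurable_cst].
  exact: (measurableT_comp mf mp).
have E y : normal_prob 0 s1 ((fun x : R => x + y)%R @^-1` U) = (\int[mu]_x f (x, y))%E.
  rewrite -(@integral_translation (fun x => f (x, y)) y); last 2 first.
  - exact: mfy.
  - by move=> x; exact: f0.
  rewrite /normal_prob integral_mkcond /=; apply: eq_integral => x _.
  rewrite patchE /f /= addrK indicE; case: (boolP (x \in _)) => /=.
    by rewrite inE /= => Ux; rewrite mem_set // mul1e.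
  by rewrite notin_setE /= => Ux; rewrite memNset // mul0e.
under eq_integral do rewrite E.
pose h (z : R * R) := (f z * (normal_pdf 0 s2 z.2)%:E)%E.
have mh : measurable_fun setT (h : measurableTypeR R * measurableTypeR R -> \bar R).
  apply: emeasurable_funM => //; apply/measurable_EFinP; apply: measurableT_comp => //.
  exact: measurable_normal_pdf.
have h0 z : (0 <= h z)%E by rewrite mule_ge0 // lee_fin normal_pdf_ge0.
rewrite integral_normal_prob; last 2 first.
- exact: (@measurable_fun_fubini_tonelli_G _ _ _ _ _ mu f mf f0).
- by move=> y; apply: integral_ge0.
transitivity (\int[mu]_y \int[mu]_x h (x, y))%E.
  apply: eq_integral => y _; rewrite -ge0_integralZr //.
  - exact: mfy.
  - by rewrite lee_fin normal_pdf_ge0.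
rewrite -(@fubini_tonelli _ _ _ _ _ mu mu h mh h0).
rewrite /normal_prob [RHS]integral_mkcond /=; apply: eq_integral => x _.
rewrite /h /f /=.
transitivity (\int[mu]_y ((\1_U x * normal_pdf 0 S x)%:E *
    (normal_pdf (s2 ^+ 2 * x / (s1 ^+ 2 + s2 ^+ 2)) (s1 * s2 / S) y)%:E))%E.
  by apply: eq_integral => y _; rewrite -!EFinM -mulrA normal_pdf_product // mulrA.
rewrite ge0_integralZl //; last 3 first.
- by apply/measurable_EFinP; exact: measurable_normal_pdf.
- by move=> y _; rewrite lee_fin normal_pdf_ge0.
- by rewrite lee_fin mulr_ge0 ?normal_pdf_ge0 // indicE.
rewrite integral_normal_pdf mule1 patchE indicE.
by case: ifP => _; rewrite ?mul1r ?mul0r.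
Qed.

(** The inequality already holds between densities: the factor [s / t] equalizes the peaks, and the
    wider exponential is the larger one. *)
Lemma normal_prob_scale_le (s t : R) U : 0 < s -> s <= t -> measurable U ->
  ((s / t)%:E * normal_prob 0 s U <= normal_prob 0 t U)%E.
Proof.
move=> s0 st mU; have t0 : 0 < t := lt_le_trans s0 st.
rewrite /normal_prob -ge0_integralZl //; last 3 first.
- by apply: measurable_funTS; apply/measurable_EFinP; exact: measurable_normal_pdf.
- by move=> x _; rewrite lee_fin normal_pdf_ge0.
- by rewrite lee_fin divr_ge0 // ltW.
apply: ge0_le_integral => //.
- by move=> x _; rewrite -EFinM lee_fin mulr_ge0 ?normal_pdf_ge0 ?divr_ge0 // ltW.
- apply: measurable_funTS; apply/measurable_EFinP; apply: measurable_funM => //.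
  exact: measurable_normal_pdf.
- by apply: measurable_funTS; apply/measurable_EFinP; exact: measurable_normal_pdf.
move=> x _; rewrite -EFinM lee_fin !normal_pdf_form ?gt_eqF // !normal_peakE // !mulrA.
have p0 : 0 <= (Num.sqrt (pi *+ 2))^-1 :> R by rewrite invr_ge0.
move: (Num.sqrt (pi *+ 2))^-1 p0 => p p0.
have -> : s / t * s^-1 * p = t^-1 * p by field; rewrite !gt_eqF.
rewrite ler_wpM2l ?mulr_ge0 ?invr_ge0 ?(ltW t0) // ler_expR subr0 !mulNr lerN2.
rewrite ler_wpM2l ?sqr_ge0 // lef_pV2 ?posrE ?pmulrn_lgt0 ?exprn_gt0 //.
by rewrite ler_pMn2r // ler_sqr ?nnegrE // ltW.
Qed.

End normal_integrals.

Section gaussian_laws.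
Context d0 (Om : measurableType d0) (R : realType) (P : probability Om R).
Implicit Types (X Y : Om -> R) (U : set (measurableTypeR R)).

(** [gaussian] bundled as a probability, so that one can integrate against it and use its
    distribution function. *)
Definition gaussian_probability (m s : R) : probability (measurableTypeR R) R :=
  if s == 0 then (dirac (m : measurableTypeR R) : probability (measurableTypeR R) R) else normal_prob m s.

Lemma gaussian_probabilityE (m s : R) U : gaussian_probability m s U = gaussian m s U.
Proof. by rewrite /gaussian_probability /gaussian; case: ifP. Qed.

Definition has_law X (m s : R) : Prop :=
  forall U, measurable U -> P (X @^-1` U) = gaussian m s U.

Lemma has_law_integral X m s (mX : measurable_fun setT X) (f : R -> \bar R) :
  has_law X m s -> measurable_fun setT f -> (forall x, 0 <= f x)%E ->
  (\int[P]_w f (X w) = \int[gaussian_probability m s]_x f x)%E.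
Proof.
move=> hX mf f0.
have mX' : measurable_fun setT (X : Om -> measurableTypeR R) by [].
rewrite -(@integral_law _ _ _ (measurableTypeR R) _ P X mX' f) //.
apply: eq_measure_integral => A mA _.
exact: etrans (hX A mA) (esym (gaussian_probabilityE m s A)).
Qed.

Lemma has_law_mgf X m s h : measurable_fun setT X -> has_law X m s -> 0 <= s ->
  (\int[P]_w (expR (h * X w))%:E = (expR (h * m + h ^+ 2 * s ^+ 2 / 2))%:E)%E.
Proof.
move=> mX hX s0.
have mf : measurable_fun setT (fun x : R => (expR (h * x))%:E).
  by apply/measurable_EFinP; apply: measurableT_comp => //; exact: measurable_funM.
rewrite (@has_law_integral X m s mX (fun x => (expR (h * x))%:E)) //.
rewrite /gaussian_probability; case: (eqVneq s 0) => [->|sn0]; last exact: gaussian_mgf.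
by rewrite integral_dirac // diracT mul1e expr0n /= mulr0 mul0r addr0.
Qed.

Lemma has_law_sqr_mgf X s h : measurable_fun setT X -> has_law X 0 s -> 0 <= s ->
  2 * h * s ^+ 2 < 1 ->
  (\int[P]_w (expR (h * X w ^+ 2))%:E = ((Num.sqrt (1 - 2 * h * s ^+ 2))^-1)%:E)%E.
Proof.
move=> mX hX s0 hs.
have mf : measurable_fun setT (fun x : R => (expR (h * x ^+ 2))%:E).
  by apply/measurable_EFinP; apply: measurableT_comp => //; exact: measurable_funM.
rewrite (@has_law_integral X 0 s mX (fun x => (expR (h * x ^+ 2))%:E)) //.
rewrite /gaussian_probability; case: (eqVneq s 0) => [->|sn0].
  by rewrite integral_dirac // diracT mul1e expr0n /= !mulr0 subr0 sqrtr1 invr1 expR0.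
by apply: gaussian_sqr_mgf; rewrite // lt0r sn0.
Qed.

Lemma Lpow0_of_integral (f : Om -> R) (b : R) : measurable_fun setT f -> (forall w, 0 <= f w) ->
  (\int[P]_w (f w)%:E = b%:E)%E -> Lpow P 0 f /\ Ex P f = b.
Proof.
move=> mf f0 fb; split; last by rewrite /Ex fb.
apply/Lpow0P/integrableP; split; first exact/measurable_EFinP.
under eq_integral do rewrite /= ger0_norm //.
by rewrite fb ltry.
Qed.

Lemma quadratic_argmin (a b : R) : 0 <= b -> (forall h, 0 <= h * a + h ^+ 2 * b) -> a = 0.
Proof.
move=> b0 hab; apply/eqP/negP => /negP a0.
have a2 : 0 < a ^+ 2 by rewrite exprn_even_gt0.
have c0 : 0 < b + 1 by rewrite ltr_wpDl.
(* Close to the minimizer of the quadratic, with [b + 1] in the denominator to include [b = 0]. *)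
have := hab (- a / (b + 1)); apply/negP; rewrite -ltNge.
have -> : - a / (b + 1) * a + (- a / (b + 1)) ^+ 2 * b = - (a ^+ 2 / (b + 1) ^+ 2).
  by field; rewrite gt_eqF.
by rewrite oppr_lt0 divr_gt0 // exprn_gt0.
Qed.

(* the mean is read off [1 + h X <= exp (h X)], and the variance off
   [1 + h X^2 <= exp (h X^2)], for small h of both signs *)
Lemma centered_normal_law X : Lpow P 1 X -> Ex P X = 0 -> normally_distributed P X ->
  has_law X 0 (Num.sqrt (Ex P (fun w => X w ^+ 2))).
Proof.
move=> LX EX [m [s [s0 hX]]].
have mX := Lpow_meas LX; have L0 : Lpow P 0 X := LpowW LX.
have L2 : Lpow P 0 (fun w => X w ^+ 2) by exact: Lpow_sqr.
have m0 : m = 0.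
  apply: (@quadratic_argmin m (s ^+ 2 / 2)) => [|h]; first by rewrite divr_ge0 ?sqr_ge0.
  have [||LE EE] := @Lpow0_of_integral (fun w => expR (h * X w)) _ _ _ (has_law_mgf h mX hX s0).
  - by apply: measurableT_comp => //; exact: measurable_funM.
  - by move=> w; exact: expR_ge0.
  have : Ex P (fun w => 1 + h * X w) <= Ex P (fun w => expR (h * X w)).
    apply: Ex_le => //; first by apply: LpowD; [exact: Lpow_cst|exact: LpowZ].
    by move=> w; exact: expR_ge1Dx.
  rewrite EE ExD ?ExZ ?Ex_cst ?EX; [|by []|exact: Lpow_cst|exact: LpowZ].
  by rewrite mulr0 addr0 -expR0 ler_expR mulrA.
rewrite m0 in hX; set q := Ex P _.
have q0 : 0 <= q by exact: Ex_sqr_ge0.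
suff -> : q = s ^+ 2 by rewrite sqrtr_sqr ger0_norm.
have key h : 2 * h * s ^+ 2 < 1 -> 0 <= 1 + h * q -> (1 + h * q) ^+ 2 * (1 - 2 * h * s ^+ 2) <= 1.
  move=> hs hq.
  have r0 : 0 < 1 - 2 * h * s ^+ 2 by rewrite subr_gt0.
  have [||LE EE] := @Lpow0_of_integral (fun w => expR (h * X w ^+ 2)) _ _ _ (has_law_sqr_mgf mX hX s0 hs).
  - by apply: measurableT_comp => //; apply: measurable_funM => //; exact: measurable_funX.
  - by move=> w; exact: expR_ge0.
  have : Ex P (fun w => 1 + h * X w ^+ 2) <= Ex P (fun w => expR (h * X w ^+ 2)).
    apply: Ex_le => //; first by apply: LpowD; [exact: Lpow_cst|exact: LpowZ].
    by move=> w; exact: expR_ge1Dx.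
  rewrite EE ExD ?ExZ ?Ex_cst; [|by []|exact: Lpow_cst|exact: LpowZ].
  rewrite -/q => le1.
  have {le1} : (1 + h * q) ^+ 2 <= (Num.sqrt (1 - 2 * h * s ^+ 2))^-1 ^+ 2.
    by apply: lerXn2r; rewrite ?nnegrE ?invr_ge0.
  rewrite exprVn sqr_sqrtr ?(ltW r0) // => le2.
  by rewrite -[leRHS](mulVf (lt0r_neq0 r0)) ler_pM2r.
have s20 : 0 <= s ^+ 2 by rewrite sqr_ge0.
move: (s ^+ 2) s20 key => z z0 key.
apply/eqP; rewrite -subr_eq0; apply/negP => /negP ne.
pose a := q - z; pose u := 1 + q + z.
have u1 : 1 <= u by rewrite /u -addrA lerDl addr_ge0.
have u0 : 0 <= u := le_trans ler01 u1.
have qu : q <= u by rewrite /u; lra.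
have zu : z <= u by rewrite /u; lra.
have au : `|a| <= u by rewrite ler_norml; apply/andP; split; rewrite /u /a; lra.
have u4 : 0 < 4 * u ^+ 4 by rewrite mulr_gt0 // exprn_gt0 // (lt_le_trans ltr01).
(* At [h = a * dl], the first-order part of [(1 + h * q) ^ 2 * (1 - 2 * h * z) - 1] is
   [2 * a ^ 2 * dl]. As [u] dominates 1, [q], [z] and [|a|], this [dl] keeps the higher-order terms
   too small to cancel it, against [key]. *)
pose dl := (4 * u ^+ 4)^-1.
have dl0 : 0 < dl by rewrite invr_gt0.
have dlu : dl * u ^+ 4 = 1 / 4 by rewrite /dl; field; rewrite gt_eqF // (lt_le_trans ltr01).
have uX k : (k <= 4)%N -> u ^+ k <= u ^+ 4 by move=> k4; rewrite ler_weXn2l.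
have small x k : (k <= 4)%N -> x <= u ^+ k -> dl * x <= 1 / 4.
  by move=> k4 xk; rewrite -dlu ler_wpM2l ?(ltW dl0) // (le_trans xk) // uX.
have qz : dl * (q * z) <= 1 / 4 by apply: (small _ 2) => //; rewrite expr2 ler_pM.
have az : dl * (`|a| * z) <= 1 / 4 by apply: (small _ 2) => //; rewrite expr2 ler_pM.
have aq : dl * (`|a| * q) <= 1 / 4 by apply: (small _ 2) => //; rewrite expr2 ler_pM.
have aqqz : dl * (`|a| * (q * (q * z))) <= 1 / 4.
  by apply: (small _ 4) => //; rewrite !exprS expr0 mulr1 !ler_pM ?mulr_ge0.
have dl14 : dl <= 1 / 4 by rewrite -[dl]mulr1; apply: (small _ 0).
have sgn x : 0 <= x -> dl * (a * x) <= dl * (`|a| * x) /\ - (dl * (`|a| * x)) <= dl * (a * x).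
  move=> x0; rewrite -mulrN !ler_pM2l // -mulNr; split; apply: ler_wpM2r => //.
    exact: ler_norm.
  by rewrite lerNl; apply: le_trans (ler_norm _) _; rewrite normrN.
have [az1 _] := sgn z z0; have [_ aq1] := sgn q q0.
have [b1 _] := sgn _ (mulr_ge0 q0 (mulr_ge0 q0 z0)).
have h1 : 2 * (a * dl) * z < 1.
  have -> : 2 * (a * dl) * z = 2 * (dl * (a * z)) by ring.
  lra.
have h2 : 0 <= 1 + a * dl * q.
  have -> : a * dl * q = dl * (a * q) by ring.
  lra.
have := key (a * dl) h1 h2.
have aa : 0 < a ^+ 2 * dl by rewrite mulr_gt0 // exprn_even_gt0.
have e1 : (1 + a * dl * q) ^+ 2 * (1 - 2 * (a * dl) * z) = 1 + (a * dl * q) ^+ 2 +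
   (a ^+ 2 * dl) * (2 - 4 * (dl * (q * z)) - 2 * (dl * (dl * (a * (q * (q * z)))))).
  by rewrite /a; ring.
rewrite e1; apply/negP; rewrite -ltNge.
have b2 : dl * (dl * (a * (q * (q * z)))) <= 1 / 4 * (1 / 4).
  apply: (@le_trans _ _ (dl * (1 / 4))); last by rewrite ler_wpM2r.
  by rewrite ler_wpM2l ?(ltW dl0) // (le_trans b1).
have f0 : 0 < 2 - 4 * (dl * (q * z)) - 2 * (dl * (dl * (a * (q * (q * z))))) by lra.
by rewrite -addrA ltrDl ltr_wpDl ?sqr_ge0 // mulr_gt0.
Qed.

Section independent_sum.
Variables (G1 G2 : set_system Om).
Hypotheses (G1m : G1 `<=` measurable) (G2m : G2 `<=` measurable).
Hypothesis ind : independent_systems P <<s G1 >> <<s G2 >>.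

(** Decoupling freezes [X] and leaves the law of [Y] translated by it, so the law of the sum is a
    convolution. A zero variance makes one factor a point mass, outside the density formula. *)
Lemma independent_normal_sum X Y (v1 v2 : R) : dep G1 X -> dep G2 Y ->
  0 <= v1 -> 0 <= v2 ->
  has_law X 0 (Num.sqrt v1) -> has_law Y 0 (Num.sqrt v2) ->
  has_law (fun w => X w + Y w) 0 (Num.sqrt (v1 + v2)).
Proof.
move=> dX dY v10 v20 hX hY U mU.
have mX := dep_measurable G1m dX; have mY := dep_measurable G2m dY.
have mXY : measurable_fun setT (fun w => X w + Y w) by exact: measurable_funD.
pose g x := gaussian_probability 0 (Num.sqrt v2) ((fun y : R => y + x)%R @^-1` U).
have mg : measurable_fun setT (g : measurableTypeR R -> \bar R).
  pose A := (fun z : measurableTypeR R * measurableTypeR R => (z.1 + z.2)%R) @^-1` U.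
  have mA : measurable A.
    rewrite -[A]setTI; apply: (_ : measurable_fun setT _) => //; exact: measurable_funD.
  rewrite (_ : g = gaussian_probability 0 (Num.sqrt v2) \o ysection A).
    exact: measurable_fun_ysection.
  by apply/funext => x; rewrite /g /= /ysection; congr (gaussian_probability _ _ _);
     apply/seteqP; split => y /=; rewrite ?inE ?mem_setE.
have step : P ((fun w => X w + Y w) @^-1` U) = (\int[P]_w g (X w))%E.
  transitivity (\int[P]_w (\1_U (X w + Y w))%:E)%E.
    rewrite (_ : (fun w => _) = EFin \o \1_((fun w => X w + Y w) @^-1` U)) //.
    rewrite integral_indic ?setIT // -[X in measurable X]setTI.
    exact: mXY.
  rewrite (@decoupling _ _ _ P _ _ G1m G2m ind (fun z => (\1_U (X z.1 + Y z.2))%:E)).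
  - apply: eq_integral => w1 _ /=.
    rewrite /g gaussian_probabilityE -hY.
      rewrite (_ : (fun w => _) = EFin \o \1_(Y @^-1` ((fun y => y + X w1) @^-1` U))); last first.
        by apply/funext => w2 /=; rewrite !indicE addrC.
      rewrite integral_indic ?setIT // -[X in measurable X]setTI; apply: mY => //.
      rewrite -[X in measurable X]setTI; apply: (_ : measurable_fun setT _) => //.
      exact: measurable_funD.
    rewrite -[X in measurable X]setTI; apply: (_ : measurable_fun setT _) => //.
    exact: measurable_funD.
  - apply/measurable_EFinP; apply: measurableT_comp => //; apply: measurable_funD.
      exact: (measurableT_comp dX measurable_fst).
    exact: (measurableT_comp dY measurable_snd).
  - by move=> z; rewrite lee_fin indicE.
rewrite step (@has_law_integral X 0 (Num.sqrt v1) mX g hX mg) // /g.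
rewrite /gaussian_probability; case: (eqVneq (Num.sqrt v1) 0) => [s10|s1n].
  rewrite integral_dirac // diracT mul1e.
  have /eqP := s10; rewrite sqrtr_eq0 => v11.
  have -> : v1 = 0 by apply/eqP; rewrite eq_le v11.
  rewrite add0r (_ : (fun y : R => y + 0)%R @^-1` U = U); last first.
    by apply/seteqP; split => y /=; rewrite addr0.
  by rewrite -gaussian_probabilityE.
case: (eqVneq (Num.sqrt v2) 0) => [s20|s2n].
  have /eqP := s20; rewrite sqrtr_eq0 => v21.
  have -> : v2 = 0 by apply/eqP; rewrite eq_le v21.
  rewrite addr0 -gaussian_probabilityE /gaussian_probability (negbTE s1n).
  rewrite (_ : (fun x : R => _) = EFin \o \1_U); first by rewrite integral_indic ?setIT.
  apply/funext => x; have E : (0 \in (fun y : R => y + x)%R @^-1` U) = (x \in U).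
    by apply/idP/idP; rewrite !inE /= add0r.
  by rewrite /= indicE -E diracE.
have s10 : 0 < Num.sqrt v1 by rewrite lt0r s1n sqrtr_ge0.
have s20 : 0 < Num.sqrt v2 by rewrite lt0r s2n sqrtr_ge0.
rewrite normal_convolution // !sqr_sqrtr // [v2 + v1]addrC /gaussian.
rewrite gt_eqF // sqrtr_gt0 ltr_wpDr // -sqrtr_gt0 //.
Qed.

End independent_sum.

Lemma mutually_independent_normal_sum (I : eqType) (D : set I) (F : I -> set_system Om)
  (Z : I -> Om -> R) (v : I -> R) (s : seq I) :
  (forall i, D i -> F i `<=` measurable) -> (forall i, D i -> setI_closed (F i)) ->
  (forall i, D i -> F i setT) -> mutually_independent P D F -> uniq s ->
  (forall i, i \in s -> [/\ D i, dep (F i) (Z i), 0 <= v i & has_law (Z i) 0 (Num.sqrt (v i))]) ->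
  has_law (fun w => \sum_(i <- s) Z i w) 0 (Num.sqrt (\sum_(i <- s) v i)).
Proof.
move=> Fm FI FT ind; elim: s => [_ _|i s IH /= /andP[is_ us] h].
  move=> U mU; rewrite big_nil sqrtr0 /gaussian eqxx.
  rewrite (_ : _ @^-1` U = if 0 \in U then setT else set0); last first.
    apply/seteqP; split => w /=; rewrite big_nil; case: ifPn => //; rewrite ?inE ?notin_setE //.
  rewrite /dirac /= indicE; case: ifP => _; first by rewrite probability_setT.
  by rewrite measure0.
have {}IH := IH us (fun j js => h j (@mem_behead _ (i :: s) j js)).
have [Di dZ vi0 hZ] := h i (mem_head _ _).
rewrite big_cons (_ : (fun w => _) = fun w => Z i w + \sum_(j <- s) Z j w); last first.
  by apply/funext => w; rewrite big_cons.
have sD : [set` s] `<=` D by move=> j js; case: (h j (@mem_behead _ (i :: s) j js)).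
have iD : [set i] `<=` D by move=> j ->.
have Gm S : S `<=` D -> \bigcup_(j in S) F j `<=` measurable.
  by move=> SD A [j Sj]; apply: Fm; exact: SD.
have disj : [set i] `&` [set` s] `<=` set0 by move=> j [-> js]; move: is_; rewrite js.
have dZi : dep (\bigcup_(j in [set i]) F j) (Z i).
  by refine (depS _ dZ) => A FA; exists i.
have dZs : dep (\bigcup_(j in [set` s]) F j) (fun w => \sum_(j <- s) Z j w).
  refine (@dep_sum _ _ _ _ _ s xpredT _ _) => j js _.
  have [_ dj _ _] := h j (@mem_behead _ (i :: s) j js).
  by refine (depS _ dj) => A FA; exists j.
have vs0 : 0 <= \sum_(j <- s) v j.
  rewrite big_seq; apply: sumr_ge0 => j js.
  by have [_ _ vj _] := h j (@mem_behead _ (i :: s) j js).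
exact: (@independent_normal_sum _ _ (Gm _ iD) (Gm _ sD)
  (mutually_independent_gen Fm FI FT ind iD sD disj) _ _ _ _ dZi dZs vi0 vs0 hZ IH).
Qed.

End gaussian_laws.

(** For standard deviations [s <= t], [normal_prob_scale_le] on [U] and on its complement gives
    distance at most [1 - s / t]; as the ratio is at most 1, squaring it gives the bound in
    variances. For [a = 0] the right-hand side is 1. *)
Lemma gaussian_dist (R : realType) (a b : R) (U : set (measurableTypeR R)) :
  0 <= a -> 0 < b -> measurable U ->
  (`|gaussian 0 (Num.sqrt a) U - gaussian 0 (Num.sqrt b) U| <= (`|a - b| / b)%:E)%E.
Proof.
move=> a0 b0 mU.
pose p s := fine (gaussian_probability 0 s U).
have pE s : gaussian 0 s U = (p s)%:E.
  by rewrite -gaussian_probabilityE fineK // fin_num_measure.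
have p0 s : 0 <= p s by exact: fine_ge0.
have p1 s : p s <= 1 by rewrite -lee_fin -pE -gaussian_probabilityE; exact: probability_le1.
rewrite !pE -EFinB abse_EFin lee_fin.
have [a00|an0] := eqVneq a 0.
  rewrite a00 sub0r normrN (gtr0_norm b0) divff ?gt_eqF //.
  move: (p0 (Num.sqrt 0)) (p1 (Num.sqrt 0)) (p0 (Num.sqrt b)) (p1 (Num.sqrt b)).
  move: (p (Num.sqrt 0)) (p (Num.sqrt b)) => x y x0 x1 y0 y1.
  by rewrite ler_norml; apply/andP; split; lra.
have {an0} a0' : 0 < a by rewrite lt0r an0.
have main s t : 0 < s -> s <= t -> `|p s - p t| <= 1 - s / t.
  move=> s0 st; have t0 : 0 < t := lt_le_trans s0 st.
  have scale V : measurable V -> s / t * fine (gaussian_probability 0 s V) <= fine (gaussian_probability 0 t V).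
    move=> mV; rewrite -lee_fin EFinM !fineK ?fin_num_measure // !gaussian_probabilityE /gaussian !gt_eqF //.
    exact: normal_prob_scale_le.
  have h1 : s / t * p s <= p t := scale _ mU.
  have cE r : fine (1 - gaussian_probability 0 r U)%E = 1 - p r.
    by rewrite -[gaussian_probability 0 r U]fineK ?fin_num_measure.
  have h2 : s / t * (1 - p s) <= 1 - p t.
    have := scale _ (measurableC mU).
    rewrite (probability_setC (gaussian_probability 0 s) mU) (probability_setC (gaussian_probability 0 t) mU).
    by rewrite (cE s) (cE t).
  have st1 : s / t <= 1 by rewrite ler_pdivrMr // mul1r.
  have ps := p0 s; have ps1 := p1 s.
  move: (s / t) (p s) (p t) st1 ps ps1 h1 h2 => r x y r1 x0 x1 h1 h2.
  have := mulr_ge0 (_ : 0 <= 1 - r) (_ : 0 <= 1 - x); rewrite !subr_ge0 => /(_ r1 x1) q1.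
  have := mulr_ge0 (_ : 0 <= 1 - r) x0; rewrite subr_ge0 => /(_ r1) q2.
  by rewrite ler_norml; apply/andP; split; lra.
have ratio (x y : R) : 0 < x -> x <= y -> 1 - Num.sqrt x / Num.sqrt y <= (y - x) / y.
  move=> x0 xy; have y0 := lt_le_trans x0 xy.
  have sy : 0 < Num.sqrt y by rewrite sqrtr_gt0.
  set r := Num.sqrt x / Num.sqrt y.
  have r0 : 0 <= r by rewrite divr_ge0.
  have r1 : r <= 1 by rewrite ler_pdivrMr // mul1r ler_wsqrtr.
  have -> : (y - x) / y = 1 - r ^+ 2.
    by rewrite expr_div_n !sqr_sqrtr ?ltW // mulrBl divff ?gt_eqF.
  have := mulr_ge0 r0 (_ : 0 <= 1 - r); rewrite subr_ge0 => /(_ r1); lra.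
have sa : 0 < Num.sqrt a by rewrite sqrtr_gt0.
have sb : 0 < Num.sqrt b by rewrite sqrtr_gt0.
have [ab|/ltW ba] := leP a b.
  apply: le_trans (main _ _ sa (ler_wsqrtr ab)) _; have h := ratio _ _ a0' ab; apply: (le_trans h).
  by rewrite ler_pM2r ?invr_gt0 // distrC ler_norm.
rewrite distrC; apply: le_trans (main _ _ sb (ler_wsqrtr ba)) _.
have h := ratio _ _ b0 ba; apply: (le_trans h).
by rewrite ger0_norm ?subr_ge0 // ler_wpM2l ?subr_ge0 // lef_pV2.
Qed.

Section right_continuity.
Context (R : realType).
Lemma prob_itv_right_continuous (p : probability (measurableTypeR R) R) (x e : R) : 0 < e ->
  exists2 dl, 0 < dl & forall y, x <= y -> y < x + dl ->
    `|fine (p `]-oo, y]%classic) - fine (p `]-oo, x]%classic)| < e.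
Proof.
move=> e0.
have mi : measurable_fun setT (id : measurableTypeR R -> R) by [].
have rc := @cdf_right_continuous _ _ R p (mfun_of mi) x.
have /fine_cvg rc' : @cdf _ _ _ p (mfun_of mi) y @[y --> x^'+] -->
    (fine (@cdf _ _ _ p (mfun_of mi) x))%:E.
  by rewrite fineK // fin_num_measure.
move/cvgrPdist_lt : rc' => /(_ e e0) [dl /= dl0 hdl].
exists dl => // y; rewrite le_eqVlt => /predU1P[<- _|xy yd]; first by rewrite subrr normr0.
rewrite distrC; apply: (hdl y) => //=.
by rewrite distrC gtr0_norm ?subr_gt0 // ltrBlDl.
Qed.

End right_continuity.

(** * Conditional law of the bootstrap statistic *)

Lemma null_bigcup_countable d0 (Om : measurableType d0) (R : realType) (P : probability Om R)
  (I : countType) (N : I -> set Om) :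
  (forall i, measurable (N i) /\ P (N i) = 0%E) -> measurable (\bigcup_i N i) ->
  P (\bigcup_i N i) = 0%E.
Proof.
move=> hN mN.
have [|A [mA A0 NA]] := @negligible_bigcup _ _ R P (fun n => if unpickle n is Some q then N q else set0).
  move=> n; case: unpickle => [q|]; last exact: negligible_set0.
  by have [mq q0] := hN q; exact/negligibleP.
apply/eqP; rewrite eq_le measure_ge0 andbT -A0 le_measure ?inE //.
move=> w [q _ Nq]; apply: NA; exists (pickle q) => //.
by rewrite pickleK.
Qed.

Section conditional_law.
Context d0 (Om : measurableType d0) (R : realType) (P : probability Om R).
Variables (G1 G2 : set_system Om).
Hypotheses (G1m : G1 `<=` measurable) (G2m : G2 `<=` measurable).
Hypothesis ind : independent_systems P <<s G1 >> <<s G2 >>.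
Notation T1 := (g_sigma_algebraType G1).
Notation T2 := (g_sigma_algebraType G2).
Variables (L : T1 -> T2 -> R) (v : Om -> R).
Variable kap : Om -> probability (measurableTypeR R) R.
Hypothesis mL : measurable_fun setT (fun z : T1 * T2 => L z.1 z.2).
Hypothesis hlaw : forall w, has_law P (fun w' : Om => L w w') 0 (Num.sqrt (v w)).
Hypothesis hkap : regular_cond_distribution P <<s G1 >> (fun w => L w w) kap.

(** By independence, integrating out the multipliers with the data frozen gives the same integral
    over every event of the data as [kap] does. Two functions measurable for the data with equal
    integrals agree almost surely; the exceptional set depends on [U]. *)
Lemma conditional_normal_law (U : set (measurableTypeR R)) : measurable U ->
  exists2 N, measurable N /\ P N = 0%E &
    forall w, ~ N w -> kap w U = gaussian 0 (Num.sqrt (v w)) U.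
Proof.
move=> mU; have [mk hk] := hkap mU.
pose g (w : T1) := gaussian 0 (Num.sqrt (v w)) U.
pose f (z : T1 * T2) : \bar R := (\1_U (L z.1 z.2))%:E.
have mf : measurable_fun setT f.
  by apply/measurable_EFinP; apply: measurableT_comp.
have f0 z : (0 <= f z)%E by rewrite lee_fin indicE.
pose P1 := law P (measurable_sub_id G1m).
pose P2 := law P (measurable_sub_id G2m).
have mLw w : measurable_fun setT (fun w' : Om => L w w').
  have m1 : measurable_fun setT (fun w' : T2 => (w, w') : T1 * T2).
    by apply: measurable_fun_pair; [exact: measurable_cst|exact: measurable_id].
  exact: (measurableT_comp (measurableT_comp mL m1) (measurable_sub_id G2m)).
have gE w : g w = (\int[P]_w' f (w, w'))%E.
  rewrite /g -hlaw // /f /= (_ : (fun w' => _) = EFin \o \1_((fun w' : Om => L w w') @^-1` U)) //.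
  rewrite integral_indic ?setIT // -[X in measurable X]setTI; exact: mLw.
have gE2 : g = fun w => (\int[P2]_w' f (w, w'))%E.
  apply/funext => w; rewrite gE /P2 integral_law //.
  have m1 : measurable_fun setT (fun w' : T2 => (w, w') : T1 * T2).
    by apply: measurable_fun_pair; [exact: measurable_cst|exact: measurable_id].
  exact: (measurableT_comp mf m1).
have mg : measurable_fun setT g.
  by rewrite gE2; exact: (@measurable_fun_fubini_tonelli_F _ _ _ _ _ P2 f mf f0).
have g0 w : (0 <= g w)%E by rewrite /g -gaussian_probabilityE.
have mk1 : measurable_fun setT ((fun w => kap w U) : T1 -> \bar R).
  by move=> _ V mV; apply: mk; exists V.
have k0 w : (0 <= kap w U)%E by [].
have eqA (A : set Om) : <<s G1 >> A ->
    (\int[P1]_(w in (A : set T1)) kap w U = \int[P1]_(w in (A : set T1)) g w)%E.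
  move=> sA; have mA : measurable A by exact: (sub_gen_measurable G1m).
  have tr (h : T1 -> \bar R) : measurable_fun setT h -> (forall w, 0 <= h w)%E ->
      (\int[P1]_(w in (A : set T1)) h w = \int[P]_(w in A) h w)%E.
    move=> mh h0; rewrite integral_mkcond integral_law; last 2 first.
    - exact/(measurable_restrictT h sA)/measurable_funTS.
    - by move=> w; rewrite patchE; case: ifP.
    by rewrite [RHS]integral_mkcond.
  rewrite !tr // -hk // .
  transitivity (\int[P]_w ((\1_A w)%:E * f (w, w))%E)%E.
    rewrite (_ : (fun w => _) = EFin \o \1_(A `&` (fun w => L w w) @^-1` U)); last first.
      by apply/funext => w /=; rewrite indicI /f /= EFinM.
    rewrite integral_indic ?setIT //; apply: measurableI => //.
    rewrite -[X in measurable X]setTI.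
    have := measurableT_comp mL (measurable_diag G1m G2m); exact.
  rewrite (@decoupling _ _ _ P _ _ G1m G2m ind (fun z => (\1_A z.1)%:E * f z)%E); last 2 first.
  - apply: emeasurable_funM => //; apply/measurable_EFinP.
    exact: (measurableT_comp (measurable_indic (sA : measurable (A : set T1))) measurable_fst).
  - by move=> z; rewrite mule_ge0 // lee_fin indicE.
  rewrite [RHS]integral_mkcond; apply: eq_integral => w _; rewrite patchE.
  rewrite /= indicE; case: ifP => wA.
    by rewrite gE; apply: eq_integral => w' _; rewrite mul1e.
  by rewrite (eq_integral (fun=> 0%E)) ?integral0 // => w' _; rewrite mul0e.
have : ae_eq P1 setT (fun w => kap w U) g.
  apply: integral_ae_eq => //.
    apply/integrableP; split => //.
    apply: (@le_lt_trans _ _ (\int[P1]_w (cst 1%E w))%E).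
      apply: ge0_le_integral => //; first exact: measurableT_comp.
      by move=> w _; rewrite gee0_abs // probability_le1.
    rewrite integral_cst // mul1e.
    by apply: le_lt_trans (probability_le1 P1 measurableT) _; rewrite ltry.
  by move=> A _ mA; exact: eqA.
move=> [N [mN N0 hN]]; exists N.
  by split; [exact: (sub_gen_measurable G1m)|exact: N0].
by move=> w nN; apply: contrapT => ne; apply: nN; apply: hN => /= /(_ I).
Qed.

Definition kolmogorov (b : R) (w : Om) : \bar R :=
  ereal_sup (range (fun x : R =>
    `| kap w `]-oo, x]%classic - gaussian 0 (Num.sqrt b) `]-oo, x]%classic |%E)).

(** By right continuity of both distribution functions, the supremum exceeds [eta] only if some
    rational point does. Countably many exceptional sets are then enough, and off their union
    [gaussian_dist] applies. *)
Lemma kolmogorov_prob (b eta : R) : 0 < b -> (forall w, 0 <= v w) -> measurable_fun setT v ->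
  (P [set w | (eta%:E < `|kolmogorov b w|)%E] <= P [set w | (eta * b < `|v w - b|)%R])%E.
Proof.
move=> b0 v0 mv.
pose G x := fine (gaussian_probability 0 (Num.sqrt b) `]-oo, x]%classic).
pose Fk w x := fine (kap w `]-oo, x]%classic).
have dE w x : `| kap w `]-oo, x]%classic - gaussian 0 (Num.sqrt b) `]-oo, x]%classic |%E =
    `|Fk w x - G x|%:E.
  rewrite -gaussian_probabilityE -abse_EFin EFinB /Fk /G !fineK //; exact: fin_num_measure.
pose S (q : rat) := [set w | eta < `|Fk w (ratr q) - G (ratr q)|].
have kol0 w : (0 <= kolmogorov b w)%E.
  apply: (@le_trans _ _ `|Fk w 0 - G 0|%:E); first by rewrite lee_fin.
  by apply: ereal_sup_ubound; exists 0.
have SE : [set w | (eta%:E < `|kolmogorov b w|)%E] = \bigcup_q S q.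
  apply/seteqP; split => w /=; last first.
    move=> [q _ /= h]; rewrite gee0_abs //.
    apply: (@lt_le_trans _ _ `|Fk w (ratr q) - G (ratr q)|%:E); first by rewrite lte_fin.
    by apply: ereal_sup_ubound; exists (ratr q).
  rewrite gee0_abs // => /ereal_sup_gt[_ [x _ <-]]; rewrite dE lte_fin => h.
  have e0 : 0 < (`|Fk w x - G x| - eta) / 2 by rewrite divr_gt0 // subr_gt0.
  have [d1 d10 h1] := prob_itv_right_continuous (kap w) x e0.
  have [d2 d20 h2] := prob_itv_right_continuous (gaussian_probability 0 (Num.sqrt b)) x e0.
  have /rat_in_itvoo[q] : x < x + Num.min d1 d2 by rewrite ltrDl lt_min d10.
  rewrite in_itv /= => /andP[xq qx]; exists q => //=.
  have q1 : ratr q < x + d1 by apply: (lt_le_trans qx); rewrite lerD2l ge_min lexx.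
  have q2 : ratr q < x + d2 by apply: (lt_le_trans qx); rewrite lerD2l ge_min lexx orbT.
  rewrite /S /=; have := h1 _ (ltW xq) q1; have := h2 _ (ltW xq) q2.
  rewrite -/(Fk w x) -/(Fk w (ratr q)) -/(G x) -/(G (ratr q)).
  move: (Fk w x) (Fk w (ratr q)) (G x) (G (ratr q)) h e0 => a a' c c' h e0 k2 k1.
  have t : `|a - c| <= `|a' - a| + `|c' - c| + `|a' - c'|.
    have -> : a - c = (a - a') + ((c' - c) + (a' - c')) by ring.
    apply: le_trans (ler_normD _ _) _; rewrite distrC -[leRHS]addrA lerD2l.
    exact: ler_normD.
  by lra.
have mF (q : rat) : measurable_fun setT (fun w => Fk w (ratr q)).
  apply/measurable_EFinP; rewrite (_ : EFin \o _ = fun w => kap w `]-oo, ratr q]%classic); last first.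
    by apply/funext => w /=; rewrite fineK // fin_num_measure.
  move=> _ V mV; rewrite setTI.
  have [mk _] := hkap (measurable_itv `]-oo, ratr q]).
  by apply: (sub_gen_measurable G1m); apply: mk; exists V; rewrite ?setTI.
have mgt (h : Om -> R) r : measurable_fun setT h -> measurable [set w | r < `|h w|].
  move=> mh; rewrite (_ : mkset _ = (fun w => `|h w|) @^-1` `]r, +oo[%classic); last first.
    by apply/seteqP; split=> w /=; rewrite in_itv /= andbT.
  rewrite -[X in measurable X]setTI.
  by have := measurableT_comp (@normr_measurable R setT) mh; apply.
have mS q : measurable (S q) by apply: mgt; exact: measurable_funB.
have mE : measurable [set w | eta * b < `|v w - b|] by apply: mgt; exact: measurable_funB.
have mT : measurable (\bigcup_q S q) by exact: bigcupT_measurable_rat.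
rewrite SE; set E := mkset _ in mE *.
have hN q := conditional_normal_law (measurable_itv `]-oo, (ratr q : R)]).
have [N hN'] := choice (fun q => let: ex_intro2 N h1 h2 := hN q in ex_intro _ N (conj h1 h2)).
pose NN := \bigcup_q N q.
have mNN : measurable NN by apply: bigcupT_measurable_rat => q; case: (hN' q) => -[].
have NN0 : P NN = 0%E by apply: null_bigcup_countable => // q; case: (hN' q).
apply: (@le_trans _ _ (P (E `|` NN))).
  apply: le_measure; rewrite ?inE //; first exact: measurableU.
  move=> w [q _ Sq]; have [wN|wN] := pselect (NN w); [by right|left].
  have nN : ~ N q w by move=> Nq; apply: wN; exists q.
  have [_ /(_ w nN) kE] := hN' q.
  have := gaussian_dist (v0 w) b0 (measurable_itv `]-oo, (ratr q : R)]).
  rewrite -kE dE lee_fin => hd.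
  by rewrite /E /= -ltr_pdivlMr // (lt_le_trans Sq).
apply: (@le_trans _ _ (P E + P NN)%E); first exact: measureU2.
by rewrite NN0 adde0.
Qed.

End conditional_law.

(** * Kernel weights and pair sums *)

Section kernel_facts.
Context (R : realType) (Ker : R -> R).
Hypothesis hK : kernel_function Ker.
Notation mu := (@lebesgue_measure R).

Lemma kernel_le1 x : Ker x <= 1.
Proof.
have h y : 0 <= y -> Ker y <= 1 by move=> y0; rewrite -(ker0 hK); exact: (ker_decr hK (lexx 0) y0).
have [x0|x0] := leP 0 x; first exact: h.
by rewrite -(ker_sym hK) h // oppr_ge0 ltW.
Qed.

Lemma kernel_continuous : continuous Ker.
Proof. by move=> x; apply/differentiable_continuous/derivable1_diffP; exact: (@ker_derivable _ _ hK). Qed.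

(** Near 0 the derivative provides the slope; at distance [dl] or more, [1 - Ker x] is at most 1,
    hence at most [|x| / dl]. *)
Lemma kernel_lipschitz0 : exists2 C, 0 <= C & forall x, 1 - Ker x <= C * `|x|.
Proof.
have /cvg_ex[l hl] : derivable Ker 0 1 by exact: (@ker_derivable _ _ hK).
have : \forall h \near 0^', `|l - h^-1 *: (Ker (h + 0) - Ker 0)| < 1.
  move/cvgrPdist_lt : hl => /(_ 1 ltr01); apply: filterS => h.
  by rewrite [h *: 1]mulr1.
move=> [dl /= dl0 hdl].
have l0 : 0 <= `|l| + 1 by rewrite addr_ge0.
have d1 : 0 <= dl^-1 by rewrite invr_ge0 ltW.
exists (`|l| + 1 + dl^-1); first exact: addr_ge0.
move=> x; have [->|x0] := eqVneq x 0; first by rewrite (ker0 hK) subrr normr0 mulr0.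
have ax : 0 < `|x| by rewrite normr_gt0.
rewrite mulrDl; have [xd|dx] := ltP `|x| dl.
  have := hdl x; rewrite /= sub0r normrN => /(_ xd x0); rewrite addr0 (ker0 hK).
  move=> h; apply: ler_wpDr; first by rewrite mulr_ge0.
  have e1 : 1 - Ker x = - (x^-1 * (Ker x - 1)) * x by field.
  rewrite e1; apply: le_trans (ler_norm _) _; rewrite normrM ler_wpM2r // normrN.
  have -> : x^-1 * (Ker x - 1) = l - (l - x^-1 * (Ker x - 1)) by ring.
  by apply: le_trans (ler_normB _ _) _; rewrite lerD2l ltW.
apply: ler_wpDl; first by rewrite mulr_ge0.
apply: (@le_trans _ _ 1); first by rewrite gerBl; exact: (ker_ge0 hK).
by rewrite -(mulVf (lt0r_neq0 dl0)) ler_wpM2l.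
Qed.

Definition kernel_mass : R := fine (\int[mu]_x (Ker x)%:E).

Lemma kernel_mass_ge0 : 0 <= kernel_mass.
Proof. by apply/fine_ge0/integral_ge0 => x _; rewrite lee_fin; exact: (ker_ge0 hK). Qed.

(** A Riemann sum at right end points, below the integral because [Ker] decreases on the positive
    half-line. *)
Lemma kernel_half_sum (H : R) (n : nat) : 0 < H ->
  \sum_(0 <= j < n) Ker (j.+1%:R / H) <= H * kernel_mass.
Proof.
move=> H0.
have mK : measurable_fun setT Ker by exact: continuous_measurable_fun kernel_continuous.
have K0 x : (0 <= (Ker x)%:E)%E by rewrite lee_fin; exact: (ker_ge0 hK).
have mKE D : measurable_fun D (fun x => (Ker x)%:E).
  by apply: measurable_funTS; exact/measurable_EFinP.
have step m : ((H^-1 * \sum_(0 <= j < m) Ker (j.+1%:R / H))%:E <=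
    \int[mu]_(x in `]0%R, (m%:R / H)%R]) (Ker x)%:E)%E.
  elim: m => [|m IH].
    by rewrite big_geq // mulr0 mul0r set_itv_ge ?bnd_simp ?integral_set0.
  have le1 : m%:R / H <= m.+1%:R / H by rewrite ler_pM2r ?invr_gt0 // ler_nat.
  have m0 : 0 <= m%:R / H by rewrite divr_ge0 // ltW.
  have U : `]0, (m.+1%:R / H)]%classic =
      `]0, (m%:R / H)]%classic `|` `](m%:R / H), (m.+1%:R / H)]%classic.
    apply/seteqP; split => x /=; rewrite !in_itv /=.
      by case/andP => x0 xm; have [h|h] := leP x (m%:R / H); [left|right]; rewrite ?x0 ?h.
    case=> /andP[h1 h2]; first by rewrite h1 (le_trans h2).
    by rewrite h2 (le_lt_trans m0).
  rewrite U ge0_integral_setU //; [|exact: mKE|]; last first.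
    apply/disj_setPS => x [] /=; rewrite !in_itv /= => /andP[_ h1] /andP[h2 _].
    by move: (lt_le_trans h2 h1); rewrite ltxx.
  rewrite big_nat_recr //= mulrDr EFinD; apply: leeD; first exact: IH.
  apply: (@le_trans _ _ (\int[mu]_(x in `](m%:R / H)%R, (m.+1%:R / H)%R]) (Ker (m.+1%:R / H)%R)%:E)%E); last first.
    apply: ge0_le_integral => //=; first exact: mKE.
    move=> x; rewrite in_itv /= => /andP[h1 h2]; rewrite lee_fin.
    by apply: (ker_decr hK _ h2); exact: le_trans (ltW h1).
  rewrite integral_cst //= lebesgue_measure_itv /= lte_fin ltr_pM2r ?invr_gt0 // ltr_nat leqnn.
  by rewrite -EFinB -EFinM lee_fin -mulrBl -natr1 addrAC subrr add0r mul1r mulrC.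
have big : ((H^-1 * \sum_(0 <= j < n) Ker (j.+1%:R / H))%:E <= \int[mu]_x (Ker x)%:E)%E.
  by apply: le_trans (step n) _; apply: ge0_subset_integral => //; exact: mKE.
have fin : (\int[mu]_x (Ker x)%:E)%E \is a fin_num.
  by rewrite ge0_fin_numE ?integral_ge0 //; exact: (ker_int hK).
by move: big; rewrite -(fineK fin) lee_fin -/kernel_mass mulrC ler_pdivrMr // mulrC.
Qed.

Definition kernel_weight (H : R) (t s : nat) : R := Ker ((t%:R - s%:R) / H).

Lemma kernel_weightC H t s : kernel_weight H t s = kernel_weight H s t.
Proof. by rewrite /kernel_weight -(ker_sym hK) -mulNr opprB. Qed.

Lemma kernel_weight01 H t s : 0 <= kernel_weight H t s <= 1.
Proof. by rewrite /kernel_weight kernel_le1 andbT; exact: (ker_ge0 hK). Qed.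

(** The 1 is the diagonal term; each side of [t] is bounded by the mass of the whole line. *)
Lemma kernel_weight_sum (H : R) (m n t : nat) : 0 < H ->
  \sum_(m <= s < n) kernel_weight H t s <= 1 + 2 * (H * kernel_mass).
Proof.
move=> H0.
have K0 x : 0 <= Ker x by exact: (ker_ge0 hK).
apply: (@le_trans _ _ (\sum_(0 <= s < t + n.+1) kernel_weight H t s)).
  have [mn|nm] := leqP m n; last by rewrite big_geq ?sumr_ge0 // 1?ltnW // => i _; exact: K0.
  rewrite [leRHS](big_cat_nat (n := m)) //=; last by lia.
  rewrite ler_wpDl ?sumr_ge0 // => [i _|]; first exact: K0.
  rewrite [leRHS](big_cat_nat (n := n)) //=; last by lia.
  by rewrite ler_wpDr ?sumr_ge0 // => i _; exact: K0.
rewrite (big_cat_nat (n := t)) //=; last by lia.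
rewrite addrC big_ltn; last by lia.
rewrite /kernel_weight subrr mul0r (ker0 hK) -addrA lerD2l mulr_natl mulr2n.
apply: lerD.
  apply: le_trans (kernel_half_sum (t + n.+1 - t.+1) H0).
  rewrite (big_addn 0 (t + n.+1) t.+1 xpredT) /=; apply: ler_sum => s _.
  rewrite -(ker_sym hK) -mulNr opprB natrD -addrA -natr1.
  by rewrite (_ : s%:R + (t%:R + 1 - t%:R) = s.+1%:R) //; rewrite -natr1; ring.
apply: le_trans (kernel_half_sum t H0); rewrite big_nat_rev /=.
apply: ler_sum_nat => s /andP[_ st]; rewrite add0n natrB // opprB addrCA subrr addr0.
exact: lexx.
Qed.

End kernel_facts.

Section second_moments.
Context d0 (Om : measurableType d0) (R : realType) (P : probability Om R).
Implicit Types X Y : Om -> R.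

Lemma expectation_Ex X : Ex P X = fine ('E_P[X])%E.
Proof. by rewrite unlock. Qed.

Lemma covariance_Ex X Y : ('E_P[X] = 0)%E -> ('E_P[Y] = 0)%E ->
  covariance P X Y = (\int[P]_w (X w * Y w)%:E)%E.
Proof.
move=> EX EY; rewrite unlock EX EY /= unlock; apply: eq_integral => w _ /=.
by rewrite mulrfctE /= !subr0.
Qed.

Lemma covariance_Lpow X (c : R) : measurable_fun setT X -> ('E_P[X] = 0)%E ->
  covariance P X X = c%:E -> Lpow P 1 X.
Proof.
move=> mX EX; rewrite covariance_Ex // => h.
have [|LX _] := @Lpow_of_integral _ _ _ P 0 X c mX; last by [].
rewrite -h le_eqVlt; apply/orP; left; apply/eqP; apply: eq_integral => w _.
by rewrite expr2.
Qed.

Lemma variance_Ex X : Lpow P 1 X ->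
  ('V_P[X] = (Ex P (fun w => X w ^+ 2) - Ex P X ^+ 2)%:E)%E.
Proof.
move=> LX; have L0 := LpowW LX; have L2 := Lpow_sqr LX.
rewrite /variance unlock -expectation_Ex unlock.
set m := Ex P X.
have LC : Lpow P 0 (fun w => (X w - m) ^+ 2).
  by apply: Lpow_sqr; apply: LpowB => //; exact: Lpow_cst.
transitivity (\int[P]_w ((X w - m) ^+ 2)%:E)%E.
  by apply: eq_integral => w _ /=; rewrite expr2.
rewrite ExE //; congr EFin.
rewrite (_ : Ex P _ = Ex P (fun w => X w ^+ 2 + ((- 2 * m) * X w + m ^+ 2))); last first.
  by apply: eq_Ex => w; ring.
rewrite ExD // ?ExD ?ExZ ?Ex_cst -/m; do ?[exact: Lpow_cst|exact: LpowZ|by []].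
  ring.
by apply: LpowD; [exact: LpowZ|exact: Lpow_cst].
Qed.

Lemma variance_affine X Y (a b : R) : Lpow P 1 X -> (forall w, Y w = a * X w + b) ->
  ('V_P[Y] = (a ^+ 2 * (Ex P (fun w => X w ^+ 2) - Ex P X ^+ 2))%:E)%E.
Proof.
move=> LX YE; have L0 := LpowW LX; have L2 := Lpow_sqr LX.
have LY : Lpow P 1 Y.
  apply: (@Lpow_eq _ _ _ _ _ (fun w => a * X w + b)) => //.
  by apply: LpowD; [exact: LpowZ|exact: Lpow_cst].
have EY : Ex P Y = a * Ex P X + b.
  by rewrite (eq_Ex _ YE) ExD ?ExZ ?Ex_cst //; [exact: LpowZ|exact: Lpow_cst].
rewrite variance_Ex // EY.
rewrite (_ : Ex P _ = Ex P (fun w => a ^+ 2 * X w ^+ 2 + ((2 * a * b) * X w + b ^+ 2))); last first.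
  by apply: eq_Ex => w; rewrite YE; ring.
rewrite ExD ?ExD ?ExZ ?Ex_cst; do ?[exact: Lpow_cst|exact: LpowZ|by []].
  congr EFin; ring.
by apply: LpowD; [exact: LpowZ|exact: Lpow_cst].
Qed.

End second_moments.

Section pair_sums.
Variables (T B B1 : nat).
Hypotheses (B0 : (0 < B)%N).

(** With [0 < B] there is no diagonal, so the pairs split into two mirror halves. In the half
    [s < t], the second index runs over the window of [t], which is empty for [t <= B]. *)
Lemma pair_sum_sym (V : nmodType) (f : nat -> nat -> V) : (forall t s, f t s = f s t) ->
  pair_sum T B B1 f =
  (\sum_(B.+1 <= t < T.+1) \sum_(maxn (t - B1) 1 <= s < (t - B).+1) f t s) *+ 2.
Proof.
move=> fC.
pose c t s := (B <= `|t%:Z - s%:Z| <= B1)%N.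
have cC t s : c t s = c s t by apply/idP/idP; rewrite /c; lia.
have split_ t : \sum_(1 <= s < T.+1 | c t s) f t s =
   \sum_(1 <= s < T.+1 | c t s && (s < t)%N) f t s +
   \sum_(1 <= s < T.+1 | c t s && (t < s)%N) f t s.
  rewrite (bigID (fun s => (s < t)%N)) /=; congr (_ + _).
  apply: eq_bigl => s; rewrite /c; apply/andP/andP => -[h1 h2]; split => //; lia.
have swap : \sum_(1 <= t < T.+1) \sum_(1 <= s < T.+1 | c t s && (t < s)%N) f t s =
    \sum_(1 <= t < T.+1) \sum_(1 <= s < T.+1 | c t s && (s < t)%N) f t s.
  rewrite (eq_bigr (fun t => \sum_(1 <= s < T.+1) if c t s && (t < s)%N then f t s else 0)); last first.
    by move=> t _; rewrite -big_mkcond.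
  rewrite exchange_big /=; apply: eq_bigr => t _; rewrite [RHS]big_mkcond /=.
  by apply: eq_bigr => s _; rewrite cC fC.
rewrite /pair_sum (eq_bigr _ (fun t _ => split_ t)) big_split /= swap -mulr2n; congr (_ *+ 2).
have inner t : \sum_(1 <= s < T.+1 | c t s && (s < t)%N) f t s =
    if (B < t)%N && (t <= T)%N then \sum_(maxn (t - B1) 1 <= s < (t - B).+1) f t s else
    \sum_(1 <= s < T.+1 | c t s && (s < t)%N) f t s.
  case: ifP => // /andP[Bt tT].
  have [le|lt] := leqP (maxn (t - B1) 1) (t - B).+1; last first.
    rewrite [RHS]big_geq ?(ltnW lt) // big_hasC //; apply/hasPn => s; rewrite mem_index_iota /c; lia.
  rewrite [RHS](@big_nat_widenl _ _ _ _ 1) ?leq_maxr // [RHS](@big_nat_widen _ _ _ _ _ T.+1); last by lia.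
  rewrite [LHS]big_nat_cond [RHS]big_nat_cond; apply: eq_bigl => s.
  by rewrite /c; apply/idP/idP => h; lia.
have [BT|TB] := leqP B.+1 T.+1; last first.
  by rewrite [RHS]big_geq ?(ltnW TB) //; apply: big1_seq => t /andP[_]; rewrite mem_index_iota => t1;
    rewrite big_hasC //; apply/hasPn => s; rewrite mem_index_iota /c; lia.
rewrite (@big_cat_nat _ _ _ B.+1) //=.
rewrite big1_seq ?add0r => [|t /andP[_]]; last first.
  rewrite mem_index_iota => t1; rewrite big_hasC //; apply/hasPn => s; rewrite mem_index_iota /c; lia.
rewrite !big_nat; apply: eq_bigr => t /andP[t1 t2].
by rewrite inner t1 -ltnS t2.
Qed.

(** Only the times after [B1] are counted, for which the window has its full size [B1 - B + 1]. *)
Lemma pair_count_ge : (B <= B1)%N -> (B1 <= T)%N ->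
  (2 * ((T - B1) * (B1 - B).+1) <= pair_count T B B1)%N.
Proof.
move=> BB1 B1T; rewrite /pair_count pair_sum_sym //.
set S := (\sum_(_ <= _ < _) _)%R.
suff h : ((T - B1) * (B1 - B).+1 <= S)%N.
  by rewrite [X in (_ <= X)%N](_ : _ = (2 * S)%N) ?leq_mul2l ?h // mulr2n; lia.
rewrite /S (@big_cat_nat _ _ _ B1.+1) //=; try lia.
apply: leq_trans (leq_addl _ _).
apply: (@leq_trans (\sum_(B1.+1 <= t < T.+1) (B1 - B).+1)).
  by rewrite sum_nat_const_nat subSS.
rewrite !big_nat; apply: leq_sum => t /andP[t1 t2].
rewrite sum_nat_const_nat muln1; lia.
Qed.

End pair_sums.

(** * Linear combinations of the multipliers of one series *)

Section multiplier_series.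
Context d0 (Om : measurableType d0) (R : realType) (P : probability Om R).
Variables (Ker : R -> R) (H : R) (n : nat) (xi : nat -> {RV P >-> R}).
Hypothesis xiN : jointly_normal P n (fun t w => xi t w).
Hypothesis xiE : forall t, (1 <= t <= n)%N -> ('E_P[xi t] = 0)%E.
Hypothesis xiC : forall t s, (1 <= t <= n)%N -> (1 <= s <= n)%N ->
  covariance P (xi t) (xi s) = (Ker ((t%:R - s%:R) / H))%:E.
Variables (m : nat) (b : nat -> R).
Hypothesis m0 : (0 < m)%N.

Definition weighted_sum (w : Om) : R := \sum_(m <= t < n.+1) b t * xi t w.

(** Moments are prescribed for times 1 to [n] only; extension by 0 makes every term square
    integrable. *)
Let x t (w : Om) : R := if (1 <= t <= n)%N then xi t w else 0.

Let weightedE w : weighted_sum w = \sum_(m <= t < n.+1) b t * x t w.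
Proof.
rewrite /weighted_sum !big_nat; apply: eq_bigr => t /andP[mt tn].
by rewrite /x (leq_trans m0 mt) -ltnS tn.
Qed.

Let xL t : Lpow P 1 (x t).
Proof.
rewrite /x; case: (boolP (1 <= t <= n)%N) => tn; last exact: Lpow_cst.
by apply: (covariance_Lpow _ (xiE tn) (xiC tn tn)).
Qed.

Let bxL t : Lpow P 1 (fun w => b t * x t w).
Proof. exact: LpowZ. Qed.

Lemma weighted_sum_moments : [/\ Lpow P 1 weighted_sum, Ex P weighted_sum = 0 &
  Ex P (fun w => weighted_sum w ^+ 2) = qform m n.+1 (kernel_weight Ker H) b].
Proof.
have L1 : Lpow P 1 weighted_sum.
  by apply: (@Lpow_eq _ _ _ _ _ (fun w => \sum_(m <= t < n.+1) b t * x t w)) => //; exact: Lpow_sum.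
split => //.
  rewrite (eq_Ex _ weightedE) Ex_sum => [|t _]; last exact: LpowW.
  rewrite big1 // => t _; rewrite ExZ; last exact: LpowW.
  rewrite /x; case: (boolP (1 <= t <= n)%N) => tn; last by rewrite Ex_cst mulr0.
  by rewrite expectation_Ex xiE // mulr0.
rewrite (_ : Ex P _ = Ex P (fun w => (\sum_(m <= t < n.+1) b t * x t w) *
   (\sum_(m <= t < n.+1) b t * x t w))); last first.
  by apply: eq_Ex => w; rewrite weightedE expr2.
rewrite Ex_sqr_sum // /qform !big_nat; apply: eq_bigr => t /andP[mt tn].
rewrite !big_nat; apply: eq_bigr => s /andP[ms sn].
have t1 : (1 <= t <= n)%N by rewrite (leq_trans m0 mt) -ltnS.
have s1 : (1 <= s <= n)%N by rewrite (leq_trans m0 ms) -ltnS.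
rewrite (_ : Ex P _ = Ex P (fun w => (b t * b s) * (x t w * x s w))); last first.
  by apply: eq_Ex => w; ring.
rewrite ExZ; last exact: LpowM.
rewrite mulrC; congr (_ * _).
have := xiC t1 s1; rewrite covariance_Ex ?xiE // /Ex /x t1 s1 => -> //.
Qed.

(** The form is the second moment of a combination of variables whose covariances are the kernel
    weights. *)
Lemma weighted_sum_psd : 0 <= qform m n.+1 (kernel_weight Ker H) b.
Proof. by have [_ _ <-] := weighted_sum_moments; exact: Ex_sqr_ge0. Qed.

Lemma weighted_sum_law :
  has_law P weighted_sum 0 (Num.sqrt (qform m n.+1 (kernel_weight Ker H) b)).
Proof.
have [L1 E0 E2] := weighted_sum_moments; rewrite -E2.
apply: centered_normal_law => //.
have [mn|nm] := leqP m n.+1; last first.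
  have := xiN (fun=> 0); congr (normally_distributed _ _); apply/funext => w.
  by rewrite /weighted_sum [RHS]big_geq ?(ltnW nm) // big1 // => t _; rewrite mul0r.
have := xiN (fun t => if (m <= t)%N then b t else 0); congr (normally_distributed _ _).
apply/funext => w; rewrite (@big_cat_nat _ _ _ m) //= big_nat big1 ?add0r; last first.
  by move=> t /andP[_ tm]; rewrite leqNgt tm mul0r.
by rewrite /weighted_sum !big_nat; apply: eq_bigr => t /andP[-> _].
Qed.

End multiplier_series.

Lemma Ex_markov d0 (Om : measurableType d0) (R : realType) (P : probability Om R)
  (X : Om -> R) (r : R) : 0 < r -> Lpow P 0 X ->
  (P [set w | (r < `|X w|)%R] <= (Ex P (fun w => `|X w|) / r)%:E)%E.
Proof.
move=> r0 LX; have LA := Lpow_norm LX; have mX := Lpow_meas LA.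
set A := mkset _.
have mA : measurable A.
  rewrite (_ : A = (fun w => `|X w|) @^-1` `]r, +oo[%classic); last first.
    by apply/seteqP; split=> w /=; rewrite in_itv /= andbT.
  by rewrite -[X in measurable X]setTI; exact: mX.
have LI : Lpow P 0 (fun w => r * \1_A w).
  apply: LpowZ; apply: (@Lpow_bounded _ _ _ P 0 _ 1) => //.
  by move=> w; rewrite indicE; case: (w \in A); rewrite ?normr1 ?normr0.
have : Ex P (fun w => r * \1_A w) <= Ex P (fun w => `|X w|).
  apply: Ex_le => // w; rewrite indicE; case: (boolP (w \in A)) => [|_]; last by rewrite mulr0.
  by rewrite inE mulr1 => /ltW.
have EI : (\int[P]_w (r * \1_A w)%:E = (r%:E * P A))%E.
  under eq_integral do rewrite EFinM.
  rewrite ge0_integralZl //; last 2 first.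
  - by apply/measurable_EFinP.
  - by rewrite lee_fin ltW.
  by rewrite integral_indic // setIT.
rewrite {1}/Ex EI => h.
have fA : P A \is a fin_num by exact: fin_num_measure.
rewrite -(fineK fA) lee_fin ler_pdivlMr // mulrC.
by move: h; rewrite fineM.
Qed.

(** * A single model *)

Lemma measurable_sum_seq d0 (T : measurableType d0) (R : realType) (I : eqType) (r : seq I)
  (F : I -> T -> R) : (forall i, i \in r -> measurable_fun setT (F i)) ->
  measurable_fun setT (fun x => \sum_(i <- r) F i x).
Proof.
elim: r => [|i r IH] h.
  by rewrite (_ : (fun x => _) = cst 0) //; apply/funext => x; rewrite big_nil.
rewrite (_ : (fun x => _) = fun x => F i x + \sum_(j <- r) F j x); last first.
  by apply/funext => x; rewrite big_cons.
apply: measurable_funD; first by apply: h; rewrite mem_head.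
by apply: IH => j jr; apply: h; rewrite inE jr orbT.
Qed.

Lemma gen_sigma_measurable d0 (Om : measurableType d0) (R : realType) (I : Type) (D : set I)
  (X : I -> Om -> R) : (forall i, D i -> measurable_fun setT (X i)) ->
  gen_sigma D X `<=` measurable.
Proof.
move=> mX; apply: smallest_sub; first exact: sigma_algebra_measurable.
by move=> A [i Di [V mV <-]]; exact: mX.
Qed.

Section single_model.
Context d0 (Om : measurableType d0) (R : realType) (P : probability Om R).
Variables (Ker : R -> R) (H : R) (K : nat) (T : nat -> nat) (d B B1 : nat).
Variables (mu : nat -> 'rV[R]_d) (e : nat -> int -> {RV P >-> R}).
Variables (g : nat -> int -> 'I_d -> (nat -> R) -> R) (xi : nat -> nat -> {RV P >-> R}).
Variables (M alpha C lam del : R) (kap : Om -> probability (measurableTypeR R) R).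

Notation series_ k := (1 <= k <= K)%N.
Notation noise_ k := (process (e k) (g k)).
Notation obs k t w := (mu k + noise_ k t%:Z w).
Notation GD := (\bigcup_(p in [set p : (nat * nat) * 'I_d | series_ p.1.1 /\ (1 <= p.1.2 <= T p.1.1)%N])
   preimage_set_system setT (fun w => obs p.1.1 p.1.2 w 0 p.2) measurable).
Notation GX := (\bigcup_(p in [set p : nat * nat | series_ p.1 /\ (1 <= p.2 <= T p.1)%N])
   preimage_set_system setT (xi p.1 p.2) measurable).
Notation FX k := (gen_sigma (fun t => (1 <= t <= T k)%N) (fun t w => xi k t w)).

Hypotheses (B0 : (0 < B)%N) (BB1 : (B < B1)%N) (K1 : (1 <= K)%N).
Hypothesis T0 : forall k, series_ k -> (0 < T k)%N.
Hypotheses (hK : kernel_function Ker) (H0 : 0 < H).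
Hypothesis ind_data : independent_systems P <<s GD >> <<s GX >>.
Hypothesis xiN : forall k, series_ k -> jointly_normal P (T k) (fun t w => xi k t w).
Hypothesis xiE : forall k t, series_ k -> (1 <= t <= T k)%N -> ('E_P[xi k t] = 0)%E.
Hypothesis xiC : forall k t s, series_ k -> (1 <= t <= T k)%N -> (1 <= s <= T k)%N ->
  covariance P (xi k t) (xi k s) = (Ker ((t%:R - s%:R) / H))%:E.
Hypothesis xiI : mutually_independent P (fun k => is_true (series_ k)) (fun k => FX k).
Hypotheses (M8 : 8 < M) (alpha2 : 2 <= alpha) (C1 : 1 <= C).
Hypothesis eI : mutually_independent P [set p : nat * int | series_ p.1]
  (fun p => preimage_set_system setT (e p.1 p.2) measurable).
Hypothesis gm : forall k t i, series_ k -> measurable_seqfun (g k t i).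
Hypothesis srd : forall k, series_ k ->
  short_range_dependent P (fun t => e k t) (g k) M alpha C.
Hypothesis rho1 : rho alpha C B <= 1.
Hypotheses (lam0 : 0 < lam) (del0 : 0 <= del).
Hypothesis hdel : forall t s, near B t s -> 1 - kernel_weight Ker H t s <= del.
Hypothesis hkap : regular_cond_distribution P <<s GD >>
  (fun w => S_hat K T B B1 (fun k t => obs k t w) (fun k t => xi k t w)) kap.

(** Turns the two parts of [S_hat] into a single sum over all series, the first one carrying
    [K - 1]. *)
Definition series_coef (k : nat) : R := 2 * (if k == 1%N then K%:R - 1 else 1) * scaling R K T d B B1 k.

Let th k t w := theta_hat T B B1 (fun k t => obs k t w) k t.
Let Q k w := qform B.+1 (T k).+1 (kernel_weight Ker H) (fun t => th k t w).
Let v w := \sum_(1 <= k < K.+1) series_coef k ^+ 2 * Q k w.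

Definition series_var k : R := let N := noise_sum (e k) (g k) B B1 (T k) in
  Ex P (fun w => N w ^+ 2) - Ex P N ^+ 2.

(** The unknown mean [mu k] cancels in the empirical centering, so the statistic sees the noise
    only. *)
Lemma theta_hatE k t w : series_ k -> (1 <= t <= T k)%N ->
  th k t w = theta_obs (e k) (g k) B B1 (T k) t w.
Proof.
move=> kK tT.
have T0' : (T k)%:R != 0 :> R by rewrite pnatr_eq0 -lt0n T0.
have muE : mu_hat T (fun k t => obs k t w) k = mu k + vmean (T k) (fun s => noise_ k s%:Z) w.
  rewrite /mu_hat big_split /= sumr_const_nat subn1 /= scalerDr; congr (_ + _).
  by rewrite -[mu k *+ _]scaler_nat scalerA mulVf // scale1r.
have epsE s : eps_hat T (fun k t => obs k t w) k s = centered_eps (e k) (g k) (T k) s w.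
  rewrite /eps_hat muE /centered_eps; apply/rowP => i; rewrite !mxE; ring.
by rewrite /th /theta_hat /theta_obs; apply: eq_bigr => s _; rewrite !epsE.
Qed.

Let th_dep k t : series_ k -> (1 <= t <= T k)%N -> dep GD (th k t).
Proof.
move=> kK tT.
have od s i : (1 <= s <= T k)%N -> dep GD (fun w => obs k s w 0 i).
  move=> sT _ V mV; apply: sub_sigma_algebra; exists ((k, s), i) => //.
  by exists V.
have md i : dep GD (fun w => mu_hat T (fun k t => obs k t w) k 0 i).
  rewrite (_ : (fun w => _) = fun w => (T k)%:R^-1 * \sum_(1 <= s < (T k).+1) obs k s w 0 i); last first.
    by apply/funext => w; rewrite /mu_hat mxE summxE.
  apply: depZ; refine (dep_sum _) => s; rewrite mem_index_iota ltnS => sT _.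
  by refine (od _ _ sT).
have ed s i : (1 <= s <= T k)%N -> dep GD (fun w => eps_hat T (fun k t => obs k t w) k s 0 i).
  move=> sT; rewrite (_ : (fun w => _) = fun w => obs k s w 0 i - mu_hat T (fun k t => obs k t w) k 0 i).
    by apply: depB; [exact: od|exact: md].
  by apply/funext => w; rewrite /eps_hat !mxE.
rewrite /th /theta_hat; refine (dep_sum _) => s; rewrite mem_index_iota => /andP[s1 s2] _.
have sT : (1 <= s <= T k)%N by move: s1; rewrite geq_max; lia.
refine (dep_sum _) => i _ _.
by apply: depM; [exact: ed|exact: ed].
Qed.

Let em k t : measurable_fun setT (e k t). Proof. by []. Qed.

Let noise_Lpow k t i : series_ k -> Lpow P 3 (fun w => noise_ k t w 0 i).
Proof.
move=> kK; exact: (eps_coord_Lpow (em k) (fun t i => @gm k t i kK) M8 C1 (srd kK) t i).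
Qed.

Let GDm : GD `<=` measurable.
Proof.
move=> A [p [kK tT] [V mV <-]].
have mo : measurable_fun setT (fun w => obs p.1.1 p.1.2 w 0 p.2).
  rewrite (_ : (fun w => _) = fun w => mu p.1.1 0 p.2 + noise_ p.1.1 p.1.2%:Z w 0 p.2); last first.
    by apply/funext => w; rewrite mxE.
  by apply: measurable_funD => //; exact: Lpow_meas (noise_Lpow _ _ kK).
exact: mo.
Qed.

Let GXm : GX `<=` measurable.
Proof. by move=> A [p [kK tT] [V mV <-]]; exact: (measurable_funP (xi p.1 p.2)). Qed.

(** Data and multipliers are read at separate points, so that one can be frozen while the other is
    integrated; the statistic is the diagonal. *)
Let L (w w' : Om) : R := \sum_(1 <= k < K.+1)
  series_coef k * \sum_(B.+1 <= t < (T k).+1) th k t w * xi k t w'.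

Lemma S_hatE w : S_hat K T B B1 (fun k t => obs k t w) (fun k t => xi k t w) = L w w.
Proof.
rewrite /S_hat /L (big_ltn (m := 1)) // addrC /series_coef eqxx; congr (_ + _).
  by rewrite !mulrA.
rewrite mulr_sumr !big_nat; apply: eq_bigr => k /andP[k2 _].
by rewrite (gtn_eqF k2) mulr1 !mulrA.
Qed.

Let mL : measurable_fun setT (fun z : g_sigma_algebraType GD * g_sigma_algebraType GX => L z.1 z.2).
Proof.
rewrite /L; apply: measurable_sum_seq => k; rewrite mem_index_iota ltnS => kK.
apply: measurable_funM => //; apply: measurable_sum_seq => t; rewrite mem_index_iota ltnS => /andP[Bt tT].
have tT' : (1 <= t <= T k)%N by rewrite tT andbT; exact: leq_ltn_trans Bt.
apply: measurable_funM.
  exact: (measurableT_comp (th_dep kK tT' : measurable_fun setT (th k t : g_sigma_algebraType GD -> R)) measurable_fst).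
have dx : measurable_fun setT (xi k t : g_sigma_algebraType GX -> R).
  move=> _ V mV; apply: sub_sigma_algebra; exists (k, t) => //; by exists V.
exact: (measurableT_comp dx measurable_snd).
Qed.

Let kappa_ : R := 1 + 2 * (H * kernel_mass Ker).

Let psd k b : series_ k -> 0 <= qform B.+1 (T k).+1 (kernel_weight Ker H) b.
Proof.
move=> kK.
exact: (weighted_sum_psd (fun t => @xiE k t kK) (fun t s => @xiC k t s kK) b (ltn0Sn B)).
Qed.

Let Q0 k w : series_ k -> 0 <= Q k w. Proof. exact: psd. Qed.

Let eik k : series_ k -> mutually_independent P [set: int]
  (fun t => preimage_set_system setT (e k t) measurable).
Proof.
move=> kK s A us hA.
have := eI (s := [seq (k, t) | t <- s]) (A := fun p => A p.2).
rewrite !big_map /=; apply; first by rewrite map_inj_uniq // => x y [].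
by move=> p /mapP[t ts ->]; split => //=; case: (hA t ts).
Qed.

Let QE k w : series_ k ->
  Q k w = qform B.+1 (T k).+1 (kernel_weight Ker H) (fun t => theta_obs (e k) (g k) B B1 (T k) t w).
Proof.
move=> kK; rewrite /Q /qform !big_nat; apply: eq_bigr => t /andP[t1 t2].
rewrite !big_nat; apply: eq_bigr => s /andP[s1 s2].
have tT : (1 <= t <= T k)%N by rewrite (leq_ltn_trans (leq0n _) t1) -ltnS.
have sT : (1 <= s <= T k)%N by rewrite (leq_ltn_trans (leq0n _) s1) -ltnS.
by rewrite (theta_hatE _ kK tT) (theta_hatE _ kK sT).
Qed.

Lemma series_facts k : series_ k -> [/\ Lpow P 0 (Q k),
  Lpow P 1 (noise_sum (e k) (g k) B B1 (T k)) &
  Ex P (fun w => `|Q k w - series_var k|) <= series_err d alpha C B B1 (T k) kappa_ lam del].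
Proof.
move=> kK.
have [LQ [LN EQ]] := series_bound (em k) (eik kK) (fun t i => @gm k t i kK) M8 C1 alpha2
  (srd kK) B0 BB1 (T0 kK) (kernel_weightC hK H) (kernel_weight01 hK H)
  (fun t _ => kernel_weight_sum hK B.+1 (T k).+1 t H0) (fun b => psd b kK) hdel lam0 del0 rho1.
have QE' : Q k = fun w => qform B.+1 (T k).+1 (kernel_weight Ker H)
    (fun t => theta_obs (e k) (g k) B B1 (T k) t w) by apply/funext => w; exact: QE.
by rewrite QE'; split; [exact: LQ|exact: LN|exact: EQ].
Qed.

Definition model_var : R := \sum_(1 <= k < K.+1) series_coef k ^+ 2 * series_var k.

(** By symmetry of the pairs, each pair sum is twice [noise_sum] minus a constant, and constants do
    not affect variances. *)
Lemma var_zetaE : var_zeta P K T B B1 (fun k => noise_ k) = model_var%:E.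
Proof.
have vE k : series_ k -> ('V_P[centered_stat P K T B B1 (fun k => noise_ k) k] =
    ((2 * scaling R K T d B B1 k) ^+ 2 * series_var k)%:E)%E.
  move=> kK; have [_ LN _] := series_facts kK.
  pose m t s := fine ('E_P[fun w' => dotp (noise_ k t%:Z w') (noise_ k s%:Z w')])%E.
  have mC t s : m t s = m s t.
    by rewrite /m; congr (fine ('E_P[_])%E); apply/funext => w; rewrite dotpC.
  apply: (variance_affine (b := - (2 * scaling R K T d B B1 k *
    \sum_(B.+1 <= t < (T k).+1) \sum_(maxn (t - B1) 1 <= s < (t - B).+1) m t s)) LN) => w.
  rewrite /centered_stat pair_sum_sym // => [|t s]; last by rewrite -/(m t s) -/(m s t) mC dotpC.
  rewrite -mulrBr /noise_sum /theta_eps -sumrB -[RHS]mulrA mulrCA mulr_natl; congr (_ * (_ *+ 2)).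
  by apply: eq_bigr => t _; rewrite -sumrB.
rewrite /var_zeta /model_var (big_ltn (m := 1)) // EFinD addeC; congr (_ + _)%E.
  rewrite vE // -EFinM; congr EFin; rewrite /series_coef eqxx; ring.
rewrite -sumEFin !big_nat; apply: eq_bigr => k /andP[k2 kK].
have k1K : series_ k by rewrite (ltnW k2).
by rewrite vE // /series_coef (gtn_eqF k2) mulr1.
Qed.

Let S_law w : has_law P (L w) 0 (Num.sqrt (v w)).
Proof.
pose Z k := weighted_sum (T k) (xi k) B.+1 (fun t => series_coef k * th k t w).
rewrite (_ : L w = fun w' => \sum_(1 <= k < K.+1) Z k w'); last first.
  apply/funext => w'; apply: eq_bigr => k _; rewrite mulr_sumr.
  by apply: eq_bigr => t _; rewrite mulrA.
rewrite (_ : v w = \sum_(1 <= k < K.+1) qform B.+1 (T k).+1 (kernel_weight Ker H)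
   (fun t => series_coef k * th k t w)); last first.
  apply: eq_bigr => k _; rewrite /Q /qform mulr_sumr; apply: eq_bigr => t _.
  by rewrite mulr_sumr; apply: eq_bigr => s _; ring.
have Fm k : series_ k -> FX k `<=` measurable by move=> kK; apply: gen_sigma_measurable.
refine (mutually_independent_normal_sum Fm _ _ xiI (iota_uniq _ _) _).
- move=> k kK A A'.
  exact: (@measurableI _ (g_sigma_algebraType (\bigcup_(t in [set t | (1 <= t <= T k)%N])
     preimage_set_system setT (xi k t) measurable)) A A').
- move=> k kK; exact: (@measurableT _ (g_sigma_algebraType (\bigcup_(t in [set t | (1 <= t <= T k)%N])
     preimage_set_system setT (xi k t) measurable))).
move=> k; rewrite mem_index_iota ltnS => kK; split => //.
- refine (@dep_sum _ _ _ _ _ _ xpredT _ _) => t; rewrite mem_index_iota ltnS => /andP[Bt tT] _.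
  have tT' : (1 <= t <= T k)%N by rewrite tT andbT; exact: leq_ltn_trans Bt.
  refine (depZ _ _) => _ V mV; apply: sub_sigma_algebra; apply: sub_sigma_algebra.
  by exists t => //; exists V.
- exact: psd.
exact: (weighted_sum_law (xiN kK) (fun t => @xiE k t kK) (fun t s => @xiC k t s kK) _ (ltn0Sn B)).
Qed.

(** Markov's inequality for the gap between the conditional variance and [var_zeta], after
    [kolmogorov_prob] has reduced the distance between laws to that gap; [c] bounds [var_zeta] from
    below. *)
Lemma model_bound (eta c : R) : 0 < eta -> 0 < c ->
  (c%:E < var_zeta P K T B B1 (fun k => noise_ k))%E ->
  (P [set w | (eta%:E < `|kolmogorov kap (fine (var_zeta P K T B B1 (fun k => noise_ k))) w|)%E] <=
   ((\sum_(1 <= k < K.+1) series_coef k ^+ 2 *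
     series_err d alpha C B B1 (T k) (1 + 2 * (H * kernel_mass Ker)) lam del) / (eta * c))%:E)%E.
Proof.
rewrite var_zetaE lte_fin /= => eta0 c0 /ltW cv; have b0 := lt_le_trans c0 cv.
have Lv : Lpow P 0 v.
  rewrite (_ : v = fun w => \sum_(k <- index_iota 1 K.+1) if series_ k then series_coef k ^+ 2 * Q k w else 0); last first.
    by apply/funext => w; rewrite /v !big_nat; apply: eq_bigr => k; rewrite ltnS => ->.
  apply: Lpow_sum => k _; case: (boolP (series_ k)) => kK; last exact: Lpow_cst.
  by apply: LpowZ; case: (series_facts kK).
have v0 w : 0 <= v w.
  by rewrite /v big_nat; apply: sumr_ge0 => k; rewrite ltnS => kK; rewrite mulr_ge0 ?sqr_ge0 // Q0.
have hkap' : regular_cond_distribution P <<s GD >> (fun w => L w w) kap.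
  by rewrite (_ : (fun w => L w w) = fun w => S_hat K T B B1 (fun k t => obs k t w) (fun k t => xi k t w)) //;
    apply/funext => w; rewrite S_hatE.
apply: le_trans (kolmogorov_prob GDm GXm ind_data mL S_law hkap' eta b0 v0 (Lpow_meas Lv)) _.
have eb0 : 0 < eta * model_var by rewrite mulr_gt0.
have LB : Lpow P 0 (fun w => v w - model_var) by apply: LpowB => //; exact: Lpow_cst.
apply: le_trans (Ex_markov eb0 LB) _; rewrite lee_fin.
have LK k : series_ k -> Lpow P 0 (fun w => `|Q k w - series_var k|).
  by move=> kK; have [LQ _ _] := series_facts kK; apply: Lpow_norm; apply: LpowB => //; exact: Lpow_cst.
pose D k w := if series_ k then series_coef k ^+ 2 * `|Q k w - series_var k| else 0.
have LD k : Lpow P 0 (D k).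
  by rewrite /D; case: (boolP (series_ k)) => kK; [apply: LpowZ; exact: LK|exact: Lpow_cst].
have S0 : Ex P (fun w => `|v w - model_var|) <= \sum_(1 <= k < K.+1) series_coef k ^+ 2 *
     series_err d alpha C B B1 (T k) (1 + 2 * (H * kernel_mass Ker)) lam del.
  apply: (@le_trans _ _ (Ex P (fun w => \sum_(1 <= k < K.+1) D k w))).
    apply: Ex_le; [exact: Lpow_norm|exact: Lpow_sum|move=> w].
    rewrite /v /model_var -sumrB; apply: le_trans (ler_norm_sum _ _ _) _.
    rewrite !big_nat; apply: ler_sum => k; rewrite ltnS => kK.
    by rewrite /D kK -mulrBr normrM ger0_norm ?sqr_ge0.
  rewrite Ex_sum // !big_nat; apply: ler_sum => k; rewrite ltnS => kK.
  rewrite /D kK ExZ; last exact: LK.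
  by rewrite ler_wpM2l ?sqr_ge0 //; have [] := series_facts kK.
have S1 : 0 <= Ex P (fun w => `|v w - model_var|) by exact: Ex_ge0.
apply: (@le_trans _ _ (Ex P (fun w => `|v w - model_var|) / (eta * c))).
  by rewrite ler_wpM2l // lef_pV2 ?posrE ?mulr_gt0 // ler_pM2l.
by rewrite ler_wpM2r // invr_ge0 mulr_ge0 // ltW.
Qed.

End single_model.

(** * Rates *)

Ltac nonneg := repeat first
  [ exact: ler0n | exact: ler01 | apply: mulr_ge0 | apply: addr_ge0 | apply: exprn_ge0
  | rewrite invr_ge0 | assumption | by apply: ltW ].
Ltac monotone := repeat first
  [ assumption | exact: lexx | (apply: ler_pM; [by nonneg|by nonneg| |]) | apply: lerD
  | (apply: lerXn2r; [by rewrite nnegrE; nonneg|by rewrite nnegrE; nonneg|]) ].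

Section series_error.
Context (R : realType).
Variables (Z x D b H lam rho_ : R).
Hypotheses (Z1 : 1 <= Z) (x1 : 1 <= x) (b1 : 1 <= b) (bD : b <= D) (H1 : 1 <= H) (lam0 : 0 < lam).

(** Here [x], [D], [b] play the roles of [Tmin], [B1], [B]. The summands are those of [series_err]
    divided by [x ^ 2 * D], stripped of constants. *)
Definition error_rate : R :=
  Num.sqrt ((D ^+ 5 + b ^+ 2 * H) / x) + b ^+ 2 / H + lam * b +
  (1 + lam^-1) * (H * D * b ^+ 2 / x + D / x ^+ 2).

Let Z0 : 0 <= Z. Proof. exact: le_trans Z1. Qed.
Let x0 : 0 <= x. Proof. exact: le_trans x1. Qed.
Let b0 : 0 <= b. Proof. exact: le_trans b1. Qed.
Let D1 : 1 <= D. Proof. exact: le_trans bD. Qed.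
Let D0 : 0 <= D. Proof. exact: le_trans D1. Qed.
Let H0 : 0 <= H. Proof. exact: le_trans H1. Qed.
Let xn0 : x != 0. Proof. by rewrite gt_eqF // (lt_le_trans ltr01). Qed.
Let Hn0 : H != 0. Proof. by rewrite gt_eqF // (lt_le_trans ltr01). Qed.

Variables (d B B1 n : nat) (c cw kap del : R).
Hypotheses (Bb : B%:R = b) (B1D : B1%:R = D) (BB1 : (B < B1)%N).
Hypotheses (dx : d%:R <= Z * x) (xn : x <= n%:R) (nx : n%:R <= Z * x).
Hypotheses (c0 : 0 <= c) (cZ : c <= Z) (cw0 : 0 <= cw) (cwZ : cw <= Z).
Hypotheses (kap0 : 0 <= kap) (kapZ : kap <= Z * H) (del0 : 0 <= del) (delZ : del <= Z * b / H).
Hypotheses (rho0 : 0 <= rho_) (rhoZ : rho_ <= Z / x ^+ 2).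

Let N'Z : (n.+1 - B.+1)%:R <= Z * x.
Proof. by rewrite subSS (le_trans _ nx) // ler_nat leq_subr. Qed.

Let m2Z : m2 d B1 c cw <= Z ^+ 3 * (x * D).
Proof.
rewrite /m2 B1D (_ : Z ^+ 3 * (x * D) = Z * (Z * x * (Z * D))); last ring.
by monotone.
Qed.

Let m20 : 0 <= m2 d B1 c cw. Proof. by rewrite /m2; nonneg. Qed.

Let m4Z : m4 d B1 c <= Z ^+ 4 * (x ^+ 2 * D ^+ 4).
Proof.
rewrite /m4 B1D (_ : Z ^+ 4 * (x ^+ 2 * D ^+ 4) = Z * ((Z * x) ^+ 2 * (D ^+ 4 * Z))); last ring.
by monotone.
Qed.

Let m40 : 0 <= m4 d B1 c. Proof. by rewrite /m4; nonneg. Qed.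

(** The near and far parts come with 384 and 32, both rounded up to [400 = 20 ^ 2] so that the
    square root is explicit. *)
Lemma qvar_le : qvar d B B1 c cw B.+1 n.+1 kap <=
  (20 * Z ^+ 4 * (x ^+ 2 * D)) ^+ 2 * ((D ^+ 5 + b ^+ 2 * H) / x).
Proof.
rewrite /qvar !natrM Bb B1D.
apply: (@le_trans _ _ (2 * (2 * (3 * (2 * D)) * ((2 * (2 * D)) ^+ 2 * (Z ^+ 4 * (x ^+ 2 * D ^+ 4))) * (Z * x)) +
  8 * (2 * b * (Z ^+ 3 * (x * D) * (2 * b * (Z ^+ 3 * (x * D)) * (Z * H))) * (Z * x)))).
  by monotone.
have Z58 : Z ^+ 5 <= Z ^+ 8 by rewrite ler_weXn2l.
apply: (@le_trans _ _ (400 * Z ^+ 8 * (x ^+ 3 * D ^+ 7) + 400 * Z ^+ 8 * (x ^+ 3 * D ^+ 2 * (b ^+ 2 * H)))).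
  apply: lerD.
    rewrite (_ : 2 * _ = 384 * Z ^+ 5 * (x ^+ 3 * D ^+ 7)); last by ring.
    by apply: ler_wpM2r; [nonneg|apply: ler_pM; [nonneg|nonneg|rewrite ler_nat|]].
  rewrite (_ : 8 * _ = 32 * Z ^+ 8 * (x ^+ 3 * D ^+ 2 * (b ^+ 2 * H))); last by ring.
  by apply: ler_wpM2r; [nonneg|apply: ler_wpM2r; [nonneg|rewrite ler_nat]].
by rewrite le_eqVlt; apply/orP; left; apply/eqP; field.
Qed.

(** The factor [n ^ -2] cancels [d ^ 2] and [d * n], all of order [x ^ 2], so only powers of [b]
    remain. *)
Lemma vY_le : vY d B n c <= 12 * Z ^+ 4 * b ^+ 2.
Proof.
have n0 : 0 < n%:R :> R by rewrite (lt_le_trans _ xn) // (lt_le_trans ltr01).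
rewrite /vY !natrM Bb.
apply: (@le_trans _ _ (2 * x ^- 2 * ((2 * b) ^+ 2 * ((Z * x) ^+ 2 * Z) + Z * (Z * x * (2 * b * Z * (Z * x)))))).
  have i2 : n%:R ^- 2 <= x ^- 2.
    by rewrite lef_pV2 ?posrE ?exprn_gt0 // ?(lt_le_trans ltr01) //; apply: lerXn2r; rewrite ?nnegrE.
  by monotone.
have -> : 2 * x ^- 2 * ((2 * b) ^+ 2 * ((Z * x) ^+ 2 * Z) + Z * (Z * x * (2 * b * Z * (Z * x)))) =
  8 * (Z ^+ 3 * b ^+ 2) + 4 * (Z ^+ 4 * b) by field.
have e1 : Z ^+ 3 * b ^+ 2 <= Z ^+ 4 * b ^+ 2.
  by apply: ler_wpM2r; [nonneg|rewrite ler_weXn2l].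
have e2 : Z ^+ 4 * b <= Z ^+ 4 * b ^+ 2.
  by apply: ler_wpM2l; [nonneg|rewrite expr2 ler_peMl].
by rewrite -mulrA; lra.
Qed.

Lemma vr_le : vr d c rho_ <= Z ^+ 5 / x ^+ 2.
Proof.
rewrite /vr; apply: (@le_trans _ _ ((Z * x) ^+ 2 * Z * (Z / x ^+ 2) ^+ 2)).
  have : 0 <= Z / x ^+ 2 by nonneg.
  by move: rhoZ => r h; monotone.
by rewrite le_eqVlt; apply/orP; left; apply/eqP; field.
Qed.

Lemma vc_le : vc d B n c rho_ <= 480 * Z ^+ 5 * b ^+ 2.
Proof.
rewrite /vc; have h1 := vr_le; have h2 := vY_le.
have z1 : Z ^+ 5 / x ^+ 2 <= Z ^+ 5 * b ^+ 2.
  rewrite ler_wpM2l //; first by nonneg.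
  apply: (@le_trans _ _ 1); last by rewrite exprn_ege1.
  by rewrite invf_le1 ?exprn_gt0 ?exprn_ege1 // (lt_le_trans ltr01).
have z2 : Z ^+ 4 * b ^+ 2 <= Z ^+ 5 * b ^+ 2.
  by apply: ler_wpM2r; [nonneg|rewrite ler_weXn2l].
rewrite -mulrA; rewrite -mulrA in h2; lra.
Qed.

(** The largest constant, [4320 = 9 * 480], and the largest power, [Z ^ 8], both come from the
    centering term and are used for all terms. *)
Lemma series_err_le (sc : R) : 0 <= sc -> sc <= Z / (x ^+ 2 * D) ->
  sc * (Num.sqrt (qvar d B B1 c cw B.+1 n.+1 kap) +
    (n.+1 - B.+1)%:R * ((2 * B)%:R * (del * m2 d B1 c cw)) +
    2 * (lam * ((n.+1 - B.+1)%:R * ((2 * B)%:R * m2 d B1 c cw))) +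
    (1 + lam^-1) * (kap * ((n.+1 - B.+1)%:R * (B1%:R ^+ 2 * (9 * vc d B n c rho_))) +
      (n.+1 - B.+1)%:R * ((n.+1 - B.+1)%:R * (B1%:R ^+ 2 * (9 * vr d c rho_))))) <=
  4320 * Z ^+ 8 * error_rate.
Proof.
move=> sc0 scZ.
have q0 : 0 <= (D ^+ 5 + b ^+ 2 * H) / x by nonneg.
have t1 : Num.sqrt (qvar d B B1 c cw B.+1 n.+1 kap) <=
    20 * Z ^+ 4 * (x ^+ 2 * D) * Num.sqrt ((D ^+ 5 + b ^+ 2 * H) / x).
  apply: le_trans (ler_wsqrtr qvar_le) _; rewrite sqrtrM ?sqr_ge0 // sqrtr_sqr ger0_norm //.
  by nonneg.
have t2 : (n.+1 - B.+1)%:R * ((2 * B)%:R * (del * m2 d B1 c cw)) <=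
    Z * x * (2 * b * (Z * b / H * (Z ^+ 3 * (x * D)))).
  have h : 0 <= Z * b / H by nonneg.
  by rewrite natrM Bb; monotone.
have t3 : 2 * (lam * ((n.+1 - B.+1)%:R * ((2 * B)%:R * m2 d B1 c cw))) <=
    2 * (lam * (Z * x * (2 * b * (Z ^+ 3 * (x * D))))).
  have h := ltW lam0.
  by rewrite natrM Bb; monotone.
have li0 : 0 <= 1 + lam^-1 by rewrite addr_ge0 // invr_ge0 ltW.
have vr0 : 0 <= vr d c rho_ by rewrite /vr; nonneg.
have vY0 : 0 <= vY d B n c by rewrite /vY; nonneg.
have vc0 : 0 <= vc d B n c rho_.
  by rewrite /vc; apply: addr_ge0; apply: mulr_ge0; [exact: ler0n|exact: vr0|exact: ler0n|exact: vY0].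
have t4 : kap * ((n.+1 - B.+1)%:R * (B1%:R ^+ 2 * (9 * vc d B n c rho_))) <=
    Z * H * (Z * x * (D ^+ 2 * (9 * (480 * Z ^+ 5 * b ^+ 2)))).
  have h := vc_le; by rewrite B1D; monotone.
have t5 : (n.+1 - B.+1)%:R * ((n.+1 - B.+1)%:R * (B1%:R ^+ 2 * (9 * vr d c rho_))) <=
    Z * x * (Z * x * (D ^+ 2 * (9 * (Z ^+ 5 / x ^+ 2)))).
  have h := vr_le; by rewrite B1D; monotone.
have xD0 : 0 < x ^+ 2 * D by rewrite mulr_gt0 ?exprn_gt0 // (lt_le_trans ltr01).
set E := _ + _ + _ + _.
have E0 : 0 <= E.
  by rewrite /E; nonneg.
apply: (@le_trans _ _ (Z / (x ^+ 2 * D) * E)); first by rewrite ler_wpM2r.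
have zz k : (k <= 7)%N -> Z ^+ k.+1 <= Z ^+ 8 by move=> k7; rewrite ler_weXn2l.
rewrite /E /error_rate.
set s := Num.sqrt ((D ^+ 5 + _) / x) in t1 *.
have s0 : 0 <= s by exact: sqrtr_ge0.
apply: (@le_trans _ _ (Z / (x ^+ 2 * D) * (20 * Z ^+ 4 * (x ^+ 2 * D) * s +
   Z * x * (2 * b * (Z * b / H * (Z ^+ 3 * (x * D)))) +
   2 * (lam * (Z * x * (2 * b * (Z ^+ 3 * (x * D))))) +
   (1 + lam^-1) * (Z * H * (Z * x * (D ^+ 2 * (9 * (480 * Z ^+ 5 * b ^+ 2)))) +
     Z * x * (Z * x * (D ^+ 2 * (9 * (Z ^+ 5 / x ^+ 2)))))))).
  rewrite ler_wpM2l ?divr_ge0 ?(ltW xD0) //.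
  apply: lerD; first by apply: lerD => //; apply: lerD.
  by rewrite ler_wpM2l // lerD.
have Dn0 : D != 0 by rewrite gt_eqF // (lt_le_trans ltr01).
rewrite (_ : Z / (x ^+ 2 * D) * _ = 20 * Z ^+ 5 * s + 2 * Z ^+ 6 * (b ^+ 2 / H) +
   4 * Z ^+ 5 * (lam * b) + (1 + lam^-1) * (4320 * Z ^+ 8 * (H * D * b ^+ 2 / x) + 9 * Z ^+ 8 * (D / x ^+ 2))); last first.
  by move: (lam^-1) => li; field; rewrite ?Dn0 ?xn0 ?Hn0.
have k0 a y k : 0 <= a -> a <= 4320 -> 0 <= y -> (k <= 7)%N -> a * Z ^+ k.+1 * y <= 4320 * Z ^+ 8 * y.
  by move=> a0 a5 y0 k7; apply: ler_wpM2r => //; apply: ler_pM => //; [nonneg|exact: zz].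
have y1 : 0 <= H * D * b ^+ 2 / x by nonneg.
have y2 : 0 <= D / x ^+ 2 by nonneg.
apply: (@le_trans _ _ (4320 * Z ^+ 8 * s + 4320 * Z ^+ 8 * (b ^+ 2 / H) + 4320 * Z ^+ 8 * (lam * b) +
  (1 + lam^-1) * (4320 * Z ^+ 8 * (H * D * b ^+ 2 / x) + 4320 * Z ^+ 8 * (D / x ^+ 2)))); last first.
  rewrite le_eqVlt; apply/orP; left; apply/eqP; move: (_ / x) (_ / x ^+ 2) (_ / H) (1 + lam^-1) => u1 u2 u3 li.
  by move: (4320 : R) => c5; ring.
apply: lerD; first apply: lerD; first apply: lerD.
- by apply: (k0 _ _ 4%N); rewrite ?ler_nat.
- by apply: (k0 _ _ 5%N); rewrite ?ler_nat //; nonneg.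
- by apply: (k0 _ _ 4%N); rewrite ?ler_nat //; nonneg.
apply: ler_wpM2l => //; apply: lerD; first exact: lexx.
by apply: (k0 _ _ 7%N); rewrite ?ler_nat.
Qed.

End series_error.

Section power_rates.
Context (R : realType).
Variables (Z x D b H k1 k2 h gam : R).
Hypotheses (Z1 : 1 <= Z) (x1 : 1 <= x) (b0 : 0 <= b) (D0 : 0 <= D) (H1 : 1 <= H).
Hypotheses (bx : b <= Z * x `^ k1) (Dx : D <= Z * x `^ k2) (Hx : H <= Z * x `^ h).
Hypothesis xH : x `^ (1 / 3) <= Z * H.
Hypotheses (k20 : 0 <= k2).
Hypotheses (g1 : 5 * k2 - 1 <= - 2 * gam) (g2 : 2 * k1 + h - 1 <= - 2 * gam).
Hypotheses (g3 : 2 * k1 - 1 / 3 <= - gam) (g4 : k1 - k2 <= - gam).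
Hypotheses (g5 : h + 2 * k2 + 2 * k1 - 1 <= - gam) (g6 : 2 * k2 - 2 <= - gam).

Let x0 : 0 < x. Proof. exact: lt_le_trans ltr01 x1. Qed.
Let Z0 : 0 <= Z. Proof. exact: le_trans ler01 Z1. Qed.
Let H0 : 0 < H. Proof. exact: lt_le_trans ltr01 H1. Qed.

Let pD r s : x `^ r * x `^ s = x `^ (r + s).
Proof. by rewrite -powRD //; apply/implyP => _; rewrite gt_eqF. Qed.

Let pX r n : (x `^ r) ^+ n = x `^ (n%:R * r).
Proof. by rewrite -powR_mulrn ?powR_ge0 // -powRrM mulrC. Qed.

Let pV : x^-1 = x `^ (- 1).
Proof. by rewrite powRN powRr1 // ltW. Qed.

Let ple r s : r <= s -> x `^ r <= x `^ s.
Proof. by move=> rs; exact: ler_powR. Qed.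

Let p0 r : 0 <= x `^ r. Proof. exact: powR_ge0. Qed.

(** The four summands contribute 2, 1, 1 and 4. Each exponent hypothesis is the power of [x] that
    remains in one of them when [lam] is [x ^ (- k2)]. *)
Lemma error_rate_le : error_rate x D b H (x `^ (- k2)) <= 8 * Z ^+ 4 * x `^ (- gam).
Proof.
have H0' := ltW H0.
have ZX k (y : R) : (k < 4)%N -> 0 <= y -> Z ^+ k.+1 * y <= Z ^+ 4 * y.
  by move=> k4 y0; rewrite ler_wpM2r // ler_weXn2l.
have Zg := p0 (- gam).
have t1 : Num.sqrt ((D ^+ 5 + b ^+ 2 * H) / x) <= 2 * (Z ^+ 4 * x `^ (- gam)).
  apply: (@le_trans _ _ (Num.sqrt ((2 * (Z ^+ 3 * x `^ (- gam))) ^+ 2))).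
    apply: ler_wsqrtr; rewrite ler_pdivrMr //.
    apply: (@le_trans _ _ ((Z * x `^ k2) ^+ 5 + (Z * x `^ k1) ^+ 2 * (Z * x `^ h))).
      by monotone.
    have e2 : (2 * (Z ^+ 3 * x `^ (- gam))) ^+ 2 * x = 4 * (Z ^+ 6 * x `^ (1 - 2 * gam)).
      have -> : x `^ (1 - 2 * gam) = x * (x `^ (- gam)) ^+ 2.
        by rewrite pX -[X in _ = X * _](@powRr1 _ x) ?(ltW x0) // pD; congr (_ `^ _); ring.
      by ring.
    have e3 : (Z * x `^ k2) ^+ 5 + (Z * x `^ k1) ^+ 2 * (Z * x `^ h) =
        Z ^+ 5 * x `^ (5 * k2) + Z ^+ 3 * x `^ (2 * k1 + h).
      by rewrite -pD -!pX; ring.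
    rewrite e2 e3.
    have i1 : Z ^+ 5 * x `^ (5 * k2) <= Z ^+ 6 * x `^ (1 - 2 * gam).
      by apply: ler_pM; [nonneg|exact: p0|rewrite ler_weXn2l|apply: ple; move: g1 g2; lra].
    have i2 : Z ^+ 3 * x `^ (2 * k1 + h) <= Z ^+ 6 * x `^ (1 - 2 * gam).
      by apply: ler_pM; [nonneg|exact: p0|rewrite ler_weXn2l|apply: ple; move: g1 g2; lra].
    have i3 : 0 <= Z ^+ 6 * x `^ (1 - 2 * gam) by nonneg.
    lra.
  rewrite sqrtr_sqr ger0_norm; last by nonneg.
  by apply: ler_wpM2l => //; exact: (ZX 2%N _ isT Zg).
have t2 : b ^+ 2 / H <= Z ^+ 4 * x `^ (- gam).
  rewrite ler_pdivrMr //.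
  apply: (@le_trans _ _ ((Z * x `^ k1) ^+ 2)); first by monotone.
  apply: (@le_trans _ _ (Z ^+ 2 * (x `^ (- gam) * x `^ (1 / 3)))).
    rewrite (_ : (Z * _) ^+ 2 = Z ^+ 2 * (x `^ k1) ^+ 2); last by ring.
    by rewrite pX pD ler_wpM2l ?exprn_ge0 //; apply: ple; move: g3 g4; lra.
  apply: (@le_trans _ _ (Z ^+ 2 * (x `^ (- gam) * (Z * H)))); first by monotone.
  rewrite (_ : Z ^+ 2 * _ = Z ^+ 3 * (x `^ (- gam) * H)); last by ring.
  by rewrite -[leRHS]mulrA; apply: (ZX 2%N) => //; nonneg.
have t3 : x `^ (- k2) * b <= Z ^+ 4 * x `^ (- gam).
  apply: (@le_trans _ _ (x `^ (- k2) * (Z * x `^ k1))); first by monotone.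
  rewrite mulrCA pD; apply: (@le_trans _ _ (Z ^+ 1 * x `^ (- gam))); last exact: (ZX 0%N _ isT Zg).
  by rewrite expr1 ler_wpM2l //; apply: ple; move: g3 g4; lra.
have t4 : 1 + (x `^ (- k2))^-1 <= 2 * x `^ k2.
  rewrite powRN invrK mulr_natl mulr2n lerD2r -(powRr0 x); apply: ple; exact: k20.
have li0 : 0 <= 1 + (x `^ (- k2))^-1 by rewrite addr_ge0 // invr_ge0.
have t5 : (1 + (x `^ (- k2))^-1) * (H * D * b ^+ 2 / x + D / x ^+ 2) <= 4 * (Z ^+ 4 * x `^ (- gam)).
  apply: (@le_trans _ _ (2 * x `^ k2 * (Z * x `^ h * (Z * x `^ k2) * (Z * x `^ k1) ^+ 2 * x^-1 + Z * x `^ k2 * (x^-1) ^+ 2))).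
    have xi0 : 0 <= x^-1 by rewrite invr_ge0 ltW.
    by rewrite exprVn -[_ ^- 2]exprVn; monotone.
  have e1 : 2 * x `^ k2 * (Z * x `^ h * (Z * x `^ k2) * (Z * x `^ k1) ^+ 2 * x^-1 + Z * x `^ k2 * (x^-1) ^+ 2) =
     2 * (Z ^+ 4 * x `^ (h + 2 * k2 + 2 * k1 - 1)) + 2 * (Z * x `^ (2 * k2 - 2)).
    have -> : x `^ (h + 2 * k2 + 2 * k1 - 1) = x `^ h * (x `^ k2) ^+ 2 * (x `^ k1) ^+ 2 * x^-1.
      by rewrite !pX pV !pD.
    have -> : x `^ (2 * k2 - 2) = (x `^ k2) ^+ 2 * (x^-1) ^+ 2.
      by rewrite pV !pX !pD; congr (_ `^ _); ring.
    by ring.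
  rewrite e1.
  have i1 : Z ^+ 4 * x `^ (h + 2 * k2 + 2 * k1 - 1) <= Z ^+ 4 * x `^ (- gam).
    by rewrite ler_wpM2l ?exprn_ge0 //; exact: ple.
  have i2 : Z * x `^ (2 * k2 - 2) <= Z ^+ 4 * x `^ (- gam).
    apply: (@le_trans _ _ (Z ^+ 1 * x `^ (- gam))); last exact: (ZX 0%N _ isT Zg).
    by rewrite expr1 ler_wpM2l //; exact: ple.
  lra.
rewrite /error_rate -mulrA; lra.
Qed.

End power_rates.

Lemma Tmin_le (K : nat) (T : nat -> nat) k : (1 <= k <= K)%N -> (Tmin K T <= T k)%N.
Proof.
move=> kK; rewrite /Tmin.
have : k \in index_iota 1 K.+1 by rewrite mem_index_iota ltnS.
elim: (index_iota 1 K.+1) => [//|j s IH]; rewrite big_cons inE => /predU1P[->|ks].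
  exact: geq_minl.
exact: leq_trans (geq_minr _ _) (IH ks).
Qed.

Lemma Tmax_ge (K : nat) (T : nat -> nat) k : (1 <= k <= K)%N -> (T k <= Tmax K T)%N.
Proof.
by move=> kK; rewrite /Tmax (@leq_bigmax_seq _ _ xpredT) // mem_index_iota ltnS.
Qed.

Lemma short_range_dependent_le d0 (Om : measurableType d0) (R : realType) (P : probability Om R)
  d (e : int -> Om -> R) (g : int -> 'I_d -> (nat -> R) -> R) (M alpha C C' : R) : C <= C' ->
  short_range_dependent P e g M alpha C -> short_range_dependent P e g M alpha C'.
Proof.
move=> CC' [h1 h2 h3]; split => //.
  by apply: le_trans h2 _; rewrite lee_fin.
by apply: le_trans h3 _; rewrite lee_fin.
Qed.

(** [2 * B <= B1] makes [B1 - B] at least half of [B1], and [2 * B1 <= Tmin] makes [pair_count] at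
    least [Tmin * (B1 - B)]; the squared coefficient then has order [1 / (Tmin ^ 2 * B1)]. *)
Lemma series_coef_sqr_le (R : realType) (K : nat) (T : nat -> nat) (d B B1 k : nat) (KK Zd : R) :
  (1 <= k <= K)%N -> (0 < B)%N -> (2 * B <= B1)%N -> (2 * B1 <= Tmin K T)%N ->
  K%:R <= KK -> (0 < d)%N -> (Tmin K T)%:R <= Zd * d%:R ->
  series_coef R K T d B B1 k ^+ 2 <=
    8 * KK ^+ 2 * Zd / ((Tmin K T)%:R ^+ 2 * B1%:R).
Proof.
move=> kK B0 BB1 B1T KKK d0 xd.
have BleB1 : (B <= B1)%N by lia.
have TT := Tmin_le T kK.
have V1 := @pair_count_ge (T k) B B1 B0 BleB1 (leq_trans (leq_trans (leq_pmull B1 (isT : 0 < 2)%N) B1T) TT).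
set V := pair_count (T k) B B1 in V1.
set N := Tmin K T in B1T xd TT *.
have B1pos : (0 < B1)%N by lia.
have V2 : (N * (B1 - B) <= V)%N.
  apply: leq_trans V1; rewrite mulnA; apply: leq_mul; lia.
have Npos : (0 < N)%N by lia.
have B1B : (0 < B1 - B)%N by lia.
have x0 : 0 < N%:R :> R by rewrite ltr0n.
have D0 : 0 < B1%:R :> R by rewrite ltr0n.
have d0' : 0 < d%:R :> R by rewrite ltr0n.
have w0 : 0 < (B1 - B)%:R :> R by rewrite ltr0n.
have wD : B1%:R <= 2 * (B1 - B)%:R :> R by rewrite -natrM ler_nat; lia.
have v0 : 0 < V%:R :> R by rewrite ltr0n (leq_trans _ V2) // muln_gt0 Npos.
have V3 : N%:R * (B1 - B)%:R <= V%:R :> R by rewrite -natrM ler_nat.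
have KK0 : 0 <= KK := le_trans (ler0n _ _) KKK.
have Zd0 : 0 <= Zd.
  by rewrite -(pmulr_lge0 _ d0') (le_trans _ xd) // ltW.
have sc : scaling R K T d B B1 k ^+ 2 <= 2 * Zd / (N%:R ^+ 2 * B1%:R).
  have q1 : 0 <= N%:R * (B1 - B)%:R :> R by rewrite mulr_ge0.
  rewrite /scaling -/N -/V -natrB // expr_div_n exprMn (sqr_sqrtr q1) (sqr_sqrtr (ltW d0')).
  rewrite ler_pdivrMr ?mulr_gt0 ?exprn_gt0 //.
  have h1 : (N%:R * (B1 - B)%:R) ^+ 2 <= V%:R ^+ 2 :> R.
    by apply: lerXn2r; rewrite ?nnegrE ?mulr_ge0 // ltW.
  rewrite mulrAC ler_pdivlMr ?mulr_gt0 ?exprn_gt0 //.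
  apply: (@le_trans _ _ (2 * (Zd * d%:R) * ((N%:R * (B1 - B)%:R) ^+ 2))); last first.
    rewrite (_ : 2 * Zd * _ = 2 * (Zd * d%:R) * V%:R ^+ 2); last by ring.
    by rewrite ler_wpM2l // mulr_ge0 // mulr_ge0 // ltW.
  apply: (@le_trans _ _ (2 * N%:R * ((N%:R * (B1 - B)%:R) ^+ 2))); last first.
    by rewrite ler_wpM2r ?exprn_ge0 ?mulr_ge0 ?(ltW x0) ?(ltW w0) // ler_wpM2l.
  rewrite (_ : 2 * N%:R * _ = N%:R * (B1 - B)%:R * (N%:R ^+ 2 * (2 * (B1 - B)%:R))); last by ring.
  rewrite ler_wpM2l ?mulr_ge0 ?(ltW x0) ?(ltW w0) //.
  by rewrite ler_wpM2l ?exprn_ge0 ?(ltW x0).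
rewrite /series_coef exprMn.
have cf : (2 * (if k == 1%N then K%:R - 1 else 1)) ^+ 2 <= 4 * KK ^+ 2.
  rewrite exprMn (_ : 2 ^+ 2 = 4); last by ring.
  apply: ler_wpM2l; first exact: ler0n.
  have K1 : 1 <= K%:R :> R by rewrite ler1n; lia.
  case: ifP => _; apply: lerXn2r; rewrite ?nnegrE ?subr_ge0 //; last exact: le_trans K1 KKK.
  by apply: le_trans KKK; rewrite gerBl.
apply: (@le_trans _ _ (4 * KK ^+ 2 * (2 * Zd / (N%:R ^+ 2 * B1%:R)))).
  by apply: ler_pM => //; exact: sqr_ge0.
by rewrite le_eqVlt; apply/orP; left; apply/eqP; ring.
Qed.

Section large_sample.
Context (R : realType) (N : nat -> nat).
Hypothesis Noo : N n @[n --> \oo] --> \oo.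

Lemma near_powR_ge (a c : R) : 0 < a -> \forall n \near \oo, c <= (N n)%:R `^ a.
Proof.
move=> a0; pose c1 := Num.max c 1.
have c10 : 0 <= c1 by rewrite le_max ler01 orbT.
have := Noo (nbhs_infty_ge (Num.truncn (c1 `^ a^-1)).+1).
move=> [n0 _ h]; exists n0 => // n /= n0n; have {h} := h n n0n => /= h.
have h2 : c1 `^ a^-1 <= (N n)%:R.
  apply: le_trans (ltW (_ : _ < (Num.truncn (c1 `^ a^-1)).+1%:R)) _; last by rewrite ler_nat.
  by apply: truncnS_gt; rewrite ?powR_ge0.
apply: (@le_trans _ _ c1); first by rewrite le_max lexx.
have -> : c1 = (c1 `^ a^-1) `^ a by rewrite -powRrM mulVf ?gt_eqF // powRr1.
by apply: ge0_ler_powR; rewrite ?nnegrE ?powR_ge0 // ltW.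
Qed.

Lemma cvg_powRN (A gam : R) : 0 < gam -> (A * (N n)%:R `^ (- gam)) @[n --> \oo] --> 0.
Proof.
move=> g0; apply/cvgrPdist_lt => eps eps0.
have := near_powR_ge ((`|A| + 1) / eps) g0; apply: filterS => n h.
have p0 : 0 < (N n)%:R `^ gam.
  by apply: lt_le_trans h; rewrite divr_gt0 // ltr_wpDl.
have i0 : 0 <= ((N n)%:R `^ gam)^-1 :> R by rewrite invr_ge0 ltW.
rewrite sub0r normrN normrM powRN (ger0_norm i0) ltr_pdivrMr //.
rewrite ler_pdivrMr // mulrC in h.
by apply: lt_le_trans h; rewrite ltrDl.
Qed.

End large_sample.

(** Serves to absorb the logarithm in the bandwidth [H] into a small power. *)
Lemma ln_le_powR (R : realType) (x dl : R) : 0 < dl -> 0 < x -> ln x <= dl^-1 * x `^ dl.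
Proof.
move=> dl0 x0; rewrite ler_pdivlMl // -ln_powR.
have p0 : 0 < x `^ dl by rewrite powR_gt0.
rewrite -ler_expR lnK ?posrE //; apply: le_trans (expR_ge1Dx _).
by rewrite lerDr.
Qed.

Lemma upper_bound_seq (R : realType) (s : seq R) : exists2 Z, 1 <= Z & forall c, c \in s -> c <= Z.
Proof.
elim: s => [|c s [Z Z1 hZ]]; first by exists 1.
exists (Num.max c Z); first by rewrite le_max Z1 orbT.
by move=> c'; rewrite inE => /predU1P[->|/hZ h]; rewrite le_max ?lexx // h orbT.
Qed.

(** With [B] of order [x ^ k1], the decay has order [x ^ (- k1 * alpha)]; [2 / alpha < kappa1] is
    exactly what makes this at most [x ^ -2]. *)
Lemma decay_le (R : realType) (alpha C CB x k1 : R) (B : nat) : 0 < C -> 0 < CB -> 1 <= x ->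
  x `^ k1 <= CB * B%:R -> 0 <= alpha -> 2 <= k1 * alpha ->
  decay alpha C B <= C * CB `^ alpha / x ^+ 2.
Proof.
move=> C0 CB0 x1 hB a0 ka; have x0 := lt_le_trans ltr01 x1.
have c0 : 0 < CB `^ alpha by rewrite powR_gt0.
have x20 : 0 < x ^+ 2 by rewrite exprn_gt0.
have b0 : 0 < (1 + B%:R) `^ alpha by rewrite powR_gt0 // ltr_wpDr.
rewrite /decay -mulrA ler_pM2l // powRN -[leLHS]mul1r ler_pdivrMr //.
rewrite mulrAC ler_pdivlMr // mul1r.
apply: (@le_trans _ _ ((x `^ k1) `^ alpha)).
  by rewrite -powRrM -powR_mulrn ?(ltW x0) //; exact: ler_powR.
rewrite -powRM ?(ltW CB0) ?addr_ge0 //; apply: ge0_ler_powR; rewrite ?nnegrE ?powR_ge0 //.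
  by rewrite mulr_ge0 ?(ltW CB0) ?addr_ge0.
by apply: (le_trans hB); rewrite ler_pM2l // lerDr.
Qed.

Section coefficient_error.
Context (R : realType) (K : nat) (T : nat -> nat) (d B B1 k : nat).
Variables (Z alpha C H kap k1 k2 h gam : R).
Notation x := ((Tmin K T)%:R : R).
Hypotheses (Z1 : 1 <= Z) (kK : (1 <= k <= K)%N) (B0 : (0 < B)%N) (BB1 : (B < B1)%N).
Hypotheses (x1 : 1 <= x) (dx : d%:R <= Z * x) (Tx : (T k)%:R <= Z * x).
Hypotheses (cA0 : 0 <= cA C) (cAZ : cA C <= Z) (cW0 : 0 <= cW C) (cWZ : cW C <= Z).
Hypotheses (H1 : 1 <= H) (kap0 : 0 <= kap) (kapZ : kap <= Z * H).
Hypotheses (rho0 : 0 <= rho alpha C B) (rhoZ : rho alpha C B <= Z / x ^+ 2).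
Hypothesis scZ : series_coef R K T d B B1 k ^+ 2 <= Z / (x ^+ 2 * B1%:R).
Hypotheses (bx : B%:R <= Z * x `^ k1) (Dx : B1%:R <= Z * x `^ k2) (Hx : H <= Z * x `^ h).
Hypotheses (xH : x `^ (1 / 3) <= Z * H) (k20 : 0 <= k2).
Hypotheses (g1 : 5 * k2 - 1 <= - 2 * gam) (g2 : 2 * k1 + h - 1 <= - 2 * gam).
Hypotheses (g3 : 2 * k1 - 1 / 3 <= - gam) (g4 : k1 - k2 <= - gam).
Hypotheses (g5 : h + 2 * k2 + 2 * k1 - 1 <= - gam) (g6 : 2 * k2 - 2 <= - gam).

Lemma coefficient_error_le :
  series_coef R K T d B B1 k ^+ 2 *
    series_err d alpha C B B1 (T k) kap (x `^ (- k2)) (Z * B%:R / H) <=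
  4320 * Z ^+ 8 * (8 * Z ^+ 4 * x `^ (- gam)).
Proof.
have b1 : 1 <= B%:R :> R by rewrite ler1n.
have bD : B%:R <= B1%:R :> R by rewrite ler_nat ltnW.
have Z0 : 0 <= Z := le_trans ler01 Z1.
have lam0 : 0 < x `^ (- k2) by rewrite powR_gt0 // (lt_le_trans ltr01).
have del0 : 0 <= Z * B%:R / H by rewrite divr_ge0 ?mulr_ge0 // (le_trans ler01).
have xT : x <= (T k)%:R by rewrite ler_nat Tmin_le.
apply: (@le_trans _ _ (4320 * Z ^+ 8 * error_rate x B1%:R B%:R H (x `^ (- k2)))).
  exact: (@series_err_le R Z x B1%:R B%:R H (x `^ (- k2)) (rho alpha C B) Z1 x1 b1 bD H1 lam0
    d B B1 (T k) (cA C) (cW C) kap (Z * B%:R / H) erefl erefl dx xT Tx cA0 cAZ cW0 cWZ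
    kap0 kapZ del0 (lexx _) rho0 rhoZ _ (sqr_ge0 _) scZ).
apply: ler_wpM2l; first by apply: mulr_ge0; [exact: ler0n|exact: exprn_ge0].
exact: (@error_rate_le R Z x B1%:R B%:R H k1 k2 h gam Z1 x1 (ler0n _ _) (ler0n _ _) H1 bx Dx Hx xH k20
  g1 g2 g3 g4 g5 g6).
Qed.

End coefficient_error.

(** The critical exponent is [1 / 3 + 2 * k2 + 2 * k1 - 1], which reaches 0 when both bandwidth
    exponents equal [1 / 6]; [eps] measures the room below that threshold. *)
Lemma rate_exponents (R : realFieldType) (k1 k2 gam eps : R) : eps = 1 / 6 - k2 -> 0 < gam ->
  2 * gam <= k2 - k1 -> 2 * gam <= eps ->
  [/\ 5 * k2 - 1 <= - 2 * gam, 2 * k1 + (1 / 3 + eps) - 1 <= - 2 * gam & 2 * k1 - 1 / 3 <= - gam] /\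
  [/\ k1 - k2 <= - gam, 1 / 3 + eps + 2 * k2 + 2 * k1 - 1 <= - gam & 2 * k2 - 2 <= - gam].
Proof. by move=> -> g0 gk ge; split; split; lra. Qed.

Lemma lt_sixth (R : realFieldType) (k : R) : k < 1 / 6 -> 0 < 1 - k.
Proof. by move=> h; lra. Qed.

Lemma near_dist (R : realType) (b t s : nat) : near b t s -> `|t%:R - s%:R| <= b%:R :> R.
Proof.
case/andP => ts st; rewrite ler_norml lerNl opprB !lerBlDl -!natrD !ler_nat.
by rewrite !(ltnW ts) (ltnW st).
Qed.

Theorem theorem5p2 (R : realType)
  (disp : nat -> measure_display)
  (Om : forall n : nat, measurableType (disp n))
  (P : forall n : nat, probability (Om n) R)
  (K : nat -> nat) (T : nat -> nat -> nat) (d B B1 : nat -> nat)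
  (H : nat -> R) (Ker : R -> R)
  (mu : forall n : nat, nat -> 'rV[R]_(d n))
  (e : forall n : nat, nat -> int -> {RV (P n) >-> R})
  (g : forall n : nat, nat -> int -> 'I_(d n) -> (nat -> R) -> R)
  (xi : forall n : nat, nat -> nat -> {RV (P n) >-> R})
  (M alpha kappa1 kappa2 : R)
  (kappa : forall n : nat, Om n -> probability (measurableTypeR R) R) :
  standing K T B B1 ->
  kernel_function Ker ->
  multipliers K T H mu e g xi Ker ->
  assumption1 K e g M alpha ->
  assumption2 K T mu ->
  assumption3 K T B B1 H alpha kappa1 kappa2 ->
  assumption4 K T B B1 e g ->
  (forall n : nat,
     regular_cond_distribution (P n) (data_sigma K T mu e g n)
       (bootstrap_stat K T B B1 mu e g xi n) (kappa n)) ->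
  littleop1 P (kolmogorov_dist K T B B1 e g kappa).
Proof.
case=> stK stB stT hK [mI mN mE mC mX] [M8 al14 eI gm [Cs hsrd]] [[KK hKK] [cT [CT [cT0 cTC hT]]] [cd [Cd [cd0 cdC hd]]] _].
case=> /andP[ak1 k16] /andP[+ k26] [cB [CB [cB0 cBC hB]]] [cD [CD [cD0 cDC hD]]] [cH [CH [cH0 cHC hH]]].
rewrite gt_max => /andP[k12 _] [c [c0 hc]] hkap eta eta0.
have [CL CL0 hL] := kernel_lipschitz0 hK.
have al0 : 0 < alpha by rewrite (lt_trans _ al14).
have k1a : 2 <= kappa1 * alpha by rewrite ltW // -ltr_pdivrMr.
have k10 : 0 < kappa1 by rewrite (lt_trans _ ak1) // divr_gt0.
pose C := Num.max Cs 1; have C1 : 1 <= C by rewrite le_max lexx orbT.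
have C0 : 0 < C := lt_le_trans ltr01 C1.
(* Also the power spent on the logarithm: [H] is bounded by a multiple of [Tmin ^ (1 / 3 + eps)]. *)
pose eps := 1 / 6 - kappa2; have eps0 : 0 < eps by rewrite /eps subr_gt0.
pose gam := Num.min (kappa2 - kappa1) eps / 2.
have gam0 : 0 < gam by rewrite /gam divr_gt0 // lt_min subr_gt0 k12.
have gk : 2 * gam <= kappa2 - kappa1.
  by rewrite /gam mulrC divfK ?pnatr_eq0 // ge_min lexx.
have ge : 2 * gam <= eps by rewrite /gam mulrC divfK ?pnatr_eq0 // ge_min lexx orbT.
pose mass := kernel_mass Ker; have mass0 : 0 <= mass := kernel_mass_ge0 hK.
have CB0 := lt_le_trans cB0 cBC; have CD0 := lt_le_trans cD0 cDC; have CH0 := lt_le_trans cH0 cHC.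
have Cd0 := lt_le_trans cd0 cdC.
(* One constant above all the others, so that the rate lemmas only track powers of [Z]. *)
have [Z Z1 hZ] := upper_bound_seq [:: cd^-1; CT; cA C; cW C; 1 + 2 * mass; CL; 5 * (C * CB `^ alpha);
  8 * KK ^+ 2 * Cd; cB^-1; cD^-1; cH^-1 * eps^-1; CH].
have {}hZ : [/\ [/\ cd^-1 <= Z, CT <= Z, cA C <= Z & cW C <= Z], [/\ 1 + 2 * mass <= Z, CL <= Z,
   5 * (C * CB `^ alpha) <= Z & 8 * KK ^+ 2 * Cd <= Z] & [/\ cB^-1 <= Z, cD^-1 <= Z,
   cH^-1 * eps^-1 <= Z & CH <= Z]].
  by split; split; apply: hZ; rewrite !inE eqxx ?orbT.
have [[Z1' Z2 Z3 Z4] [Z5 Z6 Z7 Z8] [Z9 Z10 Z11 Z12]] := hZ.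
have Z0 : 0 < Z := lt_le_trans ltr01 Z1.
pose N n := Tmin (K n) (T n).
pose A := KK * (4320 * Z ^+ 8 * (8 * Z ^+ 4)) / (eta * c).
suff bound : \forall n \near \oo, (P n [set w | (eta%:E < `|kolmogorov_dist K T B B1 e g kappa n w|)%E] <=
    (A * (N n)%:R `^ (- gam))%:E)%E.
  have lim0 : (A * (N n)%:R `^ (- gam))%:E @[n --> \oo] --> 0%E.
    apply: cvg_EFin; first by near=> n.
    exact: cvg_powRN stT A gam gam0.
  apply: (squeeze_cvge _ (cvg_cst 0%E) lim0).
  by apply: filterS bound => n h; rewrite measure_ge0.
have k21 : 0 < kappa2 - kappa1 by rewrite subr_gt0.
have k22 := lt_sixth k26.
have t13 : 0 < 1 / 3 :> R by rewrite divr_gt0.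
have big1 := near_powR_ge stT 1 ltr01.
(* Sample sizes from which the asymptotic orders become usable inequalities: [2 * B <= B1], then
   [2 * B1 <= Tmin], then with a logarithm of at least 1 also [1 <= H], and finally [rho <= 1]. *)
have big2 := near_powR_ge stT (2 * CD / cB) k21.
have big3 := near_powR_ge stT (2 / cD) k22.
have big4 := near_powR_ge stT CH t13.
have big5 := near_powR_ge stT Z (ltr0n R 2).
have big6 := near_powR_ge stT (expR 1) ltr01.
near=> n.
have x1 : 1 <= (N n)%:R :> R.
  have : 1 <= (N n)%:R `^ 1 :> R by near: n; exact: big1.
  by rewrite powRr1.
have x0 : 0 < (N n)%:R :> R := lt_le_trans ltr01 x1.
have KKn : (K n)%:R <= KK.
  by apply: le_trans (ler_norm _) _; near: n; exact: hKK.
have /andP[_ Tn] : cT * (N n)%:R <= (Tmax (K n) (T n))%:R <= CT * (N n)%:R by near: n; exact: hT.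
have /andP[d1 d2] : cd * (d n)%:R <= (N n)%:R <= Cd * (d n)%:R by near: n; exact: hd.
have /andP[b1 b2] : cB * (B n)%:R <= (N n)%:R `^ kappa1 <= CB * (B n)%:R by near: n; exact: hB.
have /andP[D1 D2] : cD * (B1 n)%:R <= (N n)%:R `^ kappa2 <= CD * (B1 n)%:R by near: n; exact: hD.
have /andP[h1 h2] : cH * H n <= (N n)%:R `^ (1 / 3) * ln (N n)%:R <= CH * H n by near: n; exact: hH.
have srdn : forall k, is_series K n k -> short_range_dependent (P n) (fun t => e n k t) (g n k) M alpha C.
  move=> k kK; apply: (@short_range_dependent_le _ _ _ _ _ _ _ _ _ Cs); first by rewrite le_max lexx.
  by move: k kK; near: n; exact: hsrd.
have cn : (c%:E < limit_var K T B B1 e g n)%E by near: n; exact: hc.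
have e2 : 2 * CD / cB <= (N n)%:R `^ (kappa2 - kappa1).
  by near: n; exact: big2.
have e3 : 2 / cD <= (N n)%:R `^ (1 - kappa2).
  by near: n; exact: big3.
have e4 : CH <= (N n)%:R `^ (1 / 3) by near: n; exact: big4.
have e5 : Z <= (N n)%:R ^+ 2 by rewrite -powR_mulrn ?(ltW x0) //; near: n; exact: big5.
have e6 : 1 <= ln (N n)%:R :> R.
  have : expR 1 <= (N n)%:R `^ 1 :> R by near: n; exact: big6.
  by rewrite powRr1 // -[X in _ <= X -> _](lnK (_ : (N n)%:R \is Num.pos)) // ler_expR.
have [B0 [BB1 _]] := stB n.
have pD r s : (N n)%:R `^ r * (N n)%:R `^ s = (N n)%:R `^ (r + s) :> R.
  by rewrite -powRD //; apply/implyP => _; rewrite gt_eqF.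
have B2 : (2 * B n <= B1 n)%N.
  rewrite -(ler_nat R) natrM -(ler_pM2l CD0); apply: le_trans D2.
  have -> : kappa2 = (kappa2 - kappa1) + kappa1 by ring.
  rewrite -pD; apply: (@le_trans _ _ (2 * CD / cB * (cB * (B n)%:R))).
    by rewrite le_eqVlt; apply/orP; left; apply/eqP; field; rewrite gt_eqF.
  apply: ler_pM => //; first by rewrite divr_ge0 ?mulr_ge0 // ltW.
  by rewrite mulr_ge0 // ltW.
have B12 : (2 * B1 n <= N n)%N.
  rewrite -(ler_nat R) natrM; have -> : (N n)%:R = (N n)%:R `^ (1 - kappa2) * (N n)%:R `^ kappa2 :> R.
    by rewrite pD subrK powRr1.
  apply: (@le_trans _ _ (2 / cD * (cD * (B1 n)%:R))).
    by rewrite le_eqVlt; apply/orP; left; apply/eqP; field; rewrite gt_eqF.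
  apply: ler_pM => //; first by rewrite divr_ge0 // ltW.
  by rewrite mulr_ge0 // ltW.
have x13 : (N n)%:R `^ (1 / 3) <= CH * H n.
  by apply: le_trans h2; rewrite ler_peMr // powR_ge0.
have H1 : 1 <= H n.
  by rewrite -(ler_pM2l CH0) mulr1; apply: le_trans x13.
have H0 : 0 < H n := lt_le_trans ltr01 H1.
have dpos : (0 < d n)%N.
  rewrite lt0n; apply/negP => /eqP d0; move: d2; rewrite d0 mulr0 leNgt x0 //.
have rhoZ : rho alpha C (B n) <= Z / (N n)%:R ^+ 2.
  apply: (@le_trans _ _ (5 * (C * CB `^ alpha / (N n)%:R ^+ 2))).
    by rewrite /rho ler_wpM2l // (decay_le C0 CB0 x1 b2) // ltW.
  by rewrite mulrA ler_wpM2r // invr_ge0 exprn_ge0 // ltW.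
have x20 : 0 < (N n)%:R ^+ 2 :> R by rewrite exprn_gt0.
have rho0 : 0 <= rho alpha C (B n) by rewrite mulr_ge0 // ltW // decay_gt0.
have rho1 : rho alpha C (B n) <= 1.
  by apply: le_trans rhoZ _; rewrite ler_pdivrMr // mul1r.
(* Small enough for [lam * B] to vanish, as [kappa1 < kappa2], and large enough for [1 / lam] times
   the centering error to vanish, as both exponents are below [1 / 6]. The value of [del] is the
   Lipschitz bound of the kernel at 0 for lags up to [B]. *)
pose lam : R := (N n)%:R `^ (- kappa2); pose del := Z * (B n)%:R / H n.
have lam0 : 0 < lam by rewrite powR_gt0.
have del0 : 0 <= del by rewrite divr_ge0 ?mulr_ge0 // ltW.
have hdel t s : near (B n) t s -> 1 - kernel_weight Ker (H n) t s <= del.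
  move=> ts; apply: le_trans (hL _) _; rewrite normrM normfV (gtr0_norm H0) /del mulrA.
  rewrite ler_wpM2r ?invr_ge0 ?(ltW H0) //; apply: ler_pM => //.
  exact: near_dist.
have kapZ : 1 + 2 * (H n * mass) <= Z * H n.
  apply: (@le_trans _ _ ((1 + 2 * mass) * H n)); last by rewrite ler_wpM2r // ltW.
  have -> : (1 + 2 * mass) * H n = H n + 2 * (H n * mass) by ring.
  by rewrite lerD2r.
have kap0 : 0 <= 1 + 2 * (H n * mass) by rewrite addr_ge0 // !mulr_ge0 // ltW.
have cA0 : 0 <= cA C := le_trans ler01 (cA1 C1).
have cW0 : 0 <= cW C by rewrite /cW mulr_ge0 ?(ltW C0) // mulr_ge0.
have scale (u a y z : R) : 0 < u -> u^-1 <= Z -> 0 <= y -> u * a <= y -> a <= Z * y.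
  move=> u0 uZ y0 uy; apply: (@le_trans _ _ (u^-1 * y)); last by rewrite ler_wpM2r.
  by rewrite ler_pdivlMl.
have dx : (d n)%:R <= Z * (N n)%:R by apply: (scale cd) => //; exact: ltW.
have bx : (B n)%:R <= Z * (N n)%:R `^ kappa1 by apply: (scale cB) => //; exact: powR_ge0.
have Dx : (B1 n)%:R <= Z * (N n)%:R `^ kappa2 by apply: (scale cD) => //; exact: powR_ge0.
have Hx : H n <= Z * (N n)%:R `^ (1 / 3 + eps).
  apply: (@le_trans _ _ (cH^-1 * eps^-1 * (N n)%:R `^ (1 / 3 + eps))); last by rewrite ler_wpM2r ?powR_ge0.
  rewrite -pD -mulrA ler_pdivlMl //; apply: (le_trans h1).
  rewrite [eps^-1 * _]mulrCA ler_wpM2l ?powR_ge0 //.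
  exact: ln_le_powR.
have xH : (N n)%:R `^ (1 / 3) <= Z * H n.
  by apply: (le_trans x13); rewrite ler_wpM2r // ltW.
have k20 : 0 <= kappa2 by rewrite ltW // (lt_trans k10).
have eE : eps = 1 / 6 - kappa2 by [].
have coefE k : (1 <= k <= K n)%N -> series_coef R (K n) (T n) (d n) (B n) (B1 n) k ^+ 2 *
    series_err (d n) alpha C (B n) (B1 n) (T n k) (1 + 2 * (H n * mass)) lam del <=
    4320 * Z ^+ 8 * (8 * Z ^+ 4 * (N n)%:R `^ (- gam)).
  move=> kK.
  have Tx : (T n k)%:R <= Z * (N n)%:R.
    apply: (@le_trans _ _ (Tmax (K n) (T n))%:R); first by rewrite ler_nat Tmax_ge.
    by apply: (le_trans Tn); rewrite ler_wpM2r // ltW.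
  have scZ : series_coef R (K n) (T n) (d n) (B n) (B1 n) k ^+ 2 <= Z / ((N n)%:R ^+ 2 * (B1 n)%:R).
    apply: (le_trans (series_coef_sqr_le kK B0 B2 B12 KKn dpos d2)).
    by rewrite ler_wpM2r // invr_ge0 mulr_ge0 // ltW.
  have [[g1 g2 g3] [g4 g5 g6]] := rate_exponents eE gam0 gk ge.
  exact: (@coefficient_error_le R (K n) (T n) (d n) (B n) (B1 n) k Z alpha C (H n) (1 + 2 * (H n * mass))
    kappa1 kappa2 (1 / 3 + eps) gam Z1 kK B0 BB1 x1 dx Tx cA0 Z3 cW0 Z4 H1 kap0 kapZ rho0 rhoZ scZ
    bx Dx Hx xH k20 g1 g2 g3 g4 g5 g6).
have al2 : 2 <= alpha by rewrite ltW // (lt_trans _ al14) // ltr_nat.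
have T0 k : (1 <= k <= K n)%N -> (0 < T n k)%N.
  by move=> kK; apply: leq_trans (Tmin_le _ kK); rewrite -(ltr_nat R).
have mb := @model_bound _ _ R (P n) Ker (H n) (K n) (T n) (d n) (B n) (B1 n) (mu n) (e n) (g n) (xi n)
  M alpha C lam del (kappa n) B0 BB1 (stK n) T0 hK H0 (mI n) (mN n) (mE n) (mC n) (mX n) M8 al2 C1
  (eI n) (gm n) srdn rho1 lam0 del0 hdel (hkap n) eta c eta0 c0 cn.
apply: (le_trans mb); rewrite lee_fin.
have ec0 : 0 < eta * c by rewrite mulr_gt0.
rewrite ler_pdivrMr //.
apply: (@le_trans _ _ ((K n)%:R * (4320 * Z ^+ 8 * (8 * Z ^+ 4 * (N n)%:R `^ (- gam))))).
  rewrite (_ : (K n)%:R * _ = \sum_(1 <= k < (K n).+1) 4320 * Z ^+ 8 * (8 * Z ^+ 4 * (N n)%:R `^ (- gam))); last first.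
    by rewrite sumr_const_nat subn1 /= mulr_natl.
  by apply: ler_sum_nat => k; rewrite ltnS; exact: coefE.
apply: (@le_trans _ _ (KK * (4320 * Z ^+ 8 * (8 * Z ^+ 4 * (N n)%:R `^ (- gam))))).
  have ZX k : 0 <= Z ^+ k by exact: exprn_ge0 (ltW Z0).
  apply: ler_wpM2r KKn; apply: mulr_ge0; first by apply: mulr_ge0 (ler0n _ _) (ZX _).
  by apply: mulr_ge0 (powR_ge0 _ _); apply: mulr_ge0 (ler0n _ _) (ZX _).
rewrite le_eqVlt; apply/orP; left; apply/eqP; rewrite /A.
move: ((N n)%:R `^ (- gam)) (4320 : R) => p c4; field.
by rewrite !gt_eqF.
Unshelve. all: end_near.
Qed.
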